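(* Suppose that $(A,B)$ satisfies the critical variational assumption (defined in the context). Suppose moreover that one of the following two conditions holds: (i) for all $T>0$ there exist $\eta,\theta,M>0$ and a progressively measurable $\phi\in L^2((0,T)\times\Omega)$ such that, a.s., for any $v\in V$ and $t\in[0,T]$, $\langle A(t,v),v\rangle-(\tfrac12+\eta)\|B(t,v)\|_{\mathcal L_2(U,H)}^2\ge\theta\|v\|_V^2-M\|v\|_H^2-|\phi(t)|^2$; or (ii) for all $T>0$ there exist $\theta,M>0$ and a progressively measurable $\phi\in L^2((0,T)\times\Omega)$ such that, a.s., for any $v\in V$ and $t\in[0,T]$, $\langle A(t,v),v\rangle-\tfrac12\|B(t,v)\|_{\mathcal L_2(U,H)}^2\ge\theta\|v\|_V^2-M\|v\|_H^2-|\phi(t)|^2$. Let $u$ and $u_n$ ($n\ge1$) denote the unique global solutions to $\mathrm{d}u(t)+A(t,u(t))\,\mathrm{d}t=B(t,u(t))\,\mathrm{d}W(t)$ with strongly $\mathscr F_0$-measurable $H$-valued initial values $u_0$ and $u_{0,n}$, respectively. Suppose that $\|u_{0,n}-u_0\|_H\to0$ in probability as $n\to\infty$. Let $T\in(0,\infty)$. Then $$\|u-u_n\|_{C([0,T];H)}+\|u-u_n\|_{L^2(0,T;V)}\to0\quad\text{in probability as }n\to\infty.$$ If additionally $\sup_{n\ge1}\mathbb E\|u_{0,n}\|_H^2<\infty$, then for any $q\in(0,2)$ $$\mathbb E\|u-u_n\|_{C([0,T];H)}^q+\mathbb E\|u-u_n\|_{L^2(0,T;V)}^q\to0\quad\text{as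 }n\to\infty.$$
   Context: **Spaces.** $V,H$ are real Hilbert spaces with $V\hookrightarrow H$ densely and continuously. $H$ is identified with its dual, so that $V\hookrightarrow H\hookrightarrow V^*$ with duality pairing $\langle h,v\rangle=(v,h)_H$ for $h\in H$, $v\in V$, extended by continuity to $V^*\times V$. For $\beta\in(0,1)$, $V_\beta=[V^*,V]_\beta$ (complex interpolation; $V_{1/2}=H$) with norm $\|\cdot\|_\beta$. $U$ is a real separable Hilbert space, $\mathcal L_2(U,H)$ the Hilbert–Schmidt operators. **Probability.** $(\Omega,\mathcal F,\mathbb P)$ is a probability space with filtration $(\mathscr F_t)_{t\ge0}$, $W$ is a $U$-cylindrical Brownian motion with respect to it, $\mathcal P$ is the progressive $\sigma$-algebra on $\mathbb R_+\times\Omega$. A process on $[0,\tau)\times\Omega=\{(t,\omega):0\le t<\tau(\omega)\}$ is strongly progressively measurable if its extension by zero is. **Critical variational assumption.** $(A,B)$ satisfies it if: (1) $A(t,v)=A_0(t,v)v-F(t,v)-f$ and $B(t,v)=B_0(t,v)v+G(t,v)+g$, where $A_0:\mathbb R_+\times\Omega\times H\to\mathcal L(V,V^* )$ and $B_0:\mathbb R_+\times\Omega\times H\to\mathcal L(V,\mathcal L_2(U,H))$ are $\mathcal P\otimes\mathcal B(H)$-measurable; $F:\mathbb R_+\times\Omega\times V\to V^*$ and $G:\mathbb R_+\times\Omega\times V\to\mathcal L_2(U,H)$ are $\mathcal P\otimes\mathcal B(V)$-measurable; $f:\mathbb R_+\times\Omega\to V^*$ and $g:\mathbb R_+\times\Omega\to\mathcal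 L_2(U,H)$ are $\mathcal P$-measurable with a.s. $f\in L^2_{\rm loc}([0,\infty);V^* )$, $g\in L^2_{\rm loc}([0,\infty);\mathcal L_2(U,H))$. (2) For all $T>0$, $n\ge1$ there exist $\theta_n>0$, $M_n>0$ such that a.s. for all $t\in[0,T]$, $u\in V$ and $v\in H$ with $\|v\|_H\le n$, $$\langle A_0(t,v)u,u\rangle-\tfrac12\|B_0(t,v)u\|_{\mathcal L_2(U,H)}^2\ge\theta_n\|u\|_V^2-M_n\|u\|_H^2.$$ (3) There are $m_F,m_G\in\mathbb N$, $\rho_j\ge0$ and $\beta_j\in(1/2,1)$ with $2\beta_j\le1+\frac1{\rho_j+1}$ for $j\in\{1,\dots,m_F+m_G\}$ such that for all $n\ge1$, $T>0$ there is a constant $C_{n,T}$ such that a.s. for all $t\in[0,T]$ and $u,v,w\in V$ with $\|u\|_H,\|v\|_H\le n$: - $\|A_0(t,u)w\|_{V^*}+\|B_0(t,u)w\|_{\mathcal L_2(U,H)}\le C_{n,T}\|w\|_V$; - $\|A_0(t,u)w-A_0(t,v)w\|_{V^*}\le C_{n,T}\|u-v\|_H\|w\|_V$; - $\|B_0(t,u)w-B_0(t,v)w\|_{\mathcal L_2(U,H)}\le C_{n,T}\|u-v\|_H\|w\|_V$; - $\|F(t,u)-F(t,v)\|_{V^*}\le C_{n,T}\sum_{j=1}^{m_F}(1+\|u\|_{\beta_j}^{\rho_j}+\|v\|_{\beta_j}^{\rho_j})\|u-v\|_{\beta_j}$; - $\|F(t,u)\|_{V^*}\le C_{n,T}\sum_{j=1}^{m_F}(1+\|u\|_{\beta_j}^{\rho_j+1})$;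 - $\|G(t,u)-G(t,v)\|_{\mathcal L_2(U,H)}\le C_{n,T}\sum_{j=m_F+1}^{m_F+m_G}(1+\|u\|_{\beta_j}^{\rho_j}+\|v\|_{\beta_j}^{\rho_j})\|u-v\|_{\beta_j}$; - $\|G(t,u)\|_{\mathcal L_2(U,H)}\le C_{n,T}\sum_{j=m_F+1}^{m_F+m_G}(1+\|u\|_{\beta_j}^{\rho_j+1})$. **Solutions.** Let $\sigma$ be a stopping time with values in $[0,\infty]$ and $u:[0,\sigma)\times\Omega\to V$ strongly progressively measurable. ($C(I;H)$ means continuous functions on $I\cap[0,\infty)$.) - $u$ is a *strong solution* (with initial value $u_0$) on $[0,\sigma]\times\Omega$ if a.s. $u\in L^2(0,\sigma;V)\cap C([0,\sigma];H)$, $F(\cdot,u)\in L^2(0,\sigma;V^* )$, $G(\cdot,u)\in L^2(0,\sigma;\mathcal L_2(U,H))$, and a.s. for all $t\in[0,\sigma)$: $u(t)-u_0+\int_0^tA(s,u(s))\,\mathrm ds=\int_0^t\mathbf 1_{[0,\sigma)\times\Omega}B(s,u(s))\,\mathrm dW(s)$. - $(u,\sigma)$ is a *local solution* if there are increasing stopping times $\sigma_n$ with $\lim_n\sigma_n=\sigma$ a.s. such that $u|_{[0,\sigma_n]\times\Omega}$ is a strong solution on $[0,\sigma_n]\times\Omega$. - A local solution $(u,\sigma)$ is *unique* if for every local solution $(u',\sigma')$, for a.a. $\omega$ and all $t\in[0,\sigma(\omega)\wedge\sigma'(\omega))$, $u(t,\omega)=u'(t,\omega)$. - A unique local solution $(u,\sigma)$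 is a *maximal (unique) solution* if for any other local solution $(u',\sigma')$ one has a.s. $\sigma'\le\sigma$ and, for a.a. $\omega$ and all $t\in[0,\sigma'(\omega))$, $u(t,\omega)=u'(t,\omega)$. - A maximal (unique) solution $(u,\sigma)$ is a *global (unique) solution* if $\sigma=\infty$ a.s. Under the hypotheses of the claim, a unique global solution exists for every strongly $\mathscr F_0$-measurable initial value in $H$, and it lies a.s. in $C([0,\infty);H)\cap L^2_{\rm loc}([0,\infty);V)$. *)

(* Defs.v *)
From HB Require Import structures.
From mathcomp Require Import all_boot all_order all_algebra.
From mathcomp Require Import all_classical all_reals all_analysis.
From mathcomp Require Import ring lra.

Set Implicit Arguments.
Unset Strict Implicit.
Unset Printing Implicit Defensive.

Import Order.TTheory GRing.Theory Num.Theory.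
Import numFieldNormedType.Exports.

Local Open Scope classical_set_scope.
Local Open Scope ring_scope.

(* real Hilbert spaces *)
HB.mixin Record CompleteNormedModule_isHilbert (R : realType) V
    of CompleteNormedModule R V := {
  dotp : V -> V -> R ;
  dotpC : forall x y, dotp x y = dotp y x ;
  dotpDl : forall x y z, dotp (x + y) z = dotp x z + dotp y z ;
  dotpZl : forall (a : R) x z, dotp (a *: x) z = a * dotp x z ;
  dotpE : forall x, dotp x x = `|x| ^+ 2 }.

#[short(type="hilbertType")]
HB.structure Definition Hilbert (R : realType) :=
  { V of CompleteNormedModule_isHilbert R V & CompleteNormedModule R V }.

Section cauchy_schwarz.
Variables (R : realType) (V : hilbertType R).

Lemma dotp_eq0 (x y : V) : x = 0 -> dotp x y = 0.
Proof. by move=> ->; rewrite -(scale0r (0 : V)) dotpZl mul0r. Qed.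

Lemma dotp_le (x y : V) : `|dotp x y| <= `|x| * `|y|.
Proof.
have [x0|x0] := eqVneq x 0; first by rewrite dotp_eq0// x0 !normr0 mul0r.
have xp : 0 < `|x| by rewrite normr_gt0.
have key (a : R) : 0 <= `|y| ^+ 2 + 2 * a * dotp x y + a ^+ 2 * `|x| ^+ 2.
  rewrite (_ : _ + _ = `|a *: x + y| ^+ 2) ?sqr_ge0//.
  rewrite -[RHS]dotpE dotpDl dotpZl ![dotp _ (_ + _)]dotpC !dotpDl !dotpZl !dotpE.
  by rewrite (dotpC y x) mulrDr; rewrite -!addrA addrC !addrA mulrA -expr2; ring.
have := key (- dotp x y / `|x| ^+ 2).
rewrite (_ : _ + _ = `|y| ^+ 2 - dotp x y ^+ 2 / `|x| ^+ 2); last first.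
  by field; rewrite gt_eqF.
rewrite subr_ge0 ler_pdivrMr ?exprn_gt0// => h.
rewrite -(ler_pXn2r (n := 2)) ?nnegrE ?mulr_ge0//.
by rewrite real_normK ?num_real// exprMn mulrC.
Qed.

End cauchy_schwarz.

Section bounded_operators.
Variables (R : realType) (X Y : normedModType R).

Definition bounded_op : {pred X -> Y} := fun f =>
  `[< (forall (a : R) x y, f (a *: x + y) = a *: f x + f y) /\
      (exists M : R, forall x, `|f x| <= M * `|x|) >].

Record bop := Bop { bop_fun :> X -> Y ; bopP : bop_fun \in bounded_op }.

HB.instance Definition _ := [isSub for bop_fun].
HB.instance Definition _ := [Choice of bop by <:].

Fact bounded_op_submod : GRing.submod_closed bounded_op.
Proof.
split=> [|a f g]; first apply/asboolP.
  split=> [a x y|]; first by rewrite scaler0 addr0.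
  by exists 0 => x; rewrite normr0 mul0r.
move=> /asboolP[fl [M fM]] /asboolP[gl [N gN]]; apply/asboolP; split.
  move=> b x y; rewrite !fctE fl gl !scalerDr !scalerA (mulrC a b) -!addrA.
  by congr (_ + _); rewrite addrCA.
exists (`|a| * M + N) => x; rewrite !fctE (le_trans (ler_normD _ _))// normrZ.
by rewrite mulrDl -mulrA lerD// ler_wpM2l.
Qed.
HB.instance Definition _ :=
  GRing.isSubmodClosed.Build R (X -> Y) bounded_op bounded_op_submod.
HB.instance Definition _ := [SubChoice_isSubLmodule of bop by <:].

(* the least constant M with |f x| <= M |x| *)
Definition op_norm (f : bop) : R :=
  inf [set M : R | 0 <= M /\ forall x, `|f x| <= M * `|x|].

Let S (f : bop) := [set M : R | 0 <= M /\ forall x, `|f x| <= M * `|x|].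

Let S_has_inf f : has_inf (S f).
Proof.
split; last by exists 0 => M [].
have /asboolP[_ [M fM]] := bopP f.
exists `|M|; split=> // x.
by rewrite (le_trans (fM x))// ler_wpM2r// ler_norm.
Qed.

Let op_norm_le f (M : R) : S f M -> op_norm f <= M.
Proof. by move=> SM; apply: ge_inf => //; exact: (S_has_inf f).2. Qed.

Lemma op_norm_ge0 (f : bop) : 0 <= op_norm f.
Proof. by apply: lb_le_inf => [|M []//]; exact: (S_has_inf f).1. Qed.

Lemma op_normP (f : bop) x : `|f x| <= op_norm f * `|x|.
Proof.
have [->|x0] := eqVneq x 0.
  have /asboolP[_ [M /(_ 0)]] := bopP f.
  by rewrite !normr0 !mulr0.
rewrite -ler_pdivrMr ?normr_gt0//; apply: lb_le_inf.
  exact: (S_has_inf f).1.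
by move=> M [_ fM]; rewrite ler_pdivrMr ?normr_gt0.
Qed.

Fact op_normD (f g : bop) : op_norm (f + g) <= op_norm f + op_norm g.
Proof.
apply: op_norm_le; split=> [|x]; first by rewrite addr_ge0// op_norm_ge0.
by rewrite mulrDl (le_trans (ler_normD _ _))// lerD// op_normP.
Qed.

Let op_normZ_le a (f : bop) : op_norm (a *: f) <= `|a| * op_norm f.
Proof.
apply: op_norm_le; split=> [|x]; first by rewrite mulr_ge0// op_norm_ge0.
by rewrite -mulrA normrZ ler_wpM2l// op_normP.
Qed.

Fact op_normZ a (f : bop) : op_norm (a *: f) = `|a| * op_norm f.
Proof.
apply/eqP; rewrite eq_le op_normZ_le/=.
have [->|a0] := eqVneq a 0; first by rewrite normr0 mul0r op_norm_ge0.
rewrite -ler_pdivlMl ?normr_gt0// -normfV.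
by rewrite -{1}(scalerK a0 f) op_normZ_le.
Qed.

Fact op_norm_eq0 (f : bop) : op_norm f = 0 -> f = 0.
Proof.
move=> f0; apply/val_inj/funext => x /=; apply/eqP; rewrite -normr_le0.
by rewrite (le_trans (op_normP f x))// f0 mul0r.
Qed.

HB.instance Definition _ :=
  Lmodule_isNormed.Build R bop op_normD op_normZ op_norm_eq0.

End bounded_operators.

Definition dual (R : realType) (V : normedModType R) := bop V (R^o : normedModType R).

Section hilbert_schmidt.
Variables (R : realType) (U H : hilbertType R).

(* orthonormal bases: orthonormal sets with dense linear span *)
Record onb := Onb {
  onb_set : set U ;
  onb_norm : forall x, onb_set x -> `|x| = 1 ;
  onb_orth : forall x y, onb_set x -> onb_set y -> x <> y -> dotp x y = 0 ;
  onb_total : dense [set x | exists (l : seq U) (a : U -> R),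
    (forall y, y \in l -> onb_set y) /\ x = \sum_(y <- l) a y *: y] }.

(* The squared Hilbert-Schmidt norm. Its value on bounded operators does not
   depend on the orthonormal basis e. *)
Definition hs_sq (e : onb) (f : U -> H) : \bar R :=
  \esum_(x in onb_set e) (`|f x| ^+ 2)%:E.

Let hs_sqZ_le e (c : R) (f g : U -> H) :
  (forall x, `|f x| ^+ 2 <= c * `|g x| ^+ 2) -> 0 <= c ->
  (hs_sq e f <= c%:E * hs_sq e g)%E.
Proof.
move=> fg c0; apply: ge_ereal_sup => _ [F [finF Fe] <-].
apply: (@le_trans _ _ (\sum_(x \in F) (c%:E * (`|g x| ^+ 2)%:E))%E).
  by apply: lee_fsum => // x _; rewrite -EFinM lee_fin.
rewrite -ge0_mule_fsumr//.
apply: lee_wpmul2l; first by rewrite lee_fin.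
by apply: ereal_sup_ubound; exists F.
Qed.

Lemma hs_sq_ge0 e (f : U -> H) : (0 <= hs_sq e f)%E.
Proof. by apply: esum_ge0 => x _; rewrite lee_fin sqr_ge0. Qed.

Lemma hs_sqZ e a (f : U -> H) :
  (hs_sq e (fun x => a *: f x) <= (a ^+ 2)%:E * hs_sq e f)%E.
Proof.
apply: hs_sqZ_le; last exact: sqr_ge0.
by move=> x; rewrite normrZ exprMn real_normK ?num_real.
Qed.

Lemma hs_sqD e (q : R) (f g : U -> H) : 0 < q ->
  (hs_sq e (fun x => (f x + g x)%R) <=
   (1 + q)%:E * hs_sq e f + (1 + q^-1)%:E * hs_sq e g)%E.
Proof.
move=> q0.
pose h (c : R) (k : U -> H) x := Num.sqrt c *: k x.
have hE c (k : U -> H) x : 0 <= c -> `|h c k x| ^+ 2 = c * `|k x| ^+ 2.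
  by move=> c0; rewrite normrZ exprMn real_normK ?num_real// sqr_sqrtr.
have c1 : 0 <= 1 + q by rewrite addr_ge0// ltW.
have c2 : 0 <= 1 + q^-1 by rewrite addr_ge0// invr_ge0 ltW.
apply: (@le_trans _ _ (hs_sq e (h (1 + q)%R f) + hs_sq e (h (1 + q^-1)%R g))%E).
  rewrite /hs_sq -esumD => [|x _|x _]; rewrite ?lee_fin ?sqr_ge0//.
  apply: le_esum => x _; rewrite -EFinD lee_fin !hE//.
  apply: (@le_trans _ _ ((`|f x| + `|g x|) ^+ 2)).
    by rewrite lerXn2r ?nnegrE ?addr_ge0// ler_normD.
  rewrite -subr_ge0 (_ : _ - _ = (q * `|f x| - `|g x|) ^+ 2 / q).
    by rewrite mulr_ge0 ?sqr_ge0// invr_ge0 ltW.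
  by field; rewrite gt_eqF.
by apply: leeD; apply: hs_sqZ_le => // x; rewrite hE.
Qed.

Variable e : onb.

Definition hs_op : {pred bop U H} := fun f => `[< (hs_sq e f < +oo)%E >].

Record hs := Hs { hs_bop :> bop U H ; hsP : hs_bop \in hs_op }.

HB.instance Definition _ := [isSub for hs_bop].
HB.instance Definition _ := [Choice of hs by <:].

Fact hs_op_submod : GRing.submod_closed hs_op.
Proof.
split=> [|a f g].
  by apply/asboolP; rewrite /hs_sq esum1// => x _; rewrite normr0 expr0n.
move=> /asboolP fe /asboolP ge; apply/asboolP.
apply: (le_lt_trans (hs_sqD e (fun x => a *: f x) g ltr01)).
rewrite lte_add_pinfty// lte_mul_pinfty ?lee_fin//.
apply: (le_lt_trans (hs_sqZ e a f)).
by rewrite lte_mul_pinfty ?lee_fin ?sqr_ge0.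
Qed.
HB.instance Definition _ :=
  GRing.isSubmodClosed.Build R (bop U H) hs_op hs_op_submod.
HB.instance Definition _ := [SubChoice_isSubLmodule of hs by <:].

Definition hs_norm (f : hs) : R := Num.sqrt (fine (hs_sq e f)).

Let hs_sqE (f : hs) : hs_sq e f = ((hs_norm f) ^+ 2)%:E.
Proof.
have /asboolP fe := hsP f.
rewrite sqr_sqrtr ?fine_ge0 ?hs_sq_ge0// fineK// ge0_fin_numE//.
exact: hs_sq_ge0.
Qed.

Let hs_norm_ge0 f : 0 <= hs_norm f. Proof. exact: sqrtr_ge0. Qed.

Fact hs_normD (f g : hs) : hs_norm (f + g) <= hs_norm f + hs_norm g.
Proof.
set s := hs_norm f; set t := hs_norm g.
apply/ler_addgt0Pr => r r0.
pose s' := s + r / 2; pose t' := t + r / 2.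
have s0 : 0 < s' by have := hs_norm_ge0 f; rewrite /s' /s; lra.
have t0 : 0 < t' by have := hs_norm_ge0 g; rewrite /t' /t; lra.
rewrite (_ : _ + r = s' + t'); last by rewrite /s' /t'; field.
have s1 := ltW s0; have t1 := ltW t0; have st1 : 0 <= s' + t' by lra.
rewrite -(ler_pXn2r (n := 2)) ?nnegrE ?hs_norm_ge0//.
suff : ((hs_norm (f + g) ^+ 2)%:E <= ((s' + t') ^+ 2)%:E)%E by rewrite lee_fin.
rewrite -hs_sqE; apply: (le_trans (hs_sqD e f g (divr_gt0 t0 s0))).
rewrite !hs_sqE -!EFinM -EFinD lee_fin -/s -/t.
apply: (@le_trans _ _ ((1 + t' / s') * s' ^+ 2 + (1 + (t' / s')^-1) * t' ^+ 2)).
  have q0 : 0 < t' / s' by rewrite divr_gt0.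
  have q1 := ltW q0; have qi1 : 0 <= (t' / s')^-1 by rewrite invr_ge0.
  have r1 := ltW r0; have sn := hs_norm_ge0 f; have tn := hs_norm_ge0 g.
  have ss : s <= s' by rewrite /s'; lra.
  have tt : t <= t' by rewrite /t'; lra.
  have p1 : 0 <= 1 + t' / s' by lra.
  have p2 : 0 <= 1 + (t' / s')^-1 by lra.
  by apply: lerD; [apply: (ler_wpM2l p1)|apply: (ler_wpM2l p2)];
    rewrite lerXn2r// nnegrE.
have -> : (1 + t' / s') * s' ^+ 2 + (1 + (t' / s')^-1) * t' ^+ 2 = (s' + t') ^+ 2.
  by field; rewrite !gt_eqF.
by [].
Qed.

Let hs_normZ_le a (f : hs) : hs_norm (a *: f) <= `|a| * hs_norm f.
Proof.
rewrite -(ler_pXn2r (n := 2)) ?nnegrE ?mulr_ge0 ?hs_norm_ge0//.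
suff : ((hs_norm (a *: f) ^+ 2)%:E <= (a ^+ 2)%:E * (hs_norm f ^+ 2)%:E)%E.
  by rewrite -EFinM lee_fin exprMn real_normK ?num_real.
rewrite -(hs_sqE (a *: f)) -(hs_sqE f).
have E0 : hs_bop (a *: f) = a *: hs_bop f by [].
have E : forall x, hs_bop (a *: f) x = a *: f x by move=> x; rewrite E0.
apply: le_trans (hs_sqZ e a f).
by apply: le_esum => x _; rewrite E.
Qed.

Fact hs_normZ a (f : hs) : hs_norm (a *: f) = `|a| * hs_norm f.
Proof.
apply/eqP; rewrite eq_le hs_normZ_le/=.
have [->|a0] := eqVneq a 0; first by rewrite normr0 mul0r hs_norm_ge0.
rewrite -ler_pdivlMl ?normr_gt0// -normfV.
by rewrite -{1}(scalerK a0 f) hs_normZ_le.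
Qed.

Fact hs_norm_eq0 (f : hs) : hs_norm f = 0 -> f = 0.
Proof.
move=> f0; apply/val_inj/val_inj/funext => x /=.
have /asboolP[flin _] := bopP f.
have f00 : f 0 = 0.
  by have := flin (-1) 0 0; rewrite !scaleN1r !addNr.
have fe y : onb_set e y -> f y = 0.
  move=> ey; apply/eqP; rewrite -normr_eq0 -sqrf_eq0 eq_le sqr_ge0 andbT.
  have : ((`|f y| ^+ 2)%:E <= hs_sq e f)%E.
    apply: esum_ge; exists [set y]; last by rewrite fsbig_set1.
    by split; [exact: finite_set1|move=> _ ->].
  by rewrite hs_sqE f0 expr0n/= lee_fin.
apply: contrapT => /eqP fx0.
pose C := op_norm f + 1.
have C0 : 0 < C by rewrite ltr_wpDl// op_norm_ge0.
have r0 : 0 < `|f x| / C by rewrite divr_gt0// normr_gt0.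
have [||z [+ [l [a [le zE]]]]] := @onb_total e (ball x (`|f x| / C)).
- by exists x; exact: ballxx.
- exact: ball_open.
rewrite -ball_normE/= ltr_pdivlMr// => /lt_geF/negP; apply.
have fz : f z = 0.
  rewrite zE; elim: l le {zE} => [|y l IH] le; first by rewrite big_nil.
  rewrite big_cons flin (fe y) ?scaler0 ?add0r; last by apply: le; rewrite mem_head.
  rewrite IH// => w wl.
  by apply: le; rewrite inE wl orbT.
have := op_normP f (x - z).
have -> : f (x - z) = f x by rewrite -scaleN1r addrC flin fz scaler0 add0r.
move=> /le_trans; apply; rewrite mulrC ler_wpM2l//.
by rewrite lerDl.
Qed.

HB.instance Definition _ :=
  Lmodule_isNormed.Build R hs hs_normD hs_normZ hs_norm_eq0.

End hilbert_schmidt.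

Arguments hs {R U} H e.

Section gelfand_triple.
Variables (R : realType) (V H : hilbertType R) (j : bop V H).

Fact gelfand_bounded (h : H) :
  (fun v => dotp h (j v)) \in @bounded_op R V (R^o : normedModType R).
Proof.
apply/asboolP; split=> [a x y|].
  have /asboolP[jlin _] := bopP j.
  by rewrite jlin ![dotp h _]dotpC dotpDl dotpZl.
exists (`|h| * op_norm j) => x.
by rewrite (le_trans (dotp_le _ _))// -mulrA ler_wpM2l// op_normP.
Qed.

(* H -> V^*, <h, v> = (v, h)_H; the duality pairing of x : dual V with v : V is
   x v *)
Definition gelfand (h : H) : dual V := Bop (gelfand_bounded h).

Definition gelfand_triple : Prop := injective j /\ dense (range j).

End gelfand_triple.

(* Complex interpolation of a couple of real Banach spaces X1 -> X0: Calderon's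
   method applied to the complexifications. A pair x : X * X stands for
   x.1 + i x.2, and z : R * R for the complex number z.1 + i z.2. *)
Section complex_interpolation.
Variables (R : realType) (X0 X1 : normedModType R) (k : X1 -> X0).

Definition cplx_norm (X : normedModType R) (x : X * X) : R :=
  Num.sqrt (`|x.1| ^+ 2 + `|x.2| ^+ 2).

Definition cplx_scale (X : normedModType R) (z : R * R) (x : X * X) : X * X :=
  (z.1 *: x.1 - z.2 *: x.2, z.1 *: x.2 + z.2 *: x.1).

Definition strip : set (R^o * R^o) := [set z | 0 <= z.1 <= 1].

Record calderon (f : R^o * R^o -> X0 * X0) (g : R^o -> X1 * X1) (M : R) : Prop := {
  calderon_cont : {within strip, continuous f} ;
  calderon_bounded : exists K : R, forall z, strip z -> `|f z| <= K ;
  calderon_holomorphic : forall z : R^o * R^o, 0 < z.1 < 1 ->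
    exists D : X0 * X0,
      (fun h : R^o * R^o => `|h|^-1 *: (f (z + h) - f z - cplx_scale h D))
        @ (0 : R^o * R^o)^' --> (0 : X0 * X0) ;
  calderon_left : forall t, cplx_norm (f (0, t)) <= M ;
  calderon_right : forall t,
    f (1, t) = (k (g t).1, k (g t).2) /\ cplx_norm (g t) <= M ;
  calderon_right_cont : continuous g }.

Definition interp_norm (theta : R) (x : X0) : R :=
  inf [set M | exists f g, calderon f g M /\ f (theta, 0) = (x, 0)].

End complex_interpolation.

(* the norm of V_b = [V^*, V]_b, on V *)
Definition Vb_norm (R : realType) (V H : hilbertType R) (j : bop V H) (b : R)
    (v : V) : R :=
  interp_norm (fun v : V => gelfand j (j v)) b (gelfand j (j v)).

Section measurability.
Variable R : realType.

Definition borel_mfun (T : Type) (X : normedModType R) (S : set (set T))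
    (f : T -> X) : Prop :=
  forall O, open O -> S (f @^-1` O).

Definition strongly_mfun (T : Type) (X : normedModType R) (S : set (set T))
    (D : set T) (f : T -> X) : Prop :=
  exists s : nat -> T -> X,
    (forall n, finite_set (range (s n)) /\ forall x, S (s n @^-1` [set x])) /\
    (forall z, D z -> s n z @[n --> \oo] --> f z).

Definition borel (X : normedModType R) : set (set X) := <<s open >>.
#[global] Arguments borel X : clear implicits.

Definition bochner_integral (X : normedModType R) (D : set R) (f : R -> X)
    (I : X) : Prop :=
  exists s : nat -> R -> X, [/\
    forall n, finite_set (range (s n)) /\
      forall x, measurable (s n @^-1` [set x]),
    \forall r \ae lebesgue_measure, D r -> s n r @[n --> \oo] --> f r,
    (\int[lebesgue_measure]_(r in D) (`|f r - s n r|)%:E)%E @[n --> \oo] --> 0%E &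
    (\sum_(x \in range (s n))
       fine (lebesgue_measure (D `&` s n @^-1` [set x])) *: x) @[n --> \oo] --> I].

End measurability.
Arguments borel {R} X.

Section stochastic_basis.
Variables (R : realType) (d : measure_display) (Omega : measurableType d).
Variable P : probability Omega R.

Definition filtration (Fil : R -> set (set Omega)) : Prop :=
  [/\ forall t : R, 0 <= t -> sigma_algebra setT (Fil t),
      forall t : R, 0 <= t -> Fil t `<=` measurable &
      forall s t, 0 <= s -> s <= t -> Fil s `<=` Fil t].

(* X n may fail to be measurable, hence the outer measure *)
Definition cvg0_in_prob (X : nat -> Omega -> \bar R) : Prop :=
  forall eps : R, 0 < eps ->
    mu_ext P [set w | (eps%:E < X n w)%E] @[n --> \oo] --> 0%E.

Variable Fil : R -> set (set Omega).

(* The time set is R_+: what happens at negative times is irrelevant. *)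
Definition prog : set (set (R * Omega)) := fun A =>
  forall t : R, 0 <= t ->
    <<s [set B `*` C | B in (measurable : set (set R)) & C in Fil t] >>
      (A `&` (`[0, t] `*` setT)).

Definition prog_borel (X : normedModType R) : set (set (R * Omega * X)) :=
  <<s [set A `*` B | A in prog & B in borel X] >>.
#[global] Arguments prog_borel X : clear implicits.

Definition strongly_prog (X : normedModType R) (f : R -> Omega -> X) : Prop :=
  strongly_mfun prog [set z | 0 <= z.1] (fun z => f z.1 z.2).

Definition stopping_time (tau : Omega -> \bar R) : Prop :=
  (forall w, (0 <= tau w)%E) /\
  (forall t : R, 0 <= t -> Fil t [set w | (tau w <= t%:E)%E]).

Definition before (X : normedModType R) (tau : Omega -> \bar R)
    (f : R -> Omega -> X) : R -> Omega -> X :=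
  fun t w => if (t%:E < tau w)%E then f t w else 0.

Record cylindrical_BM (U : hilbertType R) (W : R -> U -> Omega -> R) : Prop := {
  cbm_adapted : forall (t : R) (u : U) (B : set R), 0 <= t -> measurable B ->
    Fil t (W t u @^-1` B) ;
  cbm_linear : forall (t a : R) (u v : U), 0 <= t ->
    \forall w \ae P, W t (a *: u + v) w = a * W t u w + W t v w ;
  cbm_start : forall u : U, \forall w \ae P, W 0 u w = 0 ;
  cbm_gauss : forall (s t : R) (u : U) (B : set R),
    0 <= s -> s < t -> u != 0 -> measurable B ->
    P [set w | B (W t u w - W s u w)] =
    normal_prob 0 (Num.sqrt (t - s) * `|u|) B ;
  cbm_indep : forall (s t : R) (u : U) (B : set R) (C : set Omega),
    0 <= s -> s < t -> measurable B -> Fil s C ->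
    P (C `&` [set w | B (W t u w - W s u w)]) =
    (P C * P [set w | B (W t u w - W s u w)%R])%E ;
  cbm_cont : forall u : U, \forall w \ae P,
    {within [set t : R | 0 <= t], continuous (fun t : R => W t u w)} }.

Section stochastic_integral.
Variables (U H : hilbertType R) (e : onb U) (W : R -> U -> Omega -> R).

(* the elementary integrand 1_(lo, hi](t) 1_ev(w) (x |-> (dir, x)_U val) *)
Record step := Step {
  step_lo : R ; step_hi : R ; step_ev : set Omega ; step_dir : U ; step_val : H }.

Definition adapted_step (s : step) : Prop :=
  0 <= step_lo s <= step_hi s /\ Fil (step_lo s) (step_ev s).

Definition step_process (N : nat) (s : nat -> step) (t : R) (w : Omega)
    (x : U) : H :=
  \sum_(i < N) (\1_(`]step_lo (s i), step_hi (s i)]) t * \1_(step_ev (s i)) w *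
                dotp (step_dir (s i)) x) *: step_val (s i).

Definition step_integral (N : nat) (s : nat -> step) (t : R) (w : Omega) : H :=
  \sum_(i < N) (\1_(step_ev (s i)) w *
    (W (Num.min (step_hi (s i)) t) (step_dir (s i)) w -
     W (Num.min (step_lo (s i)) t) (step_dir (s i)) w)) *: step_val (s i).

(* M is (a version of) the process int_0^. Phi dW: the Ito integral is the
   extension of the elementary one that is continuous from convergence of the
   integrands in L^2(0,T;L_2(U,H)) in probability to convergence of the integrals
   in C([0,T];H) in probability, T > 0 *)
Definition ito_integral (Phi : R -> Omega -> hs H e) (M : R -> Omega -> H) : Prop :=
  strongly_prog Phi /\
  exists (N : nat -> nat) (s : nat -> nat -> step),
    (forall n i, adapted_step (s n i)) /\
    forall T : R, 0 < T ->
      cvg0_in_prob (fun n w => (\int[lebesgue_measure]_(t in `[0%R, T])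
        hs_sq e (fun x => (Phi t w x - step_process (N n) (s n) t w x)%R))%E) /\
      cvg0_in_prob (fun n w => ereal_sup
        [set (`|M t w - step_integral (N n) (s n) t w|)%:E | t in `[0, T]]).

End stochastic_integral.

End stochastic_basis.
Arguments prog_borel {R d Omega} Fil X.

Section equation.
Variables (R : realType) (V H U : hilbertType R) (e : onb U) (j : bop V H).
Variables (d : measure_display) (Omega : measurableType d).
Variables (P : probability Omega R) (Fil : R -> set (set Omega)).
Variable W : R -> U -> Omega -> R.

Record coefs := Coefs {
  cA0 : R -> Omega -> H -> bop V (dual V) ;
  cB0 : R -> Omega -> H -> bop V (hs H e) ;
  cF : R -> Omega -> V -> dual V ;
  cG : R -> Omega -> V -> hs H e ;
  cf : R -> Omega -> dual V ;
  cg : R -> Omega -> hs H e }.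

Variable c : coefs.

Definition cA t w (v : V) : dual V := cA0 c t w (j v) v - cF c t w v - cf c t w.
Definition cB t w (v : V) : hs H e := cB0 c t w (j v) v + cG c t w v + cg c t w.

Definition L2loc_paths (X : normedModType R) (f : R -> Omega -> X) : Prop :=
  \forall w \ae P, forall T : R, 0 < T ->
    (\int[lebesgue_measure]_(t in `[0%R, T]) (`|f t w| ^+ 2)%:E < +oo)%E.

(* the operator-valued maps A0 and B0 are measurable in the strong operator
   sense, which is weaker than Borel measurability for the operator norm *)
Definition coefs_measurable : Prop :=
  [/\ (forall v : V, borel_mfun (prog_borel Fil H)
         (fun z => cA0 c z.1.1 z.1.2 z.2 v)) /\
      (forall v : V, borel_mfun (prog_borel Fil H)
         (fun z => cB0 c z.1.1 z.1.2 z.2 v)),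
      borel_mfun (prog_borel Fil V) (fun z => cF c z.1.1 z.1.2 z.2) /\
      borel_mfun (prog_borel Fil V) (fun z => cG c z.1.1 z.1.2 z.2),
      borel_mfun (prog Fil) (fun z => cf c z.1 z.2) /\
      borel_mfun (prog Fil) (fun z => cg c z.1 z.2) &
      L2loc_paths (cf c) /\ L2loc_paths (cg c)].

Definition local_coercivity : Prop :=
  forall (T : R) (n : nat), 0 < T -> (1 <= n)%N ->
  exists theta M : R, [/\ 0 < theta, 0 < M &
    \forall w \ae P, forall (t : R) (u : V) (v : H),
      0 <= t <= T -> `|v| <= n%:R ->
      theta * `|u| ^+ 2 - M * `|j u| ^+ 2 <=
      cA0 c t w v u u - 2^-1 * `|cB0 c t w v u| ^+ 2].

Local Notation nrm := (Vb_norm j).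

Definition lip_sum (rho beta : nat -> R) (m n : nat) (u v : V) : R :=
  \sum_(m.+1 <= i < n.+1)
    (1 + nrm (beta i) u `^ rho i + nrm (beta i) v `^ rho i) *
    nrm (beta i) (u - v).

Definition growth_sum (rho beta : nat -> R) (m n : nat) (u : V) : R :=
  \sum_(m.+1 <= i < n.+1) (1 + nrm (beta i) u `^ (rho i + 1)).

Definition critical_growth : Prop :=
  exists (mF mG : nat) (rho beta : nat -> R),
  (forall i, (1 <= i <= mF + mG)%N ->
     [/\ 0 <= rho i, 2^-1 < beta i < 1 &
         2 * beta i <= 1 + (rho i + 1)^-1]) /\
  forall (n : nat) (T : R), (1 <= n)%N -> 0 < T ->
  exists C : R, \forall w \ae P, forall (t : R) (u v z : V),
    0 <= t <= T -> `|j u| <= n%:R -> `|j v| <= n%:R ->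
    [/\ `|cA0 c t w (j u) z| + `|cB0 c t w (j u) z| <= C * `|z|,
        `|cA0 c t w (j u) z - cA0 c t w (j v) z| <= C * `|j u - j v| * `|z| /\
        `|cB0 c t w (j u) z - cB0 c t w (j v) z| <= C * `|j u - j v| * `|z|,
        `|cF c t w u - cF c t w v| <= C * lip_sum rho beta 0 mF u v /\
        `|cF c t w u| <= C * growth_sum rho beta 0 mF u &
        `|cG c t w u - cG c t w v| <= C * lip_sum rho beta mF (mF + mG) u v /\
        `|cG c t w u| <= C * growth_sum rho beta mF (mF + mG) u].

Definition critical_variational : Prop :=
  [/\ coefs_measurable, local_coercivity & critical_growth].

(* An element of L^2(V) \cap C(H), as a pair of representatives: one with values
   in V, which enters the coefficients and the L^2(V)-norms and matters only up
   to null sets of times, and the H-continuous one, for pointwise statements.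
   In particular the initial value need not be in V. *)
Record process := Process {
  inV : R -> Omega -> V ;
  inH : R -> Omega -> H }.

Definition L2_before (X : normedModType R) (sigma : \bar R) (f : R -> X) : Prop :=
  (\int[lebesgue_measure]_(t in [set t : R | (0 < t)%R /\ t%:E < sigma])
     (`|f t| ^+ 2)%:E < +oo)%E.

Definition regular_path (sigma : \bar R) (v : R -> V) (h : R -> H) : Prop :=
  [/\ L2_before sigma v,
      exists2 k : R -> H,
        {within [set t : R | 0 <= t /\ (t%:E <= sigma)%E], continuous k} &
        forall t : R, 0 <= t -> (t%:E < sigma)%E -> k t = h t &
      \forall t \ae lebesgue_measure,
        0 <= t -> (t%:E < sigma)%E -> j (v t) = h t].

Definition strong_solution (u0 : Omega -> H) (sigma : Omega -> \bar R)
    (u : process) : Prop :=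
  [/\ stopping_time Fil sigma,
      strongly_prog Fil (before sigma (inV u)),
      \forall w \ae P,
        [/\ regular_path (sigma w) (inV u ^~ w) (inH u ^~ w),
            L2_before (sigma w) (fun t => cF c t w (inV u t w)) &
            L2_before (sigma w) (fun t => cG c t w (inV u t w))] &
      exists2 M : R -> Omega -> H,
        ito_integral P Fil W (before sigma (fun t w => cB t w (inV u t w))) M &
        \forall w \ae P, forall t : R, 0 <= t -> (t%:E < sigma w)%E ->
          exists2 I : dual V,
            bochner_integral `[0, t] (fun s => cA s w (inV u s w)) I &
            gelfand j (inH u t w - u0 w) + I = gelfand j (M t w)].

Definition local_solution (u0 : Omega -> H) (sigma : Omega -> \bar R)
    (u : process) : Prop :=
  [/\ stopping_time Fil sigma,
      strongly_prog Fil (before sigma (inV u)) &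
      exists s : nat -> Omega -> \bar R,
        [/\ forall n w, (s n w <= s n.+1 w)%E,
            \forall w \ae P, s n w @[n --> \oo] --> sigma w &
            forall n, strong_solution u0 (s n) u]].

Definition unique_local_solution u0 sigma u : Prop :=
  local_solution u0 sigma u /\
  forall sigma' u', local_solution u0 sigma' u' ->
    \forall w \ae P, forall t : R, 0 <= t -> (t%:E < sigma w)%E ->
      (t%:E < sigma' w)%E -> inH u t w = inH u' t w.

Definition maximal_solution u0 sigma u : Prop :=
  unique_local_solution u0 sigma u /\
  forall sigma' u', local_solution u0 sigma' u' ->
    (\forall w \ae P, (sigma' w <= sigma w)%E) /\
    \forall w \ae P, forall t : R, 0 <= t -> (t%:E < sigma' w)%E ->
      inH u t w = inH u' t w.

Definition global_solution (u0 : Omega -> H) (u : process) : Prop :=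
  exists2 sigma, maximal_solution u0 sigma u & \forall w \ae P, sigma w = +oo%E.

(* the coercivity inequality with factor k in front of |B(t,v)|^2 *)
Definition coercive_on (T k theta M : R) : Prop :=
  exists phi : R -> Omega -> R^o, [/\
    borel_mfun (prog Fil) (fun z => phi z.1 z.2),
    (\int[(lebesgue_measure \x P)%E]_(z in `]0%R, T[ `*` setT)
       (phi z.1 z.2 ^+ 2)%:E < +oo)%E &
    \forall w \ae P, forall (v : V) (t : R), 0 <= t <= T ->
      theta * `|v| ^+ 2 - M * `|j v| ^+ 2 - `|phi t w| ^+ 2 <=
      cA t w v v - k * `|cB t w v| ^+ 2].

Definition dist_C (T : R) (u v : process) (w : Omega) : \bar R :=
  ereal_sup [set (`|inH u t w - inH v t w|)%:E | t in `[0, T]].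

Definition dist_L2 (T : R) (u v : process) (w : Omega) : \bar R :=
  ((\int[lebesgue_measure]_(t in `[0%R, T])
     (`|inV u t w - inV v t w| ^+ 2)%:E) `^ 2^-1)%E.

End equation.

(* Main.v *)
Require Import Defs.
From HB Require Import structures.
From mathcomp Require Import all_boot all_order all_algebra.
From mathcomp Require Import all_classical all_reals all_analysis.
From mathcomp Require Import measurable_realfun.
From mathcomp Require Import ring lra.

Set Implicit Arguments.
Unset Strict Implicit.
Unset Printing Implicit Defensive.

Import Order.TTheory GRing.Theory Num.Theory.
Import numFieldNormedType.Exports.

Local Open Scope classical_set_scope.
Local Open Scope ring_scope.

(* By interpolation, the critical growth conditions make the coefficients locally
   monotone: 2 <A u - A v, u - v> - |B u - B v|^2 is bounded below by
   th |u - v|_V^2 - K (1 + |u|_V + |v|_V)^2 |u - v|_H^2, with th and K depending on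
   |u|_H and |v|_H. Hence the energy of w = u - u_n, weighted by exp(- int gam) with
   gam = 2 K (1 + |u|_V + |u_n|_V)^2, is dominated by |w(0)|^2 plus a martingale.
   This is proved without an Ito formula: h |-> |h|^2 is regularised to
   (h, R_s h)_H with the resolvent R_s of the triple, the stochastic integral is
   replaced by elementary ones, the resulting discrete martingale is stopped, and
   Fatou's lemma removes the approximations, which gives a maximal inequality of
   Doob type. On an event of large probability where u is bounded, a continuation
   argument keeps w small as long as |w|_H^2 + int |w|_V^2 <= 1, hence forever:
   this is convergence in probability. The same maximal inequality, applied to u
   and u_n under coercivity, bounds the tails P(dist > L) by C / L^2, so all
   moments of order q < 2 converge. Suprema and coefficients along paths need not
   be measurable, hence the outer measures and the integrals of non-measurable
   functions throughout. *)

(** * Hilbert spaces and the resolvents of a Gelfand triple *)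

(** The drift is only [V^*]-valued and the equation can only be tested against elements of [V],
    while [u - u_n] at a fixed time is merely in [H]. The resolvent supplies the test vector, and
    since [(h, R_s h) <= |h|^2] with equality in the limit, the error of this substitution is a
    single integrable defect that vanishes with [s]. The square in the weight
    [(1 + |u|_V + |v|_V)^2] is what criticality [2 beta <= 1 + 1/(rho + 1)] yields: it is integrable
    in time along every solution, so the exponential weight stays away from zero. Fatou's lemma
    needs lower bounds, but the stopped discrete energy has no uniform one; it is cut off at
    [- K_n], and completing a square shows that the cut costs at most [n^3 / (K_n - n)] in mean. The
    limits are taken in the order: elementary integrands and grids, then [s -> 0], then the cut-off.
    The constants of local monotonicity depend on both solutions, while only [u] is controlled
    uniformly in [n]; this is why the difference has to be kept below [1] by continuation. *)

Section dotp_theory.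
Context (R : realType) (V : hilbertType R).
Implicit Types x y z : V.

Lemma dotpDr x y z : dotp x (y + z) = dotp x y + dotp x z.
Proof. by rewrite dotpC dotpDl ![dotp _ x]dotpC. Qed.

Lemma dotpZr (a : R) x y : dotp x (a *: y) = a * dotp x y.
Proof. by rewrite dotpC dotpZl dotpC. Qed.

Lemma dotp0l x : dotp 0 x = 0. Proof. by rewrite dotp_eq0. Qed.

Lemma dotp0r x : dotp x 0 = 0. Proof. by rewrite dotpC dotp0l. Qed.

Lemma dotpNl x y : dotp (- x) y = - dotp x y.
Proof. by rewrite -scaleN1r dotpZl mulN1r. Qed.

Lemma dotpNr x y : dotp x (- y) = - dotp x y.
Proof. by rewrite dotpC dotpNl dotpC. Qed.

Lemma dotpBl x y z : dotp (x - y) z = dotp x z - dotp y z.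
Proof. by rewrite dotpDl dotpNl. Qed.

Lemma dotpBr x y z : dotp x (y - z) = dotp x y - dotp x z.
Proof. by rewrite dotpDr dotpNr. Qed.

Lemma dotp_suml (I : Type) (r : seq I) (Q : pred I) (F : I -> V) y :
  dotp (\sum_(i <- r | Q i) F i) y = \sum_(i <- r | Q i) dotp (F i) y.
Proof.
elim/big_rec2: _ => [|i a b _ <-]; first exact: dotp0l.
by rewrite dotpDl.
Qed.

Lemma dotp_sumr (I : Type) (r : seq I) (Q : pred I) (F : I -> V) y :
  dotp y (\sum_(i <- r | Q i) F i) = \sum_(i <- r | Q i) dotp y (F i).
Proof. by rewrite dotpC dotp_suml; apply: eq_bigr => i _; rewrite dotpC. Qed.

Lemma norm_sqD x y : `|x + y| ^+ 2 = `|x| ^+ 2 + 2 * dotp x y + `|y| ^+ 2.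
Proof. by rewrite -!dotpE dotpDl !dotpDr (dotpC y x); ring. Qed.

Lemma norm_sqB x y : `|x - y| ^+ 2 = `|x| ^+ 2 - 2 * dotp x y + `|y| ^+ 2.
Proof. by rewrite norm_sqD dotpNr normrN mulrN. Qed.

Lemma dotp_le_norm x y : dotp x y <= `|x| * `|y|.
Proof. exact: le_trans (ler_norm _) (dotp_le _ _). Qed.

End dotp_theory.

Section bop_theory.
Context (R : realType) (X Y : normedModType R).
Implicit Types (f : bop X Y) (x y : X).

Lemma bop_linear f (a : R) x y : f (a *: x + y) = a *: f x + f y.
Proof. by have /asboolP[->] := bopP f. Qed.

Lemma bop0 f : f 0 = 0.
Proof. by have := bop_linear f (-1) 0 0; rewrite !scaleN1r !addNr. Qed.

Lemma bopD f x y : f (x + y) = f x + f y.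
Proof. by have := bop_linear f 1 x y; rewrite !scale1r. Qed.

Lemma bopZ f (a : R) x : f (a *: x) = a *: f x.
Proof. by have := bop_linear f a x 0; rewrite !addr0 bop0 addr0. Qed.

Lemma bopN f x : f (- x) = - f x.
Proof. by rewrite -[in LHS]scaleN1r bopZ scaleN1r. Qed.

Lemma bopB f x y : f (x - y) = f x - f y.
Proof. by rewrite bopD bopN. Qed.

Lemma bopDE f (g : bop X Y) x : (f + g) x = f x + g x. Proof. by []. Qed.

Lemma bopNE f x : (- f) x = - f x. Proof. by []. Qed.

Lemma bop_norm_le f x : `|f x| <= `|f| * `|x|.
Proof. exact: op_normP. Qed.

Lemma op_norm_leP f (M : R) : 0 <= M -> (forall x, `|f x| <= M * `|x|) -> `|f| <= M.
Proof.
move=> M0 fM; apply: ge_inf => //; by exists 0 => N [].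
Qed.

Lemma bop_continuous f : continuous f.
Proof.
move=> x; apply/cvgrPdist_lt => eps eps0.
have K0 : 0 < `|f| + 1 by rewrite ltr_wpDl.
near=> y; rewrite -bopB (le_lt_trans (bop_norm_le _ _))//.
apply: (@le_lt_trans _ _ ((`|f| + 1) * `|x - y|)); first by rewrite ler_wpM2r// lerDl.
rewrite -ltr_pdivlMl//; near: y; move/cvgrPdist_lt: (@cvg_id _ (nbhs x)).
by apply; rewrite mulr_gt0// invr_gt0.
Unshelve. all: by end_near. Qed.

End bop_theory.

Section sequences.
Context (R : realType).

Lemma cvgn_distP (X : normedModType R) (u : nat -> X) (l : X) :
  u n @[n --> \oo] --> l <->
  forall e : R, 0 < e -> exists N, forall n, (N <= n)%N -> `|u n - l| < e.
Proof.
split=> [/cvgrPdist_lt ul e e0|ul].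
  have [N _ NP] := ul _ e0; exists N => n Nn.
  by rewrite distrC; exact: NP.
apply/cvgrPdist_lt => e e0; have [N NP] := ul _ e0.
by exists N => // n /= Nn; rewrite distrC; exact: NP.
Qed.

Lemma cauchy_bound_cvg (X : completeNormedModType R) (u : nat -> X) (b : nat -> R) :
  (forall n m, (n <= m)%N -> `|u n - u m| <= b n) -> b n @[n --> \oo] --> 0 ->
  exists l : X, u n @[n --> \oo] --> l.
Proof.
move=> ub /cvgn_distP b0; apply/cvg_ex/cauchy_cvgP/cauchy_exP => e e0.
have [N NP] := b0 _ e0.
exists (u N), N => // n /= Nn.
rewrite -ball_normE /= (le_lt_trans (ub _ _ Nn))//.
by have := NP N (leqnn _); rewrite subr0; apply: le_lt_trans; exact: ler_norm.
Qed.

(** First-order condition at a minimum. Testing at [t = - a / (b + 1)] instead of [- a / (2 b)]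
    avoids a case distinction at [b = 0]. *)
Lemma nonneg_affine_eq0 (a b : R) : 0 <= b ->
  (forall t : R, 0 <= t * a + t ^+ 2 * b) -> a = 0.
Proof.
move=> b0 h; apply/eqP; rewrite -sqrf_eq0 eq_le sqr_ge0 andbT leNgt; apply/negP => a0.
have b1 : 0 < b + 1 by rewrite ltr_wpDl.
have := h (- a / (b + 1)).
rewrite (_ : _ + _ = - (a ^+ 2 / (b + 1) ^+ 2)); last by field; rewrite gt_eqF.
by rewrite oppr_ge0 leNgt divr_gt0// exprn_gt0.
Qed.

End sequences.

Section resolvent.
Context (R : realType) (V H : hilbertType R) (j : bop V H).
Implicit Types (s : R) (x y v : V) (h : H).

Lemma dotp_cvg (X : hilbertType R) (u : nat -> X) (l x : X) :
  u n @[n --> \oo] --> l -> dotp x (u n) @[n --> \oo] --> dotp x l.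
Proof.
move=> /cvgn_distP ul; apply/cvgn_distP => e e0.
have x1 : 0 < `|x| + 1 by rewrite ltr_wpDl.
have [|N NP] := ul (e / (`|x| + 1)); first by rewrite divr_gt0.
exists N => n Nn; rewrite -dotpBr (le_lt_trans (dotp_le _ _))//.
apply: (@le_lt_trans _ _ ((`|x| + 1) * `|u n - l|)).
  by rewrite ler_wpM2r// lerDl.
by rewrite -ltr_pdivlMl// mulrC; exact: NP.
Qed.

(** Direct method: the functional [F] is bounded below and uniformly convex on [V], so minimising
    sequences are Cauchy; the stated identity is the Euler equation of the minimiser. *)
Lemma resolvent_exists s h : 0 < s ->
  exists x, forall y, dotp (j x) (j y) + s * dotp x y = dotp h (j y).
Proof.
move=> s0.
pose F x := `|j x| ^+ 2 + s * `|x| ^+ 2 - 2 * dotp h (j x).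
have Flb x : - `|h| ^+ 2 <= F x.
  rewrite /F; have := dotp_le_norm h (j x).
  have := sqr_ge0 (`|j x| - `|h|); rewrite sqrrB => h1 h2.
  have : 0 <= s * `|x| ^+ 2 by rewrite mulr_ge0 ?sqr_ge0// ltW.
  move: h1; rewrite -mulr_natr; lra.
have Fi : has_inf (range F).
  by split; [exists (F 0), 0|exists (- `|h| ^+ 2) => _ [x _ <-]].
pose m := inf (range F).
have mF x : m <= F x by apply: ge_inf; [case: Fi|exists x].
(* Parallelogram identity, with the value of [F] at the midpoint bounded below by [m]. *)
have Fmid x y : s * `|x - y| ^+ 2 <= 2 * (F x + F y - 2 * m).
  have := mF (2^-1 *: (x + y)); rewrite /F !bopZ !normrZ !exprMn bopD.
  rewrite dotpZr dotpDr ger0_norm ?invr_ge0//.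
  have := norm_sqB (j x) (j y); have := norm_sqB x y.
  rewrite (norm_sqD x y) (norm_sqD (j x) (j y)) => h1 h2.
  have := sqr_ge0 `|j x - j y|; rewrite h1 h2 => h3.
  set a := `|x| ^+ 2; set b := `|y| ^+ 2; set c := dotp x y => h4.
  set a' := `|j x| ^+ 2 in h3 h4 *; set b' := `|j y| ^+ 2 in h3 h4 *.
  set c' := dotp (j x) _ in h3 h4 *; lra.
have xnP n : exists x, F x < m + n.+1%:R^-1.
  have [|_ [x _ <-] Fx] := @inf_adherent _ (range F) n.+1%:R^-1 _ Fi.
    by rewrite invr_gt0 ltr0n.
  by exists x.
have [u uP] := choice xnP.
have [x ux] : exists l : V, u n @[n --> \oo] --> l.
  apply: (@cauchy_bound_cvg _ _ u (fun n => Num.sqrt (4 / s * n.+1%:R^-1))).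
    move=> n k nk; rewrite -(ler_pXn2r (n := 2)) ?nnegrE ?sqrtr_ge0//.
    rewrite sqr_sqrtr; last by rewrite mulr_ge0 ?invr_ge0// divr_ge0// ltW.
    rewrite -(ler_pM2l s0) (le_trans (Fmid _ _))//.
    rewrite (_ : s * _ = 4 * n.+1%:R^-1); last by rewrite mulrA mulrCA divff ?gt_eqF// mulr1.
    have := uP n; have := uP k.
    have : k.+1%:R^-1 <= n.+1%:R^-1 :> R by rewrite lef_pV2 ?posrE// ler_nat ltnS.
    move: (n.+1%:R^-1) (k.+1%:R^-1) (F (u n)) (F (u k)) => ? ? ? ?; lra.
  rewrite -[X in _ --> X]sqrtr0; apply: continuous_cvg; first exact: sqrt_continuous.
  rewrite -[X in _ --> X](mulr0 (4 / s)); apply: cvgMr; exact: cvg_harmonic.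
have jux : j (u n) @[n --> \oo] --> j x.
  by apply: continuous_cvg => //; exact: bop_continuous.
have Fx : F x = m.
  apply/eqP; rewrite eq_le mF andbT.
  have h1 : F (u n) @[n --> \oo] --> F x.
    apply: cvgB; last by apply: cvgMr; exact: dotp_cvg.
    apply: cvgD; first by apply: cvgM; exact: cvg_norm.
    by apply: cvgMr; apply: cvgM; exact: cvg_norm.
  have h2 : m + n.+1%:R^-1 @[n --> \oo] --> m + 0.
    by apply: cvgD; [exact: cvg_cst|exact: cvg_harmonic].
  rewrite -(addr0 m); apply: ler_cvg_to h1 h2 _.
  by near=> n; apply/ltW/uP.
exists x => y; apply/eqP; rewrite -subr_eq0; apply/eqP.
apply: (@nonneg_affine_eq0 _ _ ((`|j y| ^+ 2 + s * `|y| ^+ 2) / 2)).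
  by rewrite divr_ge0// addr_ge0 ?mulr_ge0 ?sqr_ge0// ltW.
move=> t; have := mF (x + t *: y); rewrite -Fx /F bopD bopZ !norm_sqD.
rewrite !dotpZr dotpDr dotpZr !normrZ !exprMn real_normK ?num_real//.
set a := dotp x y; set b := dotp (j x) _; set c := dotp h _; set d := dotp h _.
set e := `|j x| ^+ 2; set f := `|j y| ^+ 2; set g := `|x| ^+ 2; set k := `|y| ^+ 2.
by move=> h1; nra.
Unshelve. all: by end_near. Qed.

(** This is [(j^* j + s)^-1 j^* h], where [j^*] is the Hilbert adjoint of [j]; for [s <= 0] the
    value is an arbitrary default. *)
Definition resolvent s h : V :=
  if pselect (0 < s) is left s0 then sval (cid (resolvent_exists h s0)) else 0.

Lemma resolventP s h y : 0 < s ->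
  dotp (j (resolvent s h)) (j y) + s * dotp (resolvent s h) y = dotp h (j y).
Proof.
by rewrite /resolvent; case: pselect => // s0 _; case: cid.
Qed.

Lemma resolvent_unique s h x : 0 < s ->
  (forall y, dotp (j x) (j y) + s * dotp x y = dotp h (j y)) -> x = resolvent s h.
Proof.
move=> s0 xP; apply/eqP; rewrite -subr_eq0 -normr_eq0 -sqrf_eq0.
set d := x - _.
have : dotp (j d) (j d) + s * dotp d d = 0.
  have := resolventP h d s0; rewrite -(xP d) {2 4}/d bopB.
  rewrite -(subrK (dotp (j (resolvent s h)) (j d) + s * dotp (resolvent s h) d) 0).
  rewrite {1}/d bopB !dotpBl; lra.
rewrite !dotpE => /eqP; rewrite paddr_eq0 ?mulr_ge0 ?sqr_ge0 ?(ltW s0)// => /andP[_].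
by rewrite mulf_eq0 gt_eqF.
Qed.

Lemma resolvent_linear s (a : R) h h' : 0 < s ->
  resolvent s (a *: h + h') = a *: resolvent s h + resolvent s h'.
Proof.
move=> s0; apply/esym/resolvent_unique => // y.
rewrite bopD bopZ !dotpDl !dotpZl -(resolventP h y s0) -(resolventP h' y s0); ring.
Qed.

Lemma resolventB s h h' : 0 < s ->
  resolvent s (h - h') = resolvent s h - resolvent s h'.
Proof.
move=> s0; have := resolvent_linear (-1) h' h s0.
by rewrite !scaleN1r addrC => ->; rewrite addrC.
Qed.

Lemma resolvent_sym s h h' : 0 < s ->
  dotp h (j (resolvent s h')) = dotp h' (j (resolvent s h)).
Proof.
move=> s0; rewrite -(resolventP h _ s0) -(resolventP h' _ s0) (dotpC (j (resolvent s h))).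
by rewrite (dotpC (resolvent s h)).
Qed.

Lemma resolvent_sq s h : 0 < s -> dotp h (j (resolvent s h)) =
  `|j (resolvent s h)| ^+ 2 + s * `|resolvent s h| ^+ 2.
Proof. by move=> s0; rewrite -(resolventP h _ s0) !dotpE. Qed.

Lemma resolvent_contract s h : 0 < s -> `|j (resolvent s h)| <= `|h|.
Proof.
move=> s0; have := resolvent_sq h s0.
have := dotp_le_norm h (j (resolvent s h)); set x := resolvent s h => h1 h2.
have h3 : `|j x| ^+ 2 <= `|h| * `|j x|.
  by rewrite (le_trans _ h1)// h2 lerDl mulr_ge0 ?sqr_ge0// ltW.
have [->|jx0] := eqVneq (j x) 0; first by rewrite normr0.
by move: h3; rewrite expr2 ler_pM2r// normr_gt0.
Qed.

Lemma resolvent_form_ge0 s h : 0 < s -> 0 <= dotp h (j (resolvent s h)).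
Proof. by move=> s0; rewrite resolvent_sq// addr_ge0 ?mulr_ge0 ?sqr_ge0// ltW. Qed.

Lemma resolvent_form_le s h : 0 < s -> dotp h (j (resolvent s h)) <= `|h| ^+ 2.
Proof.
move=> s0; rewrite (le_trans (dotp_le_norm _ _))// expr2 ler_wpM2l//.
exact: resolvent_contract.
Qed.

Lemma resolvent_norm_sq_le s h : 0 < s -> s * `|resolvent s h| ^+ 2 <= `|h| ^+ 2.
Proof.
move=> s0; rewrite (le_trans _ (resolvent_form_le h s0))// resolvent_sq//.
by rewrite lerDr sqr_ge0.
Qed.

Lemma resolvent_norm_le s h : 0 < s -> `|resolvent s h| <= (Num.sqrt s)^-1 * `|h|.
Proof.
move=> s0; have r0 : 0 < Num.sqrt s by rewrite sqrtr_gt0.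
rewrite ler_pdivlMl// -(ler_pXn2r (n := 2)) ?nnegrE ?mulr_ge0 ?(ltW r0)//.
by rewrite exprMn sqr_sqrtr ?(ltW s0)// resolvent_norm_sq_le.
Qed.

Lemma resolvent_eqV s v y : 0 < s ->
  dotp (j (resolvent s (j v) - v)) (j y) + s * dotp (resolvent s (j v)) y = 0.
Proof. by move=> s0; rewrite bopB dotpBl addrAC resolventP// subrr. Qed.

Lemma resolvent_contractV s v : 0 < s -> `|resolvent s (j v)| <= `|v|.
Proof.
move=> s0; set x := resolvent s (j v).
have := resolvent_eqV v (x - v) s0; rewrite -/x dotpE dotpBr dotpE => h1.
have h2 : `|x| ^+ 2 <= dotp x v.
  rewrite -subr_le0 -(pmulr_rle0 _ s0); have := sqr_ge0 `|j (x - v)|; lra.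
have [->|x0] := eqVneq x 0; first by rewrite normr0.
have := le_trans h2 (dotp_le_norm _ _).
by rewrite expr2 ler_pM2l// normr_gt0.
Qed.

Lemma resolvent_distH s v : 0 < s -> `|j (resolvent s (j v) - v)| ^+ 2 <= s * `|v| ^+ 2.
Proof.
move=> s0; set x := resolvent s (j v).
have := resolvent_eqV v (x - v) s0; rewrite -/x dotpE dotpBr dotpE => h1.
have := dotp_le_norm x v; have := resolvent_contractV v s0; rewrite -/x => h2 h3.
have h4 : dotp x v <= `|v| ^+ 2 by rewrite (le_trans h3)// expr2 ler_wpM2r.
have : s * dotp x v <= s * `|v| ^+ 2 by rewrite ler_pM2l.
have : 0 <= s * `|x| ^+ 2 by rewrite mulr_ge0 ?sqr_ge0// ltW.
lra.
Qed.

(** Subtracting the two resolvent equations tested with [x - y] gives [(t - s) ((x, y) - |y|^2) = |j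
    (x - y)|^2 + s |x - y|^2 >= 0], hence [(x, y) >= |y|^2]. So [|R_s (j v)|_V] increases as [s]
    decreases, and its increments control distances. *)
Lemma resolvent_monotone s t v : 0 < s -> s <= t ->
  `|resolvent s (j v) - resolvent t (j v)| ^+ 2 <=
  `|resolvent s (j v)| ^+ 2 - `|resolvent t (j v)| ^+ 2.
Proof.
move=> s0 st; have t0 := lt_le_trans s0 st.
set x := resolvent s _; set y := resolvent t _.
have h1 := resolvent_eqV v (x - y) s0; have h2 := resolvent_eqV v (x - y) t0.
rewrite -/x -/y in h1 h2.
have h3 : `|j (x - y)| ^+ 2 + s * dotp x (x - y) - t * dotp y (x - y) = 0.
  rewrite -dotpE; transitivity (0 - 0 : R); last by rewrite subrr.
  rewrite -{1}h1 -h2 (_ : j (x - y) = j (x - v) - j (y - v)) ?dotpBl; first ring.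
  by rewrite -bopB opprB addrA subrK.
have h4 := sqr_ge0 `|j (x - y)|.
have h5 := norm_sqB x y.
rewrite !dotpBr !dotpE (dotpC y x) in h3.
have [st'|tns] := eqVneq s t.
  by rewrite /x /y st' subrr normr0 expr0n subrr.
have ts : 0 < t - s by rewrite subr_gt0 lt_neqAle tns.
have h6 := sqr_ge0 `|x - y|.
suff : 0 <= (t - s) * (dotp x y - `|y| ^+ 2) by rewrite pmulr_rge0//; lra.
rewrite h5 in h6; have := mulr_ge0 (ltW s0) h6; lra.
Qed.

Hypothesis jtriple : gelfand_triple j.

Let sn (n : nat) : R := n.+1%:R^-1.

Let sn_gt0 n : 0 < sn n. Proof. by rewrite invr_gt0. Qed.

(** The norms increase and stay below [|v|], so [resolvent_monotone] makes the sequence Cauchy in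
    [V]. The limit is identified in [H], where [resolvent_distH] gives [j (u n) --> j v], by
    injectivity of [j]. *)
Lemma resolvent_cvgV v : resolvent n.+1%:R^-1 (j v) @[n --> \oo] --> v.
Proof.
pose u n := resolvent (sn n) (j v).
have umono n m : (n <= m)%N -> `|u n - u m| ^+ 2 <= `|u m| ^+ 2 - `|u n| ^+ 2.
  move=> nm; rewrite distrC; apply: resolvent_monotone => //.
  by rewrite lef_pV2 ?posrE// ler_nat ltnS.
pose b n := `|u n| ^+ 2.
have bnd : nondecreasing_seq b.
  by move=> n m nm; rewrite -subr_ge0 (le_trans _ (umono _ _ nm))// sqr_ge0.
have bub : has_ubound (range b).
  exists (`|v| ^+ 2) => _ [n _ <-]; rewrite lerXn2r ?nnegrE//.
  exact: resolvent_contractV.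
have bcvg := nondecreasing_cvgn bnd bub; set B := sup _ in bcvg.
have bB n : b n <= B.
  by apply: ub_le_sup => //; exists n.
have [x ux] : exists l : V, u n @[n --> \oo] --> l.
  apply: (@cauchy_bound_cvg _ _ u (fun n => Num.sqrt (B - b n))).
    move=> n k nk; rewrite -(ler_pXn2r (n := 2)) ?nnegrE ?sqrtr_ge0//.
    rewrite sqr_sqrtr ?subr_ge0// (le_trans (umono _ _ nk))//.
    by rewrite lerD2r bB.
  rewrite -[X in _ --> X]sqrtr0; apply: continuous_cvg; first exact: sqrt_continuous.
  by rewrite -(subrr B); apply: cvgB => //; exact: cvg_cst.
suff vx : v = x by rewrite [X in _ --> X]vx.
apply: jtriple.1.
have h1 : j (u n) @[n --> \oo] --> j x.
  by apply: continuous_cvg => //; exact: bop_continuous.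
suff h2 : j (u n) @[n --> \oo] --> j v.
  exact: (cvg_unique _ h2 h1).
apply/cvgn_distP => e e0.
have [N NP] := (cvgn_distP _ _).1 (cvg_harmonic (R := R)) (e ^+ 2 / (`|v| ^+ 2 + 1))
  ltac:(by rewrite divr_gt0 ?exprn_gt0// ltr_wpDl// sqr_ge0).
exists N => n Nn; rewrite -(ltr_pXn2r (n := 2)) ?nnegrE ?(ltW e0)//.
rewrite -bopB (le_lt_trans (resolvent_distH _ (sn_gt0 n)))//.
have v1 : 0 < `|v| ^+ 2 + 1 by rewrite ltr_wpDl// sqr_ge0.
apply: (@le_lt_trans _ _ (sn n * (`|v| ^+ 2 + 1))).
  by rewrite ler_wpM2l ?lerDl// ltW.
rewrite -ltr_pdivlMr//; have := NP n Nn; rewrite subr0 ger0_norm//.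
Qed.

(** Contractions of [H] that converge on the dense subspace [j V] converge everywhere. *)
Lemma resolvent_cvgH h : j (resolvent n.+1%:R^-1 h) @[n --> \oo] --> h.
Proof.
apply/cvgn_distP => e e0; have e3 : 0 < e / 3 by rewrite divr_gt0.
have [||z [/= hv [v _ vE]]] := jtriple.2 (ball h (e / 3)).
- by exists h; exact: ballxx.
- apply: ball_open; exact: e3.
move: hv; rewrite -vE -ball_normE /= => hv {z vE}.
have h1 : j (resolvent n.+1%:R^-1 (j v)) @[n --> \oo] --> j v.
  by apply: continuous_cvg; [exact: bop_continuous|exact: resolvent_cvgV].
have [N NP] := (cvgn_distP _ _).1 h1 _ e3.
exists N => n Nn; have := NP n Nn; set r := resolvent _ => h2.
have h3 : `|j (r h) - j (r (j v))| <= `|h - j v|.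
  by rewrite -bopB -resolventB ?sn_gt0// resolvent_contract// sn_gt0.
have -> : j (r h) - h = (j (r h) - j (r (j v))) + (j (r (j v)) - j v) + (j v - h).
  by rewrite !addrA !subrK.
apply: le_lt_trans (ler_normD _ _) _.
have := ler_normD (j (r h) - j (r (j v))) (j (r (j v)) - j v).
rewrite (distrC (j v)); lra.
Qed.

End resolvent.

(** * The interpolation norms *)

Section interpolation_upper_bound.
Context (R : realType).

Lemma norm_pair (X Y : normedModType R) (z : X * Y) :
  `|z| = Num.max `|z.1| `|z.2|.
Proof. by []. Qed.

Lemma norm_fst_le (X Y : normedModType R) (z : X * Y) : `|z.1| <= `|z|.
Proof. by rewrite norm_pair le_max lexx. Qed.

Lemma norm_snd_le (X Y : normedModType R) (z : X * Y) : `|z.2| <= `|z|.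
Proof. by rewrite norm_pair le_max lexx orbT. Qed.

Lemma sin_norm_le (x : R) : `|sin x| <= `|x|.
Proof.
wlog x0 : x / 0 <= x.
  move=> h; have [/h//|x0] := leP 0 x.
  by have := h (- x); rewrite sinN !normrN; apply; rewrite oppr_ge0 ltW.
have [] := @MVT_segment R sin cos 0 x x0 (fun y _ => is_derive_sin y).
  exact/continuous_subspaceT/continuous_sin.
move=> c _; rewrite sin0 !subr0 => ->; rewrite normrM ler_piMl//.
exact: cos_max.
Qed.

Lemma cosB1_norm_le (x : R) : `|cos x - 1| <= x ^+ 2 / 2.
Proof.
have -> : cos x - 1 = - (2 * sin (x / 2) ^+ 2).
  have E : x = x / 2 *+ 2 by rewrite -mulr_natr divfK.
  by rewrite {1}E cos_mulr2n cos2sin2 mulr2n; ring.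
rewrite normrN normrM ger0_norm// ger0_norm ?sqr_ge0//.
rewrite -(@real_normK _ (sin _)) ?num_real//.
have h := sin_norm_le (x / 2).
have : `|sin (x / 2)| ^+ 2 <= `|x / 2| ^+ 2 by rewrite lerXn2r ?nnegrE.
rewrite (@real_normK _ (x / 2)) ?num_real// exprMn exprVn; lra.
Qed.

Lemma sinBid_norm_le (x : R) : `|x| <= 2^-1 -> `|sin x - x| <= x ^+ 2 / 4.
Proof.
wlog x0 : x / 0 <= x.
  move=> h; have [/h//|x0] := leP 0 x.
  have := h (- x); rewrite sinN normrN sqrrN -opprD normrN; apply.
  by rewrite oppr_ge0 ltW.
rewrite ger0_norm// => x2.
have der y : y \in `]0, x[ -> is_derive y 1 (fun y => sin y - y) (cos y - 1).
  by move=> _; exact: (is_deriveB (is_derive_sin y) (is_derive_id y 1)).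
have [|c] := MVT_segment x0 der.
  apply: continuous_subspaceT => y; apply: cvgB => //; exact: continuous_sin.
rewrite in_itv/= => /andP[c0 cx]; rewrite sin0 !subr0 => ->.
rewrite normrM (ger0_norm x0).
have := cosB1_norm_le c; have := normr_ge0 (cos c - 1).
have : c ^+ 2 <= x ^+ 2 by rewrite lerXn2r.
set d := `|_|; rewrite !expr2; nra.
Qed.

Lemma expRB1Bid_norm_le (x : R) : `|x| <= 2^-1 -> `|expR x - 1 - x| <= 2 * x ^+ 2.
Proof.
rewrite ler_norml => /andP[x1 x2].
have h1 := expR_ge1Dx x; have h2 := expR_ge1Dx (- x).
have h3 : expR x * expR (- x) = 1 by rewrite -expRD subrr expR0.
have h4 := expR_gt0 x.
rewrite ger0_norm; last by lra.
have h5 : expR x * (1 - x) <= 1 by rewrite -[leRHS]h3 ler_pM2l.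
suff : expR x <= 1 + x + 2 * x ^+ 2 by lra.
have h6 : 0 < 1 - x by lra.
rewrite -(ler_pM2r h6) (le_trans h5)//.
have -> : (1 + x + 2 * x ^+ 2) * (1 - x) = 1 + x ^+ 2 * (1 - 2 * x) by ring.
by rewrite lerDl mulr_ge0 ?sqr_ge0//; lra.
Qed.

(** With the next lemma, the real and imaginary parts of [|e^z - 1 - z| = O(|z|^2)] for
    [z = x + i y]: the complex differentiability of the exponentials used as Calderon functions. *)
Lemma cexp_remainder_re (x y : R) : `|x| <= 2^-1 -> `|y| <= 2^-1 ->
  `|expR x * cos y - 1 - x| <= 3 * (x ^+ 2 + y ^+ 2).
Proof.
move=> x2 y2.
have -> : expR x * cos y - 1 - x = (expR x - 1 - x) * cos y + (1 + x) * (cos y - 1).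
  by ring.
rewrite (le_trans (ler_normD _ _))// !normrM.
have h1 := expRB1Bid_norm_le x2; have h2 := cosB1_norm_le y; have h3 := cos_max y.
have h4 : `|1 + x| <= 2 by rewrite (le_trans (ler_normD _ _))// normr1; lra.
have h5 := normr_ge0 (expR x - 1 - x); have h6 := normr_ge0 (cos y - 1).
have h7 := normr_ge0 (cos y); have h8 := normr_ge0 (1 + x).
have : `|expR x - 1 - x| * `|cos y| <= 2 * x ^+ 2 * 1 by apply: ler_pM.
have : `|1 + x| * `|cos y - 1| <= 2 * (y ^+ 2 / 2) by apply: ler_pM.
have := sqr_ge0 x; have := sqr_ge0 y; lra.
Qed.

Lemma cexp_remainder_im (x y : R) : `|x| <= 2^-1 -> `|y| <= 2^-1 ->
  `|expR x * sin y - y| <= 3 * (x ^+ 2 + y ^+ 2).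
Proof.
move=> x2 y2.
have -> : expR x * sin y - y = ((expR x - 1 - x) + x) * sin y + (sin y - y).
  by ring.
rewrite (le_trans (ler_normD _ _))// normrM.
have h1 := expRB1Bid_norm_le x2; have h2 := sinBid_norm_le y2; have h3 := sin_norm_le y.
have h4 : `|expR x - 1 - x + x| <= 2 * `|x|.
  rewrite (le_trans (ler_normD _ _))//.
  have : 2 * x ^+ 2 <= `|x|.
    by rewrite -(real_normK (num_real x)) expr2; have := normr_ge0 x; nra.
  lra.
have : `|expR x - 1 - x + x| * `|sin y| <= 2 * `|x| * `|y| by apply: ler_pM.
have : 2 * `|x| * `|y| <= x ^+ 2 + y ^+ 2.
  rewrite -(real_normK (num_real x)) -(real_normK (num_real y)).
  have := sqr_ge0 (`|x| - `|y|); rewrite sqrrB -mulr_natr; lra.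
have := sqr_ge0 x; have := sqr_ge0 y; lra.
Qed.

Lemma cplx_norm_ge0 (X : normedModType R) (x : X * X) : 0 <= cplx_norm x.
Proof. exact: sqrtr_ge0. Qed.

Lemma cplx_normD (X : normedModType R) (x y : X * X) :
  cplx_norm (x + y) <= cplx_norm x + cplx_norm y.
Proof.
rewrite -(ler_pXn2r (n := 2)) ?nnegrE ?addr_ge0 ?cplx_norm_ge0//.
have sq (z : X * X) : cplx_norm z ^+ 2 = `|z.1| ^+ 2 + `|z.2| ^+ 2.
  by rewrite sqr_sqrtr// addr_ge0 ?sqr_ge0.
rewrite sqrrD !sq /=.
have h1 : `|x.1 + y.1| ^+ 2 <= (`|x.1| + `|y.1|) ^+ 2.
  by rewrite lerXn2r ?nnegrE ?addr_ge0// ler_normD.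
have h2 : `|x.2 + y.2| ^+ 2 <= (`|x.2| + `|y.2|) ^+ 2.
  by rewrite lerXn2r ?nnegrE ?addr_ge0// ler_normD.
have h3 : `|x.1| * `|y.1| + `|x.2| * `|y.2| <= cplx_norm x * cplx_norm y.
  rewrite -(ler_pXn2r (n := 2)) ?nnegrE ?addr_ge0 ?mulr_ge0 ?cplx_norm_ge0//.
  rewrite exprMn !sq; have := sqr_ge0 (`|x.1| * `|y.2| - `|x.2| * `|y.1|).
  rewrite !(sqrrB, sqrrD).
  move: `|x.1| `|x.2| `|y.1| `|y.2| => a b c d; lra.
move: h1 h2 h3; rewrite !sqrrD.
move: `|x.1| `|x.2| `|y.1| `|y.2| (cplx_norm x * _) => a b c d e; lra.
Qed.

Context (X0 X1 : normedModType R) (k : X1 -> X0).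
Hypothesis klin : forall (a : R) x y, k (a *: x + y) = a *: k x + k y.

Let k0 : k 0 = 0.
Proof. by have := klin (-1) 0 0; rewrite !scaleN1r !addNr. Qed.

Let kD x y : k (x + y) = k x + k y.
Proof. by have := klin 1 x y; rewrite !scale1r. Qed.

Let kZ a x : k (a *: x) = a *: k x.
Proof. by have := klin a x 0; rewrite k0 !addr0. Qed.

Lemma calderon0 : calderon k (fun=> 0) (fun=> 0) 0.
Proof.
have c0 (X : normedModType R) : cplx_norm (0 : X * X) <= 0.
  by rewrite /cplx_norm /= normr0 expr0n/= addr0 sqrtr0.
split=> //=.
- by apply: continuous_subspaceT => z; exact: cvg_cst.
- by exists 0 => z _; rewrite normr0.
- move=> z _; exists 0; apply/cvgrPdist_lt => e e0; apply: nearW => h.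
  have -> : cplx_scale h (0 : X0 * X0) = 0.
    by rewrite /cplx_scale /= !scaler0 subr0 addr0.
  by rewrite !subr0 scaler0 subr0 normr0.
- by move=> t; rewrite k0.
- by move=> t; exact: cvg_cst.
Qed.

Lemma calderonD f g M f' g' M' : calderon k f g M -> calderon k f' g' M' ->
  calderon k (fun z => f z + f' z) (fun t => g t + g' t) (M + M').
Proof.
move=> [c1 [K1 b1] h1 l1 r1 gc1] [c2 [K2 b2] h2 l2 r2 gc2]; split.
- by move=> z; apply: continuousD; [exact: c1|exact: c2].
- exists (K1 + K2) => z zs; rewrite (le_trans (ler_normD _ _))// lerD//.
    exact: b1.
  exact: b2.
- move=> z zs; have [D1 d1] := h1 z zs; have [D2 d2] := h2 z zs.
  exists (D1 + D2); rewrite -[X in _ --> X](addr0 (0 : X0 * X0)).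
  rewrite [X in X @ _](_ : _ =
    (fun h : R^o * R^o => `|h|^-1 *: (f (z + h) - f z - cplx_scale h D1) +
      `|h|^-1 *: (f' (z + h) - f' z - cplx_scale h D2))); first exact: cvgD.
  apply/funext => h; rewrite -scalerDr; congr (_ *: _).
  have -> : cplx_scale h (D1 + D2) = cplx_scale h D1 + cplx_scale h D2.
    rewrite /cplx_scale /=; congr (_, _) => /=; rewrite !scalerDr.
      by rewrite opprD addrACA.
    by rewrite addrACA.
  by rewrite [RHS]addrACA (addrACA (f (z + h)) (- f z)) !opprD.
- by move=> t; rewrite (le_trans (cplx_normD _ _))// lerD.
- move=> t; have [E1 n1] := r1 t; have [E2 n2] := r2 t; split.
    by rewrite E1 E2 /= !kD.
  by rewrite (le_trans (cplx_normD _ _))// lerD.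
- by move=> t; apply: cvgD; [exact: gc1|exact: gc2].
Qed.

(** [cexp_re] and [cexp_im] are the real and imaginary parts of [e^((z - th) L)], that is of
    [sigma^(z - th)] for [L = ln sigma]. *)
Definition cexp_re (th L : R) (z : R^o * R^o) : R := expR ((z.1 - th) * L) * cos (z.2 * L).
Definition cexp_im (th L : R) (z : R^o * R^o) : R := expR ((z.1 - th) * L) * sin (z.2 * L).

Let exp_part_cont th L : continuous (fun z : R^o * R^o => expR ((z.1 - th) * L) : R^o).
Proof.
move=> z; apply: continuous_comp; last exact: continuous_expR.
by apply: cvgMl; apply: cvgB; [exact: cvg_fst|exact: cvg_cst].
Qed.

Let cexp_re_cont th L : continuous (cexp_re th L : R^o * R^o -> R^o).
Proof.
move=> z; apply: cvgM; first exact: exp_part_cont.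
apply: continuous_comp; last exact: continuous_cos.
by apply: cvgMl; exact: cvg_snd.
Qed.

Let cexp_im_cont th L : continuous (cexp_im th L : R^o * R^o -> R^o).
Proof.
move=> z; apply: cvgM; first exact: exp_part_cont.
apply: continuous_comp; last exact: continuous_sin.
by apply: cvgMl; exact: cvg_snd.
Qed.

Let cexp_sq th L z : cexp_re th L z ^+ 2 + cexp_im th L z ^+ 2 =
  expR ((z.1 - th) * L) ^+ 2.
Proof. by rewrite !exprMn -mulrDr cos2Dsin2 mulr1. Qed.

Let cexp_reD th L z h : cexp_re th L (z + h) =
  cexp_re th L z * (expR (h.1 * L) * cos (h.2 * L)) -
  cexp_im th L z * (expR (h.1 * L) * sin (h.2 * L)).
Proof.
rewrite /cexp_re /cexp_im /= (_ : (z.1 + h.1 - th) * L = (z.1 - th) * L + h.1 * L); last by ring.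
by rewrite expRD (mulrDl z.2) cosD; ring.
Qed.

Let cexp_imD th L z h : cexp_im th L (z + h) =
  cexp_im th L z * (expR (h.1 * L) * cos (h.2 * L)) +
  cexp_re th L z * (expR (h.1 * L) * sin (h.2 * L)).
Proof.
rewrite /cexp_re /cexp_im /= (_ : (z.1 + h.1 - th) * L = (z.1 - th) * L + h.1 * L); last by ring.
by rewrite expRD (mulrDl z.2) sinD; ring.
Qed.

Let cexp_norm th L (z : R^o * R^o) (X : normedModType R) (x : X) :
  cplx_norm (cexp_re th L z *: x, cexp_im th L z *: x) =
  expR ((z.1 - th) * L) * `|x|.
Proof.
have E (a : R) : `|a *: x| ^+ 2 = a ^+ 2 * `|x| ^+ 2.
  by rewrite normrZ exprMn real_normK ?num_real.
rewrite /cplx_norm /= !E -mulrDl.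
by rewrite cexp_sq -exprMn sqrtr_sqr ger0_norm// mulr_ge0// expR_ge0.
Qed.

Lemma calderon_exp (th L : R) (w : X1) (M : R) :
  expR (- th * L) * `|k w| <= M -> expR ((1 - th) * L) * `|w| <= M ->
  calderon k (fun z => (cexp_re th L z *: k w, cexp_im th L z *: k w))
    (fun t => (cexp_re th L (1, t) *: w, cexp_im th L (1, t) *: w)) M.
Proof.
move=> M0 M1; split.
- apply: continuous_subspaceT => z; apply: cvg_pair => /=.
    by apply: cvgZr_tmp; exact: cexp_re_cont.
  by apply: cvgZr_tmp; exact: cexp_im_cont.
- exists (expR ((1 + `|th|) * `|L|) * `|k w|) => z /andP[z0 z1].
  have hE : expR ((z.1 - th) * L) <= expR ((1 + `|th|) * `|L|).
    rewrite ler_expR (le_trans (ler_norm _))// normrM ler_wpM2r//.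
    by rewrite (le_trans (ler_normB _ _))// lerD2r ger0_norm.
  have cz1 : `|cexp_re th L z| <= expR ((z.1 - th) * L).
    by rewrite normrM (ger0_norm (expR_ge0 _)) ler_piMr ?expR_ge0 ?cos_max.
  have cz2 : `|cexp_im th L z| <= expR ((z.1 - th) * L).
    by rewrite normrM (ger0_norm (expR_ge0 _)) ler_piMr ?expR_ge0 ?sin_max.
  rewrite norm_pair /= ge_max.
  have hz1 := le_trans cz1 hE; have hz2 := le_trans cz2 hE.
  apply/andP; split; rewrite normrZ.
    exact: (ler_wpM2r (normr_ge0 (k w)) hz1).
  exact: (ler_wpM2r (normr_ge0 (k w)) hz2).
(* The complex derivative of [e^((z - th) L) k w] is [L] times the function itself; the remainder is
   [O(|h|^2)] with the constant [c]. *)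
- move=> z _; exists (L *: (cexp_re th L z *: k w), L *: (cexp_im th L z *: k w)).
  set E := expR ((z.1 - th) * L); pose c := 6 * L ^+ 2 * E * 2 * `|k w|.
  have cz1 : `|cexp_re th L z| <= E.
    by rewrite normrM (ger0_norm (expR_ge0 _)) ler_piMr ?expR_ge0 ?cos_max.
  have cz2 : `|cexp_im th L z| <= E.
    by rewrite normrM (ger0_norm (expR_ge0 _)) ler_piMr ?expR_ge0 ?sin_max.
  have E0 : 0 < E by exact: expR_gt0.
  have c0 : 0 <= c.
    apply: mulr_ge0 => //; apply: mulr_ge0 => //; apply: mulr_ge0 (ltW E0).
    by apply: mulr_ge0 => //; exact: sqr_ge0.
  apply/cvgrPdist_lt => e e0.
  have : \forall h \near (0 : R^o * R^o)^', `|h| < Num.min (2^-1 / (`|L| + 1)) (e / (c + 1)).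
    have hm : 0 < Num.min (2^-1 / (`|L| + 1)) (e / (c + 1)).
      by rewrite lt_min !divr_gt0// ltr_wpDl.
    apply: nbhs_dnbhs; move/cvgrPdist_lt: (@cvg_id _ (nbhs (0 : R^o * R^o))).
    by move=> /(_ _ hm); apply: filterS => h; rewrite sub0r normrN.
  have hn0 : \forall h \near (0 : R^o * R^o)^', h != 0 by exact: nbhs_dnbhs_neq.
  move=> hs; near=> h.
  have : `|h| < Num.min (2^-1 / (`|L| + 1)) (e / (c + 1)) by near: h; exact: hs.
  have hh0 : h != 0 by near: h; exact: hn0.
  rewrite lt_min => /andP[hL he].
  have hp : 0 < `|h| by rewrite normr_gt0.
  have small (x : R) : `|x| <= `|h| -> `|x * L| <= 2^-1.
    move=> xh; rewrite normrM (le_trans (ler_wpM2r _ xh))//.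
    move: hL; rewrite ltr_pdivlMr ?ltr_wpDl// => /ltW; apply: le_trans.
    by rewrite ler_wpM2l ?lerDl.
  have h1s := small _ (norm_fst_le h); have h2s := small _ (norm_snd_le h).
  have sqle (x : R) : `|x| <= `|h| -> (x * L) ^+ 2 <= `|h| ^+ 2 * L ^+ 2.
    move=> xh; rewrite exprMn ler_wpM2r ?sqr_ge0// -real_normK ?num_real//.
    by rewrite lerXn2r ?nnegrE.
  have q1 := sqle _ (norm_fst_le h); have q2 := sqle _ (norm_snd_le h).
  have r1 := cexp_remainder_re h1s h2s; have r2 := cexp_remainder_im h1s h2s.
  set a := expR (h.1 * L) * cos (h.2 * L) in r1.
  set b := expR (h.1 * L) * sin (h.2 * L) in r2.
  have ra : `|a - 1 - h.1 * L| <= 6 * (`|h| ^+ 2 * L ^+ 2) by lra.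
  have rb : `|b - h.2 * L| <= 6 * (`|h| ^+ 2 * L ^+ 2) by lra.
  have B (p q : R) : `|p| <= E -> `|q| <= E ->
      `|p * (a - 1 - h.1 * L) + q * (b - h.2 * L)| <= E * 2 * (6 * (`|h| ^+ 2 * L ^+ 2)).
    move=> pE qE; rewrite (le_trans (ler_normD _ _))// !normrM.
    rewrite (_ : E * 2 * _ = E * (6 * (`|h| ^+ 2 * L ^+ 2)) + E * (6 * (`|h| ^+ 2 * L ^+ 2))); last by ring.
    by apply: lerD; apply: ler_pM.
  rewrite sub0r normrN normrZ normfV normr_id ltr_pdivrMl//.
  set p := cexp_re th L z; set q := cexp_im th L z.
  have -> : (cexp_re th L (z + h) *: k w, cexp_im th L (z + h) *: k w) - (p *: k w, q *: k w) -
      cplx_scale h (L *: (p *: k w), L *: (q *: k w)) =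
      ((p * (a - 1 - h.1 * L) + (- q) * (b - h.2 * L)) *: k w,
       (q * (a - 1 - h.1 * L) + p * (b - h.2 * L)) *: k w).
    rewrite /cplx_scale /= cexp_reD cexp_imD -/a -/b -/p -/q.
    congr (_, _) => /=; rewrite !scalerA -?scalerBl -?scalerDl -?scalerBl; congr (_ *: _); ring.
  apply: (@le_lt_trans _ _ (c * `|h| ^+ 2)).
    rewrite norm_pair /= ge_max !normrZ.
    have -> : c * `|h| ^+ 2 = E * 2 * (6 * (`|h| ^+ 2 * L ^+ 2)) * `|k w| by rewrite /c; ring.
    by rewrite !ler_wpM2r//; apply: B => //; rewrite normrN.
  rewrite expr2 mulrA mulrC ltr_pM2l//.
  move: he; rewrite ltr_pdivlMr ?ltr_wpDl//; apply: le_lt_trans.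
  by rewrite mulrC ler_wpM2l// lerDl.
- by move=> t; rewrite cexp_norm /= sub0r.
- move=> t; rewrite !kZ; split=> //.
  by rewrite cexp_norm.
- have pc : continuous (fun t : R^o => (1 : R^o, t)).
    by move=> t; exact: (@cvg_pair _ _ _ (nbhs t) (nbhs (1 : R^o)) (nbhs t) _ _ _ (fun=> 1) id (cvg_cst _) cvg_id).
  move=> t; apply: cvg_pair => /=; apply: cvgZr_tmp.
    exact: (continuous_comp (pc t) (@cexp_re_cont th L (1, t))).
  exact: (continuous_comp (pc t) (@cexp_im_cont th L (1, t))).
Unshelve. all: by end_near. Qed.

(* The summand [sigma^(z - theta) w] of a Calderon function has boundary values of
   norms [sigma^(-theta) |w|_0] and [sigma^(1 - theta) |w|_1]. *)
Lemma interp_norm_sum (th : R) (I : Type) (r : seq I) (sigma : I -> R) (w : I -> X1)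
    (M : I -> R) :
  (forall i, 0 < sigma i /\ sigma i `^ (- th) * `|k (w i)| <= M i /\
     sigma i `^ (1 - th) * `|w i| <= M i) ->
  interp_norm k th (k (\sum_(i <- r) w i)) <= \sum_(i <- r) M i.
Proof.
move=> hw; apply: ge_inf.
  exists 0 => M' [f [g [[_ _ _ l _ _] _]]].
  exact: le_trans (cplx_norm_ge0 _) (l 0).
elim: r => [|i r [f [g [fg fE]]]].
  by rewrite !big_nil k0; exists (fun=> 0), (fun=> 0); split => //; exact: calderon0.
have [s0 [m0 m1]] := hw i.
exists (fun z => (cexp_re th (ln (sigma i)) z *: k (w i),
  cexp_im th (ln (sigma i)) z *: k (w i)) + f z).
exists (fun t => (cexp_re th (ln (sigma i)) (1, t) *: w i,
  cexp_im th (ln (sigma i)) (1, t) *: w i) + g t).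
rewrite !big_cons; split.
  apply: calderonD => //; apply: calderon_exp.
    by move: m0; rewrite /powR gt_eqF.
  by move: m1; rewrite /powR gt_eqF.
rewrite fE /cexp_re /cexp_im /= subrr !mul0r expR0 cos0 sin0 mulr1 mulr0 scale1r scale0r.
by rewrite kD; congr (_, _) => /=; rewrite ?addr0.
Qed.

End interpolation_upper_bound.

Section interpolation_inequality.
Context (R : realType) (V H : hilbertType R) (j : bop V H).
Hypothesis jtriple : gelfand_triple j.

Let k (v : V) : dual V := gelfand j (j v).

Let klin (a : R) x y : k (a *: x + y) = a *: k x + k y.
Proof.
apply/val_inj/funext => z; rewrite /= bop_linear dotpDl dotpZl.
by rewrite /=.
Qed.

Lemma gelfand_norm_le (h : H) : `|gelfand j h| <= `|h| * `|j|.
Proof.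
apply: op_norm_leP => [|x]; first by rewrite mulr_ge0.
by rewrite (le_trans (dotp_le _ _))// -mulrA ler_wpM2l// bop_norm_le.
Qed.

(** Seen in [V^*], [v - R_s (j v)] is the functional [s (R_s (j v), .)_V]. *)
Let k_sub_resolvent s v : 0 < s -> `|k (v - resolvent j s (j v))| <= s * `|resolvent j s (j v)|.
Proof.
move=> s0; apply: op_norm_leP => [|x]; first by rewrite mulr_ge0// ltW.
rewrite /= -(opprB _ v) bopN dotpNl.
have /eqP := resolvent_eqV j v x s0; rewrite addr_eq0 => /eqP ->; rewrite opprK.
by rewrite normrM (gtr0_norm s0) -mulrA ler_wpM2l ?(ltW s0)// dotp_le.
Qed.

Let geom_sum_le (r : R) n : 0 <= r < 1 -> \sum_(i < n) r ^+ i <= (1 - r)^-1.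
Proof.
move=> /andP[r0 r1]; have h : 0 < 1 - r by rewrite subr_gt0.
rewrite -[leRHS]mul1r ler_pdivlMr//.
have -> : (\sum_(i < n) r ^+ i) * (1 - r) = 1 - r ^+ n.
  by rewrite mulrC -opprB mulNr -subrX1 opprB.
by rewrite gerBl exprn_ge0.
Qed.

Lemma pow4_unbounded (x : R) : exists n, x <= 4 ^+ n.
Proof.
exists (Num.trunc x).+1.
have h : x <= (Num.trunc x).+1%:R by exact/ltW/truncnS_gt.
rewrite (le_trans h)// -natrX ler_nat.
by apply/ltnW/ltn_expl.
Qed.

(* Splitting [v] along the resolvents [resolvent (4 ^ i * s)] with
   [s = (|j v| / |v|)^2], the smallest scale at which the bounds
   [|resolvent s h| <= s^(-1/2) |h|] and [|resolvent s (j v)| <= |v|] balance. *)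
Lemma Vb_norm_le (b : R) : 2^-1 < b < 1 ->
  exists C : R, forall v, Vb_norm j b v <= C * (`|j v| `^ (2 - 2 * b) * `|v| `^ (2 * b - 1)).
Proof.
move=> /andP[b2 b1].
pose c0 := `|j| + 1; have c00 : 0 < c0 by rewrite ltr_wpDl.
(* At scale [4 ^ i * s] the weight [sigma^(1 - b)] meets a [V]-norm of order [sigma^(-1/2)], which
   produces [r ^ i]. The series converges because [b > 1/2]. *)
pose r := (4 : R) `^ (2^-1 - b).
have r0 : 0 <= r by exact: powR_ge0.
have r1 : r < 1.
  rewrite -(powRr0 (4 : R)) /r /powR pnatr_eq0/= ltr_expR ltr_pM2r; first by lra.
  by rewrite ln_gt0// ltr1n.
pose C := 2 + 6 * (1 - r)^-1.
exists C => v.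
have [->|v0] := eqVneq v 0.
  apply: (@le_trans _ _ 0); last first.
    by rewrite mulr_ge0 ?mulr_ge0 ?powR_ge0// addr_ge0// mulr_ge0// invr_ge0 subr_ge0 ltW.
  have := @interp_norm_sum R _ _ k klin b nat [::] (fun=> 1) (fun=> 0) (fun=> 0).
  rewrite !big_nil; apply => i; rewrite (_ : k 0 = 0) ?normr0 ?mulr0//.
  by apply/val_inj/funext => x /=; rewrite bop0 dotp0l.
have vp : 0 < `|v| by rewrite normr_gt0.
have jv0 : 0 < `|j v|.
  rewrite normr_gt0; apply: contra_neq v0 => jv0; apply: jtriple.1.
  by rewrite jv0 bop0.
set a := `|j v| in jv0 *; set n := `|v| in vp *.
pose s := (a / n) ^+ 2.
have s0 : 0 < s by rewrite exprn_gt0// divr_gt0.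
pose sk (i : nat) := 4 ^+ i * s.
have sk0 i : 0 < sk i by rewrite mulr_gt0// exprn_gt0.
(* The telescoping stops once [sk K >= c0 ^ 2]: the last piece [y K] is then small enough in [V^*]
   by the plain embedding bound [|k (y K)| <= c0 |j v|]. *)
have [K KP] := pow4_unbounded (c0 ^+ 2 / s).
have sK : c0 ^+ 2 <= sk K by rewrite -ler_pdivrMr.
pose y i := resolvent j (sk i) (j v).
have yn i : `|y i| <= (Num.sqrt (sk i))^-1 * a by exact: resolvent_norm_le.
have kyn i : `|k (v - y i)| <= Num.sqrt (sk i) * a.
  rewrite (le_trans (k_sub_resolvent v (sk0 i)))//.
  rewrite (le_trans (ler_wpM2l (ltW (sk0 i)) (yn i)))// mulrA.
  rewrite -{1}(sqr_sqrtr (ltW (sk0 i))) expr2 mulfK// gt_eqF// sqrtr_gt0//.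
have sqS i : Num.sqrt (sk i.+1) = 2 * Num.sqrt (sk i).
  rewrite /sk exprS -mulrA sqrtrM//; congr (_ * _).
  by rewrite (_ : 4 = 2 ^+ 2) ?sqrtr_sqr ?ger0_norm//; ring.
(* The pieces of [v = (v - y 0) + sum (y i - y i.+1) + y K]; the piece [w o] has norm at most [m o]
   in [V] and [sg o * m o] in [V^*]. *)
pose w (o : option (option nat)) := match o with
  | None => v - y 0 | Some None => y K | Some (Some i) => y i - y i.+1 end.
pose sg (o : option (option nat)) := match o with
  | None => sk 0 | Some None => sk K | Some (Some i) => sk i end.
pose m (o : option (option nat)) := match o with
  | None => 2 * n | Some None => (Num.sqrt (sk K))^-1 * a
  | Some (Some i) => 3 * (Num.sqrt (sk i))^-1 * a end.
pose idx : seq (option (option nat)) :=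
  None :: Some None :: [seq Some (Some (i : nat)) | i <- iota 0 K].
have sumw : v = \sum_(o <- idx) w o.
  rewrite /idx !big_cons big_map /=.
  have tele q : \sum_(i <- iota 0 q) (y i - y i.+1) = y 0 - y q.
    elim: q => [|q IH]; first by rewrite big_nil subrr.
    by rewrite -addn1 iotaD big_cat/= IH add0n big_cons big_nil addr0 addrA subrK addn1.
  by rewrite tele [y K + _]addrC subrK subrK.
have sqk0 i : 0 < Num.sqrt (sk i) by rewrite sqrtr_gt0.
have wP o : 0 < sg o /\ `|k (w o)| <= sg o * m o /\ `|w o| <= m o.
  case: o => [[i|]|] /=; split; try exact: sk0.
  - have dk : y i - y i.+1 = (v - y i.+1) - (v - y i) by rewrite opprB [RHS]addrC subrKA.
    split.
      rewrite dk -[v - y i.+1]scale1r -(scaleN1r (v - y i)) addrC klin scaleN1r scale1r addrC.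
      rewrite (le_trans (ler_normB _ _))//.
      rewrite (le_trans (lerD (kyn _) (kyn _)))// sqS.
      rewrite -{3}(sqr_sqrtr (ltW (sk0 i))) expr2.
      by rewrite le_eqVlt; apply/orP; left; apply/eqP; field; rewrite gt_eqF.
    rewrite (le_trans (ler_normB _ _))// (le_trans (lerD (yn _) (yn _)))// sqS.
    rewrite -mulrDl ler_wpM2r ?(ltW jv0)//.
    by rewrite invfM; have := sqk0 i; rewrite -invr_gt0; lra.
  - split; last exact: yn.
    rewrite (le_trans (gelfand_norm_le _))//.
    rewrite (@le_trans _ _ (a * c0))//.
      apply: ler_pM => //; first exact: resolvent_contract.
      by rewrite /c0 lerDl.
    rewrite mulrA -{1}(sqr_sqrtr (ltW (sk0 K))) expr2 mulfK ?gt_eqF// mulrC ler_wpM2r//.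
      exact: ltW.
    by rewrite -(ler_pXn2r (n := 2)) ?nnegrE ?(ltW c00) ?sqrtr_ge0// sqr_sqrtr// ltW.
  - split.
      rewrite (le_trans (k_sub_resolvent v (sk0 0%N)))// ler_wpM2l ?(ltW (sk0 _))//.
      rewrite (le_trans (resolvent_contractV _ _ _))// -/n.
      by rewrite ler_peMl ?(ltW vp)// ler1n.
    rewrite (le_trans (ler_normB _ _))// mulr_natl mulr2n lerD//.
    exact: resolvent_contractV.
have sgP o (x : R) : sg o `^ x * sg o = sg o `^ (x + 1).
  rewrite powRD ?powRr1 ?(ltW (wP o).1)//.
  by apply/implyP => _; rewrite gt_eqF// (wP o).1.
have -> : Vb_norm j b v = interp_norm k b (k (\sum_(o <- idx) w o)) by rewrite -sumw.
apply: (@le_trans _ _ (\sum_(o <- idx) sg o `^ (1 - b) * m o)).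
  apply: (@interp_norm_sum R _ _ k klin b _ idx sg w (fun o => sg o `^ (1 - b) * m o)) => o.
  have [h1 [h2 h3]] := wP o; split=> //; split.
    have -> : 1 - b = - b + 1 by ring.
    by rewrite -sgP -mulrA ler_wpM2l ?powR_ge0.
  by rewrite ler_wpM2l ?powR_ge0.
have aE (t x : R) : 0 < t -> (t ^+ 2) `^ x = t `^ (2 * x).
  by move=> t0; rewrite -powR_mulrn ?ltW// -powRrM.
pose N := a `^ (2 - 2 * b) * n `^ (2 * b - 1).
have N0 : 0 <= N by rewrite mulr_ge0 ?powR_ge0.
have sN : s `^ (1 - b) * n = N.
  rewrite aE ?divr_gt0// (_ : 2 * (1 - b) = 2 - 2 * b); last by ring.
  rewrite powRM ?invr_ge0 ?(ltW jv0) ?(ltW vp)// -mulrA; congr (_ * _).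
  rewrite -[n^-1]powR_inv1 ?(ltW vp)// -powRrM -[X in _ * X]powRr1 ?(ltW vp)//.
  by rewrite -powRD ?(gt_eqF vp) ?implybT//; congr (_ `^ _); ring.
have skN i : sk i `^ (1 - b) * ((Num.sqrt (sk i))^-1 * a) = r ^+ i * N.
  have s12 : (Num.sqrt (sk i))^-1 = sk i `^ (- 2^-1).
    by rewrite powRN powR12_sqrt// ltW.
  rewrite s12 mulrA -powRD ?(gt_eqF (sk0 i)) ?implybT//.
  rewrite (_ : 1 - b + - 2^-1 = 2^-1 - b); last by field.
  have -> : sk i `^ (2^-1 - b) = r ^+ i * s `^ (2^-1 - b).
    have p4 : 0 <= 4 ^+ i :> R by rewrite exprn_ge0.
    rewrite (powRM _ p4 (ltW s0)); congr (_ * _).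
    by rewrite -(@powR_mulrn _ 4 i)// -powRrM (mulrC i%:R) powRrM -/r powR_mulrn.
  rewrite -mulrA; congr (_ * _).
  rewrite -sN aE ?divr_gt0// aE ?divr_gt0// -[a in LHS](divfK (negbT (gt_eqF vp))).
  rewrite mulrCA mulrA; congr (_ * n).
  move: (a / n) (divr_gt0 jv0 vp) => t tp.
  rewrite -{1}(powRr1 (ltW tp)) (mulfK (negbT (gt_eqF vp))).
  rewrite -powRD ?(gt_eqF tp) ?implybT//.
  by congr (_ `^ _); field.
rewrite /idx !big_cons big_map /= -/N.
have -> : sk 0 `^ (1 - b) * (2 * n) = 2 * N.
  by rewrite -sN /sk expr0 mul1r; ring.
rewrite skN.
have -> : \sum_(i <- iota 0 K) sk i `^ (1 - b) * (3 * (Num.sqrt (sk i))^-1 * a) =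
    3 * N * \sum_(i < K) r ^+ i.
  rewrite -{1}(subn0 K) -/(index_iota 0 K) big_mkord mulr_sumr.
  by apply: eq_bigr => i _; rewrite -(mulrA 3) mulrCA skN; ring.
have g1 := @geom_sum_le r K; have rr : 0 <= r < 1 by rewrite r0.
have {}g1 := g1 rr.
have rK : r ^+ K <= (1 - r)^-1.
  have := @geom_sum_le r K.+1 rr; rewrite big_ord_recr/=; apply: le_trans.
  by rewrite lerDr sumr_ge0// => i _; rewrite exprn_ge0.
have ri : 0 <= (1 - r)^-1 by rewrite invr_ge0 subr_ge0 ltW.
rewrite /C; set S := \sum_(_ < _) _ in g1 *; set q := (1 - r)^-1 in g1 rK ri *.
have : r ^+ K * N <= q * N by rewrite ler_wpM2r.
have : N * S <= N * q by rewrite ler_wpM2l.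
have := mulr_ge0 ri N0; nra.
Qed.

End interpolation_inequality.

(** * Local monotonicity *)

Section young.
Context (R : realType).

(** Compare [p] with [eps q], where [eps^(2 - lam) = del]: if [p <= eps q] the product is at most
    [del q^2], and otherwise [q < p / eps] bounds it by [eps^(-lam) p^2]. *)
Lemma powR_young (lam del : R) : 0 < lam < 2 -> 0 < del ->
  exists2 K : R, 0 <= K & forall p q : R, 0 <= p -> 0 <= q ->
    p `^ (2 - lam) * q `^ lam <= del * q ^+ 2 + K * p ^+ 2.
Proof.
move=> /andP[l0 l2] d0; have l2' : 0 < 2 - lam by rewrite subr_gt0.
pose eps := del `^ (2 - lam)^-1; have e0 : 0 < eps by exact: powR_gt0.
exists (eps `^ (- lam)) => [|p q p0 q0]; first exact: powR_ge0.
have sq (x : R) : 0 <= x -> x ^+ 2 = x `^ (2 - lam) * x `^ lam.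
  move=> x0; have [->|xn0] := eqVneq x 0.
    by rewrite expr0n/= (powR0 (negbT (gt_eqF l2'))) mul0r.
  by rewrite -powRD ?xn0 ?implybT// subrK powR_mulrn.
have [pq|qp] := leP p (eps * q).
  apply: (@le_trans _ _ (del * q ^+ 2)); last first.
    by rewrite lerDl mulr_ge0 ?powR_ge0 ?sqr_ge0.
  rewrite (sq q)// mulrA ler_wpM2r ?powR_ge0//.
  apply: (@le_trans _ _ ((eps * q) `^ (2 - lam))).
    by apply: ge0_ler_powR => //; rewrite ?nnegrE ?mulr_ge0// ltW.
  rewrite powRM ?(ltW e0)// /eps -powRrM mulVf ?gt_eqF// powRr1//.
  exact: ltW.
apply: (@le_trans _ _ (eps `^ (- lam) * p ^+ 2)); last first.
  by rewrite lerDr mulr_ge0 ?sqr_ge0// ltW.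
rewrite (sq p)// mulrCA ler_wpM2l ?powR_ge0//.
rewrite powRN ler_pdivlMl ?powR_gt0// -powRM ?(ltW e0)//.
by apply: ge0_ler_powR => //; rewrite ?nnegrE ?mulr_ge0 ?(ltW l0) ?(ltW e0)// ltW.
Qed.

Lemma inf_ge0 (S : set R) : (forall x, S x -> 0 <= x) -> 0 <= inf S.
Proof.
move=> S0; have [->|/set0P Sn0] := eqVneq S set0; first by rewrite inf0.
exact: lb_le_inf.
Qed.

Lemma mul_young (x y del : R) : 0 < del -> x * y <= del * x ^+ 2 + del^-1 * y ^+ 2.
Proof.
move=> d0; have h : 0 < del^-1 by rewrite invr_gt0.
have h2 : del * del^-1 = 1 by rewrite divff// gt_eqF.
have h1 : 0 <= del^-1 * ((del * x - y / 2) ^+ 2 + 3 / 4 * y ^+ 2).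
  by rewrite mulr_ge0 ?(ltW h)// addr_ge0 ?sqr_ge0// mulr_ge0 ?sqr_ge0// divr_ge0.
have E : del * x ^+ 2 + del^-1 * y ^+ 2 - x * y =
    del^-1 * ((del * x - y / 2) ^+ 2 + 3 / 4 * y ^+ 2).
  by field; rewrite gt_eqF.
by rewrite -subr_ge0 E.
Qed.

End young.

(** The linear bookkeeping that ends [local_monotonicity_at], with [bb = |u - v|_V^2] and [T] the
    squared product of [size2 u v] and [|j (u - v)|]. Five perturbation terms cost [th / 16] each,
    so [th / 2] survives. *)
Fact monotonicity_arith (R : realFieldType)
    (th M KF KG q D2 E T bb a2 X Y Z B r2 t1 t2 t3 t4 t5 t6 t7 t8 : R) :
  0 <= E * T -> 0 <= D2 * T -> 0 <= th * bb ->
  M * a2 <= M * T -> th * bb - M * a2 <= Z - 2^-1 * B ->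
  Z - t1 - t2 <= X -> Y <= B + (t8 + t8) + r2 ->
  t2 <= th / 16 * bb + KF * T -> t3 <= th / 16 * bb + KG * T ->
  t4 <= th / 16 * bb + KG * T -> t5 <= th / 16 * bb + q * T ->
  t1 <= t5 -> t6 <= t5 -> t7 <= D2 * T -> t8 <= t6 + t3 -> r2 <= 2 * t7 + 2 * t4 ->
  th / 2 * bb - (M + KF + 2 * KG + 2 * (q + D2) + E) * T <= X - 2^-1 * Y.
Proof. move=> *; lra. Qed.

Fact nonneg_sq_bounds (R : realFieldType) (D : R) : 0 <= D ->
  [/\ 1 <= (1 + D) ^+ 2, D <= (1 + D) ^+ 2 & D ^+ 2 <= (1 + D) ^+ 2].
Proof. by move=> D0; rewrite sqrrD; have := sqr_ge0 D; split; lra. Qed.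

Fact sqrD_le_dbl (R : realFieldType) (p q : R) : (p + q) ^+ 2 <= 2 * p ^+ 2 + 2 * q ^+ 2.
Proof. by have := sqr_ge0 (p - q); rewrite sqrrB sqrrD; lra. Qed.

Section subcritical.
Context (R : realType) (V H : hilbertType R) (j : bop V H).
Hypothesis jtriple : gelfand_triple j.
Local Notation nrm := (Vb_norm j).

Definition size2 (u v : V) : R := 1 + `|u| + `|v|.

Lemma size2_ge1 u v : 1 <= size2 u v.
Proof. by rewrite /size2 -addrA lerDl addr_ge0. Qed.

Lemma Vb_norm_ge0 b v : 0 <= nrm b v.
Proof.
apply: inf_ge0 => M [f [g [[_ _ _ l _ _] _]]].
exact: le_trans (cplx_norm_ge0 _) (l 0).
Qed.

(* The two ways in which a nonlinearity is absorbed: paired with [u - v], and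
   squared. *)
Definition subcritical (n : R) (S : V -> V -> R) : Prop :=
  (forall u v, 0 <= S u v) /\
  forall del L : R, 0 < del -> 0 <= L -> exists2 K : R, 0 <= K &
    forall u v, `|j u| <= n -> `|j v| <= n ->
      L * S u v * `|u - v| <= del * `|u - v| ^+ 2 + K * (size2 u v * `|j (u - v)|) ^+ 2 /\
      (L * S u v) ^+ 2 <= del * `|u - v| ^+ 2 + K * (size2 u v * `|j (u - v)|) ^+ 2.

Lemma subcritical0 n : subcritical n (fun _ _ => 0).
Proof.
split=> // del L d0 L0; exists 0 => // u v _ _.
rewrite mulr0 expr0n/= mul0r.
by have := mulr_ge0 (ltW d0) (sqr_ge0 `|u - v|); split; lra.
Qed.

Lemma subcriticalD n S1 S2 : subcritical n S1 -> subcritical n S2 ->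
  subcritical n (fun u v => S1 u v + S2 u v).
Proof.
move=> [p1 h1] [p2 h2]; split=> [u v|del L d0 L0]; first by rewrite addr_ge0.
have d2 : 0 < del / 2 by rewrite divr_gt0.
have L2 : 0 <= 2 * L by rewrite mulr_ge0.
have [K1 K10 k1] := h1 _ _ d2 L2; have [K2 K20 k2] := h2 _ _ d2 L2.
exists (K1 + K2) => [|u v un vn]; first by rewrite addr_ge0.
have [a1 b1] := k1 u v un vn; have [a2 b2] := k2 u v un vn.
have q1 : 0 <= L * S1 u v * `|u - v| by rewrite !mulr_ge0.
have q2 : 0 <= L * S2 u v * `|u - v| by rewrite !mulr_ge0.
set X := `|u - v| ^+ 2 in a1 b1 a2 b2 *; set Y := (_ * _) ^+ 2 in a1 b1 a2 b2 *.
have X0 : 0 <= X by exact: sqr_ge0.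
have Y0 : 0 <= Y by exact: sqr_ge0.
split; first by nra.
have := sqr_ge0 (L * S1 u v - L * S2 u v); nra.
Qed.

(** Put [kap = 2 b - 1]. On an [H]-ball, interpolation gives [nrm b u <= c |u|_V^kap], and the
    hypothesis on [b] reads [kap (rho + 1) <= 1], that is [kap rho <= 1 - kap]. The Lipschitz factor
    is thus at most a constant times [m^(1 - kap)] with [m = size2 u v], which combines with
    [nrm b (u - v) <= C a^(1 - kap) bb^kap] into [(m a)^(1 - kap) bb^kap]. Young's inequality with
    exponents [1 + kap] and [2 kap] gives the two bounds of [subcritical]. *)
Lemma subcritical_term (n b rho : R) : 0 <= n -> 0 <= rho -> 2^-1 < b < 1 ->
  2 * b <= 1 + (rho + 1)^-1 ->
  subcritical n (fun u v => (1 + nrm b u `^ rho + nrm b v `^ rho) * nrm b (u - v)) /\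
  exists2 C : R, 0 <= C & forall u, `|j u| <= n -> 1 + nrm b u `^ (rho + 1) <= C * (1 + `|u|).
Proof.
move=> n0 rho0 b12 brho; have [C CP] := Vb_norm_le jtriple b12.
have /andP[b2 b1] := b12.
pose kap := 2 * b - 1; have kap0 : 0 < kap by rewrite /kap; lra.
have kap1 : 0 < 1 - kap by rewrite /kap; lra.
have rho1 : 0 < rho + 1 by rewrite ltr_wpDl.
have kr : kap * (rho + 1) <= 1 by rewrite -ler_pdivlMr// mul1r /kap; lra.
pose c := `|C| * n `^ (1 - kap).
have c0 : 0 <= c by rewrite mulr_ge0 ?powR_ge0.
have E1 : 2 - 2 * b = 1 - kap by rewrite /kap; ring.
have nle u : nrm b u <= `|C| * (`|j u| `^ (1 - kap) * `|u| `^ kap).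
  rewrite (le_trans (CP u))// E1 ler_wpM2r ?mulr_ge0 ?powR_ge0//.
  exact: ler_norm.
have nlec u : `|j u| <= n -> nrm b u <= c * `|u| `^ kap.
  move=> un; rewrite (le_trans (nle u))// /c -mulrA ler_wpM2l// ler_wpM2r ?powR_ge0//.
  by apply: ge0_ler_powR => //; rewrite ?nnegrE// ltW.
have npow u (x r : R) : `|j u| <= n -> 0 <= r -> `|u| <= x -> 1 <= x -> kap * r <= 1 ->
    nrm b u `^ r <= c `^ r * x `^ (kap * r).
  move=> un r0 ux x1 kr1.
  apply: (@le_trans _ _ ((c * `|u| `^ kap) `^ r)).
    apply: ge0_ler_powR => //; rewrite ?nnegrE ?Vb_norm_ge0 ?mulr_ge0 ?powR_ge0//.
    exact: nlec.
  rewrite powRM ?powR_ge0// -powRrM ler_wpM2l ?powR_ge0//.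
  apply: ge0_ler_powR => //; rewrite ?nnegrE ?mulr_ge0 ?(ltW kap0)//.
  exact: le_trans x1.
split; last first.
  exists (1 + c `^ (rho + 1)) => [|u un]; first by rewrite addr_ge0 ?powR_ge0.
  have x1 : 1 <= 1 + `|u| by rewrite lerDl.
  rewrite mulrDl mul1r; apply: lerD => //.
  have := npow u (1 + `|u|) (rho + 1) un (ltW rho1) _ x1 kr.
  move=> h; rewrite (le_trans (h _)) ?lerDr// ler_wpM2l ?powR_ge0//.
  by rewrite -[leRHS]powRr1 ?(le_trans _ x1)// ler_powR.
split=> [u v|del L d0 L0].
  by rewrite mulr_ge0 ?Vb_norm_ge0// !addr_ge0 ?powR_ge0.
pose D := L * (1 + c `^ rho + c `^ rho) * `|C|.
have D0 : 0 <= D by rewrite !mulr_ge0// !addr_ge0 ?powR_ge0.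
have D1 : 0 < D + 1 by rewrite ltr_wpDl.
have DD : 0 < D ^+ 2 + 1 by rewrite ltr_wpDl ?sqr_ge0.
have [||K1 K10 k1] := @powR_young R (1 + kap) (del / (D + 1)).
- by apply/andP; split; lra.
- exact: divr_gt0.
have [||K2 K20 k2] := @powR_young R (2 * kap) (del / (D ^+ 2 + 1)).
- by apply/andP; split; lra.
- exact: divr_gt0.
exists (D * K1 + D ^+ 2 * K2) => [|u v un vn].
  exact: addr_ge0 (mulr_ge0 _ _) (mulr_ge0 (sqr_ge0 _) _).
set m := size2 u v; set a := `|j (u - v)|; set bb := `|u - v|.
have m1 : 1 <= m by exact: size2_ge1.
have m0 : 0 <= m by exact: le_trans m1.
have um : `|u| <= m by rewrite /m /size2; have := normr_ge0 v; lra.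
have vm : `|v| <= m by rewrite /m /size2; have := normr_ge0 u; lra.
have kr2 : kap * rho <= 1 - kap by rewrite mulrDr mulr1 in kr; lra.
have kr3 : kap * rho <= 1 by have := ltW kap0; lra.
have mm : m `^ (kap * rho) <= m `^ (1 - kap) by exact: ler_powR.
have cm : c `^ rho * m `^ (kap * rho) <= c `^ rho * m `^ (1 - kap).
  by rewrite ler_wpM2l ?powR_ge0.
have Z : 1 + nrm b u `^ rho + nrm b v `^ rho <= (1 + c `^ rho + c `^ rho) * m `^ (1 - kap).
  rewrite !mulrDl mul1r; apply: lerD; [apply: lerD|].
  - by rewrite -{1}(powRr0 m) ler_powR// ltW.
  - exact: le_trans (npow u m rho un rho0 um m1 kr3) cm.
  - exact: le_trans (npow v m rho vn rho0 vm m1 kr3) cm.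
have S : L * ((1 + nrm b u `^ rho + nrm b v `^ rho) * nrm b (u - v)) <=
    D * ((m * a) `^ (1 - kap) * bb `^ kap).
  have -> : D * ((m * a) `^ (1 - kap) * bb `^ kap) =
      L * (((1 + c `^ rho + c `^ rho) * m `^ (1 - kap)) *
        (`|C| * (a `^ (1 - kap) * bb `^ kap))).
    by rewrite powRM ?normr_ge0// /D; ring.
  have n1 := nle (u - v); have n2 := Vb_norm_ge0 b (u - v).
  have z1 : 0 <= 1 + nrm b u `^ rho + nrm b v `^ rho by rewrite !addr_ge0 ?powR_ge0.
  by apply: ler_wpM2l => //; exact: ler_pM z1 n2 Z n1.
set s := L * _ in S *; have s0 : 0 <= s.
  by rewrite /s !mulr_ge0 ?Vb_norm_ge0// !addr_ge0 ?powR_ge0.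
have ma0 : 0 <= m * a by exact: mulr_ge0 m0 (normr_ge0 _).
have bb0 : 0 <= bb by exact: normr_ge0.
have b20 := sqr_ge0 bb; have ma20 := sqr_ge0 (m * a).
have j1 := k1 (m * a) bb ma0 bb0; have j2 := k2 (m * a) bb ma0 bb0.
split.
  apply: (@le_trans _ _ (D * ((m * a) `^ (2 - (1 + kap)) * bb `^ (1 + kap)))).
    rewrite (_ : 2 - (1 + kap) = 1 - kap); last by ring.
    have -> : bb `^ (1 + kap) = bb * bb `^ kap.
      have [->|bb1] := eqVneq bb 0; last by rewrite powRD ?bb1 ?implybT// powRr1.
      by rewrite mul0r powR0// gt_eqF// ltr_wpDl// ltW.
    rewrite (mulrC bb) !mulrA ler_wpM2r// -mulrA; exact: S.
  rewrite (le_trans (ler_wpM2l D0 j1))// mulrDr; apply: lerD.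
    rewrite mulrA ler_wpM2r// mulrA ler_pdivrMr// mulrC ler_pM2l// lerDl//.
  by rewrite mulrA ler_wpM2r// lerDl mulr_ge0 ?sqr_ge0.
apply: (@le_trans _ _ (D ^+ 2 * ((m * a) `^ (2 - 2 * kap) * bb `^ (2 * kap)))).
  have pw (x y : R) : 0 <= x -> x `^ (2 * y) = (x `^ y) ^+ 2.
    by move=> x0; rewrite mulrC powRrM powR_mulrn// powR_ge0.
  have -> : 2 - 2 * kap = 2 * (1 - kap) by ring.
  rewrite !pw// -!exprMn; apply: lerXn2r; rewrite ?nnegrE//.
  by apply: mulr_ge0 D0 _; rewrite mulr_ge0 ?powR_ge0.
rewrite (le_trans (ler_wpM2l (sqr_ge0 D) j2))// mulrDr; apply: lerD.
  rewrite mulrA ler_wpM2r// mulrA ler_pdivrMr// mulrC ler_pM2l// lerDl//.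
by rewrite mulrA ler_wpM2r// lerDr mulr_ge0.
Qed.

Lemma subcritical_lip_sum (n : R) (rho beta : nat -> R) (m k : nat) : 0 <= n ->
  (forall i, (m.+1 <= i <= k)%N -> [/\ 0 <= rho i, 2^-1 < beta i < 1 &
     2 * beta i <= 1 + (rho i + 1)^-1]) ->
  subcritical n (lip_sum j rho beta m k) /\
  exists2 C : R, 0 <= C & forall u, `|j u| <= n ->
    growth_sum j rho beta m k u <= C * (1 + `|u|).
Proof.
move=> n0; rewrite /lip_sum /growth_sum => hyp.
have [km|mk] := leqP k m.
  split.
    rewrite (_ : (fun _ _ => _) = fun _ _ => 0); first exact: subcritical0.
    by apply/funext => u; apply/funext => v; rewrite big_geq.
  by exists 0 => // u _; rewrite big_geq// mul0r.
rewrite -(subnK mk) addnC.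
have : forall i, (m.+1 <= i < m.+1 + (k - m.+1).+1)%N -> [/\ 0 <= rho i, 2^-1 < beta i < 1 &
     2 * beta i <= 1 + (rho i + 1)^-1].
  move=> i /andP[i1 i2]; apply: hyp; rewrite i1/=.
  by move: i2; rewrite addnS ltnS subnKC.
rewrite -addnS; elim: (k - m.+1).+1 => [|p IH] hp.
  rewrite addn0; split.
    rewrite (_ : (fun _ _ => _) = fun _ _ => 0); first exact: subcritical0.
    by apply/funext => u; apply/funext => v; rewrite big_geq.
  by exists 0 => // u _; rewrite big_geq// mul0r.
have [|S1 [C1 C10 G1]] := IH.
  by move=> i /andP[i1 i2]; apply: hp; rewrite i1/= addnS ltnS ltnW.
have [|r1 r2 r3] := hp (m.+1 + p)%N; first by rewrite leq_addr addnS/= ltnSn.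
have [S2 [C2 C20 G2]] := subcritical_term n0 r1 r2 r3.
rewrite addnS; split.
  have := subcriticalD S1 S2; congr subcritical.
  by apply/funext => u; apply/funext => v; rewrite [RHS]big_nat_recr ?leq_addr.
exists (C1 + C2) => [|u un]; first by rewrite addr_ge0.
by rewrite big_nat_recr ?leq_addr//= mulrDl lerD// ?G1 ?G2.
Qed.

End subcritical.

Section local_monotonicity.
Context (R : realType) (V H U : hilbertType R) (e : onb U) (j : bop V H).
Context (d : measure_display) (Omega : measurableType d).
Context (P : probability Omega R) (Fil : R -> set (set Omega)) (c : coefs V H e Omega).
Hypothesis jtriple : gelfand_triple j.

Lemma local_monotonicity_at (n th M C : R) (rho beta : nat -> R) (mF mG : nat) :
  0 <= n -> 0 < th -> 0 < M ->
  (forall i, (1 <= i <= mF + mG)%N -> [/\ 0 <= rho i, 2^-1 < beta i < 1 &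
     2 * beta i <= 1 + (rho i + 1)^-1]) ->
  exists2 K : R, 0 <= K & forall t w,
  (forall (u : V) (v : H), `|v| <= n ->
      th * `|u| ^+ 2 - M * `|j u| ^+ 2 <=
      cA0 c t w v u u - 2^-1 * `|cB0 c t w v u| ^+ 2) ->
  (forall (u v z : V), `|j u| <= n -> `|j v| <= n ->
    [/\ `|cA0 c t w (j u) z| + `|cB0 c t w (j u) z| <= C * `|z|,
        `|cA0 c t w (j u) z - cA0 c t w (j v) z| <= C * `|j u - j v| * `|z| /\
        `|cB0 c t w (j u) z - cB0 c t w (j v) z| <= C * `|j u - j v| * `|z|,
        `|cF c t w u - cF c t w v| <= C * lip_sum j rho beta 0 mF u v /\
        `|cF c t w u| <= C * growth_sum j rho beta 0 mF u &
        `|cG c t w u - cG c t w v| <= C * lip_sum j rho beta mF (mF + mG) u v /\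
        `|cG c t w u| <= C * growth_sum j rho beta mF (mF + mG) u]) ->
  forall u v : V, `|j u| <= n -> `|j v| <= n ->
   [/\ th / 2 * `|u - v| ^+ 2 - K * (size2 u v) ^+ 2 * `|j (u - v)| ^+ 2 <=
       (cA j c t w u - cA j c t w v) (u - v) - 2^-1 * `|cB j c t w u - cB j c t w v| ^+ 2,
      `|cA j c t w u| <= K * (1 + `|u|) + `|cf c t w| &
      `|cB j c t w u| <= K * (1 + `|u|) + `|cg c t w|].
Proof.
move=> n0 th0 M0 hyp.
pose D := `|C|; have D0 : 0 <= D by exact: normr_ge0.
have [|SF [CF CF0 GF]] := @subcritical_lip_sum R V H j jtriple n rho beta 0 mF n0.
  by move=> i /andP[i1 i2]; apply: hyp; rewrite i1 (leq_trans i2)// leq_addr.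
have [|SG [CG CG0 GG]] := @subcritical_lip_sum R V H j jtriple n rho beta mF (mF + mG) n0.
  by move=> i /andP[i1 i2]; apply: hyp; rewrite i2 andbT (leq_trans _ i1).
have del0 : 0 < th / 16 by rewrite divr_gt0.
(* [(1 + D)^2] dominates [1], [D] and [D^2], so one constant serves the pairing with [F], the cross
   term in [B], which carries [D^2], and the squared [G]-term. *)
have L0 : 0 <= (1 + D) ^+ 2 by exact: sqr_ge0.
have [KF KF0 kF] := SF.2 _ _ del0 L0; have [KG KG0 kG] := SG.2 _ _ del0 L0.
pose Q := (1 + D) ^+ 2; pose KQ := (th / 16)^-1 * Q ^+ 2 + D ^+ 2.
have KQ0 : 0 <= KQ.
  by rewrite addr_ge0 ?sqr_ge0// mulr_ge0 ?sqr_ge0// invr_ge0 ltW.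
exists (M + KF + 2 * KG + 2 * KQ + D + D * CF + D * CG) => [|t w hc hg u v un vn].
  by rewrite !addr_ge0 ?mulr_ge0// ltW.
have Cle (x y z : R) : 0 <= y -> x <= C * y -> x <= D * y.
  by move=> y0 h; rewrite (le_trans h)// ler_wpM2r// ler_norm.
set K := M + _ + _ + _ + _ + _ + _.
have [h1 [h2 h3] [h4 h5] [h6 h7]] := hg u v u un vn.
have g0 i1 i2 (x : V) : 0 <= growth_sum j rho beta i1 i2 x.
  by apply: sumr_ge0 => i _; rewrite addr_ge0 ?powR_ge0.
have {}h1 := Cle _ _ 0 (normr_ge0 _) h1.
have nA0 := normr_ge0 (cA0 c t w (j u) u); have nB0 := normr_ge0 (cB0 c t w (j u) u).
have nu := normr_ge0 u; have nv := normr_ge0 v.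
split; last 2 first.
- rewrite /cA (le_trans (ler_normB _ _))// lerD2r (le_trans (ler_normB _ _))//.
  have {}h5 := Cle _ _ 0 (g0 _ _ _) h5.
  have := ler_wpM2l D0 (GF u un) => h8.
  have := le_trans h5 h8; have : D <= K - D * CF.
    by rewrite /K; have := mulr_ge0 D0 CG0; lra.
  set f := `|cF _ _ _ _|; set a := `|cA0 _ _ _ _ _| in h1 nA0 * => h9 h10.
  have : (K - D * CF - D) * (1 + `|u|) >= 0 by rewrite mulr_ge0 ?subr_ge0// addr_ge0.
  by move: h1; lra.
- rewrite /cB (le_trans (ler_normD _ _))// lerD2r (le_trans (ler_normD _ _))//.
  have {}h7 := Cle _ _ 0 (g0 _ _ _) h7.
  have := ler_wpM2l D0 (GG u un) => h8.
  have := le_trans h7 h8; have : D <= K - D * CG.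
    by rewrite /K; have := mulr_ge0 D0 CF0; lra.
  set f := `|cG _ _ _ _|; set a := `|cB0 _ _ _ _ _| in h1 nB0 * => h9 h10.
  have : (K - D * CG - D) * (1 + `|u|) >= 0 by rewrite mulr_ge0 ?subr_ge0// addr_ge0.
  by move: h1; lra.
set x := u - v; set m := size2 u v.
have m1 : 1 <= m by exact: size2_ge1.
have um : `|u| <= m by rewrite /m /size2; lra.
have jx : j u - j v = j x by rewrite bopB.
have := hc x (j v) vn.
have [hv _ _ _] := hg v u x vn un.
have {}hv := Cle _ _ 0 (normr_ge0 _) hv.
have a0 : 0 <= `|j x| by [].
have b0 : 0 <= `|x| by [].
rewrite jx in h2 h3.
have {}h2 : `|cA0 c t w (j u) u - cA0 c t w (j v) u| <= D * `|j x| * `|u|.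
  by rewrite -mulrA; apply: Cle 0 _ _; rewrite ?mulr_ge0// mulrA.
have {}h3 : `|cB0 c t w (j u) u - cB0 c t w (j v) u| <= D * `|j x| * `|u|.
  by rewrite -mulrA; apply: Cle 0 _ _; rewrite ?mulr_ge0// mulrA.
have {}h4 := Cle _ _ 0 (SF.1 u v) h4.
have {}h6 := Cle _ _ 0 (SG.1 u v) h6.
have [f1 f2] := kF u v un vn; have [g1 g2] := kG u v un vn.
rewrite -/x -/m in f1 f2 g1 g2.
set a := `|j x| in a0 h2 h3 f1 f2 g1 g2 *; set b := `|x| in b0 f1 f2 g1 g2 hv *.
set sF := lip_sum _ _ _ _ _ _ _ in h4 f1 f2.
set sG := lip_sum _ _ _ _ _ _ _ in h6 g1 g2.
have sF0 : 0 <= sF by exact: SF.1.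
have sG0 : 0 <= sG by exact: SG.1.
have EA : cA j c t w u - cA j c t w v = cA0 c t w (j v) x +
    (cA0 c t w (j u) u - cA0 c t w (j v) u) - (cF c t w u - cF c t w v).
  rewrite /cA /x bopB.
  set A1 := cA0 c t w (j u) u; set A2 := cA0 c t w (j v) u; set A3 := cA0 c t w (j v) v.
  set F1 := cF c t w u; set F2 := cF c t w v; set f := cf c t w.
  rewrite opprB addrA subrK (addrC (A2 - A3)) subrKA !opprB addrACA.
  by rewrite [in RHS]addrACA (addrC (- A3)).
have EB : cB j c t w u - cB j c t w v = cB0 c t w (j v) x +
    ((cB0 c t w (j u) u - cB0 c t w (j v) u) + (cG c t w u - cG c t w v)).
  rewrite /cB /x bopB.
  set A1 := cB0 c t w (j u) u; set A2 := cB0 c t w (j v) u; set A3 := cB0 c t w (j v) v.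
  set F1 := cG c t w u; set F2 := cG c t w v; set f := cg c t w.
  rewrite opprD addrACA subrr addr0 opprD addrACA [RHS]addrA; congr (_ + _).
  by rewrite [RHS]addrC subrKA.
have dle (f : dual V) (y : V) : - (`|f| * `|y|) <= f y.
  have := bop_norm_le f y; rewrite ler_norml => /andP[h _]; exact: h.
have pA : cA0 c t w (j v) x x - D * a * `|u| * b - D * sF * b <=
    (cA j c t w u - cA j c t w v) x.
  rewrite EA bopDE bopDE bopNE.
  have q1 := dle (cA0 c t w (j u) u - cA0 c t w (j v) u) x.
  have q2 : (cF c t w u - cF c t w v) x <= `|cF c t w u - cF c t w v| * `|x|.
    exact: le_trans (ler_norm _) (bop_norm_le _ _).
  have q3 := ler_wpM2r b0 h2; have q4 := ler_wpM2r b0 h4.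
  rewrite -/b in q1 q2.
  apply: lerD; first apply: lerD => //.
    by apply: le_trans q1; rewrite lerN2.
  by rewrite lerN2 (le_trans q2).
set B0 := `|cB0 c t w (j v) x| in hv *.
have B00 : 0 <= B0 by exact: normr_ge0.
have hB0 : B0 <= D * b by rewrite (le_trans _ hv)// lerDr.
set r := D * a * `|u| + D * sG.
have r0 : 0 <= r by rewrite addr_ge0 ?mulr_ge0.
have pB : `|cB j c t w u - cB j c t w v| <= B0 + r.
  rewrite EB (le_trans (ler_normD _ _))// lerD2l (le_trans (ler_normD _ _))//.
  exact: lerD.
have pB2 : `|cB j c t w u - cB j c t w v| ^+ 2 <= (B0 + r) ^+ 2.
  by apply: (lerXn2r 2 (normr_ge0 _) (addr_ge0 B00 r0) pB).
set X := (cA j c t w u - cA j c t w v) x in pA *.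
set Y := `|cB j c t w u - cB j c t w v| in pB2 *.
set Z := cA0 c t w (j v) x x in pA *.
move=> hcx.
have [Q1 QD QDD] := nonneg_sq_bounds D0; rewrite -/Q in Q1 QD QDD.
have ma0 : 0 <= m * a by rewrite mulr_ge0// (le_trans _ m1).
have s1 : D * sF * b <= th / 16 * b ^+ 2 + KF * (m * a) ^+ 2.
  by apply: le_trans f1; rewrite !ler_wpM2r.
have s2 : D * b * (D * sG) <= th / 16 * b ^+ 2 + KG * (m * a) ^+ 2.
  apply: le_trans g1; rewrite (_ : D * b * (D * sG) = D ^+ 2 * sG * b); last by ring.
  by rewrite !ler_wpM2r.
have s3 : (D * sG) ^+ 2 <= th / 16 * b ^+ 2 + KG * (m * a) ^+ 2.
  apply: le_trans g2; have Q0 : 0 <= Q by exact: le_trans Q1.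
  exact: (lerXn2r 2 (mulr_ge0 D0 sG0) (mulr_ge0 Q0 sG0) (ler_wpM2r sG0 QD)).
have uma : a * `|u| <= m * a by rewrite mulrC ler_wpM2r.
have s4 : Q * (m * a) * b <= th / 16 * b ^+ 2 + (th / 16)^-1 * Q ^+ 2 * (m * a) ^+ 2.
  have E : (Q * (m * a)) ^+ 2 = Q ^+ 2 * (m * a) ^+ 2 by rewrite exprMn.
  by have := mul_young b (Q * (m * a)) del0; rewrite E (mulrA _ (Q ^+ 2)) (mulrC b).
have s5 : D * a * `|u| * b <= Q * (m * a) * b.
  rewrite -(mulrA D); apply: (ler_wpM2r b0); apply: ler_pM => //; exact: mulr_ge0.
have s6 : D * b * (D * a * `|u|) <= Q * (m * a) * b.
  rewrite (_ : D * b * _ = D ^+ 2 * (a * `|u|) * b); last by ring.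
  apply: (ler_wpM2r b0); apply: ler_pM => //; [exact: sqr_ge0|exact: mulr_ge0].
have s7 : (D * a * `|u|) ^+ 2 <= D ^+ 2 * (m * a) ^+ 2.
  rewrite -exprMn -(mulrA D); apply: lerXn2r; rewrite ?nnegrE.
  - exact: mulr_ge0 D0 (mulr_ge0 _ _).
  - exact: mulr_ge0.
  - exact: ler_wpM2l.
have s8 : B0 * r <= D * b * (D * a * `|u|) + D * b * (D * sG).
  by rewrite -mulrDr ler_wpM2r.
have s9 : r ^+ 2 <= 2 * (D * a * `|u|) ^+ 2 + 2 * (D * sG) ^+ 2.
  exact: sqrD_le_dbl.
have -> : K * m ^+ 2 * a ^+ 2 = K * (m * a) ^+ 2 by rewrite -mulrA -exprMn.
have jx2 : M * a ^+ 2 <= M * (m * a) ^+ 2.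
  by apply: (ler_wpM2l (ltW M0)); apply: (lerXn2r 2 a0 ma0); exact: ler_peMl.
have T0 := sqr_ge0 (m * a).
have p1 : 0 <= (D + D * CF + D * CG) * (m * a) ^+ 2.
  by rewrite mulr_ge0// !addr_ge0 ?mulr_ge0.
have p2 : 0 <= D ^+ 2 * (m * a) ^+ 2 by rewrite mulr_ge0// sqr_ge0.
have p3 : 0 <= th * b ^+ 2 by rewrite mulr_ge0 ?sqr_ge0// ltW.
rewrite sqrrD mulr2n in pB2.
rewrite (_ : K = M + KF + 2 * KG + 2 * KQ + (D + D * CF + D * CG)); last by rewrite /K !addrA.
exact: (monotonicity_arith p1 p2 p3 jx2 hcx pA pB2 s1 s2 s3 s4 s5 s6 s7 s8 s9).
Qed.

(** The constants of [local_monotonicity_at] for integer radii are glued into monotone functions of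
    the actual size. Only countably many exceptional null sets occur, one for each radius. *)
Lemma critical_local_monotonicity (T : R) : 0 < T ->
  critical_variational j P Fil c ->
  exists th K : R -> R,
  [/\ forall x, 0 < th x, forall x, 0 <= K x, {homo th : x y /~ x <= y},
      {homo K : x y / x <= y} &
  \forall w \ae P, forall (t : R) (u v : V), 0 <= t <= T ->
    [/\ th (`|j u| + `|j v|) * `|u - v| ^+ 2 -
       K (`|j u| + `|j v|) * (size2 u v) ^+ 2 * `|j (u - v)| ^+ 2 <=
       (cA j c t w u - cA j c t w v) (u - v) - 2^-1 * `|cB j c t w u - cB j c t w v| ^+ 2,
      `|cA j c t w u| <= K `|j u| * (1 + `|u|) + `|cf c t w| &
      `|cB j c t w u| <= K `|j u| * (1 + `|u|) + `|cg c t w|]].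
Proof.
move=> T0 [_ lc [mF [mG [rho [beta [hyp hcg]]]]]].
have step n : exists thK : R * R, [/\ 0 < thK.1, 0 <= thK.2 &
  \forall w \ae P, forall (t : R) (u v : V), 0 <= t <= T ->
   `|j u| <= n.+1%:R -> `|j v| <= n.+1%:R ->
   [/\ thK.1 * `|u - v| ^+ 2 - thK.2 * (size2 u v) ^+ 2 * `|j (u - v)| ^+ 2 <=
       (cA j c t w u - cA j c t w v) (u - v) - 2^-1 * `|cB j c t w u - cB j c t w v| ^+ 2,
      `|cA j c t w u| <= thK.2 * (1 + `|u|) + `|cf c t w| &
      `|cB j c t w u| <= thK.2 * (1 + `|u|) + `|cg c t w|]].
  have [th [M [th0 M0 hM]]] := lc T n.+1 T0 (ltn0Sn n).
  have [C hC] := hcg n.+1 T (ltn0Sn n) T0.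
  have [K K0 hK] := @local_monotonicity_at n.+1%:R th M C rho beta mF mG (ler0n _ _) th0 M0 hyp.
  exists (th / 2, K); split => //=; first by rewrite divr_gt0.
  apply: filterS2 hM hC => w hM hC t u v tT un vn.
  apply: (hK t w) => //.
    by move=> u' v'; exact: hM.
  by move=> u' v' z; exact: hC.
have [f fP] := choice step.
(* The inverse of a sum of inverses lies below each summand's constant and decreases with the number
   of terms; the plain sum on the next line does the opposite for [K]. *)
exists (fun x => (\sum_(i < (Num.trunc x).+1) (f i).1^-1)^-1).
exists (fun x => \sum_(i < (Num.trunc x).+1) (f i).2).
have mono (g : nat -> R) : (forall i, 0 <= g i) -> {homo (fun x : R => \sum_(i < (Num.trunc x).+1) g i) : x y / x <= y}.
  move=> g0 x y xy.
  have xyt : ((Num.trunc x).+1 <= (Num.trunc y).+1)%N by rewrite ltnS le_truncn.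
  rewrite -!(big_mkord predT) (big_cat_nat (leq0n _) xyt)//= lerDl; exact: sumr_ge0.
have gi i : 0 <= (f i).1^-1 by rewrite invr_ge0 ltW//; have [] := fP i.
have gi2 i : 0 <= (f i).2 by have [] := fP i.
have pos x : 0 < \sum_(i < (Num.trunc x).+1) (f i).1^-1.
  rewrite big_ord_recl/= ltr_pwDl ?sumr_ge0// invr_gt0; by have [] := fP 0%N.
split.
- by move=> x; rewrite invr_gt0.
- by move=> x; exact: sumr_ge0.
- by move=> x y xy; rewrite lef_pV2 ?posrE//; exact: (mono (fun i => (f i).1^-1) gi _ _ xy).
- by move=> x y xy; exact: (mono (fun i => (f i).2) gi2 _ _ xy).
have h := ae_foralln (fun n => let: And3 _ _ x := fP n in x).
apply: filterS h => w hw t u v tT.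
have one (r : R) : r <= (Num.trunc r).+1%:R by exact/ltW/truncnS_gt.
split.
- have := hw (Num.trunc (`|j u| + `|j v|)) t u v tT.
  have lu : `|j u| <= (Num.trunc (`|j u| + `|j v|)).+1%:R by rewrite (le_trans _ (one _))// lerDl.
  have lv : `|j v| <= (Num.trunc (`|j u| + `|j v|)).+1%:R by rewrite (le_trans _ (one _))// lerDr.
  move=> /(_ lu lv)[h1 _ _]; apply: le_trans h1; set k := Num.trunc _.
  apply: lerB; apply: ler_wpM2r; rewrite ?sqr_ge0//.
    rewrite -[leRHS]invrK lef_pV2 ?posrE ?pos ?invr_gt0//; last by have [] := fP k.
    by rewrite big_ord_recr/= lerDr sumr_ge0.
  by apply: ler_wpM2r; rewrite ?sqr_ge0// big_ord_recr/= lerDr sumr_ge0.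
- have [_ h1 _] := hw (Num.trunc `|j u|) t u u tT (one _) (one _).
  apply: le_trans h1 _; rewrite lerD2r ler_wpM2r ?addr_ge0//.
  by rewrite big_ord_recr/= lerDr sumr_ge0.
- have [_ _ h1] := hw (Num.trunc `|j u|) t u u tT (one _) (one _).
  apply: le_trans h1 _; rewrite lerD2r ler_wpM2r ?addr_ge0//.
  by rewrite big_ord_recr/= lerDr sumr_ge0.
Qed.

End local_monotonicity.

(** * Strong measurability and filtrations *)

Section strong_measurability.
Context (R : realType) (d : measure_display) (T : measurableType d).
Implicit Types (D : set T).

Lemma measurable_simple_comp (X : Type) (s : T -> X) (F : X -> R) :
  finite_set (range s) -> (forall x, measurable (s @^-1` [set x])) ->
  measurable_fun setT (F \o s).
Proof.
move=> fs ms _ B mB; rewrite setTI.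
have -> : (F \o s) @^-1` B = \bigcup_(x in range s `&` [set x | B (F x)]) (s @^-1` [set x]).
  apply/seteqP; split=> [t Bt|t [x [_ /= Bx] /= sx]]; last by rewrite /= sx.
  by exists (s t) => //; split=> //; exists t.
by apply: fin_bigcup_measurable => //; exact: finite_setIl.
Qed.

Lemma simple_level_measurable (X : Type) (s : T -> X) (Q : set X) :
  finite_set (range s) -> (forall x, measurable (s @^-1` [set x])) ->
  measurable (s @^-1` Q).
Proof.
move=> fs ms.
have -> : s @^-1` Q = \bigcup_(x in range s `&` Q) (s @^-1` [set x]).
  apply/seteqP; split=> [t Bt|t [x [_ /= Bx] /= sx]]; last by rewrite /= sx.
  by exists (s t) => //; split=> //; exists t.
by apply: fin_bigcup_measurable => //; exact: finite_setIl.
Qed.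

Lemma strongly_mfun_real (X : normedModType R) D (f : T -> X) (F : X -> R^o) :
  measurable D -> strongly_mfun measurable D f -> continuous F ->
  measurable_fun D (fun t => F (f t) : R).
Proof.
move=> mD [s [sP sf]] cF.
apply: (@measurable_fun_cvg _ _ _ D (fun n t => F (s n t))).
  move=> n; apply: measurable_funTS.
  by apply: measurable_simple_comp; [exact: (sP n).1|exact: (sP n).2].
by move=> t Dt; apply: continuous_cvg; [exact: cF|exact: sf].
Qed.

Lemma strongly_mfun_norm (X : normedModType R) D (f : T -> X) :
  measurable D -> strongly_mfun measurable D f ->
  measurable_fun D (fun t => `|f t| : R).
Proof. by move=> mD /strongly_mfun_real; apply => // x; exact: norm_continuous. Qed.

Lemma strongly_mfun_comp (X Y : normedModType R) D (f : T -> X) (F : X -> Y) :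
  strongly_mfun measurable D f -> continuous F ->
  strongly_mfun measurable D (F \o f).
Proof.
move=> [s [sP sf]] cF; exists (fun n => F \o s n); split=> [n|t Dt].
  have [fs ms] := sP n; split.
    have -> : range (F \o s n) = F @` range (s n) by rewrite image_comp.
    exact: finite_image.
  by move=> x; apply: (simple_level_measurable (F @^-1` [set x])).
by apply: continuous_cvg; [exact: cF|exact: sf].
Qed.

Lemma strongly_mfun_pair (X Y : normedModType R) D (f : T -> X) (g : T -> Y) :
  strongly_mfun measurable D f -> strongly_mfun measurable D g ->
  strongly_mfun measurable D (fun t => (f t, g t) : X * Y).
Proof.
move=> [s [sP sf]] [r [rP rg]]; exists (fun n t => (s n t, r n t)); split=> [n|t Dt].
  have [fs ms] := sP n; have [fr mr] := rP n; split.
    apply: (@sub_finite_set _ _ (range (s n) `*` range (r n))).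
      by move=> _ [t _ <-]; split; exists t.
    exact: finite_setX.
  move=> [x y].
  have -> : (fun t => (s n t, r n t)) @^-1` [set (x, y)] =
      (s n @^-1` [set x]) `&` (r n @^-1` [set y]).
    by apply/seteqP; split=> t /= [-> ->].
  exact: measurableI.
by apply: cvg_pair; [exact: sf|exact: rg].
Qed.

Lemma strongly_mfun_comp2 (X Y Z : normedModType R) D (f : T -> X) (g : T -> Y)
    (F : X * Y -> Z) :
  strongly_mfun measurable D f -> strongly_mfun measurable D g -> continuous F ->
  strongly_mfun measurable D (fun t => F (f t, g t)).
Proof. by move=> sf sg cF; exact: (strongly_mfun_comp (strongly_mfun_pair sf sg) cF). Qed.

Lemma strongly_mfunB (X : normedModType R) D (f g : T -> X) :
  strongly_mfun measurable D f -> strongly_mfun measurable D g ->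
  strongly_mfun measurable D (fun t => f t - g t).
Proof.
move=> sf sg; apply: (strongly_mfun_comp2 sf sg (F := fun z => z.1 - z.2)) => z.
by apply: cvgB; [exact: cvg_fst|exact: cvg_snd].
Qed.

Lemma strongly_mfunD (X : normedModType R) D (f g : T -> X) :
  strongly_mfun measurable D f -> strongly_mfun measurable D g ->
  strongly_mfun measurable D (fun t => f t + g t).
Proof.
move=> sf sg; apply: (strongly_mfun_comp2 sf sg (F := fun z => z.1 + z.2)) => z.
by apply: cvgD; [exact: cvg_fst|exact: cvg_snd].
Qed.

Lemma strongly_mfun_cst (X : normedModType R) D (x : X) :
  strongly_mfun measurable D (fun=> x).
Proof.
exists (fun _ _ => x); split=> [n|t _]; last exact: cvg_cst.
split; first by apply: (@sub_finite_set _ _ [set x]) => [_ [t _ <-]|]//.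
move=> y; have [->|xy] := pselect (x = y).
  by rewrite (_ : _ @^-1` _ = setT)//; apply/seteqP; split.
by rewrite (_ : _ @^-1` _ = set0)//; apply/seteqP; split.
Qed.

Lemma strongly_mfun_patch (X : normedModType R) D E (f : T -> X) :
  measurable E -> strongly_mfun measurable D f -> (forall t, E t -> D t) ->
  strongly_mfun measurable setT (fun t => if t \in E then f t else 0).
Proof.
move=> mE [s [sP sf]] ED; exists (fun n t => if t \in E then s n t else 0); split=> [n|t _].
  have [fs ms] := sP n; split.
    apply: (@sub_finite_set _ _ (range (s n) `|` [set 0])).
      by move=> _ [t _ <-]; case: ifPn => _; [left; exists t|right].
    by rewrite finite_setU; split.
  move=> x.
  have -> : (fun t => if t \in E then s n t else 0) @^-1` [set x] =
      (E `&` (s n @^-1` [set x])) `|` (~` E `&` [set _ | 0 = x]).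
    apply/seteqP; split=> t /=.
      by case: ifPn => [/set_mem Et <-|/negP tE <-]; [left|right; split=> // /mem_set].
    by case=> [[/mem_set -> //]|[tE <-]]; case: ifPn => // /set_mem.
  apply: measurableU; first exact: measurableI.
  apply: measurableI; first exact: measurableC.
  have [<-|x0] := pselect (0 = x); first by rewrite (_ : [set _ | _] = setT)//; apply/seteqP; split.
  by rewrite (_ : [set _ | _] = set0)//; apply/seteqP; split.
case: ifPn => [/set_mem Et|_]; last exact: cvg_cst.
exact/sf/ED.
Qed.

Lemma strongly_mfunS (X : normedModType R) D E (f : T -> X) :
  E `<=` D -> strongly_mfun measurable D f -> strongly_mfun measurable E f.
Proof. by move=> ED [s [sP sf]]; exists s; split=> // t /ED; exact: sf. Qed.

Lemma eq_strongly_mfun (X : normedModType R) D (f g : T -> X) :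
  (forall t, D t -> f t = g t) -> strongly_mfun measurable D f ->
  strongly_mfun measurable D g.
Proof. by move=> fg [s [sP sf]]; exists s; split=> // t Dt; rewrite -fg//; exact: sf. Qed.

End strong_measurability.

Section product_sections.
Context (R : realType) d d' (S : measurableType d) (T : measurableType d').
Context (X : normedModType R) (D : set (S * T)) (f : S * T -> X).
Hypothesis sf : strongly_mfun measurable D f.

Lemma strongly_mfun_section1 y :
  strongly_mfun measurable [set x | D (x, y)] (fun x => f (x, y)).
Proof.
have [s [sP sfD]] := sf; exists (fun n x => s n (x, y)); split=> [n|x Dx]; last exact: sfD.
have [fs ms] := sP n; split.
  by apply: (@sub_finite_set _ _ (range (s n))) => // _ [x _ <-]; exists (x, y).
move=> z; have -> : (fun x => s n (x, y)) @^-1` [set z] = ysection (s n @^-1` [set z]) y.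
  by apply/seteqP; split=> x; rewrite ysectionE.
exact: measurable_ysection.
Qed.

End product_sections.

Notation subalg G := (g_sigma_algebraType G).

Section filtered.
Context (R : realType) d (Omega : measurableType d) (Fil : R -> set (set Omega)).
Hypothesis hF : filtration Fil.

Lemma fil_measurableE (t : R) : 0 <= t -> @measurable _ (subalg (Fil t)) = Fil t.
Proof. by move=> t0; apply: sigma_algebra_id; case: hF => h _ _; exact: h. Qed.

Lemma filT (t : R) : 0 <= t -> Fil t setT.
Proof. by move=> t0; rewrite -(fil_measurableE t0); exact: (@measurableT _ (subalg (Fil t))). Qed.

Lemma fil_sub (t : R) A : 0 <= t -> Fil t A -> d.-measurable A.
Proof. by move=> t0; case: hF => _ h _; exact: h. Qed.

Lemma fil_mono (s t : R) A : 0 <= s -> s <= t -> Fil s A -> Fil t A.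
Proof. by move=> s0 st; case: hF => _ _ h; exact: h. Qed.

Lemma fil_measurable_fun (s t : R) (f : Omega -> R) : 0 <= s -> s <= t ->
  measurable_fun (T := subalg (Fil s)) setT f ->
  measurable_fun (T := subalg (Fil t)) setT f.
Proof.
move=> s0 st mf _ B mB; have := mf measurableT B mB.
rewrite !fil_measurableE//; last exact: le_trans st.
exact: fil_mono.
Qed.

Lemma fil_measurable_funT (t : R) (f : Omega -> R) : 0 <= t ->
  measurable_fun (T := subalg (Fil t)) setT f -> measurable_fun setT f.
Proof.
move=> t0 mf _ B mB; have := mf measurableT B mB.
rewrite fil_measurableE//; exact: fil_sub.
Qed.

Lemma prog_sigma_restrict (t : R) (A : set (R * Omega)) : 0 <= t -> prog Fil A ->
  @measurable _ (R * subalg (Fil t))%type (A `&` (`[0, t] `*` setT)).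
Proof.
by move=> t0 /(_ t t0); rewrite measurable_prod_measurableType fil_measurableE.
Qed.

Lemma sub_product_measurable (t : R) (A : set (R * Omega)) : 0 <= t ->
  @measurable _ (R * subalg (Fil t))%type A -> @measurable _ (R * Omega)%type A.
Proof.
move=> t0; rewrite measurable_prod_measurableType fil_measurableE//.
apply: smallest_sub; first exact: sigma_algebra_measurable.
by move=> _ [B mB [C FC] <-]; apply: measurableX => //; exact: fil_sub FC.
Qed.

Lemma prog_restrict_measurable (A : set (R * Omega)) : prog Fil A ->
  measurable (A `&` [set z | 0 <= z.1]).
Proof.
move=> pA.
have -> : A `&` [set z | 0 <= z.1] = \bigcup_n (A `&` (`[0, n%:R] `*` setT)).
  apply/seteqP; split=> [[t w] [Atw /= t0]|[t w] [n _ [Atw [/= + _]]]].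
    exists (Num.trunc t).+1 => //; split=> //; split=> //=; rewrite in_itv/= t0.
    exact/ltW/truncnS_gt.
  by rewrite in_itv/= => /andP[t0 _]; split.
apply: bigcupT_measurable => n.
exact: sub_product_measurable (ler0n _ _) (prog_sigma_restrict (ler0n _ _) pA).
Qed.

(** Progressive measurability in product form, on [[0, t]] times [Omega] with the sigma-algebra at
    time [t]: the form to which Tonelli's theorem applies. *)
Definition adapted_strong (X : normedModType R) (f : R -> Omega -> X) : Prop :=
  forall t, 0 <= t ->
    @strongly_mfun R (R * subalg (Fil t)) X measurable (`[0, t] `*` setT) (fun z => f z.1 z.2).

Definition adapted_real (f : R -> Omega -> R) : Prop :=
  forall t, 0 <= t ->
    measurable_fun (T := (R * subalg (Fil t))%type) (`[0, t] `*` setT) (fun z => f z.1 z.2).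

Lemma itv_setT_measurable (t : R) :
  @measurable _ (R * subalg (Fil t))%type (`[0, t] `*` setT).
Proof. by apply: measurableX. Qed.

Lemma adapted_strongB (X : normedModType R) (f g : R -> Omega -> X) :
  adapted_strong f -> adapted_strong g -> adapted_strong (fun t w => f t w - g t w).
Proof. by move=> af ag t t0; apply: strongly_mfunB; [exact: af|exact: ag]. Qed.

Lemma adapted_strong_comp (X Y : normedModType R) (f : R -> Omega -> X) (F : X -> Y) :
  adapted_strong f -> continuous F -> adapted_strong (fun t w => F (f t w)).
Proof. by move=> af cF t t0; exact: strongly_mfun_comp (af t t0) cF. Qed.

Lemma adapted_strong_norm (X : normedModType R) (f : R -> Omega -> X) :
  adapted_strong f -> adapted_real (fun t w => `|f t w|).
Proof.
move=> af t t0; apply: strongly_mfun_norm; [exact: itv_setT_measurable|exact: af].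
Qed.

Lemma strongly_prog_adapted (X : normedModType R) (f : R -> Omega -> X) :
  strongly_prog Fil f -> adapted_strong f.
Proof.
move=> [s [sP sf]] t t0.
have mE := @itv_setT_measurable t.
exists (fun n z => if z \in `[0, t] `*` setT then s n z else 0); split=> [n|[r w] [/= + _]].
  have [fs ms] := sP n; split.
    apply: (@sub_finite_set _ _ (range (s n) `|` [set 0])).
      by move=> _ [z _ <-]; case: ifPn => _; [left; exists z|right].
    by rewrite finite_setU; split.
  move=> x; set E := _ `*` _ in mE *.
  have -> : (fun t => if t \in E then s n t else 0) @^-1` [set x] =
      ((s n @^-1` [set x]) `&` E) `|` (~` E `&` [set _ | 0 = x]).
    apply/seteqP; split=> z /=.
      by case: ifPn => [/set_mem Et <-|/negP tE <-]; [left|right; split=> // /mem_set].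
    by case=> [[<- /mem_set -> //]|[tE <-]]; case: ifPn => // /set_mem.
  apply: measurableU; first exact: prog_sigma_restrict.
  apply: measurableI; first exact: measurableC.
  have [<-|x0] := pselect (0 = x); first by rewrite (_ : [set _ | _] = setT)//; apply/seteqP; split.
  by rewrite (_ : [set _ | _] = set0)//; apply/seteqP; split.
rewrite in_itv/= => /andP[r0 rt].
rewrite mem_set//=; last by rewrite in_itv/= r0 rt.
exact: sf.
Qed.

Lemma strongly_prog_joint (X : normedModType R) (f : R -> Omega -> X) :
  strongly_prog Fil f ->
  @strongly_mfun R (R * Omega) X measurable [set z | 0 <= z.1] (fun z => f z.1 z.2).
Proof.
move=> [s [sP sf]].
have mE : measurable ([set z | 0 <= z.1] : set (R * Omega)).
  rewrite -(setTI [set z | _]); apply: prog_restrict_measurable => t t0.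
  rewrite setTI; apply: sub_sigma_algebra; exists `[0, t]%classic => //.
  by exists setT => //; rewrite -(fil_measurableE t0); exact: measurableT.
exists (fun n z => if z \in [set z | 0 <= z.1] then s n z else 0); split=> [n|z z0].
  have [fs ms] := sP n; split.
    apply: (@sub_finite_set _ _ (range (s n) `|` [set 0])).
      by move=> _ [z _ <-]; case: ifPn => _; [left; exists z|right].
    by rewrite finite_setU; split.
  move=> x; set E := [set z | 0 <= z.1] in mE *.
  have -> : (fun t => if t \in E then s n t else 0) @^-1` [set x] =
      ((s n @^-1` [set x]) `&` E) `|` (~` E `&` [set _ | 0 = x]).
    apply/seteqP; split=> z /=.
      by case: ifPn => [/set_mem Et <-|/negP tE <-]; [left|right; split=> // /mem_set].
    by case=> [[<- /mem_set -> //]|[tE <-]]; case: ifPn => // /set_mem.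
  apply: measurableU; first exact: prog_restrict_measurable.
  apply: measurableI; first exact: measurableC.
  have [<-|x0] := pselect (0 = x); first by rewrite (_ : [set _ | _] = setT)//; apply/seteqP; split.
  by rewrite (_ : [set _ | _] = set0)//; apply/seteqP; split.
by rewrite mem_set//; exact: sf.
Qed.

Lemma strongly_prog_path (X : normedModType R) (f : R -> Omega -> X) w :
  strongly_prog Fil f -> strongly_mfun measurable [set t : R | 0 <= t] (f ^~ w).
Proof. by move=> /strongly_prog_joint/(@strongly_mfun_section1 _ _ _ _ _ _ _ _)/(_ w). Qed.

Lemma borel_prog_norm_path (X : normedModType R) (f : R -> Omega -> X) (w : Omega) :
  borel_mfun (prog Fil) (fun z => f z.1 z.2) ->
  measurable_fun [set t : R | 0 <= t] (fun t => `|f t w| : R).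
Proof.
move=> mf; apply: (measurability _ (RGenOpens.measurableE R)) => _ [_ [a [b ->] <-]].
have oO : open ((fun x : X => `|x| : R^o) @^-1` `]a, b[%classic).
  apply: open_comp; last exact: interval_open.
  by move=> x _; exact: norm_continuous.
have := measurable_ysection w (prog_restrict_measurable (mf _ oO)).
congr measurable; apply/seteqP; split=> t; rewrite ysectionE /=; by case.
Qed.

(* Tonelli for the product with the sigma-algebra at time t: this is what makes
   time integrals of progressive processes adapted. *)
Lemma adapted_integral (f : R -> Omega -> R) (t : R) (D : set R) : 0 <= t ->
  adapted_real f -> (forall r w, 0 <= f r w) -> measurable D -> D `<=` `[0, t] ->
  measurable_fun (T := subalg (Fil t)) setT
    (fun w => \int[lebesgue_measure]_(r in D) (f r w)%:E)%E.
Proof.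
move=> t0 af f0 mD Dt.
pose g := fun z : R * subalg (Fil t) => (f z.1 z.2)%:E.
have mE : @measurable _ (R * subalg (Fil t))%type (D `*` setT) by exact: measurableX.
have mg : measurable_fun setT (g \_ (D `*` setT)).
  apply/(measurable_restrictT _ _).1 => //.
  apply/measurable_EFinP; apply: measurable_funS (af t t0) => //; first exact: itv_setT_measurable.
  by move=> [r w] [/= /Dt ? _]; split.
have g0 z : (0 <= (g \_ (D `*` setT)) z)%E.
  by rewrite patchE; case: ifPn => // _; rewrite lee_fin.
have := @measurable_fun_fubini_tonelli_G _ _ _ (subalg (Fil t)) R lebesgue_measure _ mg g0.
apply: eq_measurable_fun => w _; rewrite /fubini_G [RHS]integral_mkcond.
apply: eq_integral => r _; rewrite !patchE; congr (if _ then _ else _).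
by apply/idP/idP => /set_mem; [case=> /= h _|move=> h]; apply/mem_set.
Qed.

End filtered.

Section law_integral.
Context d (T : measurableType d) (R : realType) (m : {measure set T -> \bar R}).
Context (C : set T) (X : T -> R) (c : R) (p : R -> R).
Hypotheses (mC : measurable C) (mX : measurable_fun setT X) (c0 : 0 <= c).
Hypotheses (p0 : forall x, 0 <= p x) (mp : measurable_fun setT p).
Hypothesis law : forall B : set R, measurable B ->
  m (C `&` X @^-1` B) = (c%:E * \int[lebesgue_measure]_(x in B) (p x)%:E)%E.
Local Open Scope ereal_scope.
Local Notation mu := (@lebesgue_measure R).
Import HBNNSimple.

Let mXA (A : set R) : measurable A -> measurable (X @^-1` A).
Proof. by move=> mA; rewrite -(setTI (X @^-1` _)); exact: mX. Qed.

Let mindic (A : set R) : measurable A -> measurable_fun C (fun w => \1_A (X w) : R).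
Proof.
by move=> mA; apply: (measurable_indic (U := X @^-1` A)); exact: mXA.
Qed.

Let law_sfun (h : {nnsfun R >-> R}) :
  \int[m]_(w in C) (h (X w))%:E = c%:E * \int[mu]_x ((h x)%:E * (p x)%:E).
Proof.
have mh r : measurable (h @^-1` [set r]) by exact: measurable_sfunP.
transitivity (\sum_(r \in range h) r%:E * m (C `&` X @^-1` (h @^-1` [set r]))).
  under eq_integral do rewrite fimfunE -fsumEFin//.
  rewrite ge0_integral_fsum//; last 2 first.
  - by move=> r; apply/measurable_EFinP/measurable_funM => //; exact: mindic.
  - by move=> r x Cx; rewrite EFinM nnfun_muleindic_ge0.
  apply: eq_fsbigr => r /[!inE] -[t _ hr].
  under eq_integral do rewrite EFinM.
  rewrite ge0_integralZl//.
  - by rewrite setIC -(@integral_indic _ _ _ m C mC)//; exact: mXA.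
  - by apply/measurable_EFinP; exact: mindic.
  - by rewrite lee_fin -hr.
transitivity (c%:E * \sum_(r \in range h) r%:E * \int[mu]_(x in h @^-1` [set r]) (p x)%:E); last first.
  congr (_ * _).
  under [RHS]eq_integral => x _.
    rewrite fimfunE -fsumEFin// ge0_mule_fsuml; last first.
      by move=> r; rewrite EFinM nnfun_muleindic_ge0.
    over.
  rewrite ge0_integral_fsum//; last 2 first.
  - move=> r; apply: emeasurable_funM; apply/measurable_EFinP; last exact: mp.
    by apply: measurable_funM; [exact: measurable_cst|exact: (measurable_indic (mh r))].
  - by move=> r x _; rewrite mule_ge0 ?lee_fin// -lee_fin EFinM nnfun_muleindic_ge0.
  apply: eq_fsbigr => r /[!inE] -[t _ hr].
  under [RHS]eq_integral do rewrite EFinM -muleA.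
  rewrite ge0_integralZl//.
  - congr (_ * _); rewrite [LHS]integral_mkcond; apply: eq_integral => x _.
    by rewrite patchE indicE; case: ifP => _; rewrite ?mul1e ?mul0e.
  - apply: emeasurable_funM; apply/measurable_EFinP; last exact: mp.
    exact: (measurable_indic (mh r)).
  - by move=> x _; rewrite mule_ge0 ?lee_fin.
  - by rewrite lee_fin -hr.
rewrite ge0_mule_fsumr; last first.
  move=> r; have [[t _ <-]|rh] := pselect (range h r).
    by rewrite mule_ge0 ?lee_fin// integral_ge0// => x _; rewrite lee_fin.
  rewrite (_ : h @^-1` [set r] = set0) ?integral_set0 ?mule0//.
  by apply/seteqP; split => // x /= hx; apply: rh; exists x.
by apply: eq_fsbigr => r _; rewrite law// muleCA.
Qed.

(** The image of [m] restricted to [C] under [X] has density [c p]: the identity passes from level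
    sets to simple functions and then to monotone limits. With [c = P C] it expresses at once the
    Gaussian law of a Brownian increment and its independence of [C]. *)
Lemma law_integral (f : R -> \bar R) : measurable_fun setT f -> (forall x, 0 <= f x) ->
  \int[m]_(w in C) f (X w) = c%:E * \int[mu]_x (f x * (p x)%:E).
Proof.
move=> mf f0; pose g := nnsfun_approx measurableT mf.
have gf x : EFin (g n x) @[n --> \oo] --> f x by apply: cvg_nnsfun_approx.
have gnd x : {homo (fun n => (g n x)%:E) : a b / (a <= b)%N >-> a <= b}.
  by move=> a b ab; rewrite lee_fin; exact/lefP/nd_nnsfun_approx.
have l1 : \int[m]_(w in C) (g n (X w))%:E @[n --> \oo] --> \int[m]_(w in C) f (X w).
  under eq_integral do rewrite -(cvg_lim _ (gf _))//.
  apply: (@cvg_monotone_convergence _ _ _ m C mC (fun n w => (g n (X w))%:E)).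
  - move=> n; apply/measurable_EFinP; apply: measurableT_comp => //.
    exact: measurable_funTS.
  - by move=> n w _; rewrite lee_fin.
  - by move=> w _; exact: gnd.
have l2 : c%:E * \int[mu]_x ((g n x)%:E * (p x)%:E) @[n --> \oo] --> c%:E * \int[mu]_x (f x * (p x)%:E).
  have l3 : \int[mu]_x ((g n x)%:E * (p x)%:E) @[n --> \oo] --> \int[mu]_x (f x * (p x)%:E).
    have fE x : f x * (p x)%:E = limn (fun n => (g n x)%:E * (p x)%:E).
      by apply/esym/cvg_lim => //; apply: cvgeZr.
    under [X in _ --> X]eq_integral do rewrite fE.
    apply: (@cvg_monotone_convergence _ _ _ mu setT measurableT (fun n x => (g n x)%:E * (p x)%:E)).
    - move=> n; apply: emeasurable_funM; apply/measurable_EFinP; last exact: mp.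
      exact: (measurable_funP (g n)).
    - by move=> n x _; rewrite mule_ge0// lee_fin.
    - by move=> x _ a b ab; rewrite lee_wpmul2r ?lee_fin// -lee_fin gnd.
  exact: cvgeZl.
rewrite (_ : (fun n => _) = (fun n => c%:E * \int[mu]_x ((g n x)%:E * (p x)%:E))) in l1.
  exact: (cvg_unique _ l1 l2).
by apply/funext => n; exact: law_sfun.
Qed.

End law_integral.

(** * Integrals of real functions *)

Section real_integrable.
Context d (T : measurableType d) (R : realType) (mu : {measure set T -> \bar R}).
Context (D : set T) (mD : measurable D).
Implicit Types f g : T -> R.

Definition rint f : Prop := mu.-integrable D (EFin \o f).

Lemma rint_meas f : rint f -> measurable_fun D f.
Proof. by move=> /integrableP[/measurable_EFinP]. Qed.

Lemma rintP f : measurable_fun D f -> (\int[mu]_(x in D) (`|f x|)%:E < +oo)%E -> rint f.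
Proof. by move=> mf fo; apply/integrableP; split; first exact/measurable_EFinP. Qed.

Lemma rint_ge0P f : measurable_fun D f -> (forall x, D x -> 0 <= f x) ->
  (\int[mu]_(x in D) (f x)%:E < +oo)%E -> rint f.
Proof.
move=> mf f0 fo; apply: rintP => //; congr (_ < +oo)%E : fo.
by apply: eq_integral => x /set_mem Dx; rewrite ger0_norm// f0.
Qed.

Lemma rint_lty f : rint f -> (\int[mu]_(x in D) (`|f x|)%:E < +oo)%E.
Proof. by move=> /integrableP[]. Qed.

Lemma rint_le g f : rint g -> measurable_fun D f ->
  (forall x, D x -> `|f x| <= g x) -> rint f.
Proof.
move=> ig mf fg; apply: (le_integrable mD _ _ ig); first exact/measurable_EFinP.
by move=> x Dx /=; rewrite lee_fin (le_trans (fg x Dx))// ler_norm.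
Qed.

Lemma rintD f g : rint f -> rint g -> rint (fun x => f x + g x).
Proof. by move=> fi gi; exact: (integrableD mD fi gi). Qed.

Lemma rintZl (k : R) f : rint f -> rint (fun x => k * f x).
Proof. by move=> fi; exact: (integrableZl mD k fi). Qed.

Lemma rintN f : rint f -> rint (fun x => - f x).
Proof. by move=> /(rintZl (-1)); congr rint; apply/funext => x; rewrite mulN1r. Qed.

Lemma rintB f g : rint f -> rint g -> rint (fun x => f x - g x).
Proof. by move=> fi gi; apply: rintD => //; exact: rintN. Qed.

Lemma rintZr (k : R) f : rint f -> rint (fun x => f x * k).
Proof. by move=> /(rintZl k); congr rint; apply/funext => x; rewrite mulrC. Qed.

Lemma rint_norm f : rint f -> rint (fun x => `|f x|).
Proof. by move=> fi; exact: (integrable_norm fi). Qed.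

Lemma rint0 : rint (fun=> 0).
Proof. exact: integrable0. Qed.

Lemma rint_sum (I : Type) (r : seq I) (F : I -> T -> R) : (forall i, rint (F i)) ->
  rint (fun x => \sum_(i <- r) F i x).
Proof.
move=> iF; elim: r => [|i r IH].
  by under [X in rint X]eq_fun do rewrite big_nil; exact: rint0.
under [X in rint X]eq_fun do rewrite big_cons.
exact: rintD.
Qed.

Lemma Rintegral_sum (I : Type) (r : seq I) (F : I -> T -> R) : (forall i, rint (F i)) ->
  \int[mu]_(x in D) (\sum_(i <- r) F i x) = \sum_(i <- r) \int[mu]_(x in D) F i x.
Proof.
move=> iF; elim: r => [|i r IH].
  rewrite big_nil; under eq_Rintegral do rewrite big_nil.
  by rewrite /Rintegral integral0.
under eq_Rintegral do rewrite big_cons.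
by rewrite (RintegralD mD (iF i) (rint_sum r iF)) IH big_cons.
Qed.

Lemma rint_bounded_mul (K : R) (h : T -> R) f : measurable_fun D h ->
  (forall x, D x -> `|h x| <= K) -> rint f -> rint (fun x => h x * f x).
Proof.
move=> mh hK fi; apply: (@rint_le (fun x => K * `|f x|)).
- by apply: rintZl; exact: rint_norm.
- by apply: measurable_funM => //; exact: rint_meas.
- by move=> x Dx; rewrite normrM ler_wpM2r// hK.
Qed.

Lemma rint_sq_mul f g : measurable_fun D f -> measurable_fun D g ->
  rint (fun x => f x ^+ 2) -> rint (fun x => g x ^+ 2) -> rint (fun x => f x * g x).
Proof.
move=> mf mg f2 g2; apply: (@rint_le (fun x => f x ^+ 2 + g x ^+ 2)).
- exact: rintD.
- exact: measurable_funM.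
- move=> x _; have := sqr_ge0 (`|f x| - `|g x|); rewrite sqrrB normrM !real_normK ?num_real//.
  have := sqr_ge0 (f x); have := sqr_ge0 (g x); rewrite mulr2n.
  move: (f x ^+ 2) (g x ^+ 2) (`|f x| * `|g x|) => a b c; lra.
Qed.

Lemma rint_sqD f g : measurable_fun D f -> measurable_fun D g ->
  rint (fun x => f x ^+ 2) -> rint (fun x => g x ^+ 2) -> rint (fun x => (f x + g x) ^+ 2).
Proof.
move=> mf mg f2 g2; apply: (@rint_le (fun x => 2 * f x ^+ 2 + 2 * g x ^+ 2)).
- by apply: rintD; exact: rintZl.
- by apply: measurable_funX; exact: measurable_funD.
- move=> x _; rewrite ger0_norm ?sqr_ge0//.
  by have := sqr_ge0 (f x - g x); rewrite sqrrB sqrrD !mulr2n; lra.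
Qed.

Lemma rint_sq1 f : (mu D < +oo)%E -> measurable_fun D f -> rint (fun x => f x ^+ 2) -> rint f.
Proof.
move=> Doo mf f2; apply: (@rint_le (fun x => f x ^+ 2 + 1)) => //.
- apply: rintD => //; apply: rintP; first exact: measurable_cst.
  by rewrite integral_cst// normr1 mul1e.
- move=> x _; rewrite -(real_normK (num_real (f x))).
  by have := sqr_ge0 (`|f x| - 1); have := normr_ge0 (f x); nra.
Qed.

Lemma rint_cst (k : R) : (mu D < +oo)%E -> rint (fun=> k).
Proof.
move=> Doo; apply: rintP; first exact: measurable_cst.
by rewrite integral_cst// lte_mul_pinfty.
Qed.

Lemma ae_le_Rintegral f g : rint f -> rint g ->
  (\forall x \ae mu, D x -> f x <= g x) ->
  \int[mu]_(x in D) f x <= \int[mu]_(x in D) g x.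
Proof.
move=> fi gi fg.
have h : \int[mu]_(x in D) Num.max (f x) (g x) = \int[mu]_(x in D) g x.
  congr fine; apply: ae_eq_integral => //.
  - apply/measurable_EFinP; apply: measurable_maxr; exact: rint_meas.
  - by apply/measurable_EFinP; exact: rint_meas.
  - by apply: filterS fg => x fg Dx; rewrite max_r// fg.
rewrite -h; apply: le_Rintegral => //.
- apply: (@rint_le (fun x => `|f x| + `|g x|)).
  + by apply: rintD; exact: rint_norm.
  + by apply: measurable_maxr; exact: rint_meas.
  + move=> x _; case: (leP (f x) (g x)) => _; first by rewrite lerDr.
    by rewrite lerDl.
- by move=> x _; rewrite le_max lexx.
Qed.

Lemma rint_EFin f : rint f -> ((\int[mu]_(x in D) f x)%:E = \int[mu]_(x in D) (f x)%:E)%E.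
Proof. by move=> fi; rewrite /Rintegral fineK//; exact: (integrable_fin_num mD fi). Qed.

Lemma Rintegral_cvg (f_ : nat -> T -> R) f g : (forall n, measurable_fun D (f_ n)) ->
  measurable_fun D f -> (\forall x \ae mu, D x -> f_ n x @[n --> \oo] --> f x) ->
  rint g -> (forall n, \forall x \ae mu, D x -> `|f_ n x| <= g x) ->
  \int[mu]_(x in D) f_ n x @[n --> \oo] --> \int[mu]_(x in D) f x.
Proof.
move=> mf_ mf f_f gi fg.
have [|||||i _ h] := @dominated_convergence _ _ _ mu D mD (fun n => EFin \o f_ n) (EFin \o f) (EFin \o g).
- by move=> n; exact/measurable_EFinP.
- exact/measurable_EFinP.
- by apply: filterS f_f => x h Dx; apply: cvg_EFin; [exact: nearW|exact: h].
- exact: gi.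
- by have := ae_foralln fg; apply: filterS => x h n Dx; rewrite /= lee_fin h.
have : (EFin \o (fun n => \int[mu]_(x in D) f_ n x)) n @[n --> \oo] -->
    (\int[mu]_(x in D) f x)%:E.
  rewrite rint_EFin//; apply: cvg_trans h; apply: near_eq_cvg; apply: nearW => n /=.
  rewrite rint_EFin//; apply: (@rint_le (fun x => `|f_ n x|)) => //.
  apply: rintP; first exact: measurableT_comp.
  have := rint_lty gi; apply: le_lt_trans; apply: ae_ge0_le_integral => //.
  - by apply/measurable_EFinP/measurableT_comp => //; exact: measurableT_comp.
  - by apply/measurable_EFinP/measurableT_comp => //; exact: rint_meas.
  - apply: filterS (fg n) => x h' Dx; rewrite lee_fin normr_id (le_trans (h' Dx))//.
    exact: ler_norm.
by move/fine_cvgP => [].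
Qed.

End real_integrable.

Lemma rintS d (T : measurableType d) (R : realType) (mu : {measure set T -> \bar R})
    (D E : set T) (f : T -> R) : measurable D -> measurable E -> D `<=` E ->
  rint mu E f -> rint mu D f.
Proof. by move=> mD mE DE fi; exact: integrableS fi. Qed.

(** * Brownian increments *)

Section gaussian_moment.
Context (R : realType).
Local Notation mu := (@lebesgue_measure R).

(** Near [k = 1] the hypothesis reads [k - 1 >= (k - 1) m] to first order; dividing by [k - 1] with
    either sign gives [m <= 1] and [m >= 1]. The two values of [del] quantify this. *)
Fact second_moment_squeeze (m : R) :
  (forall k : R, 0 < k -> k != 1 -> k >= 1 + (1 - k ^- 2) / 2 * m) -> m = 1.
Proof.
move=> h; apply/eqP; rewrite eq_le; apply/andP; split.
- apply/ler_addgt0Pr => e e0.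
  pose del := Num.min 1 (e / 3).
  have d0 : 0 < del by rewrite lt_min ltr01 divr_gt0.
  have d1 : del <= 1 by rewrite ge_min lexx.
  have de : 3 * del <= e by rewrite -ler_pdivlMl// mulrC ge_min lexx orbT.
  have k0 : 0 < 1 + del by lra.
  have := h (1 + del) k0; rewrite gt_eqF ?ltrDl// => /(_ isT).
  rewrite (_ : (1 - _) / 2 * m = del * ((2 + del) / 2 * m / (1 + del) ^+ 2)); last first.
    by field; rewrite gt_eqF.
  rewrite lerD2l => h0; have : (2 + del) / 2 * m / (1 + del) ^+ 2 <= 1.
    by rewrite -(ler_pM2l d0) mulr1.
  rewrite ler_pdivrMr ?exprn_gt0// mul1r => h1.
  have : m <= (1 + del) ^+ 2 by rewrite !expr2 in h1 *; nra.
  by rewrite sqrrD; nra.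
- apply/ler_addgt0Pr => e e0.
  pose del := Num.min (2^-1) (e / 3).
  have d0 : 0 < del by rewrite lt_min invr_gt0 ltr0n divr_gt0.
  have d1 : del <= 2^-1 by rewrite ge_min lexx.
  have de : 3 * del <= e by rewrite -ler_pdivlMl// mulrC ge_min lexx orbT.
  have k0 : 0 < 1 - del by lra.
  have k1 : 1 - del != 1 by rewrite lt_eqF// gtrBl.
  have := h (1 - del) k0 k1.
  rewrite (_ : (1 - _) / 2 * m = - (del * ((2 - del) / 2 * m / (1 - del) ^+ 2))); last first.
    by field; rewrite gt_eqF.
  rewrite lerD2l lerN2 => h0.
  have : 1 <= (2 - del) / 2 * m / (1 + - del) ^+ 2 by rewrite -(ler_pM2l d0) mulr1.
  rewrite ler_pdivlMr ?exprn_gt0// mul1r => h1.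
  rewrite sqrrB in h1; nra.
Qed.

Let mT : measurable [set: g_sigma_algebraType R.-ocitv.-measurable] := measurableT.

Let pdf (s x : R) : 0 < s -> normal_pdf 0 s x = normal_peak s * expR (- (x ^+ 2) / (s ^+ 2 *+ 2)).
Proof. by move=> s0; rewrite /normal_pdf gt_eqF//= /normal_fun subr0. Qed.

Let peak_scale (s k : R) : 0 < s -> 0 < k -> normal_peak s = k * normal_peak (k * s).
Proof.
move=> s0 k0; rewrite /normal_peak.
have -> : (k * s) ^+ 2 * pi *+ 2 = k ^+ 2 * (s ^+ 2 * pi *+ 2).
  by rewrite exprMn !mulr2n; ring.
by rewrite [in RHS]sqrtrM ?sqr_ge0// sqrtr_sqr gtr0_norm// invfM mulrA divff ?gt_eqF// mul1r.
Qed.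

(** The quotient of [k] times the density of [N(0, (k s)^2)] by that of [N(0, s^2)] is exactly
    [exp((1 - k^-2) / (2 s^2) x^2)], and [exp y >= 1 + y]. *)
Let pdf_scale (s k x : R) : 0 < s -> 0 < k ->
  normal_pdf 0 s x * (1 + (1 - k ^- 2) / (2 * s ^+ 2) * x ^+ 2) <= k * normal_pdf 0 (k * s) x.
Proof.
move=> s0 k0; rewrite !pdf ?mulr_gt0//.
rewrite [leRHS]mulrA -(peak_scale s0 k0) -(mulrA (normal_peak s)) ler_wpM2l ?normal_peak_ge0//.
have -> : - x ^+ 2 / ((k * s) ^+ 2 *+ 2) = - x ^+ 2 / (s ^+ 2 *+ 2) +
    (1 - k ^- 2) / (2 * s ^+ 2) * x ^+ 2.
  have k1 : k != 0 by rewrite gt_eqF.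
  have s1 : s != 0 by rewrite gt_eqF.
  by rewrite -[(k*s)^+2 *+ 2]mulr_natr -[s^+2 *+ 2]mulr_natr; field; rewrite k1 s1.
by rewrite expRD ler_wpM2l ?expR_ge0// expR_ge1Dx.
Qed.

Let pdf_rint (s : R) : rint mu setT (normal_pdf 0 s).
Proof. exact: integrable_normal_pdf. Qed.

Let pdf_int (s : R) : \int[mu]_x (normal_pdf 0 s x) = 1.
Proof. by rewrite /Rintegral integral_normal_pdf. Qed.

Let msq_pdf (s : R) : measurable_fun setT (fun x : R => x ^+ 2 * normal_pdf 0 s x).
Proof. by apply: measurable_funM; [exact: exprn_measurable|exact: measurable_normal_pdf]. Qed.

(** The comparison with [k = 2] dominates [x^2] times the density by a multiple of a wider Gaussian
    density. *)
Lemma rint_sq_normal_pdf (s : R) : 0 < s -> rint mu setT (fun x : R => x ^+ 2 * normal_pdf 0 s x).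
Proof.
move=> s0; pose b : R := (1 - 2 ^- 2) / (2 * s ^+ 2).
have s20 : 0 < s ^+ 2 by rewrite exprn_gt0.
have b0 : 0 < b by rewrite /b divr_gt0 ?mulr_gt0//; lra.
apply: (@rint_le _ _ _ _ _ mT (fun x : R => 2 / b * normal_pdf 0 (2 * s) x)).
- exact: (rintZl mT _ (pdf_rint _)).
- exact: msq_pdf.
move=> x _; have := @pdf_scale s 2 x s0 ltac:(by []).
have p0 := normal_pdf_ge0 0 s x; rewrite -/b => h.
have e0 : 0 <= x ^+ 2 * normal_pdf 0 s x by rewrite mulr_ge0// sqr_ge0.
rewrite (ger0_norm e0) -(ler_pM2l b0).
rewrite (_ : b * (2 / b * _) = 2 * normal_pdf 0 (2 * s) x); last by field; rewrite gt_eqF.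
apply: le_trans h; rewrite mulrDr mulr1.
rewrite (_ : b * (x ^+ 2 * normal_pdf 0 s x) = normal_pdf 0 s x * (b * x ^+ 2)); last by ring.
by rewrite lerDr.
Qed.

(* Comparing the density of N(0, s^2) with the one of N(0, (k s)^2) for [k] near 1
   gives two-sided bounds on the second moment. *)
Lemma normal_second_moment (s : R) : 0 < s -> \int[mu]_x (x ^+ 2 * normal_pdf 0 s x) = s ^+ 2.
Proof.
move=> s0; set m := \int[mu]_x _.
have s20 : 0 < s ^+ 2 by rewrite exprn_gt0.
suff : m / s ^+ 2 = 1 by move=> h; rewrite -[LHS](divfK (negbT (gt_eqF s20))) h mul1r.
apply: second_moment_squeeze => k k0 _.
pose b : R := (1 - k ^- 2) / (2 * s ^+ 2).
have r1 := @rint_sq_normal_pdf s s0.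
have : \int[mu]_x (normal_pdf 0 s x + b * (x ^+ 2 * normal_pdf 0 s x)) <=
    \int[mu]_x (k * normal_pdf 0 (k * s) x).
  apply: le_Rintegral => //.
  - exact: (rintD mT (pdf_rint s) (rintZl mT _ r1)).
  - exact: (rintZl mT _ (pdf_rint _)).
  - move=> x _; have := @pdf_scale s k x s0 k0; apply: le_trans.
    by rewrite mulrDr mulr1 lerD2l (mulrC (normal_pdf 0 s x)) -/b mulrA.
rewrite (RintegralD mT (pdf_rint s) (rintZl mT _ r1)).
rewrite (RintegralZl _ mT r1) (RintegralZl _ mT (pdf_rint _)).
rewrite !pdf_int mulr1 -/m.
by rewrite (_ : b * m = (1 - k ^- 2) / 2 * (m / s ^+ 2))//; rewrite /b; field; rewrite !gt_eqF.
Qed.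

End gaussian_moment.

Section conditional_constant.
Context (R : realType) d (Omega : measurableType d) (P : probability Omega R).
Context (G : set (set Omega)) (Gsub : forall A, <<s G >> A -> d.-measurable A).
Context (Z : Omega -> R) (c : R).
Hypothesis Zi : rint P setT Z.
Hypothesis Zc : forall C, <<s G >> C -> \int[P]_(w in C) Z w = c * fine (P C).
Import HBNNSimple.

Let mT : measurable [set: Omega] := measurableT.

Let Gmeas (Y : Omega -> R) : measurable_fun (T := subalg G) setT Y -> measurable_fun setT Y.
Proof. by move=> mY _ B mB; apply: Gsub; exact: (mY measurableT B mB). Qed.

Let sfun_const (h : {nnsfun (subalg G) >-> R}) :
  rint P setT (fun w => h w * Z w) /\
  \int[P]_w (h w * Z w) = c * \int[P]_w h w.
Proof.
have mh r : <<s G >> (h @^-1` [set r]) by exact: (measurable_funPTI h).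
have mh' r : measurable (h @^-1` [set r] : set Omega) by exact: (Gsub (mh r)).
pose I : seq R := finmap.enum_fset (fset_set (range h)).
have hE (w : Omega) : h w = \sum_(r <- I) r * \1_(h @^-1` [set r]) w.
  by rewrite {1}fimfunE fsbig_finite.
have ri r : rint P setT (fun w => r * \1_(h @^-1` [set r]) w).
  apply: rintZl => //; exact: (integrable_indic).
have rZ r : rint P setT (fun w => r * \1_(h @^-1` [set r]) w * Z w).
  apply: (@rint_bounded_mul _ _ _ P _ mT `|r|) => //.
    by apply: measurable_funM => //; exact: (measurable_indic (mh' r)).
  move=> w _; rewrite normrM ler_piMr// indicE; case: (_ \in _); rewrite ?normr1 ?normr0//.
have -> : (fun w : Omega => h w * Z w) = (fun w => \sum_(r <- I) r * \1_(h @^-1` [set r]) w * Z w).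
  by apply/funext => w; rewrite hE mulr_suml.
have hF : (h : Omega -> R) = (fun w => \sum_(r <- I) r * \1_(h @^-1` [set r]) w).
  by apply/funext => w; rewrite hE.
split; first exact: (rint_sum mT).
rewrite [in RHS]hF !Rintegral_sum// mulr_sumr; apply: eq_bigr => r _.
rewrite RintegralZl//; last exact: (integrable_indic).
under eq_Rintegral do rewrite -mulrA.
rewrite RintegralZl//; last first.
  apply: (@rint_bounded_mul _ _ _ P _ mT 1) => //.
    by move=> w _; rewrite indicE; case: (_ \in _); rewrite ?normr1 ?normr0.
rewrite mulrCA; congr (_ * _).
have -> : \int[P]_w (\1_(h @^-1` [set r]) w * Z w) = \int[P]_(w in h @^-1` [set r]) Z w.
  rewrite [RHS]Rintegral_mkcond; apply: eq_Rintegral => w _.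
  by rewrite patchE indicE; case: ifP => _; rewrite ?mul1r ?mul0r.
rewrite (Zc (mh r)); congr (_ * _).
by rewrite /Rintegral integral_indic// setIT.
Qed.

Let const_ge0 (Y : Omega -> R) : measurable_fun (T := subalg G) setT Y ->
  (forall w, 0 <= Y w) -> rint P setT Y -> rint P setT (fun w => Y w * Z w) ->
  \int[P]_w (Y w * Z w) = c * \int[P]_w Y w.
Proof.
move=> mY Y0 Yi YZi.
have mYE : measurable_fun (T := subalg G) setT (EFin \o Y) by exact/measurable_EFinP.
pose h := nnsfun_approx measurableT mYE.
have hle n w : h n w <= Y w.
  by have := @le_approx _ (subalg G) R setT (EFin \o Y) n w (fun x _ => Y0 x) I; rewrite -nnsfun_approxE.
have hY w : h n w @[n --> \oo] --> Y w.
  have : (EFin \o h^~ w) n @[n --> \oo] --> (Y w)%:E.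
    exact: (@cvg_nnsfun_approx _ (subalg G) R setT measurableT (EFin \o Y) mYE (fun x _ => Y0 x) w I).
  by move/fine_cvgP => [].
have mh n : measurable_fun setT (h n : Omega -> R) by exact: Gmeas.
have l1 : \int[P]_w (h n w * Z w) @[n --> \oo] --> \int[P]_w (Y w * Z w).
  apply: (@Rintegral_cvg _ _ _ P setT measurableT _ _ (fun w => `|Y w * Z w|)).
  - by move=> n; apply: measurable_funM => //; exact: rint_meas Zi.
  - exact: rint_meas YZi.
  - by apply: aeW => w _; apply: cvgMl; exact: hY.
  - exact: rint_norm.
  - move=> n; apply: aeW => w _; rewrite !normrM ler_wpM2r// !ger0_norm//.
have l2 : c * \int[P]_w h n w @[n --> \oo] --> c * \int[P]_w Y w.
  apply: cvgMr; apply: (@Rintegral_cvg _ _ _ P setT measurableT _ _ Y) => //.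
  - exact: rint_meas Yi.
  - by apply: aeW => w _; exact: hY.
  - by move=> n; apply: aeW => w _; rewrite ger0_norm.
apply: (cvg_unique _ l1) => //.
rewrite (_ : (fun n => _) = (fun n => c * \int[P]_w h n w))//.
by apply/funext => n; have [_ ->] := sfun_const (h n).
Qed.

(** Hypothesis [Zc] says that the conditional expectation of [Z] given [G] is the constant [c]. It
    extends from sets of [G] to simple [Y], to [Y >= 0] by dominated convergence with majorant
    [|Y Z|], and to general [Y] through positive and negative parts. *)
Lemma Rintegral_mul_const (Y : Omega -> R) : measurable_fun (T := subalg G) setT Y ->
  rint P setT Y -> rint P setT (fun w => Y w * Z w) ->
  \int[P]_w (Y w * Z w) = c * \int[P]_w Y w.
Proof.
move=> mY Yi YZi.
have mZ := rint_meas Zi.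
have ip (f : Omega -> R) : rint P setT f -> rint P setT (fun w => Num.max (f w) 0).
  move=> fi; apply: (rint_le mT (rint_norm fi)).
    by apply: measurable_maxr => //; exact: rint_meas fi.
  by move=> w _; rewrite ger0_norm ?le_max ?lexx ?orbT// ge_max ler_norm normr_ge0.
have mpos (f : Omega -> R) : measurable_fun (T := subalg G) setT f ->
    measurable_fun (T := subalg G) setT (fun w => Num.max (f w) 0).
  by move=> mf; apply: measurable_maxr.
have mN : measurable_fun (T := subalg G) setT (fun w => - Y w).
  by apply: measurableT_comp.
have iN := rintN mT Yi.
have YZ (f : Omega -> R) : measurable_fun setT f -> (forall w, `|f w| <= `|Y w|) ->
    rint P setT (fun w => f w * Z w).
  move=> mf fY; apply: (rint_le mT (rint_norm YZi)).
    exact: measurable_funM.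
  by move=> w _; rewrite !normrM ler_wpM2r.
have b1 w : `|Num.max (Y w) 0| <= `|Y w|.
  by rewrite ger0_norm ?le_max ?lexx ?orbT// ge_max ler_norm normr_ge0.
have b2 w : `|Num.max (- Y w) 0| <= `|Y w|.
  by rewrite ger0_norm ?le_max ?lexx ?orbT// ge_max -normrN ler_norm normr_ge0.
have i1 := YZ _ (rint_meas (ip _ Yi)) b1.
have i2 := YZ _ (rint_meas (ip _ iN)) b2.
have pm (x : R) : x = Num.max x 0 - Num.max (- x) 0.
  have [x0|x0] := leP 0 x.
    by rewrite [X in _ = _ - X]max_r ?subr0// oppr_le0.
  by rewrite [X in _ = _ - X]max_l ?sub0r ?opprK// oppr_ge0 ltW.
have p0 (x : R) : 0 <= Num.max x 0 by rewrite le_max lexx orbT.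
have E1 := const_ge0 (mpos _ mY) (fun w => p0 _) (ip _ Yi) i1.
have E2 := const_ge0 (mpos _ mN) (fun w => p0 _) (ip _ iN) i2.
transitivity (\int[P]_w (Num.max (Y w) 0 * Z w) - \int[P]_w (Num.max (- Y w) 0 * Z w)).
  rewrite -RintegralB//; apply: eq_Rintegral => w _.
  by rewrite {1}(pm (Y w)) mulrBl.
rewrite E1 E2 -mulrBr; congr (_ * _); rewrite -RintegralB//; try exact: ip.
by apply: eq_Rintegral => w _; rewrite -pm.
Qed.

End conditional_constant.

Section brownian_increments.
Context (R : realType) (U : hilbertType R) d (Omega : measurableType d).
Context (P : probability Omega R) (Fil : R -> set (set Omega)) (W : R -> U -> Omega -> R).
Hypotheses (hF : filtration Fil) (hW : cylindrical_BM P Fil W).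

Let mT : measurable [set: Omega] := measurableT.

Definition dW (s t : R) (u : U) (w : Omega) : R := W t u w - W s u w.

Lemma brownian_adapted (t : R) (u : U) : 0 <= t ->
  measurable_fun (T := subalg (Fil t)) setT (W t u).
Proof.
move=> t0 _ B mB; rewrite setTI (fil_measurableE hF t0).
exact: (cbm_adapted hW).
Qed.

Lemma dW_adapted (s t : R) (u : U) : 0 <= s -> s <= t ->
  measurable_fun (T := subalg (Fil t)) setT (dW s t u).
Proof.
move=> s0 st; apply: measurable_funB.
  by apply: brownian_adapted; exact: le_trans st.
apply: (fil_measurable_fun hF s0 st); exact: brownian_adapted.
Qed.

Lemma dW_measurable (s t : R) (u : U) : 0 <= s -> s <= t -> measurable_fun setT (dW s t u).
Proof.
by move=> s0 st; apply: (fil_measurable_funT hF (le_trans s0 st)); exact: dW_adapted.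
Qed.

Lemma dW_linear (s t a : R) (u v : U) : 0 <= s -> s <= t ->
  \forall w \ae P, dW s t (a *: u + v) w = a * dW s t u w + dW s t v w.
Proof.
move=> s0 st; have := cbm_linear hW a u v s0; have := cbm_linear hW a u v (le_trans s0 st).
by apply: filterS2 => w h1 h2; rewrite /dW h1 h2; ring.
Qed.

Let sg (s t : R) (u : U) := Num.sqrt (t - s) * `|u|.

Let sg0 s t u : s < t -> u != 0 -> 0 < sg s t u.
Proof. by move=> st u0; rewrite mulr_gt0 ?sqrtr_gt0 ?subr_gt0 ?normr_gt0. Qed.

Let dW_law (s t : R) (u : U) (C : set Omega) (f : R -> \bar R) :
  0 <= s -> s < t -> u != 0 -> Fil s C -> measurable_fun setT f -> (forall x, (0 <= f x)%E) ->
  (\int[P]_(w in C) f (dW s t u w) =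
   P C * \int[lebesgue_measure]_x (f x * (normal_pdf 0 (sg s t u) x)%:E))%E.
Proof.
move=> s0 st u0 FC mf f0.
have fP : P C \is a fin_num by exact: fin_num_measure (fil_sub hF s0 FC).
rewrite -(fineK fP).
refine (law_integral (p := normal_pdf 0 (sg s t u)) (fil_sub hF s0 FC)
  (dW_measurable u s0 (ltW st)) _ _ _ mf f0).
- exact: normal_pdf_ge0.
- exact: measurable_normal_pdf.
move=> B mB; rewrite fineK// -[X in (_ * X)%E](cbm_gauss hW s0 st u0 mB).
exact: (cbm_indep hW).
Qed.

(** The Gaussian law is prescribed for nonzero directions; in the direction [0] the increment
    vanishes by linearity. *)
Let dW_zero s t : 0 <= s -> s <= t -> \forall w \ae P, dW s t 0 w = 0.
Proof.
move=> s0 st; apply: filterS (dW_linear (-1) 0 0 s0 st) => w.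
by rewrite scaler0 addr0 mulN1r addNr.
Qed.

Let msqE : measurable_fun setT (fun x : R => (x ^+ 2)%:E).
Proof. by apply/measurable_EFinP; exact: exprn_measurable. Qed.

Let dW_sqE (s t : R) (u : U) (C : set Omega) : 0 <= s -> s <= t -> Fil s C ->
  (\int[P]_(w in C) (dW s t u w ^+ 2)%:E = ((t - s) * `|u| ^+ 2)%:E * P C)%E.
Proof.
move=> s0 st FC; have mC := fil_sub hF s0 FC.
have z : (\forall w \ae P, dW s t u w = 0) -> (t - s) * `|u| ^+ 2 = 0 ->
    (\int[P]_(w in C) (dW s t u w ^+ 2)%:E = ((t - s) * `|u| ^+ 2)%:E * P C)%E.
  move=> h ->; rewrite mul0e -[RHS](@integral0 _ _ _ P C).
  apply: ae_eq_integral => //.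
    by apply/measurable_EFinP/measurable_funX/measurable_funTS; exact: dW_measurable.
  by apply: filterS h => w -> _; rewrite expr0n.
have [u0|u0] := eqVneq u 0.
  by apply: z; rewrite u0; [exact: dW_zero|rewrite normr0 expr0n/= mulr0].
have [st1|st1] := eqVneq s t.
  apply: z; last by rewrite st1 subrr mul0r.
  by apply: aeW => w; rewrite /dW st1 subrr.
have {}st : s < t by rewrite lt_neqAle st1.
rewrite (dW_law s0 st u0 FC msqE); last by move=> x; rewrite lee_fin sqr_ge0.
rewrite muleC; congr (_ * _)%E.
have si := @rint_sq_normal_pdf R _ (sg0 st u0).
under eq_integral do rewrite -EFinM.
rewrite -(@rint_EFin _ _ _ lebesgue_measure setT measurableT _ si) (normal_second_moment (sg0 st u0)).
by rewrite /sg exprMn sqr_sqrtr// subr_ge0 ltW.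
Qed.

Lemma dW_sq_rint (s t : R) (u : U) : 0 <= s -> s <= t -> rint P setT (fun w => dW s t u w ^+ 2).
Proof.
move=> s0 st; apply: rint_ge0P => //.
- by apply: measurable_funX; exact: dW_measurable.
- by move=> w _; exact: sqr_ge0.
- by rewrite dW_sqE//; [rewrite probability_setT mule1 ltry|exact: filT].
Qed.

Lemma dW_rint (s t : R) (u : U) : 0 <= s -> s <= t -> rint P setT (dW s t u).
Proof.
move=> s0 st; apply: rint_sq1 => //; last exact: dW_sq_rint.
  by rewrite -ge0_fin_numE// fin_num_measure.
exact: dW_measurable.
Qed.

Let dW_sq (s t : R) (u : U) (C : set Omega) : 0 <= s -> s <= t -> Fil s C ->
  \int[P]_(w in C) (dW s t u w ^+ 2) = (t - s) * `|u| ^+ 2 * fine (P C).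
Proof.
move=> s0 st FC; rewrite /Rintegral dW_sqE// fineM//.
exact: fin_num_measure (fil_sub hF s0 FC).
Qed.

Let dWN (s t : R) (u : U) : 0 <= s -> s <= t -> \forall w \ae P, dW s t (- u) w = - dW s t u w.
Proof.
move=> s0 st; apply: filterS2 (dW_linear (-1) u 0 s0 st) (dW_zero s0 st) => w.
by rewrite addr0 scaleN1r mulN1r => -> ->; rewrite addr0.
Qed.

(** The increment is symmetric on [C]: the direction [- u] has the same variance as [u] and produces
    [- dW], so positive and negative parts have equal integrals. *)
Let dW_mean (s t : R) (u : U) (C : set Omega) : 0 <= s -> s <= t -> Fil s C ->
  \int[P]_(w in C) dW s t u w = 0.
Proof.
move=> s0 st FC; have mC := fil_sub hF s0 FC.
have z : (\forall w \ae P, dW s t u w = 0) -> \int[P]_(w in C) dW s t u w = 0.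
  move=> h; rewrite /Rintegral (_ : (\int[P]_(w in C) _)%E = 0%E)//.
  rewrite -[RHS](@integral0 _ _ _ P C); apply: ae_eq_integral => //.
    by apply/measurable_EFinP/measurable_funTS; exact: dW_measurable.
  by apply: filterS h => w -> _.
have [u0|u0] := eqVneq u 0; first by apply: z; rewrite u0; exact: dW_zero.
have [st1|st1] := eqVneq s t.
  by apply: z; apply: aeW => w; rewrite /dW st1 subrr.
have {}st : s < t by rewrite lt_neqAle st1.
have Nu0 : - u != 0 by rewrite oppr_eq0.
pose p (x : R) := (Num.max x 0)%:E.
have mp : measurable_fun setT p by apply/measurable_EFinP; exact: measurable_maxr.
have p0 x : (0 <= p x)%E by rewrite lee_fin le_max lexx orbT.
have E1 := dW_law s0 st u0 FC mp p0; have E2 := dW_law s0 st Nu0 FC mp p0.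
have mdW v := @dW_measurable s t v s0 (ltW st).
have E3 : (\int[P]_(w in C) p (dW s t u w) = \int[P]_(w in C) p (- dW s t u w)%R)%E.
  rewrite E1 /sg -(normrN u) -/(sg s t (- u)) -E2; apply: ae_eq_integral => //.
  - by apply: measurableT_comp => //; exact: measurable_funTS.
  - by apply: measurableT_comp => //; apply: measurableT_comp => //; exact: measurable_funTS.
  - by apply: filterS (dWN u s0 (ltW st)) => w -> _.
have ip (f : Omega -> R) : rint P C f -> rint P C (fun w => Num.max (f w) 0).
  move=> fi; apply: (rint_le mC (rint_norm fi)).
    by apply: measurable_maxr => //; exact: rint_meas fi.
  by move=> w _; rewrite ger0_norm ?le_max ?lexx ?orbT// ge_max ler_norm normr_ge0.
have pm (x : R) : x = Num.max x 0 - Num.max (- x) 0.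
  have [x0|x0] := leP 0 x.
    by rewrite [X in _ = _ - X]max_r ?subr0// oppr_le0.
  by rewrite [X in _ = _ - X]max_l ?sub0r ?opprK// oppr_ge0 ltW.
have iC : rint P C (dW s t u) by apply: rintS (dW_rint u s0 (ltW st)).
transitivity (\int[P]_(w in C) (Num.max (dW s t u w) 0 - Num.max (- dW s t u w) 0)).
  by apply: eq_Rintegral => w _; rewrite -pm.
rewrite RintegralB//; [|exact: ip|by apply: ip; exact: rintN].
by rewrite /Rintegral [X in fine X - _]E3 subrr.
Qed.

(** Polarisation: the second moment in the direction [u + v] is expanded by linearity of [W]. *)
Let dW_mul (s t : R) (u v : U) (C : set Omega) : 0 <= s -> s <= t -> Fil s C ->
  \int[P]_(w in C) (dW s t u w * dW s t v w) = (t - s) * dotp u v * fine (P C).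
Proof.
move=> s0 st FC; have mC := fil_sub hF s0 FC.
have i x : rint P C (fun w => dW s t x w ^+ 2) by apply: rintS (dW_sq_rint x s0 st).
have mdW x : measurable_fun C (dW s t x) by apply: measurable_funTS; exact: dW_measurable.
have iuv : rint P C (fun w => dW s t u w * dW s t v w) by exact: rint_sq_mul.
have : \int[P]_(w in C) (dW s t (u + v) w ^+ 2) = \int[P]_(w in C) (dW s t u w ^+ 2) +
    2 * \int[P]_(w in C) (dW s t u w * dW s t v w) + \int[P]_(w in C) (dW s t v w ^+ 2).
  have i2 := rintZl mC 2 iuv; have i3 := rintD mC (i u) i2.
  rewrite -(RintegralZl _ mC iuv) -(RintegralD mC (i u) i2) -(RintegralD mC i3 (i v)).
  congr fine; apply: ae_eq_integral => //.
  - by apply/measurable_EFinP; exact: measurable_funX.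
  - apply/measurable_EFinP; apply: measurable_funD; last exact: measurable_funX.
    apply: measurable_funD; first exact: measurable_funX.
    by apply: measurable_funM => //; exact: measurable_funM.
  - have := dW_linear 1 u v s0 st; rewrite scale1r.
    by apply: filterS => w -> _; congr EFin; ring.
rewrite !dW_sq// norm_sqD; move: (fine (P C)) => q h.
have : 2 * \int[P]_(w in C) (dW s t u w * dW s t v w) = 2 * ((t - s) * dotp u v * q).
  by move: h; set I := \int[P]_(w in C) _; set a := `|u| ^+ 2; set b := `|v| ^+ 2; lra.
by move/mulfI; apply.
Qed.

Let Fsub (s : R) : 0 <= s -> forall A, <<s Fil s >> A -> d.-measurable A.
Proof.
by move=> s0 A; rewrite [<<s _ >>](fil_measurableE hF s0); exact: fil_sub.
Qed.

Lemma brownian_mul_mean (s t : R) (u : U) (Y : Omega -> R) : 0 <= s -> s <= t ->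
  measurable_fun (T := subalg (Fil s)) setT Y -> rint P setT (fun w => Y w ^+ 2) ->
  rint P setT (fun w => Y w * dW s t u w) /\ \int[P]_w (Y w * dW s t u w) = 0.
Proof.
move=> s0 st mY Y2.
have mY' := fil_measurable_funT hF s0 mY.
have iY : rint P setT (fun w => Y w * dW s t u w).
  by apply: rint_sq_mul => //; [exact: dW_measurable|exact: dW_sq_rint].
split=> //; rewrite (@Rintegral_mul_const _ _ _ P _ (Fsub s0) _ 0) ?mul0r//.
- exact: dW_rint.
- by move=> C FC; rewrite mul0r dW_mean// -(fil_measurableE hF s0).
- by apply: rint_sq1 => //; rewrite -ge0_fin_numE// fin_num_measure.
Qed.

Lemma brownian_mul_cov (s t : R) (u v : U) (Y : Omega -> R) (K : R) : 0 <= s -> s <= t ->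
  measurable_fun (T := subalg (Fil s)) setT Y -> (forall w, `|Y w| <= K) ->
  rint P setT (fun w => Y w * (dW s t u w * dW s t v w)) /\
  \int[P]_w (Y w * (dW s t u w * dW s t v w)) = (t - s) * dotp u v * \int[P]_w Y w.
Proof.
move=> s0 st mY YK.
have mY' := fil_measurable_funT hF s0 mY.
have iuv : rint P setT (fun w => dW s t u w * dW s t v w).
  by apply: rint_sq_mul => //; (try exact: dW_measurable); exact: dW_sq_rint.
have iY : rint P setT (fun w => Y w * (dW s t u w * dW s t v w)).
  by apply: (@rint_bounded_mul _ _ _ P _ mT K).
split=> //; rewrite (@Rintegral_mul_const _ _ _ P _ (Fsub s0) _ ((t - s) * dotp u v))//.
- by move=> C FC; rewrite dW_mul// -(fil_measurableE hF s0).
- apply: (@rint_le _ _ _ _ _ mT (fun=> K)) => //.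
  by apply: rint_cst => //; rewrite -ge0_fin_numE// fin_num_measure.
Qed.

End brownian_increments.

(** * Elementary stochastic increments *)

Section parseval.
Context (R : realType) (U H : hilbertType R) (e : onb U).

Let proj (l : seq U) (u : U) : U := \sum_(b <- l) dotp u b *: b.

Let projD l u v : proj l (u + v) = proj l u + proj l v.
Proof. by rewrite /proj -big_split; apply: eq_bigr => b _; rewrite dotpDl scalerDl. Qed.

Let projZ l a u : proj l (a *: u) = a *: proj l u.
Proof. by rewrite /proj scaler_sumr; apply: eq_bigr => b _; rewrite dotpZl scalerA. Qed.

Section proj_theory.
Variable l : seq U.
Hypotheses (lU : uniq l) (le : forall b, b \in l -> onb_set e b).

Let proj_onb b : b \in l -> proj l b = b.
Proof.
move=> bl; rewrite /proj (bigD1_seq b)//= dotpE (onb_norm (le bl)) expr1n scale1r.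
rewrite big1_seq ?addr0// => c /andP[cb cl].
by rewrite (onb_orth (le bl) (le cl)) ?scale0r// => bc; rewrite bc eqxx in cb.
Qed.

Let dotp_proj u v : dotp (proj l u) v = \sum_(b <- l) dotp u b * dotp v b.
Proof. by rewrite dotp_suml; apply: eq_bigr => b _; rewrite dotpZl (dotpC b). Qed.

Let dotp_proj_onb u b : b \in l -> dotp (proj l u) b = dotp u b.
Proof.
move=> bl; rewrite dotp_proj -[in RHS](proj_onb bl) (dotpC u) dotp_proj.
by apply: eq_bigr => c _; rewrite mulrC.
Qed.

Let proj_dist u : `|u - proj l u| <= `|u|.
Proof.
rewrite -(ler_pXn2r (n := 2)) ?nnegrE// norm_sqB.
have -> : `|proj l u| ^+ 2 = dotp u (proj l u).
  rewrite -dotpE dotp_proj dotpC dotp_proj big_seq [RHS]big_seq.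
  by apply: eq_bigr => b bl; rewrite dotp_proj_onb.
have : 0 <= dotp u (proj l u).
  by rewrite dotpC dotp_proj sumr_ge0// => b _; rewrite -expr2 sqr_ge0.
by lra.
Qed.

(** [z] in the span is fixed by the projection, so [u - proj l u = (u - z) - proj l (u - z)], and
    the complementary projection is a contraction. *)
Lemma proj_best (m : seq U) (a : U -> R) u : {subset m <= l} ->
  `|u - proj l u| <= `|u - \sum_(y <- m) a y *: y|.
Proof.
move=> ml; set z := \sum_(y <- m) _.
have pz : proj l z = z.
  rewrite /z big_seq; elim/big_ind : _ => [|x y px py|y ym].
  - by rewrite -(scale0r 0) projZ !scale0r.
  - by rewrite projD px py.
  - by rewrite projZ proj_onb// ml.
have -> : u - proj l u = (u - z) - proj l (u - z).
  have -> : proj l (u - z) = proj l u - z by rewrite -scaleN1r projD projZ pz scaleN1r.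
  by rewrite opprB addrA subrK.
exact: proj_dist.
Qed.

Lemma proj_dotp_dist u v : `|dotp u v - \sum_(b <- l) dotp u b * dotp v b| <= `|u - proj l u| * `|v|.
Proof. by rewrite -dotp_proj -dotpBl; exact: dotp_le. Qed.

End proj_theory.

(** The squared Hilbert-Schmidt norm of [z |-> sum k_i (u_i, z) x_i], written through Gram matrices
    and hence without a basis. *)
Definition gram_form (N : nat) (k : nat -> R) (u : nat -> U) (x : nat -> H) : R :=
  \sum_(i < N) \sum_(i' < N) k i * k i' * (dotp (u i) (u i') * dotp (x i) (x i')).

Lemma norm_sq_sum (N : nat) (c : nat -> R) (x : nat -> H) :
  `|\sum_(i < N) c i *: x i| ^+ 2 = \sum_(i < N) \sum_(i' < N) c i * c i' * dotp (x i) (x i').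
Proof.
rewrite -dotpE dotp_suml; apply: eq_bigr => i _; rewrite dotp_sumr.
by apply: eq_bigr => i' _; rewrite dotpZl dotpZr mulrA.
Qed.

(** Parseval for finitely many vectors. The basis may be uncountable and only its linear span is
    dense, so a finite part of it is chosen whose span comes within [del] of every [u i]. *)
Lemma gram_form_approx (N : nat) (k : nat -> R) (u : nat -> U) (x : nat -> H) (eps : R) : 0 < eps ->
  exists l : seq U, [/\ uniq l, forall b, b \in l -> onb_set e b &
  `|gram_form N k u x - \sum_(b <- l) `|\sum_(i < N) (k i * dotp (u i) b) *: x i| ^+ 2| <= eps].
Proof.
move=> eps0.
pose C := \sum_(i < N) \sum_(i' < N) `|k i * k i'| * (`|u i'| * `|dotp (x i) (x i')|).
have C0 : 0 <= C by do 2!apply: sumr_ge0 => ? _; rewrite !mulr_ge0.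
pose del := eps / (C + 1).
have del0 : 0 < del by rewrite divr_gt0// ltr_wpDl.
have /choice[m hm] : forall i, exists l : seq U, (forall b, b \in l -> onb_set e b) /\
    exists a : U -> R, `|u i - \sum_(y <- l) a y *: y| < del.
  move=> i.
  have [||z [uz [l [a [le zE]]]]] := onb_total e (O := ball (u i) del).
  - by exists (u i); exact: ballxx.
  - exact: ball_open.
  by exists l; split=> //; exists a; rewrite -zE; move: uz; rewrite -ball_normE.
pose l := undup (flatten [seq m i | i <- iota 0 N]).
have lU : uniq l by exact: undup_uniq.
have le b : b \in l -> onb_set e b.
  by rewrite mem_undup => /flatten_mapP[i _]; have [h _] := hm i; exact: h.
have ul (i : 'I_N) : `|u i - proj l (u i)| <= del.
  have [_ [a ha]] := hm i; apply: le_trans (ltW ha); apply: proj_best => // b bm.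
  by rewrite mem_undup; apply/flatten_mapP; exists (val i) => //; rewrite mem_iota/= add0n.
exists l; split=> //.
under eq_bigr do rewrite (norm_sq_sum N (fun i => k i * dotp (u i) _)).
rewrite exchange_big/=.
have -> : \sum_(i < N) \sum_(b <- l) \sum_(i' < N)
    k i * dotp (u i) b * (k i' * dotp (u i') b) * dotp (x i) (x i') =
    \sum_(i < N) \sum_(i' < N) k i * k i' * ((\sum_(b <- l) dotp (u i) b * dotp (u i') b) *
      dotp (x i) (x i')).
  apply: eq_bigr => i _; rewrite exchange_big/=; apply: eq_bigr => i' _.
  rewrite mulr_suml mulr_sumr; apply: eq_bigr => b _; ring.
rewrite /gram_form -sumrB (le_trans (ler_norm_sum _ _ _))//.
apply: (@le_trans _ _ (del * C)); last first.
  by rewrite /del mulrAC ler_pdivrMr ?ltr_wpDl// ler_wpM2l ?(ltW eps0)// lerDl.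
rewrite /C mulr_sumr; apply: ler_sum => i _; rewrite -sumrB mulr_sumr.
apply: le_trans (ler_norm_sum _ _ _) _; apply: ler_sum => i' _.
rewrite -mulrBr -mulrBl !normrM mulrCA.
rewrite [leRHS](_ : _ = del * `|u i'| * (`|k i| * `|k i'| * `|dotp (x i) (x i')|)); last by ring.
rewrite ler_wpM2r ?mulr_ge0//.
apply: le_trans (proj_dotp_dist _ _ _) _; exact: ler_wpM2r.
Qed.

Lemma gram_form_ge0 (N : nat) (k : nat -> R) (u : nat -> U) (x : nat -> H) :
  0 <= gram_form N k u x.
Proof.
apply/ler_addgt0Pr => eps eps0; have [l [_ _]] := gram_form_approx N k u x eps0.
rewrite ler_distl => /andP[h _]; apply: le_trans (lerD h (lexx eps)); rewrite subrK.
by apply: sumr_ge0 => b _; exact: sqr_ge0.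
Qed.

Lemma gram_form_le_hs (N : nat) (k : nat -> R) (u : nat -> U) (x : nat -> H) :
  ((gram_form N k u x)%:E <=
   hs_sq e (fun z => (\sum_(i < N) (k i * dotp (u i) z) *: x i)%R))%E.
Proof.
apply/lee_addgt0Pr => eps eps0; have [l [lU le]] := gram_form_approx N k u x eps0.
rewrite ler_distl => /andP[_ h].
have h1 : (\sum_(b <- l) (`|(\sum_(i < N) (k i * dotp (u i) b) *: x i)%R| ^+ 2)%:E <=
    hs_sq e (fun z => (\sum_(i < N) (k i * dotp (u i) z) *: x i)%R))%E.
  apply: ereal_sup_ubound; exists [set` l].
    by split; [exact: finite_seq|move=> b /= bl; exact: le].
  by rewrite -fsbig_seq.
by apply: le_trans (leeD2r _ h1); rewrite sumEFin -EFinD lee_fin.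
Qed.

End parseval.

Section finite_rank.
Context (R : realType) (H : hilbertType R) d (T : measurableType d).

(** Random vectors [sum c_i(w) x_i] with measurable scalar coefficients. For this class the
    measurability of inner products and norms reduces to that of the coefficients, which a Borel
    structure on [H] would not give for sums. *)
Inductive finrank : (T -> H) -> Prop :=
| finrank0 : finrank (fun=> 0)
| finrankS (c : T -> R) x X : measurable_fun setT c -> finrank X -> finrank (fun w => c w *: x + X w).

Lemma finrankD X Y : finrank X -> finrank Y -> finrank (fun w => X w + Y w).
Proof.
move=> fX fY; elim: fX => [|c x Z mc fZ IH]; first by under eq_fun do rewrite add0r.
by under eq_fun do rewrite -addrA; exact: finrankS.
Qed.

Lemma finrankZ (c : T -> R) X : measurable_fun setT c -> finrank X -> finrank (fun w => c w *: X w).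
Proof.
move=> mc; elim=> [|b x Z mb fZ IH]; first by under eq_fun do rewrite scaler0; exact: finrank0.
by under eq_fun do rewrite scalerDr scalerA; apply: finrankS => //; exact: measurable_funM.
Qed.

Lemma finrank1 (c : T -> R) x : measurable_fun setT c -> finrank (fun w => c w *: x).
Proof. by move=> mc; have := finrankS x mc finrank0; under eq_fun do rewrite addr0. Qed.

Lemma finrankB X Y : finrank X -> finrank Y -> finrank (fun w => X w - Y w).
Proof.
move=> fX fY; apply: finrankD => //; under eq_fun do rewrite -scaleN1r.
exact: finrankZ.
Qed.

Lemma finrank_sum N (c : nat -> T -> R) (x : nat -> H) : (forall i, measurable_fun setT (c i)) ->
  finrank (fun w => \sum_(i < N) c i w *: x i).
Proof.
move=> mc; elim: N => [|N IH].
  by under eq_fun do rewrite big_ord0; exact: finrank0.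
by under eq_fun do rewrite big_ord_recr/=; apply: finrankD => //; exact: finrank1.
Qed.

Lemma finrank_dotp X Y : finrank X -> finrank Y -> measurable_fun setT (fun w => dotp (X w) (Y w)).
Proof.
have h1 x Z : finrank Z -> measurable_fun setT (fun w => dotp x (Z w)).
  elim=> [|c y Z' mc fZ IH]; first by under eq_fun do rewrite dotp0r; exact: measurable_cst.
  under eq_fun do rewrite dotpDr dotpZr; apply: measurable_funD => //.
  exact: measurable_funM.
move=> fX fY; elim: fX => [|c x Z mc fZ IH]; first by under eq_fun do rewrite dotp0l; exact: measurable_cst.
under eq_fun do rewrite dotpDl dotpZl; apply: measurable_funD => //.
by apply: measurable_funM => //; exact: h1.
Qed.

Lemma finrank_norm X : finrank X -> measurable_fun setT (fun w => `|X w|).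
Proof.
move=> fX; have m2 := finrank_dotp fX fX.
have E w : `|X w| = Num.sqrt (dotp (X w) (X w)) by rewrite dotpE sqrtr_sqr normr_id.
under eq_fun do rewrite E.
by apply: measurableT_comp => //; exact: continuous_measurable_fun (@sqrt_continuous R).
Qed.

End finite_rank.

Section brownian_step.
Context (R : realType) (U H : hilbertType R) d (Omega : measurableType d).
Context (P : probability Omega R) (Fil : R -> set (set Omega)) (W : R -> U -> Omega -> R).
Hypotheses (hF : filtration Fil) (hW : cylindrical_BM P Fil W).
Context (p p' : R) (N : nat) (k : nat -> Omega -> R) (u : nat -> U) (x : nat -> H).
Hypotheses (p0 : 0 <= p) (pp' : p <= p').
Hypothesis mk : forall i, measurable_fun (T := subalg (Fil p)) setT (k i).
Hypothesis k1 : forall i w, `|k i w| <= 1.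

Let mT : measurable [set: Omega] := measurableT.

Definition step_inc (w : Omega) : H := \sum_(i < N) (k i w * dW W p p' (u i) w) *: x i.

Let g (w : Omega) : R := gram_form N (k ^~ w) u x.

Lemma step_inc_mul_mean (L : Omega -> R) (z : Omega -> H) (m : R) :
  measurable_fun (T := subalg (Fil p)) setT L -> rint P setT (fun w => L w ^+ 2) ->
  (forall y, measurable_fun (T := subalg (Fil p)) setT (fun w => dotp (z w) y)) ->
  (forall w, `|z w| <= m) ->
  rint P setT (fun w => L w * dotp (z w) (step_inc w)) /\
  \int[P]_w (L w * dotp (z w) (step_inc w)) = 0.
Proof.
move=> mL L2 mz zm.
pose Y i w := L w * (k i w * dotp (z w) (x i)).
have E w : L w * dotp (z w) (step_inc w) = \sum_(i < N) Y i w * dW W p p' (u i) w.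
  rewrite dotp_sumr mulr_sumr; apply: eq_bigr => i _; rewrite dotpZr /Y; ring.
have mY i : measurable_fun (T := subalg (Fil p)) setT (Y i).
  by apply: measurable_funM => //; exact: measurable_funM.
have b i : rint P setT (fun w => Y i w * dW W p p' (u i) w) /\
    \int[P]_w (Y i w * dW W p p' (u i) w) = 0.
  apply: (brownian_mul_mean hF hW) => //.
  apply: (@rint_le _ _ _ _ _ mT (fun w => (m * `|x i|) ^+ 2 * L w ^+ 2)).
  - exact: rintZl.
  - exact: (measurable_funX 2 (fil_measurable_funT hF p0 (mY i))).
  move=> w _; rewrite ger0_norm ?sqr_ge0// /Y exprMn mulrC ler_wpM2r ?sqr_ge0//.
  rewrite -[leLHS]real_normK ?num_real// lerXn2r ?nnegrE ?mulr_ge0 ?(le_trans (normr_ge0 _) (zm w))//.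
  rewrite normrM -[leRHS]mul1r ler_pM//.
  by rewrite (le_trans (dotp_le _ _))// ler_wpM2r.
under [X in rint _ _ X]eq_fun do rewrite E.
under eq_Rintegral do rewrite E.
split; first by apply: (rint_sum mT) => i; have [] := b i.
rewrite (Rintegral_sum mT); last by move=> i; have [] := b i.
by rewrite big1// => i _; have [_] := b i.
Qed.

(** Ito isometry on one cell, localised by a weight [Y] known at its left end: given the past,
    [E[dW u dW v] = (p' - p) (u, v)], which turns the double sum of the square into the Gram
    form. *)
Lemma step_inc_mul_sq (Y : Omega -> R) (K : R) :
  measurable_fun (T := subalg (Fil p)) setT Y -> (forall w, `|Y w| <= K) ->
  [/\ rint P setT (fun w => Y w * `|step_inc w| ^+ 2), rint P setT (fun w => Y w * g w) &
  \int[P]_w (Y w * `|step_inc w| ^+ 2) = (p' - p) * \int[P]_w (Y w * g w)].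
Proof.
move=> mY YK.
pose Z i i' w := dotp (x i) (x i') * (Y w * (k i w * k i' w)).
have K0 i i' w : `|k i w * k i' w| <= 1 by rewrite normrM mulr_ile1.
have mZ i i' : measurable_fun (T := subalg (Fil p)) setT (Z i i').
  by apply: measurable_funM => //; apply: measurable_funM => //; exact: measurable_funM.
have Zb i i' w : `|Z i i' w| <= `|dotp (x i) (x i')| * K.
  rewrite !normrM ler_wpM2l// -[leRHS]mulr1 ler_pM// ?mulr_ge0//.
  by rewrite -normrM.
have E w : Y w * `|step_inc w| ^+ 2 = \sum_(i < N) \sum_(i' < N)
    Z i i' w * (dW W p p' (u i) w * dW W p p' (u i') w).
  rewrite /step_inc (norm_sq_sum N (fun i => k i w * dW W p p' (u i) w)) mulr_sumr.
  apply: eq_bigr => i _; rewrite mulr_sumr; apply: eq_bigr => i' _; rewrite /Z; ring.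
have E' w : Y w * g w = \sum_(i < N) \sum_(i' < N) dotp (u i) (u i') * Z i i' w.
  rewrite /g /gram_form mulr_sumr.
  apply: eq_bigr => i _; rewrite mulr_sumr; apply: eq_bigr => i' _; rewrite /Z; ring.
have b i i' := brownian_mul_cov hF hW (u i) (u i') p0 pp' (mZ i i') (Zb i i').
have iZ i i' : rint P setT (Z i i').
  apply: (@rint_le _ _ _ _ _ mT (fun=> `|dotp (x i) (x i')| * K)).
  - by apply: rint_cst => //; rewrite -ge0_fin_numE// fin_num_measure.
  - exact: (fil_measurable_funT hF p0 (mZ i i')).
  - by move=> w _.
have r1 i : rint P setT (fun w => \sum_(i' < N) Z i i' w * (dW W p p' (u i) w * dW W p p' (u i') w)).
  by apply: (rint_sum mT) => i'; have [] := b i i'.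
have r2 i : rint P setT (fun w => \sum_(i' < N) dotp (u i) (u i') * Z i i' w).
  by apply: (rint_sum mT) => i'; exact: rintZl.
split.
- under [X in rint _ _ X]eq_fun do rewrite E.
  exact: (rint_sum mT).
- under [X in rint _ _ X]eq_fun do rewrite E'.
  exact: (rint_sum mT).
under eq_Rintegral do rewrite E.
under [in RHS]eq_Rintegral do rewrite E'.
rewrite !(Rintegral_sum mT)// mulr_sumr; apply: eq_bigr => i _.
rewrite (Rintegral_sum mT); last by move=> i'; have [] := b i i'.
rewrite (Rintegral_sum mT); last by move=> i'; exact: rintZl.
rewrite mulr_sumr; apply: eq_bigr => i' _.
by have [_ ->] := b i i'; rewrite (RintegralZl _ mT (iZ i i')) mulrA.
Qed.

(** [Y] plays the indicator of not having been stopped. The hypothesis on [z] places it inside the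
    square, and [Y^2 <= Y] leaves it there once, so that the isometry applies. *)
Lemma step_inc_dotp_sq (Y : Omega -> R) (z : Omega -> H) (m : R) :
  measurable_fun (T := subalg (Fil p)) setT Y -> (forall w, 0 <= Y w <= 1) ->
  (forall y, measurable_fun (T := subalg (Fil p)) setT (fun w => dotp (z w) y)) ->
  (forall w, `|z w| <= m * Y w) -> 0 <= m ->
  rint P setT (fun w => dotp (z w) (step_inc w) ^+ 2) /\
  \int[P]_w (dotp (z w) (step_inc w) ^+ 2) <= m ^+ 2 * ((p' - p) * \int[P]_w (Y w * g w)).
Proof.
move=> mY Y1 mz zm m0.
have Yb w : `|Y w| <= 1 by have /andP[? ?] := Y1 w; rewrite ger0_norm.
have [i1 i2 <-] := step_inc_mul_sq mY Yb.
have le w : dotp (z w) (step_inc w) ^+ 2 <= m ^+ 2 * (Y w * `|step_inc w| ^+ 2).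
  have /andP[Y0 Y1w] := Y1 w.
  apply: (@le_trans _ _ ((m * Y w * `|step_inc w|) ^+ 2)).
    rewrite -[leLHS]real_normK ?num_real// lerXn2r ?nnegrE ?mulr_ge0//.
    by rewrite (le_trans (dotp_le _ _))// ler_wpM2r.
  rewrite !exprMn -mulrA ler_wpM2l ?sqr_ge0// ler_wpM2r ?sqr_ge0//.
  by rewrite expr2 ler_piMr.
have iZ : rint P setT (fun w => m ^+ 2 * (Y w * `|step_inc w| ^+ 2)) by exact: rintZl.
have ii : rint P setT (fun w => dotp (z w) (step_inc w) ^+ 2).
  apply: (rint_le mT iZ).
    have E w : dotp (z w) (step_inc w) =
        \sum_(i < N) (k i w * dotp (z w) (x i)) * dW W p p' (u i) w.
      by rewrite dotp_sumr; apply: eq_bigr => i _; rewrite dotpZr; ring.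
    under eq_fun do rewrite E.
    apply: measurable_funX; apply: measurable_sum => i.
    apply: measurable_funM; last exact: (dW_measurable hF hW).
    by apply: (fil_measurable_funT hF p0); exact: measurable_funM.
  by move=> w _; rewrite ger0_norm ?sqr_ge0.
split=> //; rewrite -(RintegralZl _ mT i1); exact: le_Rintegral.
Qed.

End brownian_step.

(** * The energy of a stopped elementary martingale *)

Section measurable_le.
Context (R : realType) d (T : measurableType d).

Lemma measurable_le_cst (f : T -> R) (c : R) : measurable_fun setT f ->
  measurable [set w | f w <= c].
Proof.
move=> mf; rewrite (_ : [set _ | _] = setT `&` f @^-1` `]-oo, c]%classic).
  by apply: mf => //; exact: measurable_itv.
by rewrite setTI; apply/seteqP; split => w /=; rewrite in_itv.
Qed.

End measurable_le.

Section stopped_energy.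
Context (R : realType) (U H : hilbertType R) (e : onb U) d (Omega : measurableType d).
Context (P : probability Omega R) (Fil : R -> set (set Omega)) (W : R -> U -> Omega -> R).
Hypotheses (hF : filtration Fil) (hW : cylindrical_BM P Fil W).
Context (p : nat -> R) (N : nat) (k : nat -> nat -> Omega -> R) (u : nat -> U) (x : nat -> H).
Hypotheses (p0 : forall a, 0 <= p a) (pS : forall a, p a <= p a.+1).
Hypothesis mk : forall a i, measurable_fun (T := subalg (Fil (p a))) setT (k a i).
Hypothesis k1 : forall a i w, `|k a i w| <= 1.
Context (eta : nat -> Omega -> R) (zeta : nat -> Omega -> H) (C : set Omega).
Hypothesis meta : forall a, measurable_fun (T := subalg (Fil (p a))) setT (eta a).
Hypothesis eta01 : forall a w, 0 <= eta a w <= 1.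
Hypothesis mdot : forall a y,
  measurable_fun (T := subalg (Fil (p a))) setT (fun w => dotp (zeta a w) y).
Hypothesis mzeta : forall a, measurable_fun (T := subalg (Fil (p a))) setT (fun w => `|zeta a w|).
Hypothesis mC : Fil (p 0) C.
Context (r m lam K : R).
Hypotheses (r0 : 0 <= r) (m0 : 0 <= m) (rK : r < K).

Let mT : measurable [set: Omega] := measurableT.

Definition grid_inc a w := step_inc W (p a) (p a.+1) N (k a) u x w.

Definition grid_gram a w := gram_form N (k a ^~ w) u x.

(** An increment with mean zero: twice the pairing with a vector from the past, plus the square of
    the martingale increment minus its compensator. *)
Definition grid_term a w := eta a w *
  (2 * dotp (zeta a w) (grid_inc a w) + `|grid_inc a w| ^+ 2 - (p a.+1 - p a) * grid_gram a w).

Definition grid_energy b w := \sum_(a < b) grid_term a w.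

Definition grid_var b w := \sum_(a < b) (p a.+1 - p a) * grid_gram a w.

(** Everything tested is known at time [p a]; in particular [grid_var a.+1] contains the Gram term
    of the cell that starts at [p a], whose coefficients are already known there. The energy is
    tested before the cell is run, so once it has passed [lam] it is frozen above [lam]. *)
Definition grid_good a w :=
  [&& grid_var a.+1 w <= r, `|zeta a w| <= m & grid_energy a w <= lam].

Fixpoint grid_ok a w := (if a is a'.+1 then grid_ok a' w else w \in C) && grid_good a w.

Definition stopped_energy n w := \sum_(a < n | grid_ok a w) grid_term a w.

Let chi a (w : Omega) : R := (grid_ok a w)%:R.

Let chi01 a w : 0 <= chi a w <= 1.
Proof. by rewrite /chi; case: grid_ok; rewrite ?ler01 ?lexx. Qed.

Let stoppedE n w : stopped_energy n w = \sum_(a < n) chi a w * grid_term a w.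
Proof.
rewrite /stopped_energy big_mkcond; apply: eq_bigr => a _.
by rewrite /chi; case: grid_ok; rewrite ?mul1r ?mul0r.
Qed.

Let gram0 a w : 0 <= grid_gram a w. Proof. exact: gram_form_ge0. Qed.

Let dp a : 0 <= p a.+1 - p a. Proof. by rewrite subr_ge0. Qed.

(** [grid_ok] accumulates all earlier tests, so the active cells form an initial segment and every
    stopped sum is an ordinary partial sum up to the stopping index. *)
Lemma grid_ok_stop (F : nat -> R) n w : w \in C -> exists b, [/\ (b <= n)%N,
  \sum_(a < n | grid_ok a w) F a = \sum_(a < b) F a, (b = n \/ ~~ grid_good b w) &
  forall a, (a < b)%N -> grid_good a w].
Proof.
move=> wC; have okS a : grid_ok a w -> forall a', (a' <= a)%N -> grid_ok a' w.
  elim: a => [|a IH]; first by move=> h a'; rewrite leqn0 => /eqP ->.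
  move=> h a'; rewrite leq_eqVlt => /orP[/eqP ->//|]; rewrite ltnS => aa.
  by apply: IH => //; move: h => /= /andP[].
have okE a : (forall a', (a' <= a)%N -> grid_good a' w) -> grid_ok a w.
  elim: a => [|a IH] h /=; first by rewrite wC h.
  by rewrite h// andbT; apply: IH => a' aa; apply: h; exact: leqW.
have okG a : grid_ok a w -> grid_good a w by case: a => [|a] /= /andP[].
elim: n => [|n [b [bn bE bb bg]]].
  by exists 0%N; split=> //; [rewrite !big_ord0|left].
have [ok|nok] := boolP (grid_ok n w).
- have : b = n.
    case: bb => // nb; apply/eqP; rewrite eqn_leq bn leqNgt; apply/negP => bn'.
    by move: nb; rewrite okG// (okS _ ok)// ltnW.
  move=> ?; subst b; exists n.+1; split=> //; first by rewrite big_mkcond/= !big_ord_recr/= -big_mkcond bE ok.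
    by left.
  by move=> a an; apply: okG; exact: okS ok _ _.
- exists b; split=> //; first exact: leqW.
    by rewrite big_mkcond/= big_ord_recr/= -big_mkcond (negbTE nok) bE addr0.
  right; case: bb => // ?; subst b; apply: contra nok => g; apply: okE => a.
  by rewrite leq_eqVlt => /orP[/eqP ->//|]; exact: bg.
Qed.

Lemma stopped_energyP n w : w \in C -> exists b, [/\ (b <= n)%N,
  stopped_energy n w = grid_energy b w & (b = n \/ ~~ grid_good b w)].
Proof. by move=> wC; have [b [? ? ? _]] := grid_ok_stop (grid_term ^~ w) n wC; exists b. Qed.

Lemma stopped_energy_notin n w : w \notin C -> stopped_energy n w = 0.
Proof.
move=> wC; rewrite /stopped_energy big1// => -[a /= _]; move=> h; exfalso.
by elim: a h => [|a IH] /= /andP[h _]; [rewrite h in wC|exact: IH].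
Qed.

Let stopped_var n w : \sum_(a < n | grid_ok a w) (p a.+1 - p a) * grid_gram a w <= r.
Proof.
have [wC|wC] := boolP (w \in C).
  have [[|b] [_ -> _ g]] := grid_ok_stop (fun a => (p a.+1 - p a) * grid_gram a w) n wC.
    by rewrite big_ord0.
  by have /and3P[] := g b (ltnSn b).
rewrite big1// => -[a /= _]; move=> h; exfalso.
by elim: a h => [|a IH] /= /andP[h _]; [rewrite h in wC|exact: IH].
Qed.

Let up a b (f : Omega -> R) : (a <= b)%N -> measurable_fun (T := subalg (Fil (p a))) setT f ->
  measurable_fun (T := subalg (Fil (p b))) setT f.
Proof.
move=> ab; apply: (fil_measurable_fun hF (p0 a)).
elim: b ab => [|b IH]; first by rewrite leqn0 => /eqP ->.
rewrite leq_eqVlt => /orP[/eqP ->//|]; rewrite ltnS => ab; exact: le_trans (IH ab) (pS b).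
Qed.

Let mgram a : measurable_fun (T := subalg (Fil (p a))) setT (grid_gram a).
Proof.
do 2!apply: measurable_sum => ?; apply: measurable_funM => //; exact: measurable_funM.
Qed.

Let mdW a i : measurable_fun (T := subalg (Fil (p a.+1))) setT (fun w => k a i w * dW W (p a) (p a.+1) (u i) w).
Proof.
apply: measurable_funM; first exact: (@up a).
exact: (dW_adapted hF hW).
Qed.

Let minc_dot a : measurable_fun (T := subalg (Fil (p a.+1))) setT
  (fun w => dotp (zeta a w) (grid_inc a w)).
Proof.
under eq_fun do rewrite dotp_sumr; apply: measurable_sum => i.
under eq_fun do rewrite dotpZr; apply: measurable_funM; first exact: mdW.
exact: (@up a).
Qed.

Let minc_sq a : measurable_fun (T := subalg (Fil (p a.+1))) setT (fun w => `|grid_inc a w| ^+ 2).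
Proof.
under eq_fun do rewrite (norm_sq_sum N (fun i => k a i _ * dW W (p a) (p a.+1) (u i) _)).
do 2!apply: measurable_sum => ?; apply: measurable_funM => //.
by apply: measurable_funM; exact: mdW.
Qed.

Let mterm a : measurable_fun (T := subalg (Fil (p a.+1))) setT (grid_term a).
Proof.
apply: measurable_funM; first exact: (@up a).
apply: measurable_funB; last by apply: measurable_funM => //; exact: (@up a).
by apply: measurable_funD => //; exact: measurable_funM.
Qed.

Let menergy b : measurable_fun (T := subalg (Fil (p b))) setT (grid_energy b).
Proof. by apply: measurable_sum => a; apply: (@up a.+1) => //. Qed.

Let mvar b : measurable_fun (T := subalg (Fil (p b))) setT (grid_var b.+1).
Proof.
apply: measurable_sum => a; apply: measurable_funM => //; apply: (@up a) => //.
by rewrite -ltnS.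
Qed.

Let FilE a : @measurable _ (subalg (Fil (p a))) = Fil (p a).
Proof. exact: fil_measurableE. Qed.

Let mok a : @measurable _ (subalg (Fil (p a))) [set w | grid_ok a w].
Proof.
have mgood b : @measurable _ (subalg (Fil (p b))) [set w | grid_good b w].
  rewrite (_ : [set _ | _] = [set w | grid_var b.+1 w <= r] `&`
    ([set w | `|zeta b w| <= m] `&` [set w | grid_energy b w <= lam])).
    apply: measurableI; first exact: (@measurable_le_cst _ _ (subalg (Fil (p b)))).
    apply: measurableI; last exact: (@measurable_le_cst _ _ (subalg (Fil (p b)))).
    exact: (@measurable_le_cst _ _ (subalg (Fil (p b)))).
  apply/seteqP; split => w /=; first by move=> /and3P[].
  by move=> [h1 [h2 h3]]; apply/and3P.
elim: a => [|a IH].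
  rewrite (_ : [set _ | _] = C `&` [set w | grid_good 0 w]).
    by apply: measurableI => //; rewrite FilE.
  apply/seteqP; split => w /=; first by move=> /andP[/set_mem].
  by move=> [h1 h2]; rewrite mem_set.
rewrite (_ : [set _ | _] = [set w | grid_ok a w] `&` [set w | grid_good a.+1 w]).
  apply: measurableI => //; rewrite FilE; apply: (fil_mono hF (p0 a) (pS a)).
  by rewrite -FilE.
by apply/seteqP; split => w /=; [move=> /andP[]|move=> [-> ->]].
Qed.

Let mchi a : measurable_fun (T := subalg (Fil (p a))) setT (chi a).
Proof.
rewrite (_ : chi a = \1_[set w | grid_ok a w]); first exact: measurable_indic.
apply/funext => w; rewrite indicE /chi; congr (_%:R).
by case: (boolP (grid_ok a w)) => h; [rewrite mem_set|rewrite memNset//=; exact/negP].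
Qed.

Let mW a (f : Omega -> R) : measurable_fun (T := subalg (Fil (p a))) setT f -> measurable_fun setT f.
Proof. exact: (fil_measurable_funT hF). Qed.

(* the martingale part of the stopped energy *)
Let L b w := \sum_(a < b) dotp ((chi a w * eta a w) *: zeta a w) (grid_inc a w).

Let ce01 a w : 0 <= chi a w * eta a w <= 1.
Proof.
have /andP[c0 c1] := chi01 a w; have /andP[h0 h1] := eta01 a w.
by rewrite mulr_ge0// mulr_ile1.
Qed.

Let mce a : measurable_fun (T := subalg (Fil (p a))) setT (fun w => chi a w * eta a w).
Proof. exact: measurable_funM. Qed.

Let z_bound a w : `|(chi a w * eta a w) *: zeta a w| <= m * chi a w.
Proof.
have /andP[h0 h1] := eta01 a w.
rewrite normrZ /chi; case: (boolP (grid_ok a w)) => h; rewrite ?mul0r ?normr0 ?mul0r ?mulr0//.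
rewrite mul1r mulr1 ger0_norm//.
have : grid_good a w by case: (a) h => [|a'] /= /andP[].
by move=> /and3P[_ zm _]; rewrite -[leRHS]mul1r ler_pM.
Qed.

Let mz a y : measurable_fun (T := subalg (Fil (p a))) setT
  (fun w => dotp ((chi a w * eta a w) *: zeta a w) y).
Proof. by under eq_fun do rewrite dotpZl; apply: measurable_funM. Qed.

Let mL b : measurable_fun (T := subalg (Fil (p b))) setT (L b).
Proof.
apply: measurable_sum => a; under eq_fun do rewrite dotpZl; apply: (@up a.+1) => //.
by apply: measurable_funM => //; exact: (@up a).
Qed.

Let z_bound' a w : `|(chi a w * eta a w) *: zeta a w| <= m.
Proof.
apply: le_trans (z_bound a w) _; have /andP[c0 c1] := chi01 a w.
by rewrite ler_piMr.
Qed.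

Let inc_chi a := step_inc_mul_sq hF hW N u x (p0 a) (pS a) (@mk a) (@k1 a) (mchi (a := a)) (K := 1).

Let cb a w : `|chi a w| <= 1.
Proof. by have /andP[? ?] := chi01 a w; rewrite ger0_norm. Qed.

Let ceb a w : `|chi a w * eta a w| <= 1.
Proof. by have /andP[? ?] := ce01 a w; rewrite ger0_norm. Qed.

(** Induction over the cells: the cross term between [L b] and the next increment has mean zero, so
    the second moments add up. *)
Let L_sq b : rint P setT (fun w => L b w ^+ 2) /\ rint P setT (L b) /\
  \int[P]_w L b w = 0 /\
  \int[P]_w (L b w ^+ 2) <= m ^+ 2 * \int[P]_w (\sum_(a < b) (p a.+1 - p a) * (chi a w * grid_gram a w)).
Proof.
have iS b' : rint P setT (fun w => \sum_(a < b') (p a.+1 - p a) * (chi a w * grid_gram a w)).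
  apply: (rint_sum mT) => a; apply: rintZl => //.
  by have [_ h _] := @inc_chi a (@cb a).
elim: b => [|b [i2 [i1 [e1 e2]]]].
  have -> : L 0 = fun=> 0 by apply/funext => w; rewrite /L big_ord0.
  under [in leRHS]eq_Rintegral do rewrite big_ord0.
  rewrite [X in rint _ _ X](_ : _ = fun=> 0); last by apply/funext => w; rewrite expr0n.
  rewrite [X in X <= _](_ : _ = \int[P]_(w in setT) (0 : R)); last first.
    by apply: eq_Rintegral => w _; rewrite expr0n.
  have i0 := rint0 P setT; rewrite /Rintegral integral0 mulr0.
  by split=> //; split.
pose I w := dotp ((chi b w * eta b w) *: zeta b w) (grid_inc b w).
have LE w : L b.+1 w = L b w + I w by rewrite /L big_ord_recr.
have one : measurable_fun (T := subalg (Fil (p b))) setT (fun=> 1 : R) by exact: measurable_cst.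
have i1' : rint P setT (fun w : Omega => (1 : R) ^+ 2).
  by apply: (rint_cst mT); rewrite -ge0_fin_numE// fin_num_measure.
have [c1 c2] := step_inc_mul_mean hF hW N u x (p0 b) (pS b) (@mk b) (@k1 b) (@mL b) i2 (@mz b) (@z_bound' b).
have [d1 d2] := step_inc_mul_mean hF hW N u x (p0 b) (pS b) (@mk b) (@k1 b) one i1' (@mz b) (@z_bound' b).
have [s1 s2] := step_inc_dotp_sq hF hW N u x (p0 b) (pS b) (@mk b) (@k1 b) (@mchi b)
  (@chi01 b) (@mz b) (@z_bound b) m0.
have iI : rint P setT I by move: d1; under [X in rint _ _ X]eq_fun do rewrite mul1r.
have eI : \int[P]_w I w = 0 by move: d2; under eq_Rintegral do rewrite mul1r.
have SE w : L b.+1 w ^+ 2 = L b w ^+ 2 + 2 * (L b w * I w) + I w ^+ 2.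
  by rewrite LE; ring.
have j1 := rintZl mT 2 c1.
have j2 := rintD mT i2 j1.
have j3 := rintD mT j2 s1.
split; first by under [X in rint _ _ X]eq_fun do rewrite SE.
split; first by rewrite (funext LE); exact: (rintD mT i1 iI).
split.
  under eq_Rintegral do rewrite LE.
  by rewrite (RintegralD mT i1 iI) e1 eI addr0.
under eq_Rintegral do rewrite SE.
rewrite (RintegralD mT j2 s1) (RintegralD mT i2 j1) (RintegralZl _ mT c1) c2 mulr0 addr0.
under [in leRHS]eq_Rintegral do rewrite big_ord_recr/=.
have [_ h _] := @inc_chi b (@cb b).
rewrite (RintegralD mT (iS b) (rintZl mT _ h)) (RintegralZl _ mT h) mulrDr.
exact: lerD.
Qed.

(** The stopped energy is [2 L + B - D] with [L] a martingale, [B >= 0], [D <= r] and [E B = E D].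
    Completing the square gives [- K <= 2 L + B - D + L^2 / (K - r)], so cutting off at [- K] raises
    the mean from [0] by at most [E L^2 / (K - r)], and [E L^2 <= m^2 r]. *)
Lemma stopped_energy_max n :
  [/\ measurable_fun setT (stopped_energy n), rint P setT (fun w => Num.max (stopped_energy n w) (- K)) &
  \int[P]_w Num.max (stopped_energy n w) (- K) <= m ^+ 2 * r / (K - r)].
Proof.
have Kr : 0 < K - r by rewrite subr_gt0.
pose B w := \sum_(a < n) (chi a w * eta a w) * `|grid_inc a w| ^+ 2.
pose D w := \sum_(a < n) (p a.+1 - p a) * ((chi a w * eta a w) * grid_gram a w).
have NE w : stopped_energy n w = 2 * L n w + B w - D w.
  rewrite stoppedE /L /B /D mulr_sumr -big_split -sumrB; apply: eq_bigr => a _ /=.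
  by rewrite dotpZl /grid_term; ring.
have b a := step_inc_mul_sq hF hW N u x (p0 a) (pS a) (@mk a) (@k1 a) (@mce a) (@ceb a).
have iB : rint P setT B by apply: (rint_sum mT) => a; have [] := b a.
have iD : rint P setT D.
  by apply: (rint_sum mT) => a; apply: rintZl => //; have [] := b a.
have BD : \int[P]_w B w = \int[P]_w D w.
  rewrite (Rintegral_sum mT); last by move=> a; have [] := b a.
  rewrite (Rintegral_sum mT); last by move=> a; apply: rintZl => //; have [] := b a.
  by apply: eq_bigr => a _; have [_ h ->] := b a; rewrite (RintegralZl _ mT h).
have [i2 [i1 [e1 e2]]] := L_sq n.
have j1 := rintZl mT 2 i1; have j2 := rintD mT j1 iB; have j3 := rintB mT j2 iD.
have mN : measurable_fun setT (stopped_energy n).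
  by rewrite (funext NE); exact: rint_meas j3.
have B0 w : 0 <= B w by apply: sumr_ge0 => a _; have /andP[? _] := ce01 a w; rewrite mulr_ge0.
have SE w : \sum_(a < n) (p a.+1 - p a) * (chi a w * grid_gram a w) <= r.
  rewrite (le_trans _ (stopped_var n w))// [leRHS]big_mkcond; apply: ler_sum => a _.
  by rewrite /chi; case: grid_ok; rewrite ?mul1r ?mul0r ?mulr0.
have Dr w : D w <= r.
  rewrite (le_trans _ (SE w))//; apply: ler_sum => a _; rewrite ler_wpM2l// ler_wpM2r//.
  by have /andP[? ?] := eta01 a w; have /andP[? _] := chi01 a w; rewrite ler_piMr.
have S0 w : 0 <= \sum_(a < n) (p a.+1 - p a) * (chi a w * grid_gram a w).
  by apply: sumr_ge0 => a _; have /andP[? _] := chi01 a w; rewrite mulr_ge0// mulr_ge0.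
(* The square that is completed is [(L + (K - r))^2 / (K - r)]. *)
have key w : Num.max (stopped_energy n w) (- K) <= (2 * L n w + B w - D w) + L n w ^+ 2 * (K - r)^-1.
  rewrite NE ge_max lerDl mulr_ge0 ?sqr_ge0 ?invr_ge0 ?(ltW Kr)//=.
  have : 0 <= (L n w + (K - r)) ^+ 2 * (K - r)^-1 by rewrite mulr_ge0 ?sqr_ge0 ?invr_ge0 ?(ltW Kr).
  have -> : (L n w + (K - r)) ^+ 2 * (K - r)^-1 = L n w ^+ 2 * (K - r)^-1 + 2 * L n w + (K - r).
    by field; rewrite gt_eqF.
  by have := B0 w; have := Dr w; lra.
have j4 := rintZr mT (K - r)^-1 i2; have j5 := rintD mT j3 j4.
have iM : rint P setT (fun w => Num.max (stopped_energy n w) (- K)).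
  apply: (rint_le mT (g := fun w => `|2 * L n w + B w - D w + L n w ^+ 2 * (K - r)^-1| + `|K|)).
  - apply: rintD => //; first exact: rint_norm.
    by apply: (rint_cst mT); rewrite -ge0_fin_numE// fin_num_measure.
  - exact: measurable_maxr.
  move=> w _; rewrite ler_norml; apply/andP; split.
    rewrite le_max; apply/orP; right; rewrite lerN2; apply: le_trans (ler_norm K) _.
    by rewrite lerDr.
  apply: le_trans (key w) _; apply: le_trans (ler_norm _) _; by rewrite lerDl.
split=> //.
apply: (le_trans (le_Rintegral mT iM j5 (fun w _ => key w))).
rewrite (RintegralD mT j3 j4) (RintegralB mT j2 iD) (RintegralD mT j1 iB) (RintegralZl _ mT i1).
rewrite e1 mulr0 add0r BD subrr add0r (RintegralZr _ mT i2) ler_wpM2r ?invr_ge0 ?(ltW Kr)//.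
apply: (le_trans e2); rewrite ler_wpM2l ?sqr_ge0//.
have iS : rint P setT (fun w => \sum_(a < n) (p a.+1 - p a) * (chi a w * grid_gram a w)).
  by apply: (rint_sum mT) => a; apply: rintZl => //; have [_ h _] := @inc_chi a (@cb a).
have ir : rint P setT (fun=> r) by apply: (rint_cst mT); rewrite -ge0_fin_numE// fin_num_measure.
apply: (le_trans (le_Rintegral mT iS ir (fun w _ => SE w))).
rewrite /Rintegral integral_cst// fineM//= ?fin_num_measure//.
by rewrite [P _]probability_setT/= mulr1.
Qed.

End stopped_energy.

(** * The pathwise energy inequality *)

Section path_integrals.
Context (R : realType).
Local Notation mu := (@lebesgue_measure R).
Implicit Types (F : R -> R).

Lemma measurable_segment (a b : R) :
  measurable (`[a, b]%classic : set (g_sigma_algebraType R.-ocitv.-measurable)).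
Proof. exact: measurable_itv. Qed.

Lemma rint_itvS F a b s t : rint mu `[a, b] F -> a <= s -> t <= b -> rint mu `[s, t] F.
Proof.
move=> iF as_ tb; apply: rintS iF; [exact: measurable_itv|exact: measurable_itv|].
by move=> r /=; rewrite !in_itv/= => /andP[h1 h2]; rewrite (le_trans as_) ?(le_trans h2).
Qed.

Lemma Rintegral_itv_split F a b c : rint mu `[a, c] F -> a <= b -> b <= c ->
  \int[mu]_(r in `[a, c]) F r = \int[mu]_(r in `[a, b]) F r + \int[mu]_(r in `[b, c]) F r.
Proof.
move=> iF ab bc.
have i1 : rint mu `]b, c] F.
  apply: rintS (rint_itvS iF ab (lexx c)); [exact: measurable_itv|exact: measurable_itv|].
  by move=> r /=; rewrite !in_itv/= => /andP[h1 ->]; rewrite ltW.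
have := @Rintegral_itvB R F (BLeft a) (BRight c) b iF.
rewrite !bnd_simp => /(_ ab bc); rewrite (Rintegral_itv_obnd_cbnd i1) => <-.
by rewrite addrC subrK.
Qed.

Lemma Rintegral_itv_pt F a : \int[mu]_(r in `[a, a]) F r = 0.
Proof. by rewrite set_itv1 Rintegral_set1. Qed.

Lemma Rintegral_itv_sum F a b (tau : nat -> R) n : rint mu `[a, b] F -> tau 0%N = a ->
  (forall k, tau k <= tau k.+1) -> (forall k, tau k <= b) ->
  \sum_(k < n) \int[mu]_(r in `[tau k, tau k.+1]) F r = \int[mu]_(r in `[a, tau n]) F r.
Proof.
move=> iF t0 tS tb; have ta k : a <= tau k.
  by elim: k => [|k IH]; [rewrite t0|exact: le_trans IH (tS k)].
elim: n => [|n IH]; first by rewrite big_ord0 t0 Rintegral_itv_pt.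
rewrite big_ord_recr/= IH -Rintegral_itv_split//.
exact: rint_itvS iF (lexx a) (tb _).
Qed.

Lemma Rintegral_itv_ge0 F a b : (forall r, a <= r <= b -> 0 <= F r) ->
  0 <= \int[mu]_(r in `[a, b]) F r.
Proof. by move=> F0; apply: Rintegral_ge0 => r /=; rewrite in_itv; exact: F0. Qed.

Lemma Rintegral_itv_mono F a b c : rint mu `[a, c] F -> a <= b -> b <= c ->
  (forall r, a <= r <= c -> 0 <= F r) ->
  \int[mu]_(r in `[a, b]) F r <= \int[mu]_(r in `[a, c]) F r.
Proof.
move=> iF ab bc F0; rewrite (Rintegral_itv_split iF ab bc) lerDl.
by apply: Rintegral_itv_ge0 => r /andP[br rc]; rewrite F0// rc andbT (le_trans ab).
Qed.

Lemma segment_uniform (X : normedModType R) (f : R -> X) a b : {within `[a, b], continuous f} ->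
  forall e : R, 0 < e -> exists2 del : R, 0 < del & forall x y, a <= x <= b -> a <= y <= b ->
    `|x - y| < del -> `|f x - f y| < e.
Proof.
move=> cf e e0.
have /compact_near_coveringP/near_covering_withinP cK := @segment_compact R a b.
pose Q (del x : R) := forall y, a <= y <= b -> `|x - y| < del -> `|f x - f y| < e.
have := cK R (0^'+) Q _; case.
- move=> x xab.
  have /subspace_continuousP/(_ x xab)/cvgrPdist_lt/(_ (e / 2)) := cf.
  rewrite divr_gt0// => /(_ isT); rewrite /prop_near1 /within /= => /nbhs_ballP[d /= d0 hd].
  exists (ball x (d / 2), [set del | del < d / 2]) => /=.
    split; first by apply: nbhsx_ballx; rewrite divr_gt0.
    by apply: nbhs_right_lt; rewrite divr_gt0.
  move=> [x' del] /= [xx' dd] x'ab y yab xy.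
  have yin : `[a, b]%classic y by rewrite /= in_itv.
  have h1 : `|f x - f x'| < e / 2.
    by apply: hd => //; apply: le_ball xx'; rewrite ler_pdivrMr// ler_pMr// ler1n.
  have h2 : `|f x - f y| < e / 2.
    apply: hd => //; move: xx'; rewrite -ball_normE /= => xx'.
    rewrite (_ : x - y = (x - x') + (x' - y)); last by rewrite addrA subrK.
    by rewrite (le_lt_trans (ler_normD _ _))// [d]splitr ltrD// (lt_trans xy).
  rewrite (_ : f x' - f y = - (f x - f x') + (f x - f y)).
    by rewrite (le_lt_trans (ler_normD _ _))// normrN [e]splitr ltrD.
  by rewrite opprB addrA subrK.
- move=> del /= [d0 hd].
  exists (del / 2); first by rewrite divr_gt0.
  move=> x y xab yab xy; apply: (hd (del / 2)) => //=.
  + by rewrite sub0r normrN gtr0_norm ?divr_gt0// ltr_pdivrMr// ltr_pMr// ltr1n.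
  + by rewrite divr_gt0.
Qed.

End path_integrals.

(** The pointwise estimate behind [interval_energy] at a time [r] between [t] and [t']: [Et], [Er],
    [Et'] are the weights; [ay], [av], [aR] the values of the drift at [R_s (h t')], [v r] and
    [R_s (h r)]; [A] its norm, [w = |v r - R_s (h r)|]; [q'] and [q] the forms at [t'] and [r]. All
    errors are proportional to the oscillation [e], except for the terms in [w] and [hh - q], which
    form the resolvent defect. *)
Fact energy_integrand (R : realType) (Et Er Et' ay av aR A w g P th f hh q' q e m rho : R) :
  0 <= Et - Er <= e -> 0 <= Er - Et' <= e -> 0 < Er -> Er <= 1 -> 0 <= A -> 0 <= w -> 0 <= g -> 0 <= P ->
  0 <= f -> 0 <= q' -> q' <= m ^+ 2 -> q <= hh -> 0 <= e -> 0 <= m -> 0 <= rho ->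
  `|ay - aR| <= A * (rho * e) -> `|av - aR| <= A * w -> `|ay| <= A * (rho * m) ->
  `|q' - q| <= e * (m + m) ->
  th - g * hh - f <= 2 * av - P ->
  - (2 * Et) * ay - Et' * q' * g <= - (Er * th) + f - Et * P + (2 * (A * w) + g * (hh - q)) +
    e * ((2 * (rho * m) + 2 * rho + m ^+ 2 + 2 * m + 1) * (A + g + P)).
Proof.
move=> /andP[E1 E2] /andP[E3 E4] Er0 Er1 A0 w0 g0 P0 f0 q'0 q'm qh e0 m0 rho0.
rewrite !ler_norml => /andP[a1 a2] /andP[a3 a4] /andP[a5 a6] /andP[q1 q2] hm.
have b1 : - (2 * Et) * ay <= - (2 * Er) * ay + 2 * e * (A * (rho * m)).
  have : (Et - Er) * (- ay) <= e * (A * (rho * m)).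
    have [ay0|ay0] := leP 0 (- ay); first by rewrite ler_pM//; lra.
    by apply: (@le_trans _ _ 0); [rewrite mulr_ge0_le0// ltW|rewrite !mulr_ge0].
  by lra.
have b2 : - (2 * Er) * ay <= - (2 * Er) * av + 2 * (A * (rho * e)) + 2 * (A * w).
  have h1 : Er * (av - ay) <= A * (rho * e) + A * w.
    have h2 : av - ay <= A * (rho * e) + A * w by lra.
    have h3 : 0 <= A * (rho * e) + A * w by rewrite addr_ge0// !mulr_ge0.
    apply: (@le_trans _ _ (Er * (A * (rho * e) + A * w))); first by rewrite ler_pM2l.
    by rewrite ler_piMl.
  by lra.
have b3 : Er * (th - g * hh - f) <= Er * (2 * av - P) by rewrite ler_pM2l.
have b4 : - (Et' * q' * g) <= - (Er * q * g) + g * (e * m ^+ 2) + g * (e * (m + m)).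
  have h1 : Er * q - Et' * q' <= e * m ^+ 2 + e * (m + m).
    have h2 : Er * (q - q') <= e * (m + m).
      have h3 : 0 <= e * (m + m) by rewrite mulr_ge0// addr_ge0.
      apply: (@le_trans _ _ (Er * (e * (m + m)))); first by rewrite ler_pM2l//; lra.
      by rewrite ler_piMl.
    have h3 : (Er - Et') * q' <= e * m ^+ 2 by rewrite ler_pM.
    by lra.
  have : g * (Er * q - Et' * q') <= g * (e * m ^+ 2 + e * (m + m)) by rewrite ler_wpM2l.
  by lra.
have b5 : Er * (g * (hh - q)) <= g * (hh - q).
  by rewrite ler_piMl// mulr_ge0// subr_ge0.
have b6 : (Et - Er) * P <= e * P by rewrite ler_wpM2r.
have b7 : Er * f <= f by rewrite ler_piMl.
have n1 : 0 <= e * (rho * g) by rewrite !mulr_ge0.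
have n2 : 0 <= e * (rho * P) by rewrite !mulr_ge0.
have n3 : 0 <= e * (rho * m * g) by rewrite !mulr_ge0.
have n4 : 0 <= e * (rho * m * P) by rewrite !mulr_ge0.
have n5 : 0 <= e * (m ^+ 2 * A) by rewrite !mulr_ge0// sqr_ge0.
have n6 : 0 <= e * (m ^+ 2 * P) by rewrite !mulr_ge0// sqr_ge0.
have n7 : 0 <= e * (m * A) by rewrite !mulr_ge0.
have n8 : 0 <= e * (m * P) by rewrite !mulr_ge0.
have n9 : 0 <= e * A by rewrite mulr_ge0.
have n10 : 0 <= e * g by rewrite mulr_ge0.
by lra.
Qed.

Fact integrand_collect (R : realType) (e g P X t f d Z : R) : e * (g - P) <= X ->
  - t + f - e * P + d + Z <= - t + (f + d + Z + X) - e * g.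
Proof. by rewrite mulrBr; lra. Qed.

Fact loc_collect (R : realType) (A B C D Z : R) : A <= Z -> B + A + (D - C) <= B - C + Z + D.
Proof. lra. Qed.

Fact energy_collect (R : realType) (eps a1 a2 a3 a4 a5 a6 a7 a8 a9 b1 b2 b3 : R) :
  a1 - a2 <= a3 + a9 + a4 -> a4 <= - a5 + (a6 + a7 + b1 + (b2 + b3)) -> a2 <= a8 ->
  b1 <= eps / 4 -> b2 <= eps / 4 -> a9 <= eps / 4 -> b3 <= eps / 4 ->
  a1 + a5 <= a8 + a6 + a7 + a3 + eps.
Proof. lra. Qed.

Section resolvent_form.
Context (R : realType) (V H : hilbertType R) (j : bop V H) (s : R) (s0 : 0 < s).
Local Notation Rs := (resolvent j s).

Definition resolvent_form (x : H) : R := dotp x (j (Rs x)).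
Local Notation q := resolvent_form.

Lemma resolvent_form_dist x y : `|q x - q y| <= `|x - y| * (`|x| + `|y|).
Proof.
have -> : q x - q y = dotp (x - y) (j (Rs x)) + dotp (x - y) (j (Rs y)).
  rewrite /q !dotpBl (resolvent_sym j y x s0); ring.
rewrite mulrDr (le_trans (ler_normD _ _))// lerD// (le_trans (dotp_le _ _))//;
  by rewrite ler_wpM2l// resolvent_contract.
Qed.

(* A quadratic form with [q <= |.|^2] loses nothing when the increment
   [h' - h = D + m] is tested against the new point on the drift part [D] only. *)
Lemma resolvent_form_step (h h' m : H) :
  q h' - q h <= 2 * (dotp (h' - h) (j (Rs h')) - dotp m (j (Rs h'))) +
    2 * dotp (j (Rs h)) m + `|m| ^+ 2.
Proof.
set D := h' - h.
have hE : h = h' - D by rewrite /D opprB addrC subrK.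
clearbody D; subst h; have e1 : Rs (h' - D) = Rs h' - Rs D by rewrite resolventB.
have e2 : q (h' - D) = q h' - 2 * dotp D (j (Rs h')) + q D.
  rewrite /q e1 bopB dotpBr !dotpBl (resolvent_sym j h' D s0); ring.
have h3 : 0 <= q (m - D) by exact: resolvent_form_ge0.
have e3 : q (m - D) = q m - 2 * dotp m (j (Rs D)) + q D.
  rewrite /q resolventB// bopB dotpBr !dotpBl (resolvent_sym j D m s0); ring.
have h4 : q m <= `|m| ^+ 2 by exact: resolvent_form_le.
have e4 : dotp (j (Rs (h' - D))) m = dotp m (j (Rs h')) - dotp m (j (Rs D)).
  by rewrite e1 bopB dotpC dotpBr.
rewrite e3 in h3; rewrite e4 e2; lra.
Qed.

End resolvent_form.

Section pathwise_energy.
Context (R : realType) (V H : hilbertType R) (j : bop V H).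
Local Notation mu := (@lebesgue_measure R).
Context (T s : R) (T0 : 0 < T) (s0 : 0 < s).
Local Notation Rs := (resolvent j s).
Local Notation q := (resolvent_form j s).
Context (x0 : H) (v : R -> V) (h M : R -> H) (a : R -> dual V) (th gam f nP : R -> R) (m : R).
Local Notation itg F := (rint mu `[0, T] F).
Hypotheses (rth : itg th) (rgam : itg gam) (rf : itg f) (rP : itg (fun r => nP r ^+ 2)).
Hypotheses (th0 : forall r, 0 <= th r) (gam0 : forall r, 0 <= gam r) (f0 : forall r, 0 <= f r).
Hypothesis ra : itg (fun r => `|a r|).
Hypothesis may : forall y, measurable_fun `[0, T] (fun r => a r y).
(** The price of replacing [v] by [R_s (j v)] in the pairing with the drift and [|h|^2] by the
    resolvent form in the term with [gam]. *)
Definition resolvent_defect r :=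
  2 * (`|a r| * `|v r - Rs (j (v r))|) + gam r * (`|h r| ^+ 2 - q (h r)).
Hypothesis rdef : itg resolvent_defect.
Hypothesis heq : forall y t, 0 <= t <= T ->
  dotp (h t - x0) (j y) + \int[mu]_(r in `[0, t]) a r y = dotp (M t) (j y).
Hypothesis hx0 : h 0 = x0.
Hypothesis hjv : \forall r \ae mu, `[0, T]%classic r -> j (v r) = h r.
Hypothesis hmono : \forall r \ae mu, `[0, T]%classic r ->
  th r - gam r * `|h r| ^+ 2 - f r <= 2 * a r (v r) - nP r ^+ 2.
Hypothesis hm : forall t, 0 <= t <= T -> `|h t| <= m.
Hypothesis huc : {within `[0, T], continuous h}.

Definition weight_exponent t := \int[mu]_(r in `[0, t]) gam r.
Local Notation G := weight_exponent.
Definition weight t := expR (- G t).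
Local Notation E := weight.

Let GD r t : 0 <= r -> r <= t -> t <= T -> G t = G r + \int[mu]_(x in `[r, t]) gam x.
Proof. by move=> r0 rt tT; apply: Rintegral_itv_split => //; exact: rint_itvS rgam _ _. Qed.

Let Gmono r t : 0 <= r -> r <= t -> t <= T -> G r <= G t.
Proof. by move=> r0 rt tT; rewrite (GD r0 rt tT) lerDl Rintegral_itv_ge0. Qed.

Let G0 t : 0 <= G t. Proof. exact: Rintegral_itv_ge0. Qed.

Lemma weight_gt0 t : 0 < E t. Proof. exact: expR_gt0. Qed.

Lemma weight_le1 t : E t <= 1. Proof. by rewrite /weight expR_le1 oppr_le0. Qed.

Lemma weight_mono r t : 0 <= r -> r <= t -> t <= T -> E t <= E r.
Proof. by move=> r0 rt tT; rewrite ler_expR lerN2 Gmono. Qed.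

Lemma weight_lip r t : 0 <= r -> r <= t -> t <= T -> E r - E t <= G t - G r.
Proof.
move=> r0 rt tT; have e : E t = E r * expR (- (G t - G r)) by rewrite -expRD; congr expR; lra.
have h1 := expR_ge1Dx (- (G t - G r)); have h2 := weight_gt0 r; have h3 := weight_le1 r.
have g := Gmono r0 rt tT; rewrite e.
apply: (@le_trans _ _ (E r * (G t - G r))).
  by rewrite -[X in X - _]mulr1 -mulrBr ler_wpM2l ?(ltW h2)// lerBlDr addrC -lerBlDr.
by rewrite ler_piMl// subr_ge0.
Qed.

(** The later weight stands on the right because in [interval_energy] the increment of the weight
    multiplies the form at the later time. *)
Lemma weight_step r t : 0 <= r -> r <= t -> t <= T -> E t - E r <= - (E t * (G t - G r)).
Proof.
move=> r0 rt tT; have e : E r = E t * expR (G t - G r) by rewrite -expRD; congr expR; lra.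
have h1 := expR_ge1Dx (G t - G r); have h2 := weight_gt0 t.
by rewrite e -[X in X - _]mulr1 -mulrBr -mulrN ler_wpM2l ?(ltW h2)// lerBlDr addrC -lerBlDr opprK.
Qed.

Let mE : measurable_fun `[0, T] E.
Proof.
apply: measurableT_comp => //; apply: measurableT_comp => //.
apply: subspace_continuous_measurable_fun; first exact: measurable_itv.
exact: parameterized_integral_continuous (ltW T0) rgam.
Qed.

Let rEth : itg (fun r => E r * th r).
Proof.
apply: (@rint_bounded_mul _ _ _ mu _ (measurable_itv _) 1 E th) => // r _.
by rewrite ger0_norm ?weight_le1// ltW ?weight_gt0.
Qed.

Let rho := (Num.sqrt s)^-1.
Let rho0 : 0 <= rho. Proof. by rewrite invr_ge0. Qed.
Let kap := 2 * (rho * m) + 2 * rho + m ^+ 2 + 2 * m + 1.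

Let mem t t' r : 0 <= t -> t' <= T -> t <= r <= t' -> 0 <= r <= T.
Proof. by move=> t0 tT /andP[h1 h2]; rewrite (le_trans t0 h1) (le_trans h2 tT). Qed.

(** Discrete product rule [E' q' - E q = E (q' - q) + (E' - E) q']. The first term is expanded by
    [resolvent_form_step], whose drift part is tested at the single vector [R_s (h t')]; moving this
    vector to [R_s (h r)] and then to [v r] under the integral makes the monotonicity hypothesis
    applicable. *)
Lemma interval_energy t t' e1 : 0 <= t -> t <= t' -> t' <= T -> 0 <= e1 ->
  (forall r, t <= r <= t' -> `|h r - h t'| <= e1 /\ `|G t' - G t| <= e1) ->
  E t' * q (h t') - E t * q (h t) <=
  E t * (2 * dotp (j (Rs (h t))) (M t' - M t) + `|M t' - M t| ^+ 2) +
  \int[mu]_(r in `[t, t']) (- (E r * th r) + f r - E t * nP r ^+ 2 + resolvent_defect r +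
     e1 * (kap * (`|a r| + gam r + nP r ^+ 2))).
Proof.
move=> t0 tt' t'T e10 osc; have tT := le_trans tt' t'T; have t'0 := le_trans t0 tt'.
have m0 : 0 <= m by apply: le_trans (normr_ge0 (h 0)) (hm _); rewrite lexx ltW.
set y := Rs (h t').
have mI := measurable_segment t t'.
have S F : itg F -> rint mu `[t, t'] F by move=> iF; exact: rint_itvS iF t0 t'T.
have Rb x : `|Rs x| <= rho * `|x| by exact: resolvent_norm_le.
have ray z : itg (fun r => a r z).
  apply: (@rint_le _ _ _ mu _ (measurable_itv _) (fun r => `|a r| * `|z|)) => //.
  - exact: rintZr.
  - exact: may.
  - by move=> r _; exact: bop_norm_le.
have eqD : dotp (h t' - h t) (j y) = dotp (M t' - M t) (j y) - \int[mu]_(r in `[t, t']) a r y.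
  have e2 := heq y (t := t); have e3 := heq y (t := t').
  rewrite t0 tT in e2; rewrite t'0 t'T in e3.
  have e4 := Rintegral_itv_split (rint_itvS (ray y) (lexx 0) t'T) t0 tt'.
  have -> : h t' - h t = (h t' - x0) - (h t - x0) by rewrite opprB addrA subrK.
  by rewrite dotpBl [dotp (M t' - _) _]dotpBl -(e2 isT) -(e3 isT) e4; ring.
have st := resolvent_form_step j s0 (h t) (h t') (M t' - M t).
rewrite -/y eqD in st.
have w1 := weight_step t0 tt' t'T; have w2 := weight_gt0 t; have w3 := weight_gt0 t'.
have q'0 : 0 <= q (h t') by exact: resolvent_form_ge0.
have q'm : q (h t') <= m ^+ 2.
  apply: le_trans (resolvent_form_le _ _ s0) _; rewrite lerXn2r ?nnegrE// hm// t'0.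
  by [].
have i1 : rint mu `[t, t'] (fun r => - (2 * E t) * a r y - E t' * q (h t') * gam r).
  by apply: rintB => //; apply: rintZl => //; exact: S.
have i2 : rint mu `[t, t'] (fun r => - (E r * th r) + f r - E t * nP r ^+ 2 + resolvent_defect r +
     e1 * (kap * (`|a r| + gam r + nP r ^+ 2))).
  apply: S; have mT := measurable_segment 0 T.
  apply: rintD => //; last by do 2!apply: rintZl => //; do 2!apply: rintD => //.
  apply: rintD => //; apply: rintB => //; last exact: rintZl.
  by apply: rintD => //; exact: rintN.
have key : \int[mu]_(r in `[t, t']) (- (2 * E t) * a r y - E t' * q (h t') * gam r) <=
   \int[mu]_(r in `[t, t']) (- (E r * th r) + f r - E t * nP r ^+ 2 + resolvent_defect r +
     e1 * (kap * (`|a r| + gam r + nP r ^+ 2))).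
  apply: ae_le_Rintegral => //.
  apply: (@filterS2 _ _ (ae_filter_ringOfSetsType mu) _ _ _ _ hmono hjv) => r hr jvr /=.
  rewrite in_itv/= => tr.
  have rT := mem t0 t'T tr; move: hr jvr; rewrite /= in_itv/= rT => /(_ isT) hr /(_ isT) jvr.
  have /andP[t_r r_t'] := tr; have /andP[r0 rT'] := rT.
  have [u1 u2] := osc r tr.
  have E1 : 0 <= E t - E r <= e1.
    rewrite subr_ge0 weight_mono//= (le_trans (weight_lip t0 t_r rT'))//.
    by rewrite (le_trans _ u2)// (le_trans _ (ler_norm _))// lerB// Gmono.
  have E2 : 0 <= E r - E t' <= e1.
    rewrite subr_ge0 weight_mono//= (le_trans (weight_lip r0 r_t' t'T))//.
    by rewrite (le_trans _ u2)// (le_trans _ (ler_norm _))// lerB// Gmono.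
  have a1 : `|a r y - a r (Rs (h r))| <= `|a r| * (rho * e1).
    rewrite -bopB (le_trans (bop_norm_le _ _))// ler_wpM2l// /y -resolventB//.
    by rewrite (le_trans (Rb _))// ler_wpM2l// distrC.
  have a2 : `|a r (v r) - a r (Rs (h r))| <= `|a r| * `|v r - Rs (h r)|.
    by rewrite -bopB bop_norm_le.
  have a3 : `|a r y| <= `|a r| * (rho * m).
    rewrite (le_trans (bop_norm_le _ _))// ler_wpM2l// (le_trans (Rb _))// ler_wpM2l// hm//.
    by rewrite t'0.
  have q1 := resolvent_form_dist j s0 (h t') (h r).
  have q2 : `|q (h t') - q (h r)| <= e1 * (m + m).
    by apply: le_trans q1 _; rewrite ler_pM// ?addr_ge0// ?lerD ?hm// ?t'0// distrC.
  have q3 : q (h r) <= `|h r| ^+ 2 by exact: resolvent_form_le.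
  have Er0 := weight_gt0 r; have Er1 := weight_le1 r; have Et1 := weight_le1 t.
  have A0 : 0 <= `|a r| by [].
  have P0 : 0 <= nP r ^+ 2 by exact: sqr_ge0.
  rewrite /resolvent_defect /kap jvr.
  exact: (@energy_integrand R (E t) (E r) (E t') (a r y) (a r (v r)) (a r (Rs (h r))) `|a r|
    `|v r - Rs (h r)| (gam r) (nP r ^+ 2) (th r) (f r) (`|h r| ^+ 2) (q (h t')) (q (h r)) e1 m rho).
rewrite (RintegralB mI (rintZl mI _ (S _ (ray y))) (rintZl mI _ (S _ rgam))) in key.
rewrite (RintegralZl _ mI (S _ (ray y))) (RintegralZl _ mI (S _ rgam)) in key.
have gD := GD t0 tt' t'T.
set I := (X in _ <= _ + X); rewrite -/I in key.
move: key st w1 w2 w3 q'0; rewrite gD.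
set Ia := \int[mu]_(r in _) a r y; set Ig := \int[mu]_(r in _) gam r.
set d1 := dotp _ _; set d2 := dotp _ _; set n := `|M t' - M t| ^+ 2.
rewrite -/q; move: (q (h t')) (q (h t)) (E t) (E t') => q' q1 e e' key st w1 w2 w3 q'0.
have e5 : e * (q' - q1) <= e * (2 * (d1 - Ia - d1) + 2 * d2 + n) by rewrite ler_wpM2l// ltW.
have e6 : (e' - e) * q' <= - (e' * (G t + Ig - G t)) * q' by rewrite ler_wpM2r.
lra.
Qed.

Context (ML : nat -> R -> H) (gl dl : nat -> R -> R) (xi : nat -> nat -> H) (b : R).
Hypothesis P0 : forall r, 0 <= nP r.
Hypothesis hMb : forall t, 0 <= t <= T -> `|M t| <= b.
Hypothesis hML : \forall l \near \oo, forall t, 0 <= t <= T -> `|M t - ML l t| <= 4^-1 ^+ l.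
Definition dyadic l k := T * k%:R / 2 ^+ l.
Hypothesis hxi : \forall l \near \oo, forall k, (k < 2 ^ l)%N ->
  `|h (dyadic l k) - xi l k| <= 4^-1 ^+ l.
Hypotheses (rgl : forall l, itg (gl l)) (rdl : forall l, itg (fun r => dl l r ^+ 2)).
Hypothesis gld : forall l r, 0 <= r <= T -> gl l r <= (nP r + dl l r) ^+ 2.
Hypothesis dl0 : \int[mu]_(r in `[0, T]) dl l r ^+ 2 @[l --> \oo] --> 0.

(** The discrete martingale of the energy: increments of the elementary integrals [ML l], paired
    with the value at the left dyadic node and compensated by [gl l], which will be the squared norm
    of the integrand. The minima with [p] cut the sum at time [p]. *)
Definition approx_energy l p := \sum_(k < (2 ^ l)%N) E (dyadic l k) *
  (2 * dotp (j (Rs (xi l k))) (ML l (Num.min (dyadic l k.+1) p) - ML l (Num.min (dyadic l k) p)) +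
   `|ML l (Num.min (dyadic l k.+1) p) - ML l (Num.min (dyadic l k) p)| ^+ 2 -
   \int[mu]_(r in `[Num.min (dyadic l k) p, Num.min (dyadic l k.+1) p]) gl l r).

Let m0 : 0 <= m.
Proof. by apply: le_trans (normr_ge0 (h 0)) (hm _); rewrite lexx ltW. Qed.

Let b0 : 0 <= b.
Proof. by apply: le_trans (normr_ge0 (M 0)) (hMb _); rewrite lexx ltW. Qed.

Lemma approx_increment (M1 M2 N1 N2 x y : H) (de : R) : 0 <= de <= 1 -> `|M1| <= b -> `|M2| <= b ->
  `|M1 - N1| <= de -> `|M2 - N2| <= de -> `|x| <= m -> `|x - y| <= de ->
  2 * dotp (j (Rs x)) (M2 - M1) + `|M2 - M1| ^+ 2 <=
  2 * dotp (j (Rs y)) (N2 - N1) + `|N2 - N1| ^+ 2 + de * (12 * b + 4 * m + 8).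
Proof.
move=> /andP[de0 de1] M1b M2b h1 h2 xm xy.
set D := M2 - M1; set D' := N2 - N1.
have Db : `|D| <= b + b by rewrite (le_trans (ler_normB _ _))// lerD.
have DD : `|D - D'| <= de + de.
  have -> : D - D' = (M2 - N2) - (M1 - N1) by rewrite /D /D' !opprD !opprK addrACA.
  by rewrite (le_trans (ler_normB _ _))// lerD.
have D'b : `|D'| <= b + b + 2.
  have -> : D' = D - (D - D') by rewrite opprB addrC subrK.
  by rewrite (le_trans (ler_normB _ _))// lerD// (le_trans DD)//; lra.
have ym : `|y| <= m + 1.
  have -> : y = x - (x - y) by rewrite opprB addrC subrK.
  by rewrite (le_trans (ler_normB _ _))// lerD// (le_trans xy).
have e1 : dotp (j (Rs x)) D - dotp (j (Rs y)) D' = dotp (j (Rs (x - y))) D + dotp (j (Rs y)) (D - D').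
  by rewrite resolventB// bopB dotpBl dotpBr; ring.
have b1 : dotp (j (Rs (x - y))) D <= de * (b + b).
  rewrite (le_trans (dotp_le_norm _ _))// ler_pM// (le_trans (resolvent_contract j _ s0))//.
have b2 : dotp (j (Rs y)) (D - D') <= (m + 1) * (de + de).
  rewrite (le_trans (dotp_le_norm _ _))// ler_pM// (le_trans (resolvent_contract j _ s0))//.
have b3 : `|D| ^+ 2 - `|D'| ^+ 2 <= (de + de) * (b + b + (b + b + 2)).
  rewrite subr_sqr; have h3 : `|D| - `|D'| <= de + de by rewrite (le_trans (lerB_dist _ _)).
  have h4 : 0 <= `|D| + `|D'| by rewrite addr_ge0.
  apply: (@le_trans _ _ ((de + de) * (`|D| + `|D'|))); first by rewrite ler_wpM2r.
  by rewrite ler_wpM2l ?addr_ge0// lerD.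
by move: e1 b1 b2 b3; lra.
Qed.

(** The interval estimates are summed over the dyadic cells cut at [p]. The index [l] from which the
    bound holds does not depend on [p]: this is what allows it to be used later at random stopping
    nodes. *)
Lemma pathwise_energy eps : 0 < eps -> \forall l \near \oo, forall p, 0 <= p <= T ->
  E p * q (h p) + \int[mu]_(r in `[0, p]) (E r * th r) <=
  `|x0| ^+ 2 + \int[mu]_(r in `[0, T]) (f r) + \int[mu]_(r in `[0, T]) resolvent_defect r +
  approx_energy l p + eps.
Proof.
move=> eps0; pose c := 12 * b + 4 * m + 8.
have c0 : 0 < c by rewrite /c; have := m0; have := b0; lra.
pose K1 := \int[mu]_(r in `[0, T]) (kap * (`|a r| + gam r + nP r ^+ 2)).
pose K2 := \int[mu]_(r in `[0, T]) (nP r ^+ 2).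
have mT := measurable_segment 0 T.
have kap0 : 0 <= kap by rewrite /kap !addr_ge0 ?mulr_ge0 ?sqr_ge0// m0.
have iK1 : itg (fun r => kap * (`|a r| + gam r + nP r ^+ 2)).
  by apply: rintZl => //; apply: rintD => //; exact: rintD.
have K10 : 0 <= K1.
  by apply: Rintegral_itv_ge0 => r _; rewrite mulr_ge0// !addr_ge0// sqr_ge0.
have K20 : 0 <= K2 by apply: Rintegral_itv_ge0 => r _; rewrite sqr_ge0.
(* Four errors receive [eps / 4] each: the oscillation ([e1]), the Young loss ([qq]), the distance
   [dl] to the elementary integrand, and the replacement of [M] and [h] by [ML] and [xi]. *)
pose e1 := eps / 4 / (K1 + 1); pose qq := eps / 4 / (K2 + 1).
have e40 : 0 < eps / 4 by rewrite divr_gt0.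
have e10 : 0 < e1 by rewrite divr_gt0// ltr_wpDl.
have qq0 : 0 < qq by rewrite divr_gt0// ltr_wpDl.
have [d1 d10 hd1] := segment_uniform huc e10.
have [d2 d20 hd2] := segment_uniform (parameterized_integral_continuous (ltW T0) rgam) e10.
have n1 : \forall l \near \oo, 2^-1 ^+ l * c < eps / 4.
  have : (2^-1 ^+ l * c : R) @[l --> \oo] --> 0 * c.
    by apply: cvgMl; apply: cvg_expr; rewrite ger0_norm ?invr_ge0// invf_lt1// ltr1n.
  rewrite mul0r => /cvgrPdist_lt/(_ _ e40); apply: filterS => l.
  by rewrite sub0r normrN; apply: le_lt_trans; exact: ler_norm.
have n2 : \forall l \near \oo, T * 2^-1 ^+ l < Num.min d1 d2.
  have : (T * 2^-1 ^+ l : R) @[l --> \oo] --> T * 0.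
    by apply: cvgMr; apply: cvg_expr; rewrite ger0_norm ?invr_ge0// invf_lt1// ltr1n.
  rewrite mulr0 => /cvgrPdist_lt/(_ (Num.min d1 d2)); rewrite lt_min d10 d20 => /(_ isT).
  by apply: filterS => l; rewrite sub0r normrN; apply: le_lt_trans; exact: ler_norm.
have n3 : \forall l \near \oo, (1 + qq^-1) * \int[mu]_(r in `[0, T]) (dl l r ^+ 2) < eps / 4.
  have : ((1 + qq^-1) * \int[mu]_(r in `[0, T]) (dl l r ^+ 2)) @[l --> \oo] --> (1 + qq^-1) * 0.
    exact: cvgMr.
  rewrite mulr0 => /cvgrPdist_lt/(_ _ e40); apply: filterS => l.
  by rewrite sub0r normrN; apply: le_lt_trans; exact: ler_norm.
near=> l => p /andP[p0 pT].
have hc : 2^-1 ^+ l * c < eps / 4 by near: l.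
have hlen : T * 2^-1 ^+ l < Num.min d1 d2 by near: l.
have hdl : (1 + qq^-1) * \int[mu]_(r in `[0, T]) (dl l r ^+ 2) < eps / 4 by near: l.
have hMl : forall t, 0 <= t <= T -> `|M t - ML l t| <= 4^-1 ^+ l by near: l.
have hxil : forall k, (k < 2 ^ l)%N -> `|h (dyadic l k) - xi l k| <= 4^-1 ^+ l by near: l.
pose tau k := Num.min (dyadic l k) p.
have p2 : 0 < 2 ^+ l :> R by rewrite exprn_gt0.
have dS k : dyadic l k.+1 = dyadic l k + T * 2^-1 ^+ l.
  by rewrite /dyadic -natr1 exprVn; field; rewrite gt_eqF.
have step0 : 0 < T * 2^-1 ^+ l by rewrite mulr_gt0// exprn_gt0.
have d0 k : 0 <= dyadic l k by rewrite /dyadic !mulr_ge0// ?ltW// invr_gt0.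
have tau0 : tau 0%N = 0 by rewrite /tau /dyadic mulr0 mul0r min_l.
have tauS k : tau k <= tau k.+1.
  by rewrite /tau le_min !ge_min dS lerDl (ltW step0) /= lexx orbT.
have taup k : tau k <= p by rewrite /tau ge_min lexx orbT.
have tau_ge k : 0 <= tau k by rewrite /tau le_min d0.
have tauN : tau (2 ^ l)%N = p.
  by rewrite /tau /dyadic natrX mulfK ?gt_eqF// min_r.
have tauT k : tau k <= T by rewrite (le_trans (taup k)).
have taud k : tau k.+1 - tau k <= T * 2^-1 ^+ l.
  rewrite /tau lerBlDr dS; have [h1|h1] := leP (dyadic l k) p.
    by rewrite ge_min addrC lexx.
  by rewrite ge_min; apply/orP; right; rewrite lerDr ltW.
pose X r := qq * nP r ^+ 2 + (1 + qq^-1) * dl l r ^+ 2.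
have iX : itg X by apply: rintD => //; exact: rintZl.
have X0 r : 0 <= X r.
  by rewrite /X addr_ge0// mulr_ge0 ?sqr_ge0 ?addr_ge0 ?invr_ge0// ltW.
(* [(x + y)^2 <= (1 + qq) x^2 + (1 + 1/qq) y^2], so the compensator exceeds [nP^2] by at most
   [X]. *)
have glX r : 0 <= r <= T -> gl l r - nP r ^+ 2 <= X r.
  move=> rT; have := gld l rT; have : 0 <= (qq * nP r - dl l r) ^+ 2 * qq^-1.
    by rewrite mulr_ge0 ?sqr_ge0// invr_ge0 ltW.
  have -> : (qq * nP r - dl l r) ^+ 2 * qq^-1 = qq * nP r ^+ 2 - 2 * (nP r * dl l r) + qq^-1 * dl l r ^+ 2.
    by field; rewrite gt_eqF.
  rewrite /X sqrrD; move: (nP r * dl l r) (nP r ^+ 2) (dl l r ^+ 2) => A B C.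
  by rewrite mulrDl mul1r; lra.
pose FF r := - (E r * th r) + (f r + resolvent_defect r + e1 * (kap * (`|a r| + gam r + nP r ^+ 2)) + X r).
have irest : itg (fun r => f r + resolvent_defect r + e1 * (kap * (`|a r| + gam r + nP r ^+ 2)) + X r).
  by apply: rintD => //; apply: rintD => //; [exact: rintD|exact: rintZl].
have iFF : itg FF by apply: rintD => //; exact: rintN.
have de01 : 0 <= (4^-1 ^+ l : R) <= 1.
  by rewrite exprn_ge0 ?invr_ge0//= exprn_ile1// ?invr_ge0// invf_le1// ler1n.
have de0 := andP de01.
have loc (k : 'I_(2 ^ l)%N) : E (tau k.+1) * q (h (tau k.+1)) - E (tau k) * q (h (tau k)) <=
  E (dyadic l k) *
  (2 * dotp (j (Rs (xi l k))) (ML l (tau k.+1) - ML l (tau k)) +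
   `|ML l (tau k.+1) - ML l (tau k)| ^+ 2 - \int[mu]_(r in `[tau k, tau k.+1]) gl l r) +
   4^-1 ^+ l * c + \int[mu]_(r in `[tau k, tau k.+1]) FF r.
  have [kp|kp] := leP (dyadic l k) p; last first.
    have t1 : tau k = p by rewrite /tau min_r// ltW.
    have t2 : tau k.+1 = p by rewrite /tau min_r// dS ltW// ltr_wpDr// ltW.
    rewrite t1 t2 !subrr normr0 expr0n/= dotp0r !Rintegral_itv_pt !(mulr0, subr0, addr0, add0r).
    by rewrite mulr_ge0 ?(ltW c0)//; case: de0.
  have t1 : tau k = dyadic l k by rewrite /tau min_l.
  have osc r : tau k <= r <= tau k.+1 -> `|h r - h (tau k.+1)| <= e1 /\ `|G (tau k.+1) - G (tau k)| <= e1.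
    move=> /andP[r1 r2]; have lt : tau k.+1 - tau k < Num.min d1 d2 by exact: le_lt_trans (taud k) hlen.
    move: lt; rewrite lt_min => /andP[l1 l2]; split; apply: ltW.
      apply: hd1; rewrite ?(le_trans (tau_ge k) r1) ?(le_trans r2) ?tau_ge ?tauT//.
      by rewrite distrC ger0_norm ?subr_ge0// (le_lt_trans _ l1)// lerB.
    apply: hd2; rewrite ?tau_ge ?tauT//.
    by rewrite ger0_norm ?subr_ge0.
  have ie := interval_energy (tau_ge k) (tauS k) (tauT k.+1) (ltW e10) osc.
  have tk r : 0 <= tau r <= T by rewrite tau_ge tauT.
  have xh : `|h (tau k) - xi l k| <= 4^-1 ^+ l by rewrite t1; exact: hxil.
  have ap := approx_increment de01 (hMb (tk k)) (hMb (tk k.+1)) (hMl _ (tk k)) (hMl _ (tk k.+1))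
    (hm (tk k)) xh.
  rewrite -/c in ap; rewrite -t1; apply: le_trans ie _.
  have mI := measurable_segment (tau k) (tau k.+1).
  have S F : itg F -> rint mu `[tau k, tau k.+1] F by move=> iF; exact: rint_itvS iF (tau_ge k) (tauT k.+1).
  have Ek := weight_gt0 (tau k); have Ek1 := weight_le1 (tau k).
  have I1 : \int[mu]_(r in `[tau k, tau k.+1]) (- (E r * th r) + f r - E (tau k) * nP r ^+ 2 +
     resolvent_defect r + e1 * (kap * (`|a r| + gam r + nP r ^+ 2))) <=
     \int[mu]_(r in `[tau k, tau k.+1]) (FF r - E (tau k) * gl l r).
    apply: le_Rintegral => //.
    - apply: S; apply: rintD => //; last exact: rintZl.
      apply: rintD => //; apply: rintB => //; last exact: rintZl.
      by apply: rintD => //; exact: rintN.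
    - by apply: S; apply: rintB => //; exact: rintZl.
    move=> r /=; rewrite in_itv/= => rk; have rT := mem (tau_ge k) (tauT k.+1) rk.
    have h1 : E (tau k) * (gl l r - nP r ^+ 2) <= X r.
      have [g0|g0] := leP 0 (gl l r - nP r ^+ 2).
        by apply: le_trans (glX _ rT); rewrite ler_piMl.
      by apply: le_trans (X0 r); rewrite mulr_ge0_le0 ?ltW.
    exact: (integrand_collect (E r * th r) (f r) (resolvent_defect r) (e1 * (kap * (`|a r| + gam r + nP r ^+ 2))) h1).
  have I2 := RintegralB mI (S _ iFF) (rintZl mI (E (tau k)) (S _ (rgl l))).
  rewrite (RintegralZl _ mI (S _ (rgl l))) in I2; rewrite I2 in I1.
  have ap2 := ler_wpM2l (ltW Ek) ap.
  have dc : E (tau k) * (4^-1 ^+ l * c) <= 4^-1 ^+ l * c.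
    by rewrite ler_piMl// mulr_ge0 ?(ltW c0)//; case: de0.
  apply: le_trans (lerD ap2 I1) _; rewrite mulrDr mulrBr.
  move: dc; move: (E (tau k) * (4^-1 ^+ l * c)) (E (tau k) * (_ + _)) (E (tau k) * _)
    (\int[mu]_(r in _) FF r) (4^-1 ^+ l * c) => A B C D Z.
  exact: loc_collect.
have sumE : \sum_(k < (2 ^ l)%N) (E (tau k.+1) * q (h (tau k.+1)) - E (tau k) * q (h (tau k))) =
    E p * q (h p) - E 0 * q x0.
  rewrite -(big_mkord predT (fun k => E (tau k.+1) * q (h (tau k.+1)) - E (tau k) * q (h (tau k)))).
  by rewrite telescope_sumr// tauN tau0 hx0.
have S1 := @ler_sum R 'I_(2 ^ l)%N (index_enum _) xpredT _ _ (fun k _ => loc k).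
rewrite sumE !big_split/= -/(approx_energy l p) in S1.
rewrite (Rintegral_itv_sum _ iFF tau0 tauS tauT) tauN sumr_const card_ord in S1.
have I3 : \int[mu]_(r in `[0, p]) FF r <= - (\int[mu]_(r in `[0, p]) (E r * th r)) +
    (\int[mu]_(r in `[0, T]) f r + \int[mu]_(r in `[0, T]) resolvent_defect r + e1 * K1 +
     (qq * K2 + (1 + qq^-1) * \int[mu]_(r in `[0, T]) dl l r ^+ 2)).
  have S F : itg F -> rint mu `[0, p] F by move=> iF; exact: rint_itvS iF (lexx 0) pT.
  have mp := measurable_segment 0 p.
  rewrite (RintegralD mp (rintN mp (S _ rEth)) (S _ irest)).
  apply: lerD.
    have -> : \int[mu]_(x in `[0, p]) - (E x * th x) = \int[mu]_(x in `[0, p]) (-1 * (E x * th x)).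
      by apply: eq_Rintegral => x _; rewrite mulN1r.
    by rewrite (RintegralZl _ mp (S _ rEth)) mulN1r.
  apply: (le_trans (Rintegral_itv_mono irest p0 pT _)).
    move=> r _; have df0 : 0 <= resolvent_defect r.
      by rewrite /resolvent_defect addr_ge0 ?mulr_ge0// subr_ge0 resolvent_form_le.
    have k0 : 0 <= e1 * (kap * (`|a r| + gam r + nP r ^+ 2)).
      apply: mulr_ge0; first exact: ltW.
      by apply: mulr_ge0 => //; rewrite addr_ge0 ?sqr_ge0// addr_ge0.
    apply: addr_ge0 => //; apply: addr_ge0 => //; exact: addr_ge0.
  have i1 : itg (fun r => f r + resolvent_defect r) by exact: rintD.
  have i2 : itg (fun r => e1 * (kap * (`|a r| + gam r + nP r ^+ 2))) by exact: rintZl.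
  have i3 := rintD mT i1 i2.
  rewrite (RintegralD mT i3 iX) (RintegralD mT i1 i2) (RintegralD mT rf rdef) (RintegralZl _ mT iK1).
  rewrite (RintegralD mT (rintZl mT _ rP) (rintZl mT _ (rdl l))).
  by rewrite (RintegralZl _ mT rP) (RintegralZl _ mT (rdl l)).
have q0 : E 0 * q x0 <= `|x0| ^+ 2.
  by apply: le_trans (resolvent_form_le j x0 s0); rewrite ler_piMl ?weight_le1// resolvent_form_ge0.
have h1 : e1 * K1 <= eps / 4.
  by rewrite /e1 mulrAC ler_pdivrMr ?ltr_wpDl// ler_wpM2l ?(ltW e40)// lerDl.
have h2 : qq * K2 <= eps / 4.
  by rewrite /qq mulrAC ler_pdivrMr ?ltr_wpDl// ler_wpM2l ?(ltW e40)// lerDl.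
(* There are [2 ^ l] cells, each with an error of order [4 ^ - l]; this is why approximations are
   required at the rate [4 ^ - l]. *)
have h3 : (4^-1 ^+ l * c) *+ 2 ^ l <= eps / 4.
  have h4 : 2 * 4^-1 = 2^-1 :> R by field.
  by rewrite -mulr_natl natrX mulrA -exprMn h4 ltW.
exact: (energy_collect S1 I3 q0 h1 h2 h3 (ltW hdl)).
Unshelve. all: end_near.
Qed.

End pathwise_energy.

(** * Adapted versions *)

Section versions.
Context (R : realType) (d : measure_display) (T : measurableType d).

Lemma simple_strongly_mfun (X : normedModType R) (s : T -> X) : finite_set (range s) ->
  (forall x, measurable (s @^-1` [set x])) -> strongly_mfun measurable setT s.
Proof. by move=> fs ms; exists (fun=> s); split=> // t _; exact: cvg_cst. Qed.

(** The set where a sequence of simple functions is Cauchy is measurable, so the limit may be set to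
    [0] outside of it. The resulting function is the limit wherever one exists. *)
Lemma simple_limit (X : completeNormedModType R) (s : nat -> T -> X) :
  (forall n, finite_set (range (s n)) /\ forall x, measurable (s n @^-1` [set x])) ->
  exists2 g : T -> X, strongly_mfun measurable setT g &
    forall w l, s n w @[n --> \oo] --> l -> g w = l.
Proof.
move=> sP.
pose A i n m := [set w | `|s n w - s m w| < i.+1%:R^-1].
pose G := \bigcap_i \bigcup_N \bigcap_(n in [set n | (N <= n)%N]) A i N n.
have mA i n m : measurable (A i n m).
  have [fn mn] := sP n; have [fm mm] := sP m.
  have mB := strongly_mfun_norm measurableT
    (strongly_mfunB (simple_strongly_mfun fn mn) (simple_strongly_mfun fm mm)).
  rewrite (_ : A i n m = setT `&` (fun w => `|s n w - s m w|) @^-1` `]-oo, (i.+1%:R^-1 : R)[%classic).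
    by apply: mB => //; exact: measurable_itv.
  by rewrite setTI; apply/seteqP; split => w /=; rewrite in_itv.
have mG : measurable G.
  apply: bigcapT_measurable => i; apply: bigcupT_measurable => N.
  by apply: bigcap_measurable => [|n _]; [exists N => /=|exact: mA].
have Gcvg w : G w <-> cvg (s n w @[n --> \oo]).
  split=> [Gw|].
    apply/cauchy_cvgP/cauchy_exP => e e0.
    have [i ie] : exists i : nat, i.+1%:R^-1 < e.
      have := @near_infty_natSinv_lt R (PosNum e0); case=> i _ /(_ i (leqnn i)) h; by exists i.
    have [N _ hN] := Gw i I; exists (s N w); exists N => // n Nn.
    by rewrite -ball_normE /=; apply: lt_trans ie; exact: hN.
  move=> /cvg_ex[l /cvgn_distP sl] i _.
  have [|N hN] := sl (i.+1%:R^-1 / 2); first by rewrite divr_gt0.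
  exists N => // n Nn; rewrite /A /=.
  have -> : s N w - s n w = (s N w - l) - (s n w - l) by rewrite opprB addrA subrK.
  by rewrite (le_lt_trans (ler_normB _ _))// [_^-1]splitr ltrD// hN.
have sG : strongly_mfun measurable G (fun w => lim (s n w @[n --> \oo])).
  by exists s; split=> // w /Gcvg.
exists (fun w => if w \in G then lim (s n w @[n --> \oo]) else 0).
  exact: strongly_mfun_patch mG sG _.
move=> w l sl; have Gw : G w by apply/Gcvg; apply/cvg_ex; exists l.
by rewrite mem_set//; apply: cvg_lim.
Qed.

Section argmin.
Context (D : nat -> T -> \bar R).
Hypothesis mD : forall p, measurable_fun setT (D p).

Fixpoint argmin n w : nat :=
  if n is n'.+1 then (if (D n w < D (argmin n' w) w)%E then n else argmin n' w) else 0%N.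

Lemma argmin_le n w q : (q <= n)%N -> (D (argmin n w) w <= D q w)%E.
Proof.
elim: n => [|n IH]; first by rewrite leqn0 => /eqP ->.
rewrite leq_eqVlt => /orP[/eqP ->|]; rewrite /=.
  by case: ltP.
by rewrite ltnS => qn; case: ltP => [h|_]; [apply: (le_trans (ltW h)); exact: IH|exact: IH].
Qed.

Lemma argmin_bound n w : (argmin n w <= n)%N.
Proof. by elim: n => //= n IH; case: ifP => // _; exact: leqW. Qed.

Lemma argmin_measurable n p : measurable [set w | argmin n w = p].
Proof.
elim: n p => [|n IH] p /=.
  have [<-|np] := pselect (0%N = p); first by rewrite (_ : [set _ | _] = setT)//; apply/seteqP; split.
  by rewrite (_ : [set _ | _] = set0)//; apply/seteqP; split.
pose L := [set w | (D n.+1 w < D (argmin n w) w)%E].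
have mL : measurable L.
  rewrite (_ : L = \bigcup_q ([set w | argmin n w = q] `&` [set w | (D n.+1 w < D q w)%E])).
    apply: bigcupT_measurable => q; apply: measurableI => //.
    by rewrite -[[set w | _]]setTI; exact: measurable_lte.
  apply/seteqP; split => w /=; first by move=> h; exists (argmin n w).
  by move=> [q _ /= [<-]].
have mE : measurable [set w : T | n.+1 = p].
  have [->|np] := pselect (n.+1 = p); first by rewrite (_ : [set _ | _] = setT)//; apply/seteqP; split.
  by rewrite (_ : [set _ | _] = set0)//; apply/seteqP; split.
rewrite (_ : [set _ | _] = (L `&` [set w | n.+1 = p]) `|` (~` L `&` [set w | argmin n w = p])).
  by apply: measurableU; apply: measurableI => //; exact: measurableC.
apply/seteqP; split => w /=.
  by case: ifPn => h <-; [left|right; split=> //; exact/negP].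
by case=> [[h <-]|[/negP/negbTE h <-]]; [rewrite h|rewrite [X in if X then _ else _]h].
Qed.

Lemma argmin_simple (X : normedModType R) (x : nat -> X) n :
  finite_set (range (fun w => x (argmin n w))) /\
  forall y, measurable ((fun w => x (argmin n w)) @^-1` [set y]).
Proof.
split.
  apply: (@sub_finite_set _ _ (x @` `I_n.+1)); last exact/finite_image/finite_II.
  by move=> _ [w _ <-]; exists (argmin n w) => //=; rewrite ltnS argmin_bound.
move=> y; rewrite (_ : _ @^-1` _ = \bigcup_(p in [set p | x p = y]) [set w | argmin n w = p]).
  by apply: bigcup_measurable => p _; exact: argmin_measurable.
by apply/seteqP; split => w /=; [move=> h; exists (argmin n w)|move=> [p /= + ->]].
Qed.

End argmin.
End versions.

Section adapted_version.
Context (R : realType) (V H : hilbertType R) (j : bop V H).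
Context d (Omega : measurableType d) (P : probability Omega R) (Fil : R -> set (set Omega)).
Hypothesis hF : filtration Fil.
Local Notation mu := (@lebesgue_measure R).

Lemma strongly_mfun_dense (dS : measure_display) (S : measurableType dS) (X : normedModType R) D (f : S -> X) :
  strongly_mfun measurable D f ->
  exists x : nat -> X, forall z, D z -> forall e : R, 0 < e -> exists p, `|f z - x p| < e.
Proof.
move=> [s [sP sf]].
have /choice[L hL] : forall i, exists l : seq X, range (s i) = [set` l].
  by move=> i; have [/finite_seqP] := sP i.
exists (fun p => if unpickle p is Some (i, k) then nth 0 (L i) k else 0) => z Dz e e0.
have /cvgn_distP/(_ e e0)[N hN] := sf z Dz.
have zL : s N z \in L N by have : [set` L N] (s N z) by rewrite -hL; exists z.
exists (pickle (N, index (s N z) (L N))); rewrite pickleK nth_index// distrC; exact: hN.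
Qed.

(** On the window [h] stays within [o] of [h t] and agrees with [j v] almost everywhere, so the mean
    distances of [j v] to [x] and to [y] are those of [h t] up to [o]. *)
Lemma window_distance (v : R -> V) (h : R -> H) (t len o : R) (x y : H) : 0 < len -> 0 < o ->
  measurable_fun `[t - len, t] (fun r => `|j (v r) - x|) ->
  measurable_fun `[t - len, t] (fun r => `|j (v r) - y|) ->
  (forall r, t - len <= r <= t -> `|h r - h t| <= o) ->
  (\forall r \ae mu, `[t - len, t]%classic r -> j (v r) = h r) ->
  (\int[mu]_(r in `[(t - len)%R, t]) (`|j (v r) - x|)%:E <=
   \int[mu]_(r in `[(t - len)%R, t]) (`|j (v r) - y|)%:E)%E ->
  `|h t - x| <= `|h t - y| + 2 * o.
Proof.
move=> len0 o0 mx my osc vh int_le.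
have mI := measurable_segment (t - len) t.
have mu_len : mu `[t - len, t] = len%:E.
  by rewrite lebesgue_measure_itv/= lte_fin ltrBlDr ltrDl len0 -EFinB opprB addrCA subrr addr0.
have h1 : (\int[mu]_(r in `[(t - len)%R, t]) (`|j (v r) - y|)%:E <= ((`|h t - y| + o) * len)%:E)%E.
  rewrite EFinM -mu_len -integral_cst//; apply: ae_ge0_le_integral => //.
  - exact/measurable_EFinP.
  - by move=> r _; rewrite /= lee_fin addr_ge0// ltW.
  - apply: (@filterS _ _ (ae_filter_ringOfSetsType mu) _ _ _ vh) => r hr rI.
    rewrite hr// lee_fin (_ : h r - y = (h t - y) + (h r - h t)); last by rewrite [RHS]addrC addrA subrK.
    by rewrite (le_trans (ler_normD _ _))// lerD2l osc//; move: rI; rewrite /= in_itv.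
have h2 : ((`|h t - x| * len)%:E <= \int[mu]_(r in `[(t - len)%R, t]) (`|j (v r) - x|)%:E + (o * len)%:E)%E.
  rewrite (EFinM o) -[X in (_ <= _ + _ * X)%E]mu_len -integral_cst// -ge0_integralD//; last 2 first.
  - exact/measurable_EFinP.
  - by move=> r _; rewrite /= lee_fin ltW.
  rewrite EFinM -mu_len -integral_cst//; apply: ae_ge0_le_integral => //.
  - by move=> r _; rewrite /= lee_fin.
  - by move=> r _; rewrite /= -EFinD lee_fin addr_ge0// ltW.
  - by apply: emeasurable_funD => //; exact/measurable_EFinP.
  - apply: (@filterS _ _ (ae_filter_ringOfSetsType mu) _ _ _ vh) => r hr rI.
    rewrite hr// -EFinD lee_fin (_ : h t - x = (h r - x) + (h t - h r)); last by rewrite [RHS]addrC addrA subrK.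
    by rewrite (le_trans (ler_normD _ _))// lerD2l distrC osc//; move: rI; rewrite /= in_itv.
have := le_trans h2 (leeD2r (o * len)%:E (le_trans int_le h1)).
rewrite -EFinD lee_fin -mulrDl ler_pM2r//; lra.
Qed.

(** [h t] itself carries no measurability; it is seen only through [j v], for almost every time. The
    averages of [|j v - x p|] over the windows [[t - t/(n+1), t]] are measurable at time [t] by
    Tonelli. The best of the first [n + 1] points of a sequence dense in the values of [j v]
    converges to [h t]. *)
Lemma adapted_version (v : R -> Omega -> V) (h : R -> Omega -> H) (t : R) : 0 < t ->
  adapted_strong Fil v ->
  (\forall w \ae P, {within `[0, t], continuous (h ^~ w)} /\
     \forall r \ae mu, `[0, t]%classic r -> j (v r w) = h r w) ->
  exists2 g : Omega -> H, strongly_mfun (@measurable _ (subalg (Fil t))) setT g &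
    \forall w \ae P, g w = h t w.
Proof.
move=> t0 av hv.
have ajv := adapted_strong_comp av (@bop_continuous _ _ _ j).
have [x hx] := strongly_mfun_dense (ajv t (ltW t0)).
pose len n : R := t / n.+1%:R.
have len0 n : 0 < len n by rewrite divr_gt0.
have lent n : len n <= t by rewrite /len ler_pdivrMr// ler_peMr ?ler1n// ltW.
have an p : adapted_real Fil (fun r w => `|j (v r w) - x p|).
  apply: adapted_strong_norm; apply: (adapted_strong_comp (F := fun y => y - x p) ajv) => y.
  by apply: cvgB; [exact: cvg_id|exact: cvg_cst].
have sub n : `[t - len n, t] `<=` `[0, t].
  move=> r /=; rewrite !in_itv/= => /andP[h1 ->]; rewrite andbT (le_trans _ h1)//.
  by rewrite subr_ge0.
pose D n p w := (\int[mu]_(r in `[(t - len n)%R, t]) (`|j (v r w) - x p|)%:E)%E.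
have mD n p : measurable_fun (T := subalg (Fil t)) setT (D n p).
  apply: (adapted_integral (f := fun r w => `|j (v r w) - x p|)) => //; exact: ltW.
have [g sg gl] := simple_limit (fun n => argmin_simple (mD n) x n).
exists g => //; move: hv; apply: filterS => w [ch vh]; apply: gl.
apply/cvgn_distP => e e0.
pose o := e / 8; have o0 : 0 < o by rewrite divr_gt0.
have [del del0 hdel] := segment_uniform ch o0.
have win r n : len n < del -> t - len n <= r <= t -> `|h r w - h t w| <= o.
  move=> ld /andP[r1 r2]; apply/ltW/hdel.
  - by rewrite r2 andbT (le_trans _ r1)// subr_ge0.
  - by rewrite lexx ltW.
  - by rewrite distrC ger0_norm ?subr_ge0// (le_lt_trans _ ld)//; lra.
have [n0 hn0] : exists n0, forall n, (n0 <= n)%N -> len n < del.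
  have dt : 0 < del / t by rewrite divr_gt0.
  have [n0 _ h0] := @near_infty_natSinv_lt R (PosNum dt); exists n0 => n /h0 /= hn.
  by rewrite /len mulrC -ltr_pdivlMr.
have [q hq] : exists q, `|h t w - x q| <= 2 * o.
  have ld := hn0 n0 (leqnn _).
  (* A window has positive length, so it cannot consist of exceptional times. *)
  have [r [rI rvh]] : exists r, `[t - len n0, t]%classic r /\ j (v r w) = h r w.
    apply: contrapT => /forallNP nr.
    have : mu.-negligible `[t - len n0, t].
      apply: negligibleS vh => r rI /=; apply/not_implyP; split; first exact: sub rI.
      by move=> e1; apply: (nr r).
    move=> /negligibleP -/(_ (measurable_segment _ _)).
    rewrite /= lebesgue_measure_itv/= lte_fin ltrBlDr ltrDl len0 -EFinB opprB addrCA subrr addr0.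
    by move=> /eqP; rewrite eqe gt_eqF.
  have rt : (`[0, t] `*` setT) (r, w) by split=> //; exact: sub rI.
  have [q hq] := hx _ rt _ o0; exists q; rewrite /= rvh in hq.
  rewrite (_ : h t w - x q = (h t w - h r w) + (h r w - x q)); last by rewrite addrA subrK.
  rewrite (le_trans (ler_normD _ _))// mulr_natl mulr2n lerD ?(ltW hq)// distrC.
  by apply: win ld _; move: rI; rewrite /= in_itv.
(* From index [q] on, [x q] takes part in the minimisation. *)
exists (maxn n0 q) => n; rewrite geq_max => /andP[n1 n2].
have mp p : measurable_fun `[t - len n, t] (fun r => `|j (v r w) - x p|).
  have sv := strongly_mfunS (D := [set r | (`[0, t] `*` setT) (r, w)])
    (E := `[(t - len n)%R, t]) _ (strongly_mfun_section1 (ajv t (ltW t0)) w).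
  apply: strongly_mfun_norm; first exact: measurable_segment.
  apply: strongly_mfunB; last exact: strongly_mfun_cst.
  by apply: sv => r rI; split => //; exact: sub rI.
have := window_distance (h := h ^~ w) (len0 n) o0 (mp (argmin (D n) n w)) (mp q)
  (fun r => win r n (hn0 n n1)) _
  (argmin_le (D n) w n2).
rewrite distrC => key; apply: le_lt_trans (key _) _.
  apply: (@filterS _ _ (ae_filter_ringOfSetsType mu) _ _ _ vh) => r hr rI; exact: hr (sub _ _ rI).
apply: le_lt_trans (lerD hq (lexx _)) _; rewrite /o; lra.
Qed.

End adapted_version.

(** * Outer probability and Fatou bounds *)

Section outer_probability.
Context (R : realType) d (Omega : measurableType d) (P : probability Omega R).

Lemma mu_ext_le_ae (B A : set Omega) : measurable A -> (\forall w \ae P, B w -> A w) ->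
  (mu_ext P B <= P A)%E.
Proof.
move=> mA [N [mN PN hN]].
have BAN : B `<=` A `|` N.
  by move=> w Bw; have [Aw|nAw] := pselect (A w); [left|right; apply: hN => /(_ Bw)].
apply: (le_trans (le_mu_ext P BAN)); rewrite measurable_mu_extE; last exact: measurableU.
by apply: (le_trans (measureU2 P mA mN)); rewrite [X in (_ + X <= _)%E]PN adde0.
Qed.

Lemma mu_ext_markov (B : set Omega) (g : Omega -> \bar R) (lam : R) : 0 <= lam ->
  measurable_fun setT g -> (forall w, (0 <= g w)%E) ->
  (\forall w \ae P, B w -> (lam%:E <= g w)%E) ->
  (lam%:E * mu_ext P B <= \int[P]_w g w)%E.
Proof.
move=> lam0 mg g0 Bg; pose A := [set w | (lam%:E <= g w)%E].
have mA : measurable A.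
  rewrite (_ : A = setT `&` g @^-1` `[lam%:E, +oo[%classic).
    by apply: mg => //; exact: emeasurable_itv.
  by rewrite setTI; apply/seteqP; split => w /=; rewrite in_itv/= andbT.
apply: (@le_trans _ _ (lam%:E * P A)%E).
  by rewrite lee_wpmul2l ?lee_fin//; exact: mu_ext_le_ae.
rewrite -integral_cst//; apply: (@le_trans _ _ (\int[P]_(w in A) g w)%E).
  by apply: ge0_le_integral => //; exact: measurable_funTS.
exact: ge0_subset_integral.
Qed.

End outer_probability.

Section fatou_limits.
Context (R : realType) d (T : measurableType d) (mu : {measure set T -> \bar R}).
Local Open Scope ereal_scope.

Lemma limn_einfE (u : (\bar R)^nat) : limn_einf u = ereal_sup (range (einfs u)).
Proof.
by rewrite limn_einf_lim; apply/cvg_lim => //; exact/ereal_nondecreasing_cvgn/nondecreasing_einfs.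
Qed.

Lemma limn_einf_ge (u : (\bar R)^nat) y : (\forall n \near \oo, y <= u n) -> y <= limn_einf u.
Proof.
move=> [N _ hN]; rewrite limn_einfE; apply: (@le_trans _ _ (einfs u N)).
  by apply: le_ereal_inf_tmp => _ [n /= Nn <-]; exact: hN.
by apply: ereal_sup_ubound; exists N.
Qed.

Lemma limn_einf_le (u : (\bar R)^nat) y : (\forall n \near \oo, u n <= y) -> limn_einf u <= y.
Proof.
move=> [N _ hN]; rewrite limn_einfE; apply: ge_ereal_sup => _ [n _ <-].
apply: (@le_trans _ _ (u (maxn n N))); last by apply: hN; exact: leq_maxr.
by apply: ereal_inf_lbound; exists (maxn n N) => //=; exact: leq_maxl.
Qed.

(** Fatou's lemma in a form that can be iterated: the limit function is remembered only through its
    integral bound and the lower bounds that it inherits. *)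
Lemma fatou_bound (f : nat -> T -> \bar R) (c : nat -> R) (c0 : R) :
  (forall n, measurable_fun setT (f n)) -> (forall n x, 0 <= f n x) ->
  (forall n, \int[mu]_x f n x <= (c n)%:E) -> c n @[n --> \oo] --> c0 ->
  exists g : T -> \bar R, [/\ measurable_fun setT g, forall x, 0 <= g x,
    \int[mu]_x g x <= c0%:E & forall x y, (\forall n \near \oo, y <= f n x) -> y <= g x].
Proof.
move=> mf f0 fc cc; exists (fun x => limn_einf (f ^~ x)); split.
- apply: measurableT_comp => //.
  by apply: measurable_fun_limn_esup => n; exact: measurableT_comp.
- by move=> x; apply: limn_einf_ge; exact: nearW.
- apply: (le_trans (fatou _ measurableT mf (fun n x _ => f0 n x))).
  apply/lee_addgt0Pr => e e0; apply: limn_einf_le.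
  move/cvgrPdist_lt : cc => /(_ e e0); apply: filterS => n h.
  apply: (le_trans (fc n)); rewrite -EFinD lee_fin -lerBlDl.
  by rewrite (le_trans (ler_norm _))// distrC ltW.
- by move=> x y; exact: limn_einf_ge.
Qed.

End fatou_limits.

Section triple_fatou.
Context (R : realType) d (Omega : measurableType d) (P : probability Omega R).

(** Fatou in [l], then [i], then [n]. In the first two limits the cut-off gives the lower bound
    [- K n]. It is not uniform in [n], but after these limits the pathwise bound [- D] is available
    and replaces it. Markov's inequality is applied to the last limit. *)
Lemma triple_fatou (Y : nat -> nat -> nat -> Omega -> R) (K del : nat -> R) (D : Omega -> R)
    (B : set Omega) (lam : R) :
  (forall n, 0 <= K n) -> (forall n i l, rint P setT (Y n i l)) -> (forall n i l w, - K n <= Y n i l w) ->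
  (forall n i l, \int[P]_w Y n i l w <= del n) -> del n @[n --> \oo] --> 0 ->
  rint P setT D -> (forall w, 0 <= D w) -> 0 < lam ->
  (\forall w \ae P, forall n (e : R), 0 < e -> \forall i \near \oo, \forall l \near \oo,
     - D w - e <= Y n i l w) ->
  (\forall w \ae P, B w -> \forall n \near \oo, forall e : R, 0 < e ->
     \forall i \near \oo, \forall l \near \oo, lam - e <= Y n i l w) ->
  (lam%:E * mu_ext P B <= (\int[P]_w D w)%:E)%E.
Proof.
move=> K0 iY YK Yd del0 iD D0 lam0 h1 h2.
have mT : measurable [set: Omega] := measurableT.
have Pfin : (P setT < +oo)%E by rewrite -ge0_fin_numE// fin_num_measure.
have icst k : rint P setT (fun=> k) by exact: (rint_cst mT).
have int_cst (k : R) : \int[P]_(w in setT) k = k.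
  by rewrite /Rintegral integral_cst// [X in fine (_ * X)]probability_setT mule1.
pose f n i l w := (Y n i l w + K n)%:E.
have mf n i l : measurable_fun setT (f n i l).
  by apply/measurable_EFinP; apply: measurable_funD => //; exact: rint_meas (iY n i l).
have f0 n i l w : (0 <= f n i l w)%E by rewrite lee_fin -lerBlDr sub0r.
have fI n i l : (\int[P]_w f n i l w <= (del n + K n)%:E)%E.
  have i1 := rintD mT (iY n i l) (icst (K n)).
  rewrite -(rint_EFin mT i1) lee_fin (RintegralD mT (iY n i l) (icst _)) int_cst lerD2r.
  exact: Yd.
have cc n : (fun _ : nat => del n + K n) i @[i --> \oo] --> del n + K n by exact: cvg_cst.
have /choice[g gP] : forall ni : nat * nat, exists g : Omega -> \bar R, [/\ measurable_fun setT g,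
    forall w, (0 <= g w)%E, (\int[P]_w g w <= (del ni.1 + K ni.1)%:E)%E &
    forall w y, (\forall l \near \oo, (y <= f ni.1 ni.2 l w)%E) -> (y <= g w)%E].
  by move=> [n i]; exact: (fatou_bound (mf n i) (f0 n i) (fI n i) (cc n)).
have /choice[g' g'P] : forall n : nat, exists g' : Omega -> \bar R, [/\ measurable_fun setT g',
    forall w, (0 <= g' w)%E, (\int[P]_w g' w <= (del n + K n)%:E)%E &
    forall w y, (\forall i \near \oo, (y <= g (n, i) w)%E) -> (y <= g' w)%E].
  move=> n; apply: (fatou_bound (f := fun i => g (n, i)) _ _ _ (cc n)) => i.
  - by have [] := gP (n, i).
  - by have [] := gP (n, i).
  - by have [] := gP (n, i).
(* The shift by [K n] is undone and [D] is added. The maximum is almost surely redundant; it makes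
   [G] nonnegative everywhere. *)
pose G n w := maxe (g' n w + (D w - K n)%:E)%E 0%E.
have mG n : measurable_fun setT (G n).
  apply: measurable_maxe => //; apply: emeasurable_funD; first by have [] := g'P n.
  by apply/measurable_EFinP; apply: measurable_funB => //; exact: rint_meas iD.
have G0 n w : (0 <= G n w)%E by rewrite /G le_max lexx orbT.
have low n (y : R) w : (forall e : R, 0 < e -> \forall i \near \oo, \forall l \near \oo,
    y - e <= Y n i l w) -> ((y + K n)%:E <= g' n w)%E.
  move=> h; apply/lee_subgt0Pr => e e0; have [_ _ _] := g'P n; apply.
  move: (h e e0); apply: filterS => i hi; have [_ _ _] := gP (n, i); apply.
  by move: hi; apply: filterS => l hl /=; rewrite /f lee_fin; lra.
have GI n : (\int[P]_w G n w <= (del n + \int[P]_w D w)%:E)%E.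
  rewrite -(@leeD2rE _ (K n)%:E)//.
  have [mg' g'0 g'I _] := g'P n.
  have KE : (K n)%:E = (\int[P]_w (K n)%:E)%E.
    by rewrite integral_cst// [X in (_ * X)%E]probability_setT mule1.
  rewrite [X in (_ + X <= _)%E]KE -ge0_integralD//; last by move=> w _; rewrite lee_fin.
  rewrite (_ : (\int[P]_w (G n w + (K n)%:E) = \int[P]_w (g' n w + (D w)%:E))%E); last first.
    apply: ae_eq_integral => //.
    - by apply: emeasurable_funD.
    - by apply: emeasurable_funD => //; apply/measurable_EFinP; exact: rint_meas iD.
    move: h1; apply: filterS => w h1 _.
    have h3 := low n _ w (h1 n).
    rewrite /G max_l; first by rewrite -addeA -EFinD subrK.
    have := leeD2r (D w - K n)%:E h3; rewrite -EFinD; apply: le_trans.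
    by rewrite lee_fin; lra.
  rewrite ge0_integralD//; last 2 first.
  - by move=> w _; rewrite lee_fin.
  - by apply/measurable_EFinP; exact: rint_meas iD.
  rewrite -(rint_EFin mT iD); apply: (le_trans (leeD2r _ g'I)).
  by rewrite -!EFinD lee_fin addrAC.
have [g2 [mg2 g20 g2I g2P]] : exists g : Omega -> \bar R, [/\ measurable_fun setT g,
    forall w, (0 <= g w)%E, (\int[P]_w g w <= (\int[P]_w D w)%:E)%E &
    forall w y, (\forall n \near \oo, (y <= G n w)%E) -> (y <= g w)%E].
  apply: (fatou_bound mG G0 GI); rewrite -[X in _ --> X]add0r.
  by apply: cvgD => //; exact: cvg_cst.
apply: (le_trans _ g2I); apply: mu_ext_markov => //; first exact: ltW.
move: h2; apply: filterS => w h2 Bw; apply: g2P; move: (h2 Bw); apply: filterS => n h.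
have h3 := low n _ w h; rewrite /G le_max; apply/orP; left.
have := leeD2r (D w - K n)%:E h3; rewrite -EFinD; apply: le_trans.
by rewrite lee_fin; have := D0 w; lra.
Qed.

End triple_fatou.

(** * Grids *)

Lemma grid_exists (R : realType) (T : R) (s : seq R) : 0 \in s -> T \in s ->
  (forall y, y \in s -> 0 <= y <= T) ->
  exists (p : nat -> R) (n : nat), [/\ p 0%N = 0, p n = T, forall a, p a <= p a.+1,
    forall a, 0 <= p a <= T & forall y, y \in s -> forall a, y <= p a \/ p a.+1 <= y].
Proof.
(* The default [T] of [nth] continues the sorted list by the constant [T], so the cells beyond its
   end are degenerate. *)
move=> s0 sT sb; pose t := sort <=%R s; exists (nth T t), (size t).
have mem y : (y \in t) = (y \in s) by rewrite mem_sort.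
have T0 : 0 <= T by have /andP[] := sb T sT.
have st : sorted <=%R t by apply: sort_sorted; exact: le_total.
have mono i k : (i <= k)%N -> (k < size t)%N -> nth T t i <= nth T t k.
  move=> ik kt; apply: (sorted_leq_nth le_trans le_refl T st) => //.
  by rewrite inE (leq_ltn_trans ik).
have bd a : 0 <= nth T t a <= T.
  have [ta|ta] := ltnP a (size t); last by rewrite nth_default// T0 lexx.
  by apply: sb; rewrite -mem; exact: mem_nth.
split.
- have t0 : 0 \in t by rewrite mem.
  have := mono 0%N (index 0 t) (leq0n _); rewrite index_mem t0 nth_index// => /(_ isT) h.
  by apply/le_anti; rewrite h; have /andP[-> _] := bd 0%N.
- by rewrite nth_default.
- move=> a; have [ta|ta] := ltnP a.+1 (size t); first exact: mono.
  by rewrite [leRHS]nth_default//; have /andP[] := bd a.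
- exact: bd.
- move=> y ys a; have yt : y \in t by rewrite mem.
  have it : (index y t < size t)%N by rewrite index_mem.
  rewrite -(nth_index T yt); have [h|h] := leqP (index y t) a.
    have [ta|ta] := ltnP a (size t); first by left; exact: mono.
    left; rewrite [leRHS]nth_default// nth_index//.
    by have /andP[] := sb y ys.
  by right; exact: mono.
Qed.

Lemma grid_node (R : realType) (T : R) (p : nat -> R) (n : nat) (y : R) :
  p 0%N = 0 -> p n = T -> 0 <= y <= T -> (forall a, y <= p a \/ p a.+1 <= y) ->
  exists2 b, (b <= n)%N & p b = y.
Proof.
move=> p0 pT /andP[y0 yT] ys.
have ex : exists b, y <= p b by exists n; rewrite pT.
case: (ex_minnP ex) => b yb bmin; exists b; first by apply: bmin; rewrite pT.
case: b yb bmin => [|b] yb bmin; first by apply/le_anti; rewrite yb p0 y0.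
apply/le_anti; rewrite yb andbT; have [h|//] := ys b.
by have := bmin b h; rewrite ltnn.
Qed.

Lemma grid_cell (R : realType) (T : R) (l : nat) (p : nat -> R) (a : nat) : 0 <= T ->
  (forall a, 0 <= p a <= T) -> p a <= p a.+1 ->
  (forall k, (k <= 2 ^ l)%N -> dyadic T l k <= p a \/ p a.+1 <= dyadic T l k) ->
  exists2 k, (k < 2 ^ l)%N & dyadic T l k <= p a /\ p a.+1 <= dyadic T l k.+1.
Proof.
move=> T0 pb pS ps.
have d0 : dyadic T l 0 = 0 by rewrite /dyadic mulr0 mul0r.
have dT : dyadic T l (2 ^ l) = T by rewrite /dyadic natrX mulfK// gt_eqF// exprn_gt0.
have : forall m, (m <= 2 ^ l)%N -> (exists2 k, (k < 2 ^ l)%N &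
    dyadic T l k <= p a /\ p a.+1 <= dyadic T l k.+1) \/ dyadic T l m <= p a.
  elim=> [_|m IH m2]; first by right; rewrite d0; have /andP[] := pb a.
  have [|h|h] := IH; [exact: ltnW|by left|].
  by have [h2|h2] := ps m.+1 m2; [right|left; exists m].
move=> /(_ (2 ^ l)%N (leqnn _))[//|]; rewrite dT => Tp.
have N0 : (0 < 2 ^ l)%N by rewrite expn_gt0.
(* A degenerate cell at [T] is assigned to the last dyadic interval. *)
exists (2 ^ l).-1; first by rewrite prednK.
rewrite prednK// dT; split; last by have /andP[] := pb a.+1.
apply: le_trans Tp; rewrite -[leRHS]dT /dyadic ler_pM2r ?invr_gt0 ?exprn_gt0//.
by rewrite ler_wpM2l// ler_nat leq_pred.
Qed.

Section grid_identities.
Context (R : realType) (U H : hilbertType R) d (Omega : measurableType d).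
Context (W : R -> U -> Omega -> R) (N : nat) (S : nat -> step Omega U H) (w : Omega).
Local Notation mu := (@lebesgue_measure R).

(** If no endpoint of a step lies inside the cell, the step is on or off throughout. The test
    [step_lo <= t] makes the coefficient known at time [t]: otherwise it is zero. *)
Definition active_coef (t t' : R) (i : nat) (w : Omega) : R :=
  ((step_lo (S i) <= t) && (t' <= step_hi (S i)))%:R * \1_(step_ev (S i)) w.

Definition step_gram (r : R) (w : Omega) : R :=
  gram_form N (fun i => \1_(`]step_lo (S i), step_hi (S i)]) r * \1_(step_ev (S i)) w)
    (fun i => step_dir (S i)) (fun i => step_val (S i)).

Section cell.
Context (t t' : R) (tt' : t <= t').
Hypothesis lohi : forall i, step_lo (S i) <= step_hi (S i).
Hypothesis sep : forall i, (i < N)%N -> (step_lo (S i) <= t \/ t' <= step_lo (S i)) /\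
  (step_hi (S i) <= t \/ t' <= step_hi (S i)).

Lemma step_integral_inc : step_integral W N S t' w - step_integral W N S t w =
  step_inc W t t' N (active_coef t t') (fun i => step_dir (S i)) (fun i => step_val (S i)) w.
Proof.
rewrite /step_integral -sumrB; apply: eq_bigr => i _; rewrite -scalerBl -mulrBr; congr (_ *: _).
rewrite /active_coef /dW mulrAC mulrC; congr (_ * _).
have [[lt|lt] ht] := sep (ltn_ord i); rewrite ?lt/=.
- rewrite ![Num.min (step_lo _) _]min_l ?(le_trans lt)//.
  case: ht => [ht|ht]; last by rewrite ht mul1r min_r// min_r ?(le_trans tt')//; ring.
  rewrite min_l ?(le_trans ht)// min_l// subrr.
  have [h|h] := boolP (t' <= _); rewrite ?mul0r// mul1r.
  by rewrite (_ : t' = t) ?subrr//; apply/le_anti; rewrite tt' andbT (le_trans h).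
- have lh := lohi i.
  rewrite [Num.min (step_lo _) t']min_r// [Num.min (step_lo _) t]min_r ?(le_trans tt')//.
  rewrite [Num.min _ t']min_r ?(le_trans lt)// [Num.min _ t]min_r ?(le_trans tt') ?(le_trans lt)//.
  rewrite !subrr; have [h|h] := boolP (step_lo (S i) <= t); rewrite /= ?mul0r//.
  have -> : t' = t by apply/le_anti; rewrite tt' (le_trans lt h).
  by rewrite subrr mulr0.
Qed.

Lemma step_gram_cell r : t < r <= t' -> step_gram r w =
  gram_form N (fun i => active_coef t t' i w) (fun i => step_dir (S i)) (fun i => step_val (S i)).
Proof.
move=> /andP[tr rt']; have e (i : 'I_N) : \1_(`]step_lo (S i), step_hi (S i)]) r * \1_(step_ev (S i)) w =
    active_coef t t' i w.
  rewrite /active_coef; congr (_ * _); rewrite indicE mem_setE in_itv/=; congr (_%:R).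
  have [h1 h2] := sep (ltn_ord i); congr (nat_of_bool _); congr (_ && _).
    case: h1 => h1; first by rewrite h1 (le_lt_trans h1).
    rewrite [RHS]leNgt (lt_le_trans tr (le_trans rt' h1)).
    by rewrite ltNge (le_trans rt' h1).
  case: h2 => h2; last by rewrite h2 (le_trans rt' h2).
  rewrite [LHS]leNgt (le_lt_trans h2 tr); apply/esym/negbTE.
  by rewrite -ltNge (le_lt_trans h2)// (lt_le_trans tr).
by rewrite /step_gram; do 2!apply: eq_bigr => ? _; rewrite !e.
Qed.

Hypothesis isg : rint mu `[t, t'] (step_gram ^~ w).

Lemma step_gram_integral : \int[mu]_(r in `[t, t']) step_gram r w =
  (t' - t) * gram_form N (fun i => active_coef t t' i w) (fun i => step_dir (S i)) (fun i => step_val (S i)).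
Proof.
have sub : `]t, t']%classic `<=` `[t, t']%classic.
  by move=> r /=; rewrite !in_itv/= => /andP[/ltW -> ->].
have i1 : rint mu `]t, t'] (step_gram ^~ w).
  by apply: rintS isg => //; exact: measurable_itv.
rewrite -(Rintegral_itv_obnd_cbnd i1).
set G := gram_form _ _ _ _.
have -> : \int[mu]_(r in `]t, t']) step_gram r w = \int[mu]_(r in `]t, t']) G.
  by apply: eq_Rintegral => r /set_mem; rewrite /= in_itv/= => rI; exact: step_gram_cell.
rewrite /Rintegral integral_cst; last exact: measurable_itv.
rewrite /= lebesgue_measure_itv/= lte_fin.
have [lt|lt] := ltP t t'; first by rewrite -EFinB -EFinM/= mulrC.
by rewrite mule0/= (_ : t' = t) ?subrr ?mul0r//; apply/le_anti; rewrite lt.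
Qed.

End cell.
End grid_identities.

Section approx_energy_step.
Context (R : realType) (V H : hilbertType R) (j : bop V H) (T s : R) (T0 : 0 < T).
Local Notation mu := (@lebesgue_measure R).
Context (gam : R -> R) (ML : nat -> R -> H) (gl : nat -> R -> R) (xi : nat -> nat -> H) (l : nat).
Hypothesis igl : rint mu `[0, T] (gl l).

Lemma approx_energy0 : approx_energy j T s gam ML gl xi l 0 = 0.
Proof.
rewrite /approx_energy big1// => k _.
have d0 i : 0 <= dyadic T l i by rewrite /dyadic !mulr_ge0 ?invr_ge0 ?exprn_ge0// ltW.
by rewrite !(min_r (d0 _)) subrr dotp0r normr0 expr0n/= Rintegral_itv_pt !(mulr0, addr0, subr0).
Qed.

(** Expanding the square of the increment since the dyadic node leaves a cross term with
    [ML l t - ML l (dyadic T l k)], which joins the vector that is paired with the new increment.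
    The energy over dyadic cells is thus also an energy over any finer grid. *)
Lemma approx_energyS (k : nat) (t t' : R) : (k < 2 ^ l)%N -> t <= t' ->
  dyadic T l k <= t -> t' <= dyadic T l k.+1 ->
  approx_energy j T s gam ML gl xi l t' = approx_energy j T s gam ML gl xi l t +
  weight gam (dyadic T l k) *
   (2 * dotp (j (resolvent j s (xi l k)) + (ML l t - ML l (dyadic T l k))) (ML l t' - ML l t) +
    `|ML l t' - ML l t| ^+ 2 - \int[mu]_(r in `[t, t']) gl l r).
Proof.
move=> kl tt' kt t'k; rewrite /approx_energy (bigD1 (Ordinal kl))//= [in RHS](bigD1 (Ordinal kl))//=.
have dm i i' : (i <= i')%N -> dyadic T l i <= dyadic T l i'.
  by move=> ii; rewrite /dyadic ler_pM2r ?invr_gt0 ?exprn_gt0// ler_wpM2l ?ler_nat// ltW.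
have d0 i : 0 <= dyadic T l i by rewrite /dyadic !mulr_ge0 ?invr_ge0 ?exprn_ge0// ltW.
have dT i : (i <= 2 ^ l)%N -> dyadic T l i <= T.
  move=> ii; apply: le_trans (dm _ _ ii) _; rewrite /dyadic natrX mulfK// gt_eqF// exprn_gt0//.
rewrite [RHS]addrAC; congr (_ + _); last first.
  apply: eq_bigr => i ik; have {}ik : i != k :> nat by apply: contra ik => /eqP ik; apply/eqP/val_inj.
  have [ik'|ik'] := ltnP i k.
    have h1 : dyadic T l i <= t by apply: le_trans kt; exact/dm/ltnW.
    have h2 : dyadic T l i.+1 <= t by apply: le_trans kt; exact: dm.
    by rewrite !min_l// (le_trans _ tt').
  have ki : (k < i)%N by rewrite ltn_neqAle eq_sym ik.
  have h1 : t' <= dyadic T l i by apply: le_trans t'k _; exact: dm.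
  have h2 : t' <= dyadic T l i.+1 by apply: le_trans h1 _; exact: dm.
  rewrite !min_r ?(le_trans tt')//.
  by rewrite !subrr dotp0r normr0 expr0n/= !Rintegral_itv_pt.
have h1 : t <= dyadic T l k.+1 := le_trans tt' t'k.
have h2 : dyadic T l k <= t' := le_trans kt tt'.
rewrite (min_l kt) (min_l h2) (min_r h1) (min_r t'k) -mulrDr; congr (_ * _).
have e : ML l t' - ML l (dyadic T l k) = (ML l t - ML l (dyadic T l k)) + (ML l t' - ML l t).
  by rewrite [RHS]addrC addrA subrK.
have -> : \int[mu]_(r in `[dyadic T l k, t']) gl l r =
    \int[mu]_(r in `[dyadic T l k, t]) gl l r + \int[mu]_(r in `[t, t']) gl l r.
  by apply: Rintegral_itv_split => //; apply: rint_itvS igl _ _ => //; exact: le_trans t'k (dT _ kl).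
by rewrite e dotpDl dotpDr norm_sqD; ring.
Qed.

End approx_energy_step.

(** * Vanishing of the resolvent defect *)

Section defect.
Context (R : realType) (V H : hilbertType R) (j : bop V H) (jtriple : gelfand_triple j) (T : R) (T0 : 0 < T).
Local Notation mu := (@lebesgue_measure R).
Local Notation itg F := (rint mu `[0, T] F).
Local Notation sn i := (i.+1%:R^-1 : R).

Lemma within_comp (X Y : normedModType R) (h : R -> X) (F : X -> Y) :
  {within `[0, T], continuous h} -> continuous F -> {within `[0, T], continuous (F \o h)}.
Proof.
move=> /subspace_continuousP ch cF; apply/subspace_continuousP => x xA.
exact: (cvg_comp _ _ (ch x xA) (cF (h x))).
Qed.

Lemma resolvent_form_continuous s : 0 < s -> continuous (resolvent_form j s : H -> R^o).
Proof.
move=> s0 x; apply/cvgrPdist_lt => e e0.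
have c0 : 0 < 2 * `|x| + 1 by rewrite ltr_wpDl// mulr_ge0.
near=> y; apply: le_lt_trans (resolvent_form_dist j s0 x y) _.
have h1 : `|x - y| < 1 by near: y; apply: cvgr_dist_lt.
have h2 : `|x - y| < e / (2 * `|x| + 1) by near: y; apply: cvgr_dist_lt; rewrite ?divr_gt0.
have h3 : `|y| <= `|x| + 1.
  rewrite -[y](subrK x) addrC (le_trans (ler_normD _ _))// lerD2l// distrC ltW.
apply: (@le_lt_trans _ _ (`|x - y| * (2 * `|x| + 1))).
  by rewrite ler_wpM2l//; lra.
by rewrite -ltr_pdivlMr.
Unshelve. all: end_near.
Qed.

Lemma resolvent_bounded s : 0 < s -> continuous (resolvent j s : H -> V).
Proof.
move=> s0 x; apply/cvgrPdist_lt => e e0.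
have r0 : 0 < Num.sqrt s by rewrite sqrtr_gt0.
near=> y; rewrite -resolventB// (le_lt_trans (resolvent_norm_le _ _ s0))//.
rewrite mulrC ltr_pdivrMr//; near: y; apply: cvgr_dist_lt; rewrite ?mulr_gt0//.
Unshelve. all: end_near.
Qed.

Context (v : R -> V) (h : R -> H) (a : R -> dual V) (gam : R -> R).
Hypothesis mv : strongly_mfun measurable `[0, T] v.
Hypothesis rv : itg (fun r => `|v r| ^+ 2).
Hypothesis ma : measurable_fun `[0, T] (fun r => `|a r|).
Hypothesis ra : itg (fun r => `|a r| ^+ 2).
Hypotheses (rgam : itg gam) (gam0 : forall r, 0 <= gam r).
Hypothesis ch : {within `[0, T], continuous h}.

Let mT := measurable_segment 0 T.

Lemma within_bounded (X : normedModType R) (g : R -> X) : {within `[0, T], continuous g} ->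
  exists m, forall t, 0 <= t <= T -> `|g t| <= m.
Proof.
move=> cg; have cn := within_comp cg (@norm_continuous _ _).
have [c _ hc] := EVT_max (ltW T0) cn.
by exists (`|g c|) => t tT; apply: hc; rewrite in_itv.
Qed.

Let mh (F : H -> R) : continuous (F : H -> R^o) -> measurable_fun `[0, T] (fun r => F (h r)).
Proof.
move=> cF; apply: subspace_continuous_measurable_fun; first exact: measurable_itv.
exact: (within_comp ch cF).
Qed.

Let mdiff s : 0 < s -> measurable_fun `[0, T] (fun r => `|v r - resolvent j s (j (v r))|).
Proof.
move=> s0; apply: (strongly_mfun_real mT mv (F := fun x => `|x - resolvent j s (j x)|)) => x.
apply: cvg_norm; apply: cvgB; first exact: cvg_id.
apply: (continuous_comp (f := j) (g := resolvent j s)); first exact: bop_continuous.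
exact: resolvent_bounded.
Qed.

Let iav : itg (fun r => `|a r| * `|v r|).
Proof. by apply: (rint_sq_mul mT) => //; exact: strongly_mfun_norm. Qed.

Let hbound := within_bounded ch.

Let igh : itg (fun r => gam r * `|h r| ^+ 2).
Proof.
have [m hm] := hbound.
have := @rint_bounded_mul _ _ _ mu _ mT (m ^+ 2) (fun r => `|h r| ^+ 2) gam.
under [X in _ -> _ -> _ -> rint _ _ X]eq_fun do rewrite mulrC.
apply => //.
  apply: (mh (F := fun x => `|x| ^+ 2)) => x.
  by apply: (continuous_comp (f := fun x : H => `|x|) (g := fun y : R => y ^+ 2));
    [exact: norm_continuous|exact: exprn_continuous].
move=> r; rewrite /= in_itv/= => rT; rewrite ger0_norm ?sqr_ge0// lerXn2r ?nnegrE//.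
  by apply: le_trans (normr_ge0 (h 0)) (hm _ _); rewrite lexx ltW.
exact: hm.
Qed.

Let defect_bound i r : `|resolvent_defect j (sn i) v h a gam r| <=
  4 * (`|a r| * `|v r|) + gam r * `|h r| ^+ 2.
Proof.
have s0 : 0 < sn i by rewrite invr_gt0.
have q1 := resolvent_form_ge0 j (h r) s0; have q2 := resolvent_form_le j (h r) s0.
rewrite /resolvent_defect ger0_norm; last first.
  by rewrite addr_ge0 ?mulr_ge0// subr_ge0.
rewrite lerD//; last by rewrite ler_wpM2l// gerBl.
rewrite (_ : 4 = 2 * 2) -?mulrA ?ler_wpM2l//; last by ring.
rewrite mulrCA ler_wpM2l// (le_trans (ler_normB _ _))// mulr_natl mulr2n lerD2l.
exact: resolvent_contractV.
Qed.

Let mdefect i : measurable_fun `[0, T] (resolvent_defect j (sn i) v h a gam).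
Proof.
have s0 : 0 < sn i by rewrite invr_gt0.
apply: measurable_funD.
  by apply: measurable_funM => //; apply: measurable_funM => //; exact: mdiff.
apply: measurable_funM; first exact: rint_meas rgam.
apply: measurable_funB; last by apply: mh; exact: resolvent_form_continuous.
apply: (mh (F := fun x => `|x| ^+ 2)) => x.
by apply: (continuous_comp (f := fun x : H => `|x|) (g := fun y : R => y ^+ 2));
  [exact: norm_continuous|exact: exprn_continuous].
Qed.

Let idom : itg (fun r => 4 * (`|a r| * `|v r|) + gam r * `|h r| ^+ 2).
Proof. by apply: rintD => //; exact: rintZl. Qed.

Lemma resolvent_defect_rint i : itg (resolvent_defect j (sn i) v h a gam).
Proof. by apply: (rint_le mT idom); [exact: mdefect|move=> r _; exact: defect_bound]. Qed.

Lemma resolvent_form_cvg x : resolvent_form j (sn i) x @[i --> \oo] --> `|x| ^+ 2.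
Proof. by rewrite -dotpE; apply: dotp_cvg; exact: resolvent_cvgH. Qed.

(** Dominated convergence. The resolvent contracts [V], and the form lies between [0] and [|h|^2];
    this yields the majorant [4 |a| |v| + gam |h|^2]. *)
Lemma resolvent_defect_cvg :
  \int[mu]_(r in `[0, T]) resolvent_defect j (sn i) v h a gam r @[i --> \oo] --> 0.
Proof.
suff : \int[mu]_(r in `[0, T]) resolvent_defect j (sn i) v h a gam r @[i --> \oo] -->
    \int[mu]_(r in `[0, T]) (0 : R) by rewrite {2}/Rintegral integral0.
apply: (Rintegral_cvg mT mdefect (measurable_cst _) _ idom); last first.
  by move=> i; apply: aeW => r _; exact: defect_bound.
apply: aeW => r _; rewrite /resolvent_defect.
rewrite [X in _ --> X](_ : _ = 2 * (`|a r| * 0) + gam r * (`|h r| ^+ 2 - `|h r| ^+ 2)); last first.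
  by rewrite subrr !mulr0 addr0.
apply: cvgD.
  apply: cvgMr; apply: cvgMr; apply/cvgn_distP => e e0.
  have /cvgn_distP/(_ e e0)[N hN] : resolvent j (sn n) (j (v r)) @[n --> \oo] --> v r.
    exact: resolvent_cvgV.
  by exists N => n /hN; rewrite subr0 normr_id distrC.
by apply: cvgMr; apply: cvgB; [exact: cvg_cst|exact: resolvent_form_cvg].
Qed.

End defect.

(** * The maximal energy inequality *)

Section energy_maximal.
Context (R : realType) (V H U : hilbertType R) (e : onb U) (j : bop V H) (jtriple : gelfand_triple j).
Context d (Omega : measurableType d) (P : probability Omega R) (Fil : R -> set (set Omega)).
Context (W : R -> U -> Omega -> R) (hF : filtration Fil) (hW : cylindrical_BM P Fil W).
Context (T : R) (T0 : 0 < T).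
Local Notation mu := (@lebesgue_measure R).
Local Notation itg F := (rint mu `[0, T] F).
Local Notation sn i := (i.+1%:R^-1 : R).
Context (v : R -> Omega -> V) (h M : R -> Omega -> H) (a : R -> Omega -> dual V).
Context (x0 : Omega -> H) (th gam f nP : R -> Omega -> R).
Context (N : nat -> nat) (S : nat -> nat -> step Omega U H) (dl : nat -> R -> Omega -> R).
Hypothesis av : adapted_strong Fil v.
Hypothesis mx0 : strongly_mfun (@measurable _ (subalg (Fil 0))) setT x0.
Hypothesis agam : adapted_real Fil gam.
Hypotheses (gam0 : forall r w, 0 <= gam r w) (th0 : forall r w, 0 <= th r w).
Hypothesis f0 : forall r w, 0 <= f r w.
Hypothesis aS : forall l i, adapted_step Fil (S l i).

(** What is known along a single path. [a] is the drift, [nP] the norm of the integrand, [dl l] its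
    distance to the elementary integrand [l]; [th] and [f] are the dissipation and the forcing. The
    record covers both the difference of two solutions, with [f = 0], and one coercive solution. *)
Record energy_path (w : Omega) : Prop := EnergyPath {
  ep_cont : {within `[0, T], continuous (h ^~ w)} ;
  ep_x0 : h 0 w = x0 w ;
  ep_jv : \forall r \ae mu, `[0, T]%classic r -> j (v r w) = h r w ;
  ep_v2 : itg (fun r => `|v r w| ^+ 2) ;
  ep_ma : measurable_fun `[0, T] (fun r => `|a r w|) ;
  ep_a2 : itg (fun r => `|a r w| ^+ 2) ;
  ep_may : forall y, measurable_fun `[0, T] (fun r => a r w y) ;
  ep_eq : forall y t, 0 <= t <= T ->
    dotp (h t w - x0 w) (j y) + \int[mu]_(r in `[0, t]) a r w y = dotp (M t w) (j y) ;
  ep_P2 : itg (fun r => nP r w ^+ 2) ;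
  ep_dl2 : forall l, itg (fun r => dl l r w ^+ 2) ;
  ep_dl0 : \int[mu]_(r in `[0, T]) dl l r w ^+ 2 @[l --> \oo] --> 0 ;
  ep_gram : forall l r, 0 <= r <= T -> step_gram (N l) (S l) r w <= (nP r w + dl l r w) ^+ 2 ;
  ep_ML : \forall l \near \oo, forall t, 0 <= t <= T ->
    `|M t w - step_integral W (N l) (S l) t w| <= 4^-1 ^+ l ;
  ep_M : exists b, forall t, 0 <= t <= T -> `|M t w| <= b ;
  ep_th : itg (th ^~ w) ;
  ep_gam : itg (gam ^~ w) ;
  ep_f : itg (f ^~ w) ;
  ep_mono : \forall r \ae mu, `[0, T]%classic r ->
    th r w - gam r w * `|h r w| ^+ 2 - f r w <= 2 * a r w (v r w) - nP r w ^+ 2 }.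

Hypothesis hpath : \forall w \ae P, energy_path w.
Context (C : set Omega) (mC : Fil 0 C) (D : Omega -> R) (iD : rint P setT D) (D0 : forall w, 0 <= D w).
Hypothesis hD : \forall w \ae P, C w -> `|x0 w| ^+ 2 + \int[mu]_(r in `[0, T]) f r w <= D w.
Context (lam : R) (lam0 : 0 < lam).

Let E t w := weight (gam ^~ w) t.

Definition weighted_energy t w : R :=
  E t w * `|h t w| ^+ 2 + \int[mu]_(r in `[0, t]) (E r w * th r w).

Let mT := measurable_segment 0 T.
Let sn0 i : 0 < sn i. Proof. by rewrite invr_gt0. Qed.

Let version : exists eta : R -> Omega -> H, forall t, 0 <= t <= T ->
  strongly_mfun (@measurable _ (subalg (Fil t))) setT (eta t) /\
  \forall w \ae P, eta t w = h t w.
Proof.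
suff : forall t, exists et : Omega -> H, 0 <= t <= T ->
    strongly_mfun (@measurable _ (subalg (Fil t))) setT et /\ \forall w \ae P, et w = h t w.
  by move=> /choice[et etP]; exists et.
move=> t; have [/andP[t0 tT]|nt] := boolP (0 <= t <= T); last by exists x0 => //.
move: t0; rewrite le_eqVlt => /orP[/eqP t0|t0].
  exists x0 => _; rewrite -t0; split => //.
  by move: hpath; apply: filterS => w [].
have [|g sg gh] := adapted_version (P := P) (h := h) (j := j) t0 av.
  move: hpath; apply: filterS => w hw; split.
    apply: continuous_subspaceW (ep_cont hw) => r /=; rewrite !in_itv/= => /andP[-> h2].
    exact: le_trans tT.
  apply: (@filterS _ _ (ae_filter_ringOfSetsType mu) _ _ _ (ep_jv hw)) => r hr; rewrite /= in_itv/= => rt.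
  by apply: hr; rewrite /= in_itv/=; have /andP[-> h2] := rt; rewrite (le_trans h2).
by exists g.
Qed.

Let eta : R -> Omega -> H := sval (cid version).
Let etaP := svalP (cid version).
Let xi l k w := eta (dyadic T l k) w.
Let ML l t w := step_integral W (N l) (S l) t w.

Let lo_ge0 l i : 0 <= step_lo (S l i). Proof. by have [/andP[]] := aS l i. Qed.
Let lohi l i : step_lo (S l i) <= step_hi (S l i). Proof. by have [/andP[]] := aS l i. Qed.

Let dyadic_ge0 l k : 0 <= dyadic T l k.
Proof. by rewrite /dyadic !mulr_ge0 ?invr_ge0 ?exprn_ge0// ltW. Qed.

Let dyadic_le l k : (k <= 2 ^ l)%N -> dyadic T l k <= T.
Proof.
move=> kl; rewrite /dyadic ler_pdivrMr ?exprn_gt0// ler_wpM2l ?(ltW T0)//.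
by rewrite -natrX ler_nat.
Qed.

Let grids l : exists g : (nat -> R) * nat * (nat -> nat), [/\ g.1.1 0%N = 0, g.1.1 g.1.2 = T,
  forall b, g.1.1 b <= g.1.1 b.+1 /\ 0 <= g.1.1 b <= T,
  forall i b, (i < N l)%N -> (step_lo (S l i) <= g.1.1 b \/ g.1.1 b.+1 <= step_lo (S l i)) /\
    (step_hi (S l i) <= g.1.1 b \/ g.1.1 b.+1 <= step_hi (S l i)) &
  forall b, [/\ (g.2 b < 2 ^ l)%N, dyadic T l (g.2 b) <= g.1.1 b & g.1.1 b.+1 <= dyadic T l (g.2 b).+1] /\
    forall k, (k <= 2 ^ l)%N -> dyadic T l k <= g.1.1 b \/ g.1.1 b.+1 <= dyadic T l k].
Proof.
pose s := [seq dyadic T l k | k <- iota 0 (2 ^ l).+1] ++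
  [seq y <- [seq step_lo (S l i) | i <- iota 0 (N l)] ++ [seq step_hi (S l i) | i <- iota 0 (N l)] | 0 <= y <= T].
have ds k : (k <= 2 ^ l)%N -> dyadic T l k \in s.
  move=> kl; rewrite mem_cat; apply/orP; left; apply/mapP; exists k => //.
  by rewrite mem_iota add0n ltnS.
have d0 : dyadic T l 0 = 0 by rewrite /dyadic mulr0 mul0r.
have dT : dyadic T l (2 ^ l) = T by rewrite /dyadic natrX mulfK// gt_eqF// exprn_gt0.
have [||| p [n [p0 pn pS pb sep]]] := @grid_exists R T s.
- by rewrite -d0 ds.
- by rewrite -dT ds.
- move=> y; rewrite mem_cat => /orP[/mapP[k + ->]|].
    by rewrite mem_iota add0n ltnS => /= kl; rewrite dyadic_ge0 dyadic_le.
  by rewrite mem_filter => /andP[].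
have /choice[kk kkP] : forall b, exists k, (k < 2 ^ l)%N /\
    (dyadic T l k <= p b /\ p b.+1 <= dyadic T l k.+1).
  move=> b; have [|k k1 k2] := @grid_cell R T l p b (ltW T0) pb (pS b); last by exists k.
  by move=> k kl; apply: sep; exact: ds.
have out y b : 0 <= y -> y \in s \/ T < y -> y <= p b \/ p b.+1 <= y.
  move=> y0 [ys|yT]; first exact: sep.
  by right; apply: le_trans (ltW yT); have /andP[] := pb b.+1.
exists ((p, n), kk); split => //=.
- move=> i b iN; have memlo (g : nat -> R) : (g = fun i => step_lo (S l i)) \/ (g = fun i => step_hi (S l i)) ->
      0 <= g i -> g i \in s \/ T < g i.
    move=> gE gi0; have [gT|] := leP (g i) T; last by right.
    left; rewrite mem_cat mem_filter gi0 gT /= mem_cat; apply/orP; right; apply/orP.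
    have ii : i \in iota 0 (N l) by rewrite mem_iota add0n.
    by case: gE => ->; [left|right]; apply/mapP; exists i.
  have hi0 : 0 <= step_hi (S l i) by exact: le_trans (lo_ge0 l i) (lohi l i).
  split; apply: out => //; first exact: (memlo (fun i => step_lo (S l i)) (or_introl erefl)).
  exact: (memlo (fun i => step_hi (S l i)) (or_intror erefl)).
- move=> b; split; first by have [? []] := kkP b.
  by move=> k kl; apply: sep; exact: ds.
Qed.

Let gr l := sval (cid (grids l)).
Let grP l := svalP (cid (grids l)).
Let p l := (gr l).1.1.
Let nn l := (gr l).1.2.
Let kk l := (gr l).2.

Let p00 l : p l 0%N = 0. Proof. by have [] := grP l. Qed.
Let pn l : p l (nn l) = T. Proof. by have [] := grP l. Qed.
Let pS l b : p l b <= p l b.+1. Proof. by have [_ _ /(_ b)[]] := grP l. Qed.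
Let pT l b : 0 <= p l b <= T. Proof. by have [_ _ /(_ b)[]] := grP l. Qed.
Let p0 l b : 0 <= p l b. Proof. by have /andP[] := pT l b. Qed.
Let psep l i b : (i < N l)%N -> (step_lo (S l i) <= p l b \/ p l b.+1 <= step_lo (S l i)) /\
    (step_hi (S l i) <= p l b \/ p l b.+1 <= step_hi (S l i)).
Proof. by have [_ _ _ h1 _] := grP l; exact: h1. Qed.
Let kkP l b : [/\ (kk l b < 2 ^ l)%N, dyadic T l (kk l b) <= p l b & p l b.+1 <= dyadic T l (kk l b).+1].
Proof. by have [_ _ _ _ /(_ b)[]] := grP l. Qed.
Let pdy l k b : (k <= 2 ^ l)%N -> dyadic T l k <= p l b \/ p l b.+1 <= dyadic T l k.
Proof. by have [_ _ _ _ /(_ b)[_]] := grP l; apply. Qed.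

Let uu l i := step_dir (S l i).
Let xx l i := step_val (S l i).
Let ac l b i := active_coef (S l) (p l b) (p l b.+1) i.
Let wt l b w := E (dyadic T l (kk l b)) w.
Let node l b := dyadic T l (kk l b).
(** The vector of [approx_energyS]: the regularised value at the dyadic node plus the martingale
    gained since then. *)
Let zeta i l b w := j (resolvent j (sn i) (xi l (kk l b) w)) + (ML l (p l b) w - ML l (node l b) w).

Let node_le l b : 0 <= node l b <= p l b.
Proof. by have [_ h1 _] := kkP l b; rewrite dyadic_ge0. Qed.

Let up s t (g : Omega -> R) : 0 <= s <= t -> measurable_fun (T := subalg (Fil s)) setT g ->
  measurable_fun (T := subalg (Fil t)) setT g.
Proof. by move=> /andP[s0 st]; exact: (fil_measurable_fun hF s0 st). Qed.

Let mev t l i : step_lo (S l i) <= t ->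
  measurable_fun (T := subalg (Fil t)) setT (\1_(step_ev (S l i)) : Omega -> R).
Proof.
move=> lt; apply: (@measurable_indic _ (subalg (Fil t))).
have t0 := le_trans (lo_ge0 l i) lt.
by rewrite (fil_measurableE hF t0); apply: (fil_mono hF (lo_ge0 l i) lt); have [_] := aS l i.
Qed.

Let mac l b i : measurable_fun (T := subalg (Fil (p l b))) setT (ac l b i).
Proof.
rewrite /ac /active_coef; have [h1|h1] := boolP (step_lo (S l i) <= p l b).
  by apply: measurable_funM; [exact: measurable_cst|exact: mev].
by under eq_fun do rewrite /= mul0r; exact: measurable_cst.
Qed.

Let ac1 l b i w : `|ac l b i w| <= 1.
Proof.
rewrite /ac /active_coef normrM mulr_ile1//.
- by case: (_ && _); rewrite ?normr1 ?normr0.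
- by rewrite indicE; case: (_ \in _); rewrite ?normr1 ?normr0.
Qed.

Let mwt l b : measurable_fun (T := subalg (Fil (p l b))) setT (wt l b).
Proof.
apply: (up (node_le l b)); have [n0 _] := andP (node_le l b).
have mi : measurable_fun (T := subalg (Fil (node l b))) setT
    (fun w => \int[mu]_(r in `[0%R, (node l b)]) (gam r w)%:E)%E.
  by apply: (adapted_integral n0 agam gam0) => //; exact: measurable_itv.
have mf := measurableT_comp (fine_measurable measurableT) mi.
have m2 : measurable_fun (T := subalg (Fil (node l b))) setT
    (fun w => - fine (\int[mu]_(r in `[0%R, (node l b)]) (gam r w)%:E)%E).
  exact: (measurableT_comp (f := -%R : R -> R)) mf.
exact: (measurableT_comp (f := expR : R -> R)) m2.
Qed.

Let wt01 l b w : 0 <= wt l b w <= 1.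
Proof.
by rewrite (ltW (weight_gt0 _ _)) weight_le1//.
Qed.

Let frML l t : 0 <= t -> finrank (T := subalg (Fil t)) (ML l t).
Proof.
move=> t0; pose c i w := \1_(step_ev (S l i)) w *
  (W (Num.min (step_hi (S l i)) t) (step_dir (S l i)) w - W (Num.min (step_lo (S l i)) t) (step_dir (S l i)) w).
apply: (@finrank_sum R H _ (subalg (Fil t)) (N l) c (fun i => step_val (S l i))) => i; rewrite /c.
have hi0 := le_trans (lo_ge0 l i) (lohi l i).
have mW s : 0 <= s -> measurable_fun (T := subalg (Fil t)) setT (W (Num.min s t) (step_dir (S l i))).
  move=> s0; apply: (@up (Num.min s t)); first by rewrite le_min s0 t0 ge_min lexx orbT.
  by apply: (brownian_adapted hF hW); rewrite le_min s0.
have [lt|lt] := leP (step_lo (S l i)) t.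
  apply: measurable_funM; [exact: mev|apply: measurable_funB; first exact: mW].
  by apply: (@up (step_lo (S l i))); [rewrite lo_ge0|exact: (brownian_adapted hF hW)].
rewrite ?(min_r (ltW lt)) (min_r (le_trans (ltW lt) (lohi l i))).
by under eq_fun do rewrite subrr mulr0; exact: measurable_cst.
Qed.
Let dyT l b : 0 <= node l b <= T.
Proof. by have [k1 _ _] := kkP l b; rewrite dyadic_ge0 dyadic_le// ltnW. Qed.

Let Kxi i l b w := j (resolvent j (sn i) (xi l (kk l b) w)).

Let mKdot i l b y : measurable_fun (T := subalg (Fil (p l b))) setT (fun w => dotp (Kxi i l b w) y).
Proof.
apply: (up (node_le l b)); have [se _] := etaP (dyT l b).
apply: (strongly_mfun_real measurableT se (F := fun x => dotp (j (resolvent j (sn i) x)) y)) => x.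
apply/cvgrPdist_lt => ep ep0; have c0 : 0 < `|y| + 1 by rewrite ltr_wpDl.
near=> z; rewrite -dotpBl -bopB -resolventB// (le_lt_trans (dotp_le _ _))//.
apply: (@le_lt_trans _ _ (`|x - z| * (`|y| + 1))).
  by rewrite ler_pM// ?lerDl// resolvent_contract.
by rewrite -ltr_pdivlMr//; near: z; apply: cvgr_dist_lt; rewrite ?divr_gt0.
Unshelve. all: end_near.
Qed.

Let mKnorm i l b : measurable_fun (T := subalg (Fil (p l b))) setT (fun w => `|Kxi i l b w|).
Proof.
apply: (up (node_le l b)); have [se _] := etaP (dyT l b).
apply: (strongly_mfun_real measurableT se (F := fun x => `|j (resolvent j (sn i) x)|)) => x.
apply: cvg_norm; apply: (continuous_comp (f := resolvent j (sn i)) (g := j)).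
  exact: resolvent_bounded.
exact: bop_continuous.
Qed.

Let frB l b : finrank (T := subalg (Fil (p l b))) (fun w => ML l (p l b) w - ML l (node l b) w).
Proof.
apply: finrankB; first exact: frML.
have /andP[n0 np] := node_le l b.
elim: (frML l n0) => [|c x X mc _ IH]; first exact: finrank0.
by apply: finrankS => //; exact: (up (node_le l b)).
Qed.

Let mzdot i l b y : measurable_fun (T := subalg (Fil (p l b))) setT (fun w => dotp (zeta i l b w) y).
Proof.
under eq_fun do rewrite dotpDl; apply: measurable_funD; first exact: mKdot.
have c1 := finrank1 y (@measurable_cst _ _ (subalg (Fil (p l b))) R setT 1).
by have := finrank_dotp (frB l b) c1; under eq_fun do rewrite scale1r.
Qed.

Let mznorm i l b : measurable_fun (T := subalg (Fil (p l b))) setT (fun w => `|zeta i l b w|).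
Proof.
have mKX X : finrank (T := subalg (Fil (p l b))) X ->
    measurable_fun (T := subalg (Fil (p l b))) setT (fun w => dotp (Kxi i l b w) (X w)).
  elim=> [|c x Y mc fY IH]; first by under eq_fun do rewrite dotp0r; exact: measurable_cst.
  under eq_fun do rewrite dotpDr dotpZr; apply: measurable_funD => //.
  by apply: measurable_funM => //; exact: mKdot.
have E2 w : `|zeta i l b w| = Num.sqrt (`|Kxi i l b w| ^+ 2 +
    2 * dotp (Kxi i l b w) (ML l (p l b) w - ML l (node l b) w) +
    `|ML l (p l b) w - ML l (node l b) w| ^+ 2).
  by rewrite -norm_sqD sqrtr_sqr normr_id.
under eq_fun do rewrite E2.
apply: measurableT_comp; first exact: continuous_measurable_fun (@sqrt_continuous R).
apply: measurable_funD; last by apply: measurable_funX; exact: finrank_norm.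
apply: measurable_funD; first by apply: measurable_funX; exact: mKnorm.
by apply: measurable_funM; [exact: measurable_cst|exact: mKX].
Qed.

Let rr n : R := n%:R.
(** [KK n - rr n = (n + 1)^4] beats the [n^3] in the bound of [SEmax], so the cut-off becomes free
    in the limit. *)
Let KK n : R := n%:R + n.+1%:R ^+ 4.

Let SE n i l w := stopped_energy W (p l) (N l) (ac l) (uu l) (xx l) (wt l) (zeta i l) C (rr n) (rr n) lam (nn l) w.

Let SEmax n i l : [/\ measurable_fun setT (SE n i l), rint P setT (fun w => Num.max (SE n i l w) (- KK n)) &
  \int[P]_w Num.max (SE n i l w) (- KK n) <= rr n ^+ 2 * rr n / (KK n - rr n)].
Proof.
refine (stopped_energy_max e hF hW (N l) (uu l) (xx l) (p0 l) (pS l) (@mac l) (@ac1 l) (@mwt l) (@wt01 l)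
  (@mzdot i l) (@mznorm i l) _ lam _ _ _ (nn l)) => //.
- by rewrite p00.
- by rewrite ltrDl exprn_gt0.
Qed.

Let gl l r w := step_gram (N l) (S l) r w.

Let igl w : energy_path w -> forall l, itg (gl l ^~ w).
Proof.
move=> hw l; have i1 := ep_P2 hw; have i2 := ep_dl2 hw l.
apply: (rint_le mT (rintD mT (rintZl mT 2 i1) (rintZl mT 2 i2))).
  apply: measurable_sum => i; apply: measurable_sum => i'; apply: measurable_funM => //.
  have mI k : measurable_fun `[0, T] (fun r => \1_(`]step_lo (S l k), step_hi (S l k)]) r * \1_(step_ev (S l k)) w : R).
    by apply: measurable_funM => //; apply: measurable_funTS; exact: measurable_indic.
  by apply: measurable_funM; exact: mI.
move=> r; rewrite /= in_itv/= => rT; rewrite ger0_norm; last exact: (gram_form_ge0 e).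
apply: le_trans (ep_gram hw l rT) _; have := sqr_ge0 (nP r w - dl l r w).
by rewrite sqrrB sqrrD; lra.
Qed.

Let AE i l t w := approx_energy j T (sn i) (gam ^~ w) (fun l t => ML l t w) (fun l r => gl l r w)
  (fun l k => xi l k w) l t.

Let incE l b w : ML l (p l b.+1) w - ML l (p l b) w = grid_inc W (p l) (N l) (ac l) (uu l) (xx l) b w.
Proof. by apply: step_integral_inc => // i iN; exact: psep. Qed.

Let gramE l b w : energy_path w -> \int[mu]_(r in `[p l b, p l b.+1]) gl l r w =
  (p l b.+1 - p l b) * grid_gram (N l) (ac l) (uu l) (xx l) b w.
Proof.
move=> hw; apply: step_gram_integral => //; first by move=> i iN; exact: psep.
by apply: rint_itvS (igl hw l) (p0 l b) _; have /andP[] := pT l b.+1.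
Qed.

Let gridE i l b w : energy_path w ->
  grid_energy W (p l) (N l) (ac l) (uu l) (xx l) (wt l) (zeta i l) b w = AE i l (p l b) w.
Proof.
move=> hw; have il : itg (fun r => gl l r w) by exact: igl.
elim: b => [|b IH]; first by rewrite /grid_energy big_ord0 p00 /AE approx_energy0.
have [k1 k2 k3] := kkP l b.
rewrite /AE (approx_energyS j (sn i) T0 (gam ^~ w) (fun l t => ML l t w) (fun l k => xi l k w) il k1 (pS l b) k2 k3).
by rewrite -/(AE i l (p l b) w) -IH /grid_energy big_ord_recr/= /grid_term incE gramE.
Qed.

Let gridV l b w : energy_path w ->
  grid_var (p l) (N l) (ac l) (uu l) (xx l) b w = \int[mu]_(r in `[0, p l b]) gl l r w.
Proof.
move=> hw; elim: b => [|b IH]; first by rewrite /grid_var big_ord0 p00 Rintegral_itv_pt.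
rewrite /grid_var big_ord_recr/= -/(grid_var _ _ _ _ _ b w) IH -gramE// -Rintegral_itv_split//.
by apply: rint_itvS (igl hw l) _ _ => //; have /andP[] := pT l b.+1.
Qed.

Let xi_ok w := forall l k, (k <= 2 ^ l)%N -> xi l k w = h (dyadic T l k) w.

Let xi_ae : \forall w \ae P, xi_ok w.
Proof.
apply: ae_foralln => l; apply: ae_foralln => k; have [kl|kl] := leqP k (2 ^ l).
  have [|_ h1] := etaP (t := dyadic T l k); first by rewrite dyadic_ge0 dyadic_le.
  by move: h1; apply: filterS.
by apply: aeW.
Qed.

Let df i w := \int[mu]_(r in `[0, T]) resolvent_defect j (sn i) (v ^~ w) (h ^~ w) (a ^~ w) (gam ^~ w) r.

Let vpath w : strongly_mfun measurable `[0, T] (v ^~ w).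
Proof.
have := strongly_mfun_section1 (av (ltW T0)) w; apply: strongly_mfunS => r rT.
by split.
Qed.

Let df_rint w : energy_path w -> forall i,
  itg (resolvent_defect j (sn i) (v ^~ w) (h ^~ w) (a ^~ w) (gam ^~ w)).
Proof.
move=> hw; apply: resolvent_defect_rint => //.
- exact: ep_v2 hw.
- exact: ep_ma hw.
- exact: ep_a2 hw.
- exact: ep_gam hw.
- exact: ep_cont hw.
Qed.

Let df_cvg w : energy_path w -> df i w @[i --> \oo] --> 0.
Proof.
move=> hw; apply: resolvent_defect_cvg => //.
- exact: ep_v2 hw.
- exact: ep_ma hw.
- exact: ep_a2 hw.
- exact: ep_gam hw.
- exact: ep_cont hw.
Qed.

Let QI i t w : R := E t w * resolvent_form j (sn i) (h t w) + \int[mu]_(r in `[0, t]) (E r w * th r w).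

Let path_l w i (eps : R) : energy_path w -> xi_ok w -> 0 < eps -> \forall l \near \oo, forall t, 0 <= t <= T ->
  QI i t w <= `|x0 w| ^+ 2 + \int[mu]_(r in `[0, T]) f r w + df i w + AE i l t w + eps.
Proof.
move=> hw xw eps0; have [m hm] := within_bounded T0 (ep_cont hw); have [b hb] := ep_M hw.
have ia : itg (fun r => `|a r w|).
  by apply: (rint_sq1 mT) (ep_a2 hw) => //; [rewrite /= lebesgue_measure_itv/= lte_fin T0 -EFinB ltry|exact: ep_ma hw].
apply: (pathwise_energy T0 (sn0 i) (ep_th hw) (ep_gam hw) (ep_f hw) (ep_P2 hw) (fun r => gam0 r w)
  (fun r => f0 r w) ia (ep_may hw) (df_rint hw i) (ep_eq hw) (ep_x0 hw) (ep_jv hw) (ep_mono hw) hm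
  (ep_cont hw) hb (ep_ML hw) _ (igl hw) (ep_dl2 hw) (ep_gram hw) (ep_dl0 hw) eps0) => //.
by apply: nearW => l k kl; rewrite xw ?(ltnW kl)// subrr normr0 exprn_ge0.
Qed.

(** A fixed path obeys the bounds on variance and on [zeta] for all large [n], so that eventually
    only the test against [lam] can stop it. The bound [n0] is chosen before [i] and [l], as the
    order of the limits demands. *)
Let good_ev w : energy_path w -> xi_ok w -> exists n0, forall n, (n0 <= n)%N -> forall i,
  \forall l \near \oo, forall b, grid_var (p l) (N l) (ac l) (uu l) (xx l) b w <= rr n /\
    `|zeta i l b w| <= rr n.
Proof.
move=> hw xw; have [m hm] := within_bounded T0 (ep_cont hw); have [b0 hb] := ep_M hw.
pose I2 := \int[mu]_(r in `[0, T]) nP r w ^+ 2.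
exists (Num.truncn (`|2 * I2 + 2| + `|m + 2 * (b0 + 1)|)).+1 => n nn' i.
have hn : `|2 * I2 + 2| + `|m + 2 * (b0 + 1)| <= rr n.
  by rewrite ltW// (lt_le_trans (truncnS_gt _))// ler_nat.
have n1 : 2 * I2 + 2 <= rr n.
  by apply: le_trans hn; rewrite (le_trans (ler_norm _))// lerDl.
have n2 : m + 2 * (b0 + 1) <= rr n.
  by apply: le_trans hn; rewrite (le_trans (ler_norm _))// lerDr.
have e1 := ep_ML hw; have e2 := ep_dl0 hw.
have e3 : \forall l \near \oo, \int[mu]_(r in `[0, T]) dl l r w ^+ 2 <= 1.
  move/cvgrPdist_lt : e2 => /(_ 1 ltr01); apply: filterS => l.
  by rewrite sub0r normrN => h1; rewrite ltW// (le_lt_trans (ler_norm _)).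
near=> l => b; split.
  have dl1 : \int[mu]_(r in `[0, T]) dl l r w ^+ 2 <= 1 by near: l.
  rewrite gridV//; have /andP[_ pbT] := pT l b.
  have ge r : 0 <= gl l r w by exact: (gram_form_ge0 e).
  apply: (le_trans (Rintegral_itv_mono (igl hw l) (p0 l b) pbT (fun r _ => ge r))).
  have i1 := ep_P2 hw; have i2 := ep_dl2 hw l.
  have i3 := rintD mT (rintZl mT 2 i1) (rintZl mT 2 i2).
  apply: (@le_trans _ _ (\int[mu]_(r in `[0, T]) (2 * nP r w ^+ 2 + 2 * dl l r w ^+ 2))).
    apply: (le_Rintegral mT (igl hw l) i3) => r; rewrite /= in_itv/= => rT.
    apply: le_trans (ep_gram hw l rT) _; have := sqr_ge0 (nP r w - dl l r w).
    by rewrite sqrrB sqrrD; lra.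
  rewrite (RintegralD mT (rintZl mT 2 i1) (rintZl mT 2 i2)) (RintegralZl _ mT i1) (RintegralZl _ mT i2).
  by rewrite -/I2; lra.
have hMl : forall t, 0 <= t <= T -> `|M t w - ML l t w| <= 4^-1 ^+ l by near: l.
have ML1 t : 0 <= t <= T -> `|ML l t w| <= b0 + 1.
  move=> tT; rewrite -[ML l t w](subKr (M t w)) (le_trans (ler_normB _ _))// lerD ?hb//.
  by rewrite (le_trans (hMl t tT))// exprn_ile1// ?invr_ge0// invf_le1// ler1n.
apply: le_trans n2; rewrite /zeta (le_trans (ler_normD _ _))// lerD//.
  rewrite (le_trans (resolvent_contract j _ (sn0 i)))// xw; last by have [/ltnW] := kkP l b.
  exact: hm (dyT l b).
by rewrite (le_trans (ler_normB _ _))// mulr_natl mulr2n lerD// ML1// dyT.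
Unshelve. all: end_near.
Qed.

(** If only the test against [lam] can fail, crossing [lam] at any node leaves the stopped energy at
    least [lam]. *)
Let stop_exceed n i l b w : w \in C -> (b <= nn l)%N ->
  (forall c, grid_var (p l) (N l) (ac l) (uu l) (xx l) c w <= rr n /\ `|zeta i l c w| <= rr n) ->
  lam < grid_energy W (p l) (N l) (ac l) (uu l) (xx l) (wt l) (zeta i l) b w -> lam <= SE n i l w.
Proof.
move=> wC bn gd lb; rewrite /SE /stopped_energy; have [b' [b'n -> bb bg]] := grid_ok_stop W (p l) (N l) (ac l) (uu l) (xx l) (wt l) (zeta i l)
  (rr n) (rr n) lam (grid_term W (p l) (N l) (ac l) (uu l) (xx l) (wt l) (zeta i l) ^~ w) (nn l) wC.
case: bb => [b'E|nb].
  have [blt|blt] := ltnP b b'; first by have /and3P[_ _] := bg b blt; rewrite leNgt lb.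
  have -> : b' = b by apply/eqP; rewrite eqn_leq blt b'E bn.
  exact: ltW.
move: nb; rewrite /grid_good; have [-> _] := gd b'.+1; have [_ ->] := gd b'.
by rewrite /= -ltNge => /ltW.
Qed.

Let nearest l t : 0 <= t <= T -> exists2 k, (k <= 2 ^ l)%N & `|dyadic T l k - t| <= T * 2^-1 ^+ l.
Proof.
move=> tT; have [//|//|k _|k kl [k1 k2]] := @grid_cell R T l (fun=> t) 0%N (ltW T0).
  by apply/orP; rewrite le_total.
exists k; first exact: ltnW.
rewrite distrC ger0_norm ?subr_ge0// lerBlDl (le_trans k2)//.
rewrite /dyadic -natr1 exprVn mulrDr mulr1 mulrDl lexx.
by [].
Qed.

Let QI_cont i w : energy_path w -> {within `[0, T], continuous (QI i ^~ w)}.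
Proof.
move=> hw; have cE : {within `[0, T], continuous (fun t => E t w)}.
  apply: (within_comp (F := fun x : R => expR (- x) : R)).
    exact: (parameterized_integral_continuous (ltW T0) (ep_gam hw)).
  move=> x; apply: continuous_comp; [exact: opp_continuous|exact: continuous_expR].
have cq := within_comp (ep_cont hw) (@resolvent_form_continuous _ _ _ j _ (sn0 i)).
have iE : itg (fun r => E r w * th r w).
  apply: (@rint_bounded_mul _ _ _ mu _ mT 1 (fun r => E r w) (th ^~ w)) (ep_th hw).
    by apply: subspace_continuous_measurable_fun; first exact: measurable_itv.
  by move=> r _; rewrite ger0_norm ?weight_le1// ltW ?weight_gt0.
have cI := parameterized_integral_continuous (ltW T0) iE.
move=> t; apply: cvgD; last exact: cI.
by apply: cvgM; [exact: cE|exact: cq].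
Qed.

(** A maximal inequality of Doob type without any measurability in [t]. By [pathwise_energy] the
    stopped energy is at least [- D] up to errors, and at least [lam] up to errors on the paths
    whose weighted energy exceeds [lam + D]; its cut-off mean is at most [n^3 / (n + 1)^4]. The
    conclusion is [triple_fatou]. *)
Theorem energy_maximal :
  (lam%:E * mu_ext P [set w | C w /\ exists2 t : R, (0 <= t <= T)%R & (lam + D w < weighted_energy t w)%R] <=
   (\int[P]_w D w)%:E)%E.
Proof.
apply: (triple_fatou (Y := fun n i l w => Num.max (SE n i l w) (- KK n)) (K := KK)
  (del := fun n => rr n ^+ 2 * rr n / (KK n - rr n))) => //.
- by move=> n; rewrite addr_ge0// exprn_ge0.
- by move=> n i l; have [] := SEmax n i l.
- by move=> n i l w; rewrite le_max lexx orbT.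
- by move=> n i l; have [] := SEmax n i l.
- apply: (@squeeze_cvgr _ _ _ _ (fun=> 0) (fun n => n.+1%:R^-1 : R)).
  + apply: nearW => n; have n0 : 0 <= rr n by [].
    rewrite /KK addrAC subrr add0r divr_ge0 ?mulr_ge0 ?exprn_ge0//=.
    rewrite ler_pdivrMr ?exprn_gt0// -ler_pdivrMl ?invr_gt0// invrK.
    rewrite mulrC -[X in X * n.+1%:R]exprSr.
    rewrite [leRHS](_ : _ = n.+1%:R ^+ 3 * n.+1%:R); last by rewrite -exprSr.
    by rewrite ler_pM ?exprn_ge0// lerXn2r ?nnegrE ?ler_nat//.
  + exact: cvg_cst.
  + exact: cvg_harmonic.
- have h1 := hpath; have h2 := xi_ae; have h3 := hD.
  move: h1 h2 h3; apply: filterS3 => w hw xw Dw n ep ep0.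
  have e4 : 0 < ep / 4 by rewrite divr_gt0.
  near=> i; have dfi : df i w < ep / 4.
    near: i; have := df_cvg hw => /cvgrPdist_lt/(_ _ e4); apply: filterS => i.
    by rewrite sub0r normrN; apply: le_lt_trans; exact: ler_norm.
  near=> l; have pl : forall t, 0 <= t <= T ->
    QI i t w <= `|x0 w| ^+ 2 + \int[mu]_(r in `[0, T]) f r w + df i w + AE i l t w + ep / 4.
    by near: l; exact: path_l.
  rewrite le_max; apply/orP; left; have [wC|wC] := boolP (w \in C); last first.
    by rewrite /SE stopped_energy_notin//; have := D0 w; lra.
  rewrite /SE; have [b [bn -> _]] := stopped_energyP W (p l) (N l) (ac l) (uu l) (xx l) (wt l) (zeta i l) (rr n) (rr n) lam (nn l) wC.
  rewrite gridE//; have := pl _ (pT l b); have := Dw (set_mem wC).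
  (* The energy on the left of [path_l] is nonnegative, so the discrete martingale cannot fall below
     [- D] by more than the errors, wherever the path is stopped. *)
  have : 0 <= QI i (p l b) w.
    rewrite addr_ge0 ?mulr_ge0 ?(ltW (weight_gt0 _ _))//; first exact: resolvent_form_ge0.
    by apply: Rintegral_itv_ge0 => r _; rewrite mulr_ge0// ltW// weight_gt0.
  by move: dfi; lra.
have h1 := hpath; have h2 := xi_ae; have h3 := hD.
move: h1 h2 h3; apply: filterS3 => w hw xw Dw [Cw [t tT ht]].
have [n0 hn0] := good_ev hw xw; exists n0 => // n /= nn0 ep ep0.
pose de := weighted_energy t w - (lam + D w).
have de0 : 0 < de by rewrite subr_gt0.
(* The excess [de] pays for four errors of [de / 8]: the defect, the replacement of [|h|^2] by the
   form, the error of [path_l], and the passage from [t] to a nearby dyadic node. *)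
have d8 : 0 < de / 8 by rewrite divr_gt0.
near=> i.
have dfi : df i w < de / 8.
  near: i; have := df_cvg hw => /cvgrPdist_lt/(_ _ d8); apply: filterS => i.
  by rewrite sub0r normrN; apply: le_lt_trans; exact: ler_norm.
have qi : weighted_energy t w - de / 8 < QI i t w.
  have : `|h t w| ^+ 2 - resolvent_form j (sn i) (h t w) < de / 8.
    near: i; have : resolvent_form j (sn i) (h t w) @[i --> \oo] --> `|h t w| ^+ 2 by exact: resolvent_form_cvg.
    move=> /cvgrPdist_lt/(_ _ d8); apply: filterS => i.
    by apply: le_lt_trans; exact: ler_norm.
  have qle := resolvent_form_le j (h t w) (sn0 i).
  rewrite /weighted_energy /QI => h1; rewrite addrAC ltrD2r ltrBlDr -ltrBlDl -mulrBr.
  by apply: le_lt_trans h1; rewrite ler_piMl ?subr_ge0// weight_le1.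
have [del del0 hdel] := segment_uniform (@QI_cont i w hw) d8.
near=> l.
have pl : forall t, 0 <= t <= T ->
  QI i t w <= `|x0 w| ^+ 2 + \int[mu]_(r in `[0, T]) f r w + df i w + AE i l t w + de / 8.
  by near: l; exact: path_l.
have gd : forall b, grid_var (p l) (N l) (ac l) (uu l) (xx l) b w <= rr n /\ `|zeta i l b w| <= rr n.
  by near: l; exact: hn0.
have sm : T * 2^-1 ^+ l < del.
  near: l; have : (T * 2^-1 ^+ l : R) @[l --> \oo] --> T * 0.
    by apply: cvgMr; apply: cvg_expr; rewrite ger0_norm ?invr_ge0// invf_lt1// ltr1n.
  rewrite mulr0 => /cvgrPdist_lt/(_ _ del0); apply: filterS => l.
  by rewrite sub0r normrN; apply: le_lt_trans; exact: ler_norm.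
rewrite le_max; apply/orP; left.
have [k kl kt] := nearest l tT.
have kT : 0 <= dyadic T l k <= T by rewrite dyadic_ge0 dyadic_le.
have [b bn pb] := grid_node (p00 l) (pn l) kT (fun b => pdy b kl).
have Qk := hdel _ _ kT tT (le_lt_trans kt sm).
have lb : lam < grid_energy W (p l) (N l) (ac l) (uu l) (xx l) (wt l) (zeta i l) b w.
  rewrite gridE// pb; have := pl _ kT; have := Dw Cw.
  move: Qk; rewrite ltr_norml => /andP[Qk _].
  have deE : weighted_energy t w = lam + D w + de by rewrite /de addrC subrK.
  by move: Qk qi dfi deE; lra.
have := stop_exceed (mem_set Cw) bn gd lb; apply: le_trans.
by rewrite gerBl ltW.
Unshelve. all: end_near.
Qed.

End energy_maximal.

(** * Integrals of non-measurable functions and outer measure *)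

Section nonmeasurable_integrand.
Context (R : realType) d (T : measurableType d) (mu : {measure set T -> \bar R}).
Local Open Scope ereal_scope.

(** The integral of a nonnegative function is a supremum over the simple functions below it, so
    monotonicity costs no measurability. *)
Lemma ge0_le_integral_sup (D : set T) (f g : T -> \bar R) :
  (forall x, D x -> 0 <= f x) -> (forall x, D x -> f x <= g x) ->
  \int[mu]_(x in D) f x <= \int[mu]_(x in D) g x.
Proof.
move=> f0 fg; have g0 x : D x -> 0 <= g x by move=> Dx; rewrite (le_trans (f0 _ Dx))// fg.
rewrite !ge0_integralE//; apply: le_ereal_sup => _ [k kf <-]; exists k => // x.
by rewrite (le_trans (kf x))//; apply: lee_restrict.
Qed.

(** The smaller function is set to zero on the exceptional null set, which leaves its integral
    unchanged by measurability; then pointwise monotonicity applies. *)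
Lemma ae_le_integral_sup (D : set T) (f g : T -> \bar R) : measurable D -> measurable_fun D f ->
  (forall x, D x -> 0 <= f x) -> (forall x, D x -> 0 <= g x) ->
  (\forall x \ae mu, D x -> f x <= g x) ->
  \int[mu]_(x in D) f x <= \int[mu]_(x in D) g x.
Proof.
move=> mD mf f0 g0 [N [mN N0 hN]].
have mk : measurable_fun D (f \_ (~` N)).
  by apply/(measurable_restrict _ (measurableC mN) mD); apply: measurable_funS mf => // x [].
have k0 x : D x -> 0 <= (f \_ (~` N)) x.
  by move=> Dx; rewrite /patch; case: ifPn => // _; exact: f0.
rewrite (_ : \int[mu]_(x in D) f x = \int[mu]_(x in D) (f \_ (~` N)) x); last first.
  apply: ge0_ae_eq_integral => //; exists N; split => // x /= h; apply: contrapT => Nx; apply: h => _.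
  by rewrite /patch mem_set.
apply: ge0_le_integral_sup => // x Dx; rewrite /patch; case: ifPn => [|_]; last exact: g0.
by rewrite inE /= => Nx; apply: contrapT => h; apply: Nx; apply: hN => /= /(_ Dx).
Qed.

End nonmeasurable_integrand.

Section outer_hull.
Context (R : realType) d (Omega : measurableType d) (P : probability Omega R).
Local Open Scope ereal_scope.

Lemma mu_ext_hull (A : set Omega) (x : \bar R) : mu_ext P A < x ->
  exists B, [/\ measurable B, A `<=` B & P B < x].
Proof.
move=> /ereal_inf_lt[_ [F [mF AF] <-] h].
exists (\bigcup_k F k); split => //; first exact: bigcup_measurable.
apply: le_lt_trans h; apply: measure_sigma_subadditive => //.
exact: bigcup_measurable.
Qed.

(** Each set is enlarged to a measurable hull of probability below [2 ^ - l], to which the classical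
    argument applies. *)
Lemma outer_borel_cantelli (A : nat -> set Omega) :
  (forall l, mu_ext P (A l) < (2^-1 ^+ l)%:E) ->
  \forall w \ae P, \forall l \near \oo, ~ A l w.
Proof.
move=> hA; have /choice[B hB] := fun l => mu_ext_hull (hA l).
have mB l : measurable (B l) by have [] := hB l.
exists (lim_sup_set B); split.
- by apply: bigcap_measurable => // k _; apply: bigcup_measurable.
- apply: lim_sup_set_cvg0 => //.
  apply: (@le_lt_trans _ _ (\sum_(n <oo) (2 / (2 ^ (n + 1))%:R)%:E)); last first.
    by rewrite (cvg_lim _ (@cvg_geometric_eseries_half R 2 0))// ltry.
  apply: lee_nneseries => // n _; have [_ _ /ltW h] := hB n.
  rewrite (le_trans h)// lee_fin addn1 natrX exprS invfM mulrA divff// mul1r exprVn.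
  by [].
- move=> w /= h k _ /=; apply: contrapT => nB; apply: h.
  exists k => // l kl Al; apply: nB; exists l => //.
  by have [_ + _] := hB l; apply.
Qed.

End outer_hull.

(** * Elementary integrands as Hilbert-Schmidt operators *)

Section hs_operators.
Context (R : realType) (U H : hilbertType R) (e : onb U).

Lemma hs_sq_norm (f : hs H e) : hs_sq e f = (`|f| ^+ 2)%:E.
Proof.
have /asboolP fe := hsP f.
rewrite /Num.norm/= /hs_norm sqr_sqrtr ?fine_ge0 ?hs_sq_ge0// fineK// ge0_fin_numE//.
exact: hs_sq_ge0.
Qed.

(** The factor [2] comes from estimating [||u|^2 - sum|] by [|u|^2]; the bound serves to show that
    operators of rank one have a finite Hilbert-Schmidt norm. *)
Lemma bessel (l : seq U) (u : U) : uniq l -> (forall b, b \in l -> onb_set e b) ->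
  \sum_(b <- l) dotp u b ^+ 2 <= 2 * `|u| ^+ 2.
Proof.
move=> lU le; have := @proj_dotp_dist _ _ l u u.
have := @proj_best _ _ e l lU le [::] (fun=> 0) u.
rewrite big_nil subr0 => h1 h2.
have h3 : `|u - \sum_(b <- l) dotp u b *: b| * `|u| <= `|u| * `|u|.
  by rewrite ler_wpM2r// h1.
move: (le_trans h2 h3); rewrite dotpE ler_norml -expr2 => /andP[h4 _].
by under eq_bigr do rewrite expr2; lra.
Qed.

Fact rank_one_bop (u : U) (x : H) : (fun z => dotp u z *: x) \in @bounded_op R U H.
Proof.
apply/asboolP; split=> [a y z|]; first by rewrite dotpDr dotpZr scalerDl scalerA.
exists (`|u| * `|x|) => z.
by rewrite normrZ -mulrA (mulrC `|x|) mulrA ler_wpM2r// dotp_le.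
Qed.

Fact rank_one_hs (u : U) (x : H) : Bop (rank_one_bop u x) \in hs_op e.
Proof.
apply/asboolP; apply: (@le_lt_trans _ _ (2 * `|u| ^+ 2 * `|x| ^+ 2)%:E); last exact: ltry.
apply: ge_ereal_sup => _ [F [finF Fe] <-] /=.
rewrite fsbig_finite//= sumEFin lee_fin.
under eq_bigr do rewrite normrZ exprMn real_normK ?num_real//.
rewrite -mulr_suml ler_wpM2r ?sqr_ge0// bessel//; first exact: finmap.fset_uniq.
by move=> b; rewrite in_fset_set// inE => /Fe.
Qed.

Definition rank_one (u : U) (x : H) : hs H e := Hs (rank_one_hs u x).

End hs_operators.

Section step_operators.
Context (R : realType) (U H : hilbertType R) (e : onb U) d (Omega : measurableType d).

Section one_list.
Context (N : nat) (S : nat -> step Omega U H).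

Definition step_coef (i : nat) (r : R) (w : Omega) : R :=
  \1_(`]step_lo (S i), step_hi (S i)]) r * \1_(step_ev (S i)) w.

Definition step_op (r : R) (w : Omega) : hs H e :=
  \sum_(i < N) step_coef i r w *: rank_one e (step_dir (S i)) (step_val (S i)).

Lemma hs_sumE (I : Type) (s : seq I) (F : I -> hs H e) z :
  (\sum_(i <- s) F i) z = \sum_(i <- s) F i z.
Proof.
elim: s => [|i s IH]; first by rewrite !big_nil.
by rewrite !big_cons -IH.
Qed.

Lemma step_opE r w z : step_op r w z = step_process N S r w z.
Proof.
rewrite /step_op hs_sumE; apply: eq_bigr => i _ /=.
by rewrite -scalerA.
Qed.

Lemma step_op_path w : strongly_mfun measurable setT (fun r => step_op r w).
Proof.
rewrite /step_op; elim: (index_enum _) => [|i s IH].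
  under eq_fun do rewrite big_nil; exact: strongly_mfun_cst.
under eq_fun do rewrite big_cons.
apply: strongly_mfunD => //.
pose c : hs H e := \1_(step_ev (S i)) w *: rank_one e (step_dir (S i)) (step_val (S i)).
have mI : measurable (`]step_lo (S i), step_hi (S i)] : set R) by exact: measurable_itv.
have := @strongly_mfun_patch R _ _ _ setT _ (fun=> c) mI (strongly_mfun_cst _ c) (fun _ _ => I).
apply: eq_strongly_mfun => r _; rewrite /step_coef indicE; case: ifP => _.
  by rewrite mul1r.
by rewrite mul0r scale0r.
Qed.

Lemma step_op_bounded w : exists b, forall r, `|step_op r w| <= b.
Proof.
exists (\sum_(i < N) `|rank_one e (step_dir (S i)) (step_val (S i))|) => r.
apply: (le_trans (ler_norm_sum _ _ _)); apply: ler_sum => i _.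
rewrite normrZ ler_piMl// normrM mulr_ile1// ?indicE ?normr_nat ?lern1 ?leq_b1//.
Qed.

End one_list.

Lemma step_gram_le_op N (S : nat -> step Omega U H) r w :
  step_gram N S r w <= `|step_op N S r w| ^+ 2.
Proof.
rewrite -lee_fin -hs_sq_norm (le_trans (gram_form_le_hs e _ _ _ _))// le_eqVlt; apply/orP; left; apply/eqP.
by congr (hs_sq e _); apply/funext => z; rewrite step_opE.
Qed.

Lemma step_gram_le_sum N (S : nat -> step Omega U H) (f : hs H e) r w :
  step_gram N S r w <= (`|f| + `|f - step_op N S r w|) ^+ 2.
Proof.
apply: (le_trans (step_gram_le_op _ _ _ _)); rewrite lerXn2r ?nnegrE ?addr_ge0//.
by rewrite -[X in `|X| <= _](subKr f) (le_trans (ler_normB _ _)).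
Qed.

Section difference.
Context (N1 N2 : nat) (S1 S2 : nat -> step Omega U H).

Definition step_opp (s : step Omega U H) : step Omega U H :=
  Step (step_lo s) (step_hi s) (step_ev s) (step_dir s) (- step_val s).

(** The first list followed by the second with opposite values, so that the difference of two
    elementary integrands is again elementary. *)
Definition step_diff (i : nat) : step Omega U H :=
  if (i < N1)%N then S1 i else step_opp (S2 (i - N1)).

Lemma step_diff_sum (X : zmodType) (F : step Omega U H -> X) :
  (forall s, F (step_opp s) = - F s) ->
  \sum_(i < N1 + N2) F (step_diff i) = \sum_(i < N1) F (S1 i) - \sum_(i < N2) F (S2 i).
Proof.
move=> FN; rewrite big_split_ord/= -sumrN; congr (_ + _); apply: eq_bigr => i _.
  by rewrite /step_diff ltn_ord.
by rewrite /step_diff ltnNge leq_addr/= addKn FN.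
Qed.

Lemma step_diff_op r w :
  step_op (N1 + N2) step_diff r w = step_op N1 S1 r w - step_op N2 S2 r w.
Proof.
rewrite /step_op -(step_diff_sum (F := fun s => (\1_(`]step_lo s, step_hi s]) r * \1_(step_ev s) w) *:
  rank_one e (step_dir s) (step_val s)))// => s /=.
rewrite -scalerN; congr (_ *: _); apply/val_inj/val_inj/funext => z /=.
by rewrite scalerN.
Qed.

Lemma step_diff_integral (W : R -> U -> Omega -> R) t w :
  step_integral W (N1 + N2) step_diff t w = step_integral W N1 S1 t w - step_integral W N2 S2 t w.
Proof.
rewrite /step_integral -(step_diff_sum (F := fun s => (\1_(step_ev s) w *
    (W (Num.min (step_hi s) t) (step_dir s) w - W (Num.min (step_lo s) t) (step_dir s) w)) *: step_val s))//.
by move=> s /=; rewrite scalerN.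
Qed.

Lemma step_diff_adapted (Fil : R -> set (set Omega)) : (forall i, adapted_step Fil (S1 i)) ->
  (forall i, adapted_step Fil (S2 i)) -> forall i, adapted_step Fil (step_diff i).
Proof. by move=> h1 h2 i; rewrite /step_diff; case: ifP => _; [exact: h1|exact: (h2 (i - N1)%N)]. Qed.

End difference.

Lemma step_integral0 (W : R -> U -> Omega -> R) N (S : nat -> step Omega U H) w :
  (forall i, 0 <= step_lo (S i) <= step_hi (S i)) -> step_integral W N S 0 w = 0.
Proof.
move=> h; rewrite /step_integral big1// => i _; have /andP[lo0 lohi] := h i.
by rewrite !min_r// ?subrr ?mulr0 ?scale0r// (le_trans lo0).
Qed.

Lemma step_integral_bounded (W : R -> U -> Omega -> R) N (S : nat -> step Omega U H) (T : R) w : 0 < T ->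
  (forall i, 0 <= step_lo (S i) <= step_hi (S i)) ->
  (forall i, {within [set t : R | 0 <= t], continuous (fun t : R => W t (step_dir (S i)) w)}) ->
  exists b, forall t, 0 <= t <= T -> `|step_integral W N S t w| <= b.
Proof.
move=> T0 lohi cW.
have hb i : exists m, forall t, 0 <= t <= T -> `|W t (step_dir (S i)) w| <= m.
  apply: (within_bounded T0 (X := R^o)); apply: continuous_subspaceW (cW i) => t /=.
  by rewrite in_itv/= => /andP[].
have /choice[m hm] := hb.
exists (\sum_(i < N) (2 * m i) * `|step_val (S i)|) => t /andP[t0 tT].
apply: (le_trans (ler_norm_sum _ _ _)); apply: ler_sum => i _.
rewrite normrZ ler_wpM2r//; have /andP[lo0 lh] := lohi i.
have inT y : 0 <= y -> 0 <= Num.min y t <= T.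
  by move=> y0; rewrite le_min y0 t0 ge_min tT orbT.
have m0 : `|W (Num.min (step_hi (S i)) t) (step_dir (S i)) w -
    W (Num.min (step_lo (S i)) t) (step_dir (S i)) w| <= 2 * m i.
  rewrite (le_trans (ler_normB _ _))// mulr_natl mulr2n lerD// hm// inT//.
  exact: le_trans lh.
apply: le_trans m0; rewrite normrM ler_piMl// indicE normr_nat lern1.
by case: (_ \in _).
Qed.

End step_operators.

(** * The paths of a global solution *)

Fact eval_bop (R : realType) (X Y : normedModType R) (y : X) :
  (fun f : bop X Y => f y) \in @bounded_op R (bop X Y) Y.
Proof.
apply/asboolP; split=> [//|]; exists `|y| => f.
by rewrite mulrC bop_norm_le.
Qed.

Lemma bop_eval_continuous (R : realType) (X Y : normedModType R) (y : X) :
  continuous (fun f : (bop X Y : normedModType R) => f y).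
Proof. exact: (@bop_continuous _ _ _ (Bop (@eval_bop R X Y y))). Qed.

Section bochner_pairing.
Context (R : realType).
Local Notation mu := (@lebesgue_measure R).

Lemma segment_finite (a b : R) : (mu `[a, b] < +oo)%E.
Proof. by rewrite /= lebesgue_measure_itv; case: ifP => _; rewrite /= ?ltry// -EFinB ltry. Qed.

Lemma finite_range_bounded (T : Type) (X : normedModType R) (s : T -> X) :
  finite_set (range s) -> exists b, forall r, `|s r| <= b.
Proof.
move=> /finite_seqP[l lE]; exists (\sum_(x <- l) `|x|) => r.
have : s r \in l by have : range s (s r) by [exists r]; rewrite lE.
elim: l {lE} => // x l IH; rewrite inE big_cons => /orP[/eqP->|/IH h].
  by rewrite lerDl sumr_ge0.
by rewrite (le_trans h)// lerDr.
Qed.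

Lemma simple_pairing (V : normedModType R) (t : R) (s : R -> dual V) y : let D := `[0, t]%classic in
  finite_set (range s) -> (forall x, measurable (s @^-1` [set x])) ->
  (\sum_(x \in range s) fine (mu (D `&` s @^-1` [set x])) *: x) y = \int[mu]_(r in D) s r y.
Proof.
move=> D fs ms; have mD := measurable_segment 0 t; have fD := segment_finite 0 t; rewrite fsbig_finite//=.
set l := finmap.enum_fset _; have lu : uniq l by exact: finmap.fset_uniq.
have sl r : s r \in l by rewrite in_fset_set// inE; exists r.
have E r : s r y = \sum_(x <- l) x y * \1_(s @^-1` [set x]) r.
  rewrite (bigD1_seq (s r))//= indicE mem_set// mulr1 big1 ?addr0// => x xs.
  by rewrite indicE memNset ?mulr0// => /= sx; rewrite sx eqxx in xs.
under [RHS]eq_Rintegral do rewrite E.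
have ri x : rint mu D (\1_(s @^-1` [set x]) : R -> R).
  apply: (rint_le mD (rint_cst mD 1 fD)).
    by apply: measurable_funTS; apply: measurable_indic; exact: ms.
  by move=> r _; rewrite indicE normr_nat lern1 leq_b1.
rewrite Rintegral_sum//; last by move=> x; exact: rintZl.
have -> (q : seq (dual V)) (F : dual V -> dual V) : (\sum_(x <- q) F x) y = \sum_(x <- q) F x y.
  by elim: q => [|x q IH]; rewrite ?big_nil// !big_cons bopDE IH.
have RI x : \int[mu]_(r in D) (\1_(s @^-1` [set x]) r : R) = fine (mu (D `&` s @^-1` [set x])).
  rewrite /Rintegral setIC; congr fine.
  by apply: (integral_indic mu mD); exact: ms.
apply: eq_bigr => x _; rewrite (RintegralZl _ mD (ri x)) RI.
by move: (fine _) => k; change (k * x y = x y * k); rewrite mulrC.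
Qed.

(** Evaluation at [y] is continuous on [V^*], so [I y] is the limit of the integrals of the simple
    functions evaluated at [y]. These also converge to the integral of [a r y], where [a] is a
    measurable version of [f]. *)
Lemma bochner_pairing (V : normedModType R) (t : R) (f a : R -> dual V) (I : dual V) y : let D := `[0, t]%classic in bochner_integral D f I ->
  strongly_mfun measurable D a -> (\forall r \ae mu, D r -> a r = f r) ->
  rint mu D (fun r => `|a r|) -> I y = \int[mu]_(r in D) a r y.
Proof.
move=> D; have mD := measurable_segment 0 t; have fD := segment_finite 0 t; case=> s [hs _ h0 hI] sa af ia.
have ss n : strongly_mfun measurable D (s n).
  by have [h1 h2] := hs n; apply: strongly_mfunS (simple_strongly_mfun h1 h2).
have ma : measurable_fun D (fun r => a r y).
  exact: (strongly_mfun_real (measurable_itv _) sa (@bop_eval_continuous _ _ _ y)).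
have msn n : rint mu D (fun r => s n r y).
  have [fs ms] := hs n; have [b hb] := finite_range_bounded fs.
  apply: (rint_le mD (rint_cst mD (`|b| * `|y|) fD)).
    exact: (measurable_funTS (measurable_simple_comp (fun x : dual V => x y : R) fs ms)).
  by move=> r _; rewrite (le_trans (bop_norm_le _ _))// ler_wpM2r// (le_trans (hb r))// ler_norm.
have ray : rint mu D (fun r => a r y).
  apply: (rint_le mD (rintZr mD `|y| ia)) => // r _; exact: bop_norm_le.
have rd n : rint mu D (fun r => `|a r - s n r|).
  have [fs ms] := hs n; have [b hb] := finite_range_bounded fs.
  apply: (rint_le mD (rintD mD ia (rint_cst mD `|b| fD))).
    by apply: strongly_mfun_norm => //; exact: strongly_mfunB.
  move=> r _; rewrite normr_id (le_trans (ler_normB _ _))// lerD2l.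
  by rewrite (le_trans (hb r))// ler_norm.
have d0 : \int[mu]_(r in D) `|a r - s n r| @[n --> \oo] --> 0.
  have : (\int[mu]_(r in D) (`|a r - s n r|)%:E)%E @[n --> \oo] --> 0%E.
    apply: (@squeeze_cvge _ _ _ _ (fun=> 0%E) _ _ _ _ _ h0); last exact: cvg_cst.
    apply: nearW => n; apply/andP; split; first exact: integral_ge0.
    apply: ae_le_integral_sup => //.
      by apply/measurable_EFinP; exact: rint_meas (rd n).
    apply: (@filterS _ _ (ae_filter_ringOfSetsType mu) _ _ _ af) => r h Dr.
    by rewrite h.
  by move/fine_cvg.
have c1 : (\sum_(x \in range (s n)) fine (mu (D `&` s n @^-1` [set x])) *: x) y @[n --> \oo] --> I y.
  exact: (continuous_cvg _ (@bop_eval_continuous _ V R^o y I) hI).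
have c2 : (\sum_(x \in range (s n)) fine (mu (D `&` s n @^-1` [set x])) *: x) y @[n --> \oo] -->
    \int[mu]_(r in D) a r y.
  apply/cvgrPdist_le => ep ep0; near=> n; have [fs ms] := hs n.
  rewrite simple_pairing// -(RintegralB mD ray (msn n)).
  apply: (@le_trans _ _ (\int[mu]_(r in D) (`|a r - s n r| * `|y|))).
    apply: (le_trans (le_normr_Rintegral mD (rintB mD ray (msn n)))).
    apply: le_Rintegral => //; [exact: rint_norm (rintB mD ray (msn n))|exact: rintZr|].
    by move=> r _; exact: (bop_norm_le (a r - s n r) y).
  under eq_Rintegral do rewrite mulrC.
  rewrite (RintegralZl _ mD (rd n)) mulrC; have c0 : 0 < `|y| + 1 by rewrite ltr_wpDl.
  apply: (@le_trans _ _ (\int[mu]_(r in D) `|a r - s n r| * (`|y| + 1))).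
    by rewrite ler_wpM2l ?lerDl// Rintegral_ge0.
  rewrite -ler_pdivlMr//; near: n.
  have e0 : 0 < ep / (`|y| + 1) by rewrite divr_gt0.
  move/cvgrPdist_le : d0 => /(_ _ e0); apply: filterS => n.
  by rewrite sub0r normrN; apply: le_trans; exact: ler_norm.
exact: (cvg_unique _ c1 c2).
Unshelve. all: end_near.
Qed.

End bochner_pairing.

Lemma dense_dotp_eq0 (R : realType) (V H : hilbertType R) (j : bop V H) (x : H) :
  gelfand_triple j -> (forall y, dotp x (j y) = 0) -> x = 0.
Proof.
move=> [_ dj] hx; suff : `|x| ^+ 2 <= 0 by rewrite exprn_even_le0//= normr_eq0 => /eqP.
rewrite -dotpE; apply/ler_addgt0Pr => ep ep0; rewrite add0r.
have c0 : 0 < `|x| + 1 by rewrite ltr_wpDl.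
have d0 := divr_gt0 ep0 c0.
have [z [zb [y _ yE]]] := dj (ball x (ep / (`|x| + 1))) (ex_intro _ x (@ballxx _ _ x _ d0)) (ball_open _ _).
have -> : dotp x x = dotp x (x - j y) by rewrite dotpBr hx subr0.
move: zb; rewrite -yE -ball_normE /= => zb; rewrite (le_trans (dotp_le_norm _ _))//.
apply: (@le_trans _ _ ((`|x| + 1) * `|x - j y|)); first by rewrite ler_wpM2r// lerDl.
by rewrite -ler_pdivlMl// mulrC ltW.
Qed.

Section path_tools.
Context (R : realType).
Local Notation mu := (@lebesgue_measure R).

Lemma rint_le_ae (T : R) (f g : R -> R) : rint mu `[0, T] g -> measurable_fun `[0, T] f ->
  (\forall r \ae mu, `[0, T]%classic r -> `|f r| <= g r) -> rint mu `[0, T] f.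
Proof.
move=> ig mf fg; have mT := measurable_segment 0 T; apply: rintP => //.
have := rint_lty ig; apply: le_lt_trans; apply: ae_le_integral_sup => //.
  by apply/measurable_EFinP; apply: measurableT_comp.
apply: (@filterS _ _ (ae_filter_ringOfSetsType mu) _ _ _ fg) => r h rT.
by rewrite lee_fin (le_trans (h rT))// ler_norm.
Qed.

(** Off a null set [f] is a limit of simple functions; there it is kept, and it is set to [0]
    elsewhere. *)
Lemma bochner_version (X : normedModType R) (D : set R) (f : R -> X) (I : X) :
  measurable D -> bochner_integral D f I ->
  exists2 a : R -> X, strongly_mfun measurable setT a & \forall r \ae mu, D r -> a r = f r.
Proof.
move=> mD [s [hs [N [mN N0 hN]] _ _]].
have mE : measurable (D `&` ~` N) by apply: measurableI => //; exact: measurableC.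
exists (fun r => if r \in D `&` ~` N then f r else 0).
  apply: strongly_mfun_patch mE _ (fun _ h => h).
  exists s; split => // r [Dr Nr]; apply: contrapT => h; apply: Nr; apply: hN => /= /(_ Dr).
  exact: h.
exists N; split => // r /= h; apply: contrapT => Nr; apply: h => Dr.
by rewrite mem_set.
Qed.

Lemma measurable_halfline_segment (f : R -> R) (T : R) :
  measurable_fun [set t : R | 0 <= t] f -> measurable_fun `[0, T] f.
Proof.
apply: measurable_funS => [|r /=]; last by rewrite in_itv/= => /andP[].
by rewrite (_ : [set _ | _] = `[0, +oo[%classic) //; apply/seteqP; split => r /=; rewrite in_itv/= andbT.
Qed.

Lemma L2_before_rint (X : normedModType R) (f : R -> X) (sigma : \bar R) (T : R) :
  (T%:E < sigma)%E -> measurable_fun [set t : R | 0 <= t] (fun t => `|f t|) ->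
  L2_before sigma f -> rint mu `[0, T] (fun r => `|f r| ^+ 2).
Proof.
move=> Ts mf h; have mT := measurable_segment 0 T.
have mf2 : measurable_fun `[0, T] (fun r => `|f r| ^+ 2).
  by apply: measurable_funX; exact: measurable_halfline_segment.
apply: rint_ge0P => //; apply: le_lt_trans h; rewrite integral_mkcond [leRHS]integral_mkcond.
apply: ae_le_integral_sup => //.
- by apply/(measurable_restrictT _ mT); apply/measurable_EFinP.
- by move=> r _; apply: erestrict_ge0 => z _; rewrite lee_fin sqr_ge0.
- by move=> r _; apply: erestrict_ge0 => z _; rewrite lee_fin sqr_ge0.
(* The two domains of integration can differ inside [[0, T]] only at time [0]. *)
exists [set 0]; split => //; first exact: lebesgue_measure_set1.
move=> r /= hr; apply: contrapT => r0; apply: hr => _; rewrite /patch.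
case: ifPn => [|_]; last by case: ifP => // _; rewrite lee_fin sqr_ge0.
rewrite inE /= in_itv/= => /andP[r1 r2]; rewrite mem_set//=; split.
  by rewrite lt_neqAle r1 andbT; apply/eqP => r0'; apply: r0.
by apply: le_lt_trans Ts; rewrite lee_fin.
Qed.

Lemma growth_rint (T m : R) (g x : R -> R) : measurable_fun `[0, T] g -> measurable_fun `[0, T] x ->
  rint mu `[0, T] (fun r => g r ^+ 2) -> rint mu `[0, T] (fun r => x r ^+ 2) ->
  rint mu `[0, T] (fun r => (m * (1 + g r) + x r) ^+ 2).
Proof.
move=> mg mx ig ix; have mT := measurable_segment 0 T.
have i1 : rint mu `[0, T] (fun r => (1 + g r) ^+ 2).
  apply: (rint_sqD mT _ mg) => //.
  by apply: rint_cst => //; exact: segment_finite.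
apply: (rint_sqD mT _ mx) => //.
  by apply: measurable_funM => //; apply: measurable_funD.
have E : (fun r => (m * (1 + g r)) ^+ 2) = (fun r => m ^+ 2 * (1 + g r) ^+ 2).
  by apply: funext => r; rewrite exprMn.
by rewrite E; exact: (rintZl mT (m ^+ 2) i1).
Qed.

End path_tools.

Section solution_data.
Context (R : realType) (V H U : hilbertType R) (e : onb U) (j : bop V H) (jtriple : gelfand_triple j).
Context d (Omega : measurableType d) (P : probability Omega R) (Fil : R -> set (set Omega)).
Context (W : R -> U -> Omega -> R) (hF : filtration Fil) (hW : cylindrical_BM P Fil W).
Context (c : coefs V H e Omega) (hc : critical_variational j P Fil c) (T : R) (T0 : 0 < T).
Local Notation mu := (@lebesgue_measure R).
Local Notation itg F := (rint mu `[0, T] F).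

(** The part of a global solution that enters the energy estimates, on one path. [a] is a measurable
    version of the drift. The rate [4 ^ - (l + 1)] keeps a factor [4] in reserve: the difference of
    two solutions adds two such errors and must stay below [4 ^ - l]. *)
Record solution_path (u0 : Omega -> H) (u : process V H Omega) (v : R -> Omega -> V)
    (M : R -> Omega -> H) (a : R -> Omega -> dual V) (N : nat -> nat)
    (S : nat -> nat -> step Omega U H) (w : Omega) : Prop := SolutionPath {
  sp_cont : {within `[0, T], continuous (inH u ^~ w)} ;
  sp_start : inH u 0 w = u0 w ;
  sp_v : forall r, v r w = inV u r w ;
  sp_jv : \forall r \ae mu, `[0, T]%classic r -> j (v r w) = inH u r w ;
  sp_v2 : itg (fun r => `|v r w| ^+ 2) ;
  sp_a : strongly_mfun measurable `[0, T] (a ^~ w) ;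
  sp_aA : \forall r \ae mu, `[0, T]%classic r -> a r w = cA j c r w (v r w) ;
  sp_a2 : itg (fun r => `|a r w| ^+ 2) ;
  sp_eq : forall y t, 0 <= t <= T ->
    dotp (inH u t w - u0 w) (j y) + \int[mu]_(r in `[0, t]) a r w y = dotp (M t w) (j y) ;
  sp_b : strongly_mfun measurable `[0, T] (fun r => cB j c r w (v r w)) ;
  sp_b2 : itg (fun r => `|cB j c r w (v r w)| ^+ 2) ;
  sp_dl : \int[mu]_(r in `[0, T]) `|cB j c r w (v r w) - step_op e (N l) (S l) r w| ^+ 2 @[l --> \oo] --> 0 ;
  sp_ML : \forall l \near \oo, forall t, 0 <= t <= T ->
    `|M t w - step_integral W (N l) (S l) t w| <= 4^-1 ^+ l.+1 ;
  sp_M : exists b, forall t, 0 <= t <= T -> `|M t w| <= b }.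

Let mT := measurable_segment 0 T.

(** For large [l] the localising time [s l] exceeds [T], so the strong solution on [[0, s l]] covers
    [[0, T]]. The path is bounded in [H], so the growth bounds make the drift and the diffusion
    square integrable in time. *)
Lemma good_path (u0 : Omega -> H) (u : process V H Omega) (sigma : Omega -> \bar R)
    (s : nat -> Omega -> \bar R) (Mn : nat -> R -> Omega -> H) (N : nat -> nat)
    (S : nat -> nat -> step Omega U H) (K : R -> R) (w : Omega) (l0 : nat) :
  {homo K : x y / x <= y} -> (forall l i, adapted_step Fil (S l i)) ->
  strongly_prog Fil (before sigma (inV u)) -> sigma w = +oo%E ->
  (forall l, strongly_prog Fil (before (s l) (fun t w => cB j c t w (inV u t w)))) ->
  (forall l, (l0 <= l)%N -> [/\ (T%:E < s l w)%E,
     regular_path j (s l w) (inV u ^~ w) (inH u ^~ w),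
     forall t : R, 0 <= t -> (t%:E < s l w)%E ->
          exists2 I : dual V,
            bochner_integral `[0, t] (fun s => cA j c s w (inV u s w)) I &
            gelfand j (inH u t w - u0 w) + I = gelfand j (Mn l t w),
     (\int[mu]_(t in `[0%R, T])
        hs_sq e (fun x => (before (s l) (fun t w => cB j c t w (inV u t w)) t w x - step_process (N l) (S l) t w x)%R) <= (4^-1 ^+ l.+1)%R%:E)%E &
     (ereal_sup [set (`|Mn l t w - step_integral W (N l) (S l) t w|)%R%:E | t in `[0%R, T]] <= (4^-1 ^+ l.+1)%R%:E)%E]) ->
  (forall t (u : V), 0 <= t <= T -> `|cA j c t w u| <= K `|j u| * (1 + `|u|) + `|cf c t w| /\
    `|cB j c t w u| <= K `|j u| * (1 + `|u|) + `|cg c t w|) ->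
  measurable_fun [set t : R | 0 <= t] (fun t => `|cf c t w|) ->
  measurable_fun [set t : R | 0 <= t] (fun t => `|cg c t w|) ->
  itg (fun t => `|cf c t w| ^+ 2) -> itg (fun t => `|cg c t w| ^+ 2) ->
  (forall l i, {within [set t : R | 0 <= t], continuous (fun t : R => W t (step_dir (S l i)) w)}) ->
  exists M a, solution_path u0 u (before sigma (inV u)) (fun t _ => M t) (fun t _ => a t) N S w.
Proof.
move=> Kmono aS sv soo sPhi hl gr mf mg if2 ig2 cW.
set v := before sigma (inV u).
have vE r : v r w = inV u r w by rewrite /v /before soo ltry.
have sub0 : `[0, T] `<=` [set t : R | 0 <= t] by move=> r /=; rewrite in_itv/= => /andP[].
have svp := strongly_prog_path hF w sv.
have mv0 : measurable_fun [set t : R | 0 <= t] (fun t => `|v t w|).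
  apply: strongly_mfun_norm svp.
  by rewrite (_ : [set _ | _] = `[0, +oo[%classic) //; apply/seteqP; split => r /=; rewrite in_itv/= andbT.
have mv : measurable_fun `[0, T] (fun t => `|v t w|) by exact: measurable_halfline_segment.
have [Ts [L2v [k ck kh] jv] eqn _ _] := hl l0 (leqnn _).
have inT r : `[0, T]%classic r -> 0 <= r /\ (r%:E < s l0 w)%E.
  by rewrite /= in_itv/= => /andP[r0 rT]; split => //; apply: le_lt_trans Ts; rewrite lee_fin.
have ch : {within `[0, T], continuous (inH u ^~ w)}.
  apply: (@subspace_eq_continuous _ _ _ k).
    by move=> r /set_mem /inT[r0 rs]; exact: kh.
  apply: continuous_subspaceW ck => r /inT[r0 rs]; split => //; exact: ltW.
have jvT : \forall r \ae mu, `[0, T]%classic r -> j (v r w) = inH u r w.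
  apply: (@filterS _ _ (ae_filter_ringOfSetsType mu) _ _ _ jv) => r hr /inT[r0 rs].
  by rewrite vE hr.
have v2 : itg (fun r => `|v r w| ^+ 2).
  apply: (L2_before_rint Ts mv0); rewrite /L2_before.
  by under eq_integral do rewrite vE.
have [m hm] := within_bounded T0 ch.
have gra : \forall r \ae mu, `[0, T]%classic r ->
    `|cA j c r w (v r w)| <= K m * (1 + `|v r w|) + `|cf c r w| /\
    `|cB j c r w (v r w)| <= K m * (1 + `|v r w|) + `|cg c r w|.
  apply: (@filterS _ _ (ae_filter_ringOfSetsType mu) _ _ _ jvT) => r hr rT.
  have rT' : 0 <= r <= T by move: rT; rewrite /= in_itv.
  have [h1 h2] := gr r (v r w) rT'.
  have hK : K `|j (v r w)| * (1 + `|v r w|) <= K m * (1 + `|v r w|).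
    by apply: ler_wpM2r; [rewrite addr_ge0|apply: Kmono; rewrite hr// hm].
  by split; [apply: le_trans h1 _|apply: le_trans h2 _]; rewrite lerD2r.
(* The Bochner integral over all of [[0, T]] supplies one measurable version of the drift, good for
   every [t <= T]. *)
have [I0 bI0 _] := eqn T (ltW T0) Ts.
have [a sa aE] := bochner_version (measurable_segment 0 T) bI0.
have sa' : strongly_mfun measurable `[0, T] a by exact: strongly_mfunS sa.
have ma : measurable_fun `[0, T] (fun r => `|a r|) by apply: strongly_mfun_norm => //; exact: measurable_itv.
have aA : \forall r \ae mu, `[0, T]%classic r -> a r = cA j c r w (v r w).
  by apply: (@filterS _ _ (ae_filter_ringOfSetsType mu) _ _ _ aE) => r hr rT; rewrite vE hr.
have mf' : measurable_fun `[0, T] (fun t => `|cf c t w|) by exact: measurable_halfline_segment.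
have mg' : measurable_fun `[0, T] (fun t => `|cg c t w|) by exact: measurable_halfline_segment.
have sq_le (x y : R) : 0 <= x -> x <= y -> `|x ^+ 2| <= y ^+ 2.
  by move=> x0 xy; rewrite ger0_norm ?sqr_ge0// lerXn2r// nnegrE// (le_trans x0).
have a2 : itg (fun r => `|a r| ^+ 2).
  apply: (rint_le_ae (growth_rint (K m) mv mf' v2 if2)); first exact: measurable_funX.
  apply: (@filterS2 _ _ (ae_filter_ringOfSetsType mu) _ _ _ _ aA gra) => r h1 h2 rT.
  by apply: sq_le => //; rewrite h1//; have [] := h2 rT.
have PhiE l r : (l0 <= l)%N -> `[0, T]%classic r ->
    before (s l) (fun t w => cB j c t w (inV u t w)) r w = cB j c r w (v r w).
  move=> ll; rewrite /= in_itv/= => /andP[r0 rT]; have [Tl _ _ _ _] := hl l ll.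
  by rewrite /before vE ifT//; apply: le_lt_trans Tl; rewrite lee_fin.
have sb : strongly_mfun measurable `[0, T] (fun r => cB j c r w (v r w)).
  have := strongly_mfunS sub0 (strongly_prog_path hF w (sPhi l0)).
  by apply: eq_strongly_mfun => r; exact: PhiE.
have mb : measurable_fun `[0, T] (fun r => `|cB j c r w (v r w)|).
  by apply: strongly_mfun_norm => //; exact: measurable_itv.
have b2 : itg (fun r => `|cB j c r w (v r w)| ^+ 2).
  apply: (rint_le_ae (growth_rint (K m) mv mg' v2 ig2)); first exact: measurable_funX.
  apply: (@filterS _ _ (ae_filter_ringOfSetsType mu) _ _ _ gra) => r h2 rT.
  by apply: sq_le => //; have [] := h2 rT.
have ia t : t <= T -> rint mu `[0, t] (fun r => `|a r|).
  move=> tT; apply: rint_itvS (rint_sq1 mT (segment_finite 0 T) ma a2) (lexx _) tT.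
have eqM l t y : (l0 <= l)%N -> 0 <= t <= T ->
    dotp (inH u t w - u0 w) (j y) + \int[mu]_(r in `[0, t]) a r y = dotp (Mn l t w) (j y).
  move=> ll /andP[t0 tT]; have [Tl _ eql _ _] := hl l ll.
  have tl : (t%:E < s l w)%E by apply: le_lt_trans Tl; rewrite lee_fin.
  have [I bI IE] := eql t t0 tl.
  have subt : `[0, t] `<=` `[0, T] by move=> r /=; rewrite !in_itv/= => /andP[-> /le_trans]; apply.
  rewrite -(@bochner_pairing _ _ t _ a I y bI); last exact: ia.
  - by have /(congr1 (fun f : dual V => f y)) := IE.
  - exact: strongly_mfunS sa.
  - by apply: (@filterS _ _ (ae_filter_ringOfSetsType mu) _ _ _ aE) => r hr /subt.
(* Each localisation comes with its own stochastic integral. The equation determines their pairings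
   with [j y], so by density they agree on [[0, T]], and the first one can be compared with all
   elementary integrals. *)
have MnE l t : (l0 <= l)%N -> 0 <= t <= T -> Mn l t w = Mn l0 t w.
  move=> ll tT; apply/eqP; rewrite -subr_eq0; apply/eqP; apply: dense_dotp_eq0 jtriple _ => y.
  by rewrite dotpBl -(eqM l)// -(eqM l0)// subrr.
have ML l t : (l0 <= l)%N -> 0 <= t <= T -> `|Mn l0 t w - step_integral W (N l) (S l) t w| <= 4^-1 ^+ l.+1.
  move=> ll tT; rewrite -(MnE l)//; have [_ _ _ _ h] := hl l ll.
  by rewrite -lee_fin; apply: le_trans h; apply: ereal_sup_ubound; exists t => //=; rewrite in_itv.
have lohi l i : 0 <= step_lo (S l i) <= step_hi (S l i) by have [] := aS l i.
have q0 l : 0 <= 4^-1 ^+ l.+1 :> R by rewrite exprn_ge0.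
have c4 : (4^-1 ^+ l.+1 : R) @[l --> \oo] --> 0.
  have := @cvg_expr R 4^-1; rewrite ger0_norm// invf_lt1// ltr1n => /(_ isT) h.
  by rewrite -(cvg_shiftS (fun l => 4^-1 ^+ l : R)) in h.
exists (fun t => Mn l0 t w), a; split => //.
(* Elementary integrals vanish at time [0], hence so does their limit, and the equation at [t = 0]
   gives the initial value. *)
- have M0 : Mn l0 0 w = 0.
    apply/eqP; rewrite -normr_le0; apply/ler_addgt0Pr => ep ep0; rewrite add0r.
    near \oo => l; have ll : (l0 <= l)%N by near: l; exists l0.
    have := ML l 0 ll; rewrite lexx (ltW T0) step_integral0// subr0 => /(_ isT)/le_trans; apply.
    near: l; move/cvgrPdist_le : c4 => /(_ _ ep0); apply: filterS => l.
    by rewrite sub0r normrN; apply: le_trans; exact: ler_norm.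
  have hx y : dotp (inH u 0 w - u0 w) (j y) = 0.
    have := eqM l0 0 y (leqnn _); rewrite lexx (ltW T0) M0 dotp0l => /(_ isT).
    by rewrite Rintegral_itv_pt addr0.
  by apply/eqP; rewrite -subr_eq0; apply/eqP; exact: dense_dotp_eq0 jtriple hx.
- by move=> y t; exact: eqM.
- have sq0 l : 0 <= \int[mu]_(r in `[0, T]) `|cB j c r w (v r w) - step_op e (N l) (S l) r w| ^+ 2.
    by apply: Rintegral_itv_ge0 => r _; exact: sqr_ge0.
  apply/cvgrPdist_le => ep ep0; near=> l; have ll : (l0 <= l)%N by near: l; exists l0.
  rewrite sub0r normrN ger0_norm//; apply: (@le_trans _ _ (4^-1 ^+ l.+1)); last first.
    near: l; move/cvgrPdist_le : c4 => /(_ _ ep0); apply: filterS => l.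
    by rewrite sub0r normrN; apply: le_trans; exact: ler_norm.
  have [_ _ _ h _] := hl l ll.
  have h' : (\int[mu]_(r in `[0%R, T]) (`|cB j c r w (v r w) - step_op e (N l) (S l) r w| ^+ 2)%:E <= (4^-1 ^+ l.+1)%R%:E)%E.
    apply: le_trans h; rewrite le_eqVlt; apply/orP; left; apply/eqP; apply: eq_integral => r /set_mem rT.
    rewrite PhiE// -hs_sq_norm; congr (hs_sq e _); apply/funext => x.
    by rewrite -(step_opE e).
  rewrite /Rintegral -lee_fin fineK// ge0_fin_numE; last by apply: integral_ge0 => r _; rewrite lee_fin sqr_ge0.
  exact: le_lt_trans h' (ltry _).
- by exists l0 => // l /= ll t tT; exact: ML.
- have [b hb] := step_integral_bounded (N l0) T0 (lohi l0) (cW l0).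
  exists (4^-1 ^+ l0.+1 + b) => t tT.
  rewrite -[Mn l0 t w](subrK (step_integral W (N l0) (S l0) t w)) (le_trans (ler_normD _ _))// lerD ?ML ?hb//.
Unshelve. all: end_near.
Qed.

(** For every [l] an elementary integrand is picked whose two errors exceed [4 ^ - (l + 1)] only
    with outer probability below [2 ^ - l]; Borel-Cantelli turns convergence in probability into a
    pathwise rate. *)
Theorem solution_data (u0 : Omega -> H) (u : process V H Omega) : global_solution j P Fil W c u0 u ->
  exists v M a N S, [/\ adapted_strong Fil v, forall l i, adapted_step Fil (S l i) &
    \forall w \ae P, solution_path u0 u v M a N S w].
Proof.
case=> sigma [[[_ sv [s [_ scvg ss]]] _] _] soo.
have /choice[M' hM'] : forall k, exists M, ito_integral P Fil W (before (s k) (fun t w => cB j c t w (inV u t w))) M /\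
    \forall w \ae P, regular_path j (s k w) (inV u ^~ w) (inH u ^~ w) /\
     forall t : R, 0 <= t -> (t%:E < s k w)%E ->
          exists2 I : dual V,
            bochner_integral `[0, t] (fun s => cA j c s w (inV u s w)) I &
            gelfand j (inH u t w - u0 w) + I = gelfand j (M t w).
  move=> k; have [_ _ reg [M ito eqn]] := ss k; exists M; split => //.
  by move: reg eqn; apply: filterS2 => w [].
have /choice[NS hNS] : forall l, exists NS : nat * (nat -> step Omega U H),
  [/\ forall i, adapted_step Fil (NS.2 i),
   (mu_ext P [set w | ((4^-1 ^+ l.+1)%R%:E < \int[mu]_(t in `[0%R, T])
        hs_sq e (fun x => (before (s l) (fun t w => cB j c t w (inV u t w)) t w x - step_process NS.1 NS.2 t w x)%R))%E] < (2^-1 ^+ l)%R%:E)%E &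
   (mu_ext P [set w | ((4^-1 ^+ l.+1)%R%:E < ereal_sup [set (`|M' l t w - step_integral W NS.1 NS.2 t w|)%R%:E | t in `[0%R, T]])%E] < (2^-1 ^+ l)%R%:E)%E].
  move=> l; have [[_ [N [S [aS /(_ T T0)[c1 c2]]]]] _] := hM' l.
  have q0 : 0 < 4^-1 ^+ l.+1 :> R by rewrite exprn_gt0.
  have p0 : 0 < 2^-1 ^+ l :> R by rewrite exprn_gt0.
  have small (f : nat -> \bar R) : f n @[n --> \oo] --> 0%E -> \forall n \near \oo, (f n < (2^-1 ^+ l)%R%:E)%E.
    move=> fc; apply: (fc [set x | (x < (2^-1 ^+ l)%R%:E)%E]).
    by apply: open_ereal_lt'; rewrite lte_fin.
  near \oo => k; exists (N k, S k); split => //=.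
    by near: k; apply: small; exact: c1.
  by near: k; apply: small; exact: c2.
have [th [K [_ K0 _ Km hK]]] := critical_local_monotonicity jtriple T0 hc.
have [[_ _ [mf mg] [f2 g2]] _ _] := hc.
pose N l := (NS l).1; pose S l := (NS l).2.
have aS l i : adapted_step Fil (S l i) by have [h _ _] := hNS l; exact: h.
have sPhi l : strongly_prog Fil (before (s l) (fun t w => cB j c t w (inV u t w))) by have [[]] := hM' l.
pose E1 l w := (\int[mu]_(t in `[0%R, T])
  hs_sq e (fun x => (before (s l) (fun t w => cB j c t w (inV u t w)) t w x - step_process (N l) (S l) t w x)%R))%E.
pose E2 l w := ereal_sup [set (`|M' l t w - step_integral W (N l) (S l) t w|)%R%:E | t in `[0%R, T]].
have e1 : \forall w \ae P, \forall l \near \oo, ~ ((4^-1 ^+ l.+1)%R%:E < E1 l w)%E.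
  by apply: outer_borel_cantelli => l; have [] := hNS l.
have e2 : \forall w \ae P, \forall l \near \oo, ~ ((4^-1 ^+ l.+1)%R%:E < E2 l w)%E.
  by apply: outer_borel_cantelli => l; have [] := hNS l.
have e3 : \forall w \ae P, forall l, regular_path j (s l w) (inV u ^~ w) (inH u ^~ w) /\
     forall t : R, 0 <= t -> (t%:E < s l w)%E ->
          exists2 I : dual V,
            bochner_integral `[0, t] (fun s => cA j c s w (inV u s w)) I &
            gelfand j (inH u t w - u0 w) + I = gelfand j (M' l t w).
  by apply: ae_foralln => l; have [] := hM' l.
have e4 : \forall w \ae P, forall l i, {within [set t : R | 0 <= t], continuous (fun t : R => W t (step_dir (S l i)) w)}.
  by apply: ae_foralln => l; apply: ae_foralln => i; exact: cbm_cont hW _.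
have : \forall w \ae P, exists Ma : (R -> H) * (R -> dual V),
    solution_path u0 u (before sigma (inV u)) (fun t _ => Ma.1 t) (fun t _ => Ma.2 t) N S w.
  have aeI (A B : set Omega) : (\forall w \ae P, A w) -> (\forall w \ae P, B w) ->
      \forall w \ae P, A w /\ B w by apply: filterS2.
  have hA := aeI _ _ hK (aeI _ _ f2 g2); have hB := aeI _ _ (aeI _ _ e1 e2) (aeI _ _ e3 e4).
  have hC := aeI _ _ soo scvg.
  move: hA hB hC; apply: filterS3 => w [hKw [f2w g2w]] [[e1w e2w] [e3w e4w]] [soow scvgw].
  have e5 : \forall l \near \oo, (T%:E < s l w)%E.
    move: scvgw; rewrite soow; move=> fc; apply: (fc [set x | (T%:E < x)%E]).
    exact: nbhs_open_ereal_pinfty.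
  have [l0 _ hl0] := filterI e5 (filterI e1w e2w).
  have [||||||| M [a Ma]] := @good_path u0 u sigma s M' N S K w l0 Km aS sv soow sPhi.
  - move=> l ll; have [h5 [/negP h1 /negP h2]] := hl0 l ll; have [h3 h4] := e3w l.
    by split => //; [move: h1|move: h2]; rewrite -leNgt.
  - by move=> t x tT; have [_ h1 h2] := hKw t x x tT.
  - exact: (@borel_prog_norm_path _ _ _ _ hF _ (cf c) w mf).
  - exact: (@borel_prog_norm_path _ _ _ _ hF _ (cg c) w mg).
  - apply: rint_ge0P => //; last exact: f2w.
    by apply: measurable_funX; apply: measurable_halfline_segment; exact: (@borel_prog_norm_path _ _ _ _ hF _ (cf c) w mf).
  - apply: rint_ge0P => //; last exact: g2w.
    by apply: measurable_funX; apply: measurable_halfline_segment; exact: (@borel_prog_norm_path _ _ _ _ hF _ (cg c) w mg).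
  - exact: e4w.
  by exists (M, a).
move=> h.
(* [M] and [a] are chosen path by path, with the default [0] on exceptional paths. Their
   measurability in [w] is never claimed. *)
have /choice[Ma hMa] : forall w, exists Ma : (R -> H) * (R -> dual V),
   (exists Ma : (R -> H) * (R -> dual V),
     solution_path u0 u (before sigma (inV u)) (fun t _ => Ma.1 t) (fun t _ => Ma.2 t) N S w) ->
   solution_path u0 u (before sigma (inV u)) (fun t _ => Ma.1 t) (fun t _ => Ma.2 t) N S w.
  by move=> w; have [[Ma hM]|nM] := pselect (exists Ma : (R -> H) * (R -> dual V),
     solution_path u0 u (before sigma (inV u)) (fun t _ => Ma.1 t) (fun t _ => Ma.2 t) N S w);
    [exists Ma|exists (fun=> 0, fun=> 0) => /nM].
exists (before sigma (inV u)), (fun t w => (Ma w).1 t), (fun t w => (Ma w).2 t), N, S; split => //.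
  exact: strongly_prog_adapted.
by move: h; apply: filterS => w /hMa[]; split.
Unshelve. all: end_near.
Qed.

End solution_data.

(** * Continuation and lower bounds for the weighted energy *)

Section continuation.
Context (R : realType) (T : R) (T0 : 0 < T).
Local Notation mu := (@lebesgue_measure R).
Local Notation itg F := (rint mu `[0, T] F).

(** By uniform continuity [F] rises by less than [1 - eta] over a time step of length [del / 2]. So
    a bound by [eta] up to one step gives a bound by [1] up to the next, which the hypothesis
    improves to [eta] again. *)
Lemma continuation (F : R -> R) (eta : R) : {within `[0, T], continuous F} ->
  eta < 1 -> F 0 <= eta ->
  (forall t, 0 <= t <= T -> (forall s, 0 <= s <= t -> F s <= 1) -> F t <= eta) ->
  forall t, 0 <= t <= T -> F t <= eta.
Proof.
move=> cF eta1 F0 hF; have e0 : 0 < 1 - eta by rewrite subr_gt0.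
have [del del0 hdel] := segment_uniform (X := R^o) cF e0.
pose del2 := del / 2; have d20 : 0 < del2 by rewrite divr_gt0.
have d2 : del2 < del by rewrite /del2 ltr_pdivrMr// mulr_natr mulr2n ltrDl.
suff key k : forall t, 0 <= t <= T -> t <= k%:R * del2 -> F t <= eta.
  move=> t tT; have /andP[t0 _] := tT; apply: (key (Num.truncn (t / del2)).+1) => //.
  by rewrite -ler_pdivrMr// ltW// truncnS_gt.
elim: k => [|k IH] t tT tk.
  have /andP[t0 _] := tT; suff -> : t = 0 by [].
  by apply/eqP; rewrite eq_le t0 andbT; rewrite mul0r in tk.
apply: hF => // s /andP[s0 st]; have /andP[t0 tT'] := tT.
have sT : 0 <= s <= T by rewrite s0 (le_trans st).
have [sk|sk] := leP s (k%:R * del2); first by rewrite (le_trans (IH s sT sk))// ltW.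
have kT : 0 <= k%:R * del2 <= T.
  by rewrite mulr_ge0 ?(ltW d20)//= (le_trans (ltW sk))// (le_trans st).
have := IH _ kT (lexx _).
have : `|F s - F (k%:R * del2)| < 1 - eta.
  apply: hdel => //; rewrite ger0_norm ?subr_ge0 ?(ltW sk)//.
  apply: le_lt_trans d2; rewrite lerBlDl (le_trans st)// (le_trans tk)//.
  by rewrite -natr1 mulrDl mul1r.
by rewrite ltr_norml => /andP[_]; lra.
Qed.

Lemma weight_mul_rint (gam th : R -> R) : itg gam -> (forall r, 0 <= gam r) -> itg th ->
  itg (fun r => weight gam r * th r).
Proof.
move=> ig g0 ith; apply: (@rint_bounded_mul _ _ _ mu _ (measurable_segment 0 T) 1 (weight gam) th) ith.
  apply: subspace_continuous_measurable_fun; first exact: measurable_itv.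
  apply: (within_comp (F := fun x : R => expR (- x) : R)).
    exact: (parameterized_integral_continuous (ltW T0) ig).
  by move=> x; apply: continuous_comp; [exact: opp_continuous|exact: continuous_expR].
by move=> r _; rewrite ger0_norm ?weight_le1// ltW ?weight_gt0.
Qed.

Lemma weight_lower (gam : R -> R) (t G : R) : itg gam -> (forall r, 0 <= gam r) -> t <= T ->
  \int[mu]_(r in `[0, t]) gam r <= G -> forall r, 0 <= r <= t -> expR (- G) <= weight gam r.
Proof.
move=> ig g0 tT hG r /andP[r0 rt]; rewrite /weight ler_expR lerN2; apply: le_trans hG.
exact: (Rintegral_itv_mono (rint_itvS ig (lexx 0) tT)).
Qed.

(** As long as the exponent is at most [G] the weight is at least [exp(- G)], so bounds on the
    weighted energy become bounds on the norms themselves. *)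
Lemma weighted_energy_lower (gam th p : R -> R) (x t G k : R) : itg gam -> (forall r, 0 <= gam r) ->
  itg th -> (forall r, 0 <= th r) -> itg p -> 0 <= x -> 0 <= t <= T -> 0 <= k <= 1 ->
  \int[mu]_(r in `[0, t]) gam r <= G ->
  (\forall r \ae mu, `[0, t]%classic r -> k * p r <= th r) ->
  expR (- G) * k * (x + \int[mu]_(r in `[0, t]) p r) <=
  weight gam t * x + \int[mu]_(r in `[0, t]) (weight gam r * th r).
Proof.
move=> ig g0 ith th0 ip x0 /andP[t0 tT] /andP[k0 k1] hG hp.
have wl := weight_lower ig g0 tT hG; have mt := measurable_segment 0 t.
have i1 := rint_itvS (weight_mul_rint ig g0 ith) (lexx 0) tT.
have ip' := rint_itvS ip (lexx 0) tT.
rewrite mulrDr lerD//.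
  rewrite ler_wpM2r// (@le_trans _ _ (expR (- G)))//; first by rewrite ler_piMr// expR_ge0.
  by apply: wl; rewrite t0 lexx.
rewrite -(RintegralZl _ mt ip'); apply: (ae_le_Rintegral mt (rintZl mt _ ip') i1).
apply: (@filterS _ _ (ae_filter_ringOfSetsType mu) _ _ _ hp) => r hr rt.
rewrite -mulrA; apply: (@le_trans _ _ (expR (- G) * th r)).
  by rewrite ler_wpM2l ?expR_ge0// hr.
by rewrite ler_wpM2r//; apply: wl; move: rt; rewrite /= in_itv.
Qed.

End continuation.

(** * The difference of two solutions *)

Section adapted_algebra.
Context (R : realType) d (Omega : measurableType d) (Fil : R -> set (set Omega)).

Lemma adapted_realD (f g : R -> Omega -> R) : adapted_real Fil f -> adapted_real Fil g ->
  adapted_real Fil (fun t w => f t w + g t w).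
Proof. by move=> mf mg t t0; apply: measurable_funD; [exact: mf|exact: mg]. Qed.

Lemma adapted_realM (f g : R -> Omega -> R) : adapted_real Fil f -> adapted_real Fil g ->
  adapted_real Fil (fun t w => f t w * g t w).
Proof. by move=> mf mg t t0; apply: measurable_funM; [exact: mf|exact: mg]. Qed.

Lemma adapted_real_cst (k : R) : adapted_real Fil (fun _ _ => k).
Proof. by move=> t t0; exact: measurable_cst. Qed.

Lemma adapted_real_comp (F : R -> R) (f : R -> Omega -> R) : measurable_fun setT F ->
  adapted_real Fil f -> adapted_real Fil (fun t w => F (f t w)).
Proof. by move=> mF mf t t0; apply: measurableT_comp => //; exact: mf. Qed.

Lemma adapted_real_path (f : R -> Omega -> R) (T : R) w : 0 < T -> adapted_real Fil f -> measurable_fun `[0, T] (f ^~ w).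
Proof.
move=> T0 /(_ T (ltW T0)) mf.
have mp : measurable_fun setT (fun r : R => (r, w : subalg (Fil T))) by exact: measurable_pair2.
apply: (measurable_comp _ _ mf (g := fun r : R => (r, w : subalg (Fil T)))) => //.
- exact: itv_setT_measurable.
- by move=> _ [r rT <-].
- exact: measurable_funTS.
Qed.

End adapted_algebra.

Lemma rint_sq_norm_sub (R : realType) (X : normedModType R) (T : R) (f g : R -> X) :
  strongly_mfun measurable `[0, T] f -> strongly_mfun measurable `[0, T] g ->
  rint lebesgue_measure `[0, T] (fun r => `|f r| ^+ 2) ->
  rint lebesgue_measure `[0, T] (fun r => `|g r| ^+ 2) ->
  rint lebesgue_measure `[0, T] (fun r => `|f r - g r| ^+ 2).
Proof.
move=> sf sg f2 g2; have mT := measurable_segment 0 T.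
apply: (rint_le mT (rintD mT (rintZl mT 2 f2) (rintZl mT 2 g2))).
  apply: measurable_funX; apply: strongly_mfun_norm; first exact: measurable_itv.
  exact: strongly_mfunB.
move=> r _; rewrite ger0_norm ?sqr_ge0//.
apply: (@le_trans _ _ ((`|f r| + `|g r|) ^+ 2)); last exact: sqrD_le_dbl.
by rewrite lerXn2r ?nnegrE ?addr_ge0// ler_normB.
Qed.

Lemma Rintegral_sq_norm_sub (R : realType) (X : normedModType R) (T : R) (f g : R -> X) :
  strongly_mfun measurable `[0, T] f -> strongly_mfun measurable `[0, T] g ->
  rint lebesgue_measure `[0, T] (fun r => `|f r| ^+ 2) ->
  rint lebesgue_measure `[0, T] (fun r => `|g r| ^+ 2) ->
  \int[lebesgue_measure]_(r in `[0, T]) `|f r - g r| ^+ 2 <=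
  2 * \int[lebesgue_measure]_(r in `[0, T]) `|f r| ^+ 2 + 2 * \int[lebesgue_measure]_(r in `[0, T]) `|g r| ^+ 2.
Proof.
move=> sf sg f2 g2; have mT := measurable_segment 0 T; have fg2 := rint_sq_norm_sub sf sg f2 g2.
rewrite -(RintegralZl _ mT f2) -(RintegralZl _ mT g2) -(RintegralD mT (rintZl mT 2 f2) (rintZl mT 2 g2)).
apply: (le_Rintegral mT fg2 (rintD mT (rintZl mT 2 f2) (rintZl mT 2 g2))) => r _.
apply: (@le_trans _ _ ((`|f r| + `|g r|) ^+ 2)); last exact: sqrD_le_dbl.
by rewrite lerXn2r ?nnegrE ?addr_ge0// ler_normB.
Qed.

Lemma step_op_rint (R : realType) (U H : hilbertType R) (e : onb U) d (Omega : measurableType d)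
    (N : nat) (S : nat -> step Omega U H) (T : R) (w : Omega) :
  rint lebesgue_measure `[0, T] (fun r => `|step_op e N S r w| ^+ 2).
Proof.
have [b hb] := step_op_bounded e N S w; have mT := measurable_segment 0 T.
apply: (rint_le mT (rint_cst mT (b ^+ 2) (segment_finite 0 T))).
  apply: measurable_funX; apply: strongly_mfun_norm; [exact: measurable_itv|].
  exact: strongly_mfunS (@subsetT _ _) (step_op_path e N S w).
by move=> r _; rewrite ger0_norm ?sqr_ge0// lerXn2r ?nnegrE// (le_trans _ (hb r)).
Qed.

Section difference_estimate.
Context (R : realType) (V H U : hilbertType R) (e : onb U) (j : bop V H) (jtriple : gelfand_triple j).
Context d (Omega : measurableType d) (P : probability Omega R) (Fil : R -> set (set Omega)).
Context (W : R -> U -> Omega -> R) (hF : filtration Fil) (hW : cylindrical_BM P Fil W).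
Context (c : coefs V H e Omega) (T : R) (T0 : 0 < T).
Local Notation mu := (@lebesgue_measure R).
Local Notation itg F := (rint mu `[0, T] F).

Context (th K : R -> R) (th0 : forall x, 0 < th x) (K0 : forall x, 0 <= K x).
Hypothesis thm : {homo th : x y /~ x <= y}.
Hypothesis Km : {homo K : x y / x <= y}.
Hypothesis hK : \forall w \ae P, forall (t : R) (u v : V), 0 <= t <= T ->
  th (`|j u| + `|j v|) * `|u - v| ^+ 2 -
       K (`|j u| + `|j v|) * (size2 u v) ^+ 2 * `|j (u - v)| ^+ 2 <=
       (cA j c t w u - cA j c t w v) (u - v) - 2^-1 * `|cB j c t w u - cB j c t w v| ^+ 2.

Context (u01 u02 : Omega -> H) (u1 u2 : process V H Omega) (v1 v2 : R -> Omega -> V).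
Context (M1 M2 : R -> Omega -> H) (a1 a2 : R -> Omega -> dual V) (N1 N2 : nat -> nat).
Context (S1 S2 : nat -> nat -> step Omega U H).
Hypotheses (m01 : strongly_mfun (Fil 0) setT u01) (m02 : strongly_mfun (Fil 0) setT u02).
Hypotheses (av1 : adapted_strong Fil v1) (av2 : adapted_strong Fil v2).
Hypotheses (aS1 : forall l i, adapted_step Fil (S1 l i)) (aS2 : forall l i, adapted_step Fil (S2 l i)).
Hypothesis sp1 : \forall w \ae P, solution_path j W c T u01 u1 v1 M1 a1 N1 S1 w.
Hypothesis sp2 : \forall w \ae P, solution_path j W c T u02 u2 v2 M2 a2 N2 S2 w.

Definition size_rate (u v : V) : R := `|j u| + `|j v|.
(** The rates of local monotonicity, doubled as in the energy of the square. They are evaluated at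
    [v1] and [v2] rather than at the continuous paths in [H], because only the former are known to
    be adapted. *)
Definition gap_th (r : R) (w : Omega) : R :=
  2 * th (size_rate (v1 r w) (v2 r w)) * `|v1 r w - v2 r w| ^+ 2.
Definition gap_gam (r : R) (w : Omega) : R :=
  2 * K (size_rate (v1 r w) (v2 r w)) * size2 (v1 r w) (v2 r w) ^+ 2.
Definition gap_h (r : R) (w : Omega) : H := inH u1 r w - inH u2 r w.

Let mT := measurable_segment 0 T.
Let mK : measurable_fun setT K.
Proof. by apply: nondecreasing_measurable => // x y xy; exact: Km. Qed.
Let mth : measurable_fun setT th.
Proof. by apply: nonincreasing_measurable => // x y xy; exact: thm. Qed.

Let pv (v : R -> Omega -> V) w : adapted_strong Fil v -> strongly_mfun measurable `[0, T] (v ^~ w).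
Proof.
move=> av; have := strongly_mfun_section1 (av _ (ltW T0)) w; apply: strongly_mfunS => r rT.
by split.
Qed.

Let asize : adapted_real Fil (fun r w => size_rate (v1 r w) (v2 r w)).
Proof.
by apply: adapted_realD; apply: adapted_strong_norm; apply: adapted_strong_comp => //; exact: bop_continuous.
Qed.

Let asize2 : adapted_real Fil (fun r w => size2 (v1 r w) (v2 r w)).
Proof.
apply: adapted_realD; last exact: adapted_strong_norm.
by apply: adapted_realD; [exact: adapted_real_cst|exact: adapted_strong_norm].
Qed.

Let agam : adapted_real Fil gap_gam.
Proof.
apply: adapted_realM; last by apply: (adapted_real_comp (F := fun x : R => x ^+ 2)) => //; exact: exprn_measurable.
by apply: adapted_realM; [exact: adapted_real_cst|exact: adapted_real_comp].
Qed.

Let path_meas (f : R -> Omega -> R) w : adapted_real Fil f -> measurable_fun `[0, T] (f ^~ w).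
Proof. exact: adapted_real_path. Qed.

Let ath : adapted_real Fil gap_th.
Proof.
apply: adapted_realM.
  by apply: adapted_realM; [exact: adapted_real_cst|exact: adapted_real_comp].
apply: (adapted_real_comp (F := fun x : R => x ^+ 2)); first exact: exprn_measurable.
by apply: adapted_strong_norm; exact: adapted_strongB.
Qed.

Lemma gap_th_ge0 r w : 0 <= gap_th r w.
Proof. by rewrite !mulr_ge0 ?sqr_ge0// ltW. Qed.

Lemma gap_gam_ge0 r w : 0 <= gap_gam r w.
Proof. by rewrite /gap_gam mulr_ge0 ?sqr_ge0// mulr_ge0. Qed.

Lemma gap_v2 w : solution_path j W c T u01 u1 v1 M1 a1 N1 S1 w ->
  solution_path j W c T u02 u2 v2 M2 a2 N2 S2 w -> itg (fun r => `|v1 r w - v2 r w| ^+ 2).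
Proof.
move=> h1 h2; apply: rint_sq_norm_sub (pv w av1) (pv w av2) (sp_v2 h1) (sp_v2 h2).
Qed.

Lemma gap_th_rint w : solution_path j W c T u01 u1 v1 M1 a1 N1 S1 w ->
  solution_path j W c T u02 u2 v2 M2 a2 N2 S2 w -> itg (gap_th ^~ w).
Proof.
move=> h1 h2; apply: (rint_le mT (rintZl mT (2 * th 0) (gap_v2 h1 h2))); first exact: path_meas.
move=> r _; rewrite ger0_norm ?gap_th_ge0// /gap_th ler_wpM2r ?sqr_ge0// ler_pM2l//.
by apply: thm; rewrite addr_ge0.
Qed.

Lemma gap_gam_rint w : solution_path j W c T u01 u1 v1 M1 a1 N1 S1 w ->
  solution_path j W c T u02 u2 v2 M2 a2 N2 S2 w -> itg (gap_gam ^~ w).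
Proof.
move=> h1 h2; have [m1 hm1] := within_bounded T0 (sp_cont h1); have [m2 hm2] := within_bounded T0 (sp_cont h2).
have i0 : itg (fun r => (1 * (1 + `|v1 r w|) + `|v2 r w|) ^+ 2).
  by apply: growth_rint (sp_v2 h1) (sp_v2 h2); (apply: strongly_mfun_norm; [exact: measurable_itv|exact: pv]).
apply: (rint_le_ae (rintZl mT (2 * K (m1 + m2)) i0)); first exact: path_meas.
apply: (@filterS2 _ _ (ae_filter_ringOfSetsType mu) _ _ _ _ (sp_jv h1) (sp_jv h2)) => r j1 j2 rT.
have rT' : 0 <= r <= T by move: rT; rewrite /= in_itv.
rewrite ger0_norm ?gap_gam_ge0// /gap_gam /size2 mul1r ler_wpM2r ?sqr_ge0// ler_pM2l//.
by apply: Km; rewrite /size_rate j1// j2// lerD ?hm1 ?hm2.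
Qed.

Let gap_path w : solution_path j W c T u01 u1 v1 M1 a1 N1 S1 w ->
  solution_path j W c T u02 u2 v2 M2 a2 N2 S2 w ->
  (forall (t : R) (u v : V), 0 <= t <= T ->
  th (`|j u| + `|j v|) * `|u - v| ^+ 2 -
       K (`|j u| + `|j v|) * (size2 u v) ^+ 2 * `|j (u - v)| ^+ 2 <=
       (cA j c t w u - cA j c t w v) (u - v) - 2^-1 * `|cB j c t w u - cB j c t w v| ^+ 2) ->
  energy_path j W T (fun r w => v1 r w - v2 r w) gap_h (fun r w => M1 r w - M2 r w) (fun r w => a1 r w - a2 r w)
    (fun w => u01 w - u02 w) gap_th gap_gam (fun _ _ => 0) (fun r w => `|cB j c r w (v1 r w) - cB j c r w (v2 r w)|)
    (fun l => N1 l + N2 l)%N (fun l => step_diff (N1 l) (S1 l) (S2 l))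
    (fun l r w => `|cB j c r w (v1 r w) - cB j c r w (v2 r w) - step_op e (N1 l + N2 l) (step_diff (N1 l) (S1 l) (S2 l)) r w|) w.
Proof.
move=> h1 h2 hKw; have sa := strongly_mfunB (sp_a h1) (sp_a h2); have sb := strongly_mfunB (sp_b h1) (sp_b h2).
have ra : itg (fun r => `|a1 r w - a2 r w| ^+ 2) by exact: rint_sq_norm_sub (sp_a h1) (sp_a h2) (sp_a2 h1) (sp_a2 h2).
have iy (h : R -> dual V) y : strongly_mfun measurable `[0, T] h -> itg (fun r => `|h r| ^+ 2) -> itg (fun r => h r y).
  move=> sh h2'; have mh : measurable_fun `[0, T] (fun r => `|h r|) by apply: strongly_mfun_norm sh; exact: measurable_itv.
  apply: (rint_le mT (rintZr mT `|y| (rint_sq1 mT (segment_finite 0 T) mh h2'))).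
    exact: (strongly_mfun_real (measurable_itv _) sh (@bop_eval_continuous _ _ _ y)).
  by move=> r _; exact: bop_norm_le.
have dlE l r : `|cB j c r w (v1 r w) - cB j c r w (v2 r w) - step_op e (N1 l + N2 l) (step_diff (N1 l) (S1 l) (S2 l)) r w| =
    `|(cB j c r w (v1 r w) - step_op e (N1 l) (S1 l) r w) - (cB j c r w (v2 r w) - step_op e (N2 l) (S2 l) r w)|.
  rewrite step_diff_op; congr (`|_|); rewrite !opprB addrACA [RHS]addrACA; congr (_ + _); exact: addrC.
have so (N : nat -> nat) (S : nat -> nat -> step Omega U H) l : strongly_mfun measurable `[0, T] (fun r => step_op e (N l) (S l) r w).
  exact: strongly_mfunS (@subsetT _ _) (step_op_path e _ _ w).
have iso (N : nat -> nat) (S : nat -> nat -> step Omega U H) l : itg (fun r => `|step_op e (N l) (S l) r w| ^+ 2).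
  exact: step_op_rint.
have e1 l := rint_sq_norm_sub (sp_b h1) (so N1 S1 l) (sp_b2 h1) (iso N1 S1 l).
have e2 l := rint_sq_norm_sub (sp_b h2) (so N2 S2 l) (sp_b2 h2) (iso N2 S2 l).
have d1 l := strongly_mfunB (sp_b h1) (so N1 S1 l); have d2 l := strongly_mfunB (sp_b h2) (so N2 S2 l).
have e3 l : itg (fun r => `|cB j c r w (v1 r w) - cB j c r w (v2 r w) - step_op e (N1 l + N2 l) (step_diff (N1 l) (S1 l) (S2 l)) r w| ^+ 2).
  have E : (fun r => `|cB j c r w (v1 r w) - cB j c r w (v2 r w) - step_op e (N1 l + N2 l) (step_diff (N1 l) (S1 l) (S2 l)) r w| ^+ 2) =
      (fun r => `|(cB j c r w (v1 r w) - step_op e (N1 l) (S1 l) r w) - (cB j c r w (v2 r w) - step_op e (N2 l) (S2 l) r w)| ^+ 2).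
    by apply: funext => r; rewrite dlE.
  by rewrite E; exact: rint_sq_norm_sub (d1 l) (d2 l) (e1 l) (e2 l).
split => //=.
- move=> t; apply: cvgB; [exact: (sp_cont h1)|exact: (sp_cont h2)].
- by rewrite /gap_h (sp_start h1) (sp_start h2).
- apply: (@filterS2 _ _ (ae_filter_ringOfSetsType mu) _ _ _ _ (sp_jv h1) (sp_jv h2)) => r j1 j2 rT.
  by rewrite bopB j1// j2.
- exact: gap_v2 h1 h2.
- by apply: strongly_mfun_norm => //; exact: measurable_itv.
- by move=> y; exact: (strongly_mfun_real (measurable_itv _) sa (@bop_eval_continuous _ _ _ y)).
- move=> y t tT; have /andP[_ tT'] := tT.
  have i1 := rint_itvS (iy _ y (sp_a h1) (sp_a2 h1)) (lexx 0) tT'.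
  have i2 := rint_itvS (iy _ y (sp_a h2) (sp_a2 h2)) (lexx 0) tT'.
  rewrite (RintegralB (measurable_segment 0 t) i1 i2) [dotp (M1 t w - _) _]dotpBl -(sp_eq h1)// -(sp_eq h2)//.
  by rewrite /gap_h !dotpBl; lra.
- exact: rint_sq_norm_sub (sp_b h1) (sp_b h2) (sp_b2 h1) (sp_b2 h2).
- have c0 : (2 * \int[mu]_(r in `[0, T]) `|cB j c r w (v1 r w) - step_op e (N1 l) (S1 l) r w| ^+ 2 +
      2 * \int[mu]_(r in `[0, T]) `|cB j c r w (v2 r w) - step_op e (N2 l) (S2 l) r w| ^+ 2) @[l --> \oo] --> 0.
    rewrite [X in _ --> X](_ : _ = 2 * 0 + 2 * 0); last by rewrite mulr0 addr0.
    by apply: cvgD; apply: cvgM; [exact: cvg_cst|exact: sp_dl h1|exact: cvg_cst|exact: sp_dl h2].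
  apply: squeeze_cvgr c0; last exact: (cvg_cst (0 : R)).
  apply: nearW => l; apply/andP; split; first by apply: Rintegral_itv_ge0 => r _; exact: sqr_ge0.
  have E : (fun r => `|cB j c r w (v1 r w) - cB j c r w (v2 r w) - step_op e (N1 l + N2 l) (step_diff (N1 l) (S1 l) (S2 l)) r w| ^+ 2) =
      (fun r => `|(cB j c r w (v1 r w) - step_op e (N1 l) (S1 l) r w) - (cB j c r w (v2 r w) - step_op e (N2 l) (S2 l) r w)| ^+ 2).
    by apply: funext => r; rewrite dlE.
  by rewrite E; exact: Rintegral_sq_norm_sub (d1 l) (d2 l) (e1 l) (e2 l).
- by move=> l r _; exact: step_gram_le_sum.
- near=> l => t tT; rewrite step_diff_integral.
  have b1 : `|M1 t w - step_integral W (N1 l) (S1 l) t w| <= 4^-1 ^+ l.+1.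
    by move: t tT; near: l; exact: sp_ML h1.
  have b2 : `|M2 t w - step_integral W (N2 l) (S2 l) t w| <= 4^-1 ^+ l.+1.
    by move: t tT {b1}; near: l; exact: sp_ML h2.
  rewrite (_ : _ - _ - _ = (M1 t w - step_integral W (N1 l) (S1 l) t w) - (M2 t w - step_integral W (N2 l) (S2 l) t w)); last first.
    rewrite !opprB addrACA [RHS]addrACA; congr (_ + _); exact: addrC.
  rewrite (le_trans (ler_normB _ _))//.
  apply: (le_trans (lerD b1 b2)); rewrite exprS.
  have : 0 <= 4^-1 ^+ l :> R by rewrite exprn_ge0.
  by lra.
- have [b1 hb1] := sp_M h1; have [b2 hb2] := sp_M h2; exists (b1 + b2) => t tT.
  by rewrite (le_trans (ler_normB _ _))// lerD ?hb1 ?hb2.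
- exact: gap_th_rint.
- exact: gap_gam_rint.
- exact: rint0.
- have ej := @filterI _ _ (ae_filter_ringOfSetsType mu) _ _ (sp_jv h1) (sp_jv h2).
  apply: (@filterS3 _ _ (ae_filter_ringOfSetsType mu) _ _ _ _ _ ej (sp_aA h1) (sp_aA h2)) => r [j1 j2] A1 A2 rT.
  have rT' : 0 <= r <= T by move: rT; rewrite /= in_itv.
  have := hKw r (v1 r w) (v2 r w) rT'; rewrite -A1// -A2// bopB j1// j2//.
  rewrite (_ : (a1 r w - a2 r w) _ = a1 r w (v1 r w - v2 r w) - a2 r w (v1 r w - v2 r w))//.
  set Y := a1 r w _ - _ => hh.
  change (gap_th r w - gap_gam r w * `|gap_h r w| ^+ 2 - 0 <= 2 * Y - `|cB j c r w (v1 r w) - cB j c r w (v2 r w)| ^+ 2).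
  rewrite /gap_th /gap_gam /gap_h /size_rate j1// j2// subr0; move: hh.
  by move: Y (_ ^+ 2) (_ ^+ 2) (_ ^+ 2) (_ ^+ 2) => Y x y z t; lra.
Unshelve. all: end_near.
Qed.

(** The maximal inequality without forcing, on the event that the initial values are within [del],
    with the constant [D = del^2]. *)
Lemma difference_estimate (del lam : R) : 0 <= del -> 0 < lam ->
  (lam%:E * mu_ext P [set w | (`|u01 w - u02 w| <= del)%R /\ exists2 t : R, (0 <= t <= T)%R &
     (lam + del ^+ 2 < weighted_energy gap_h gap_th gap_gam t w)%R] <= (del ^+ 2)%:E)%E.
Proof.
move=> del0 lam0.
have mx0 : strongly_mfun (@measurable _ (subalg (Fil 0))) setT (fun w => u01 w - u02 w).
  by apply: strongly_mfunB; rewrite (fil_measurableE hF (lexx 0)).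
pose C := [set w | `|u01 w - u02 w| <= del].
have mC : Fil 0 C.
  rewrite -(fil_measurableE hF (lexx 0)).
  have mn := strongly_mfun_norm measurableT mx0.
  rewrite (_ : C = setT `&` (fun w => `|u01 w - u02 w|) @^-1` `]-oo, del]%classic).
    by apply: mn => //; exact: measurable_itv.
  by rewrite setTI; apply/seteqP; split => w /=; rewrite in_itv.
have hp : \forall w \ae P, energy_path j W T (fun r w => v1 r w - v2 r w) gap_h (fun r w => M1 r w - M2 r w) (fun r w => a1 r w - a2 r w)
    (fun w => u01 w - u02 w) gap_th gap_gam (fun _ _ => 0) (fun r w => `|cB j c r w (v1 r w) - cB j c r w (v2 r w)|)
    (fun l => N1 l + N2 l)%N (fun l => step_diff (N1 l) (S1 l) (S2 l))
    (fun l r w => `|cB j c r w (v1 r w) - cB j c r w (v2 r w) - step_op e (N1 l + N2 l) (step_diff (N1 l) (S1 l) (S2 l)) r w|) w.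
  by move: sp1 sp2 hK; apply: filterS3 => w; exact: gap_path.
have := energy_maximal e jtriple hF hW T0 (adapted_strongB av1 av2) mx0 agam gap_gam_ge0 gap_th_ge0 (fun _ _ => lexx 0)
  (fun l => step_diff_adapted (N1 l) (aS1 l) (aS2 l)) hp mC (D := fun=> del ^+ 2) _ _ _ lam0.
rewrite (_ : \int[P]_w del ^+ 2 = del ^+ 2); last first.
  by rewrite (Rintegral_cst P measurableT) [X in fine X](probability_setT P) mulr1.
apply.
- apply: (rint_cst measurableT).
  by apply: (@le_lt_trans _ _ 1%E); [rewrite probability_le1|exact: ltry].
- by move=> w; exact: sqr_ge0.
- apply: aeW => w Cw; rewrite Rintegral_cst// mul0r addr0 lerXn2r ?nnegrE//.
Qed.

(** A bound for the weight exponent while the difference is at most [1]: the first solution is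
    bounded by [m] in [H], the second by [m + 1], and [size2_sq_le] integrates to
    [3 (T + 4 m + 1)]. *)
Definition gap_bound (m : R) : R := 2 * K (2 * m + 1) * (3 * (T + 4 * m + 1)).

Definition gap_factor (m : R) : R := expR (- gap_bound m) * Num.min 1 (2 * th (2 * m + 1)).

Lemma gap_factor_gt0 m : 0 < gap_factor m.
Proof. by rewrite mulr_gt0 ?expR_gt0// lt_min ltr01 mulr_gt0. Qed.

Lemma size2_sq_le (u v : V) : size2 u v ^+ 2 <= 3 * (1 + 4 * `|u| ^+ 2 + `|u - v| ^+ 2).
Proof.
have h : size2 u v <= 1 + 2 * `|u| + `|u - v|.
  have : `|v| <= `|u| + `|u - v| by rewrite -{1}(subKr u v) (le_trans (ler_normB _ _)).
  by rewrite /size2; lra.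
apply: (@le_trans _ _ ((1 + 2 * `|u| + `|u - v|) ^+ 2)).
  by rewrite lerXn2r ?nnegrE ?addr_ge0 ?mulr_ge0.
have := sqr_ge0 (1 - 2 * `|u|); have := sqr_ge0 (1 - `|u - v|); have := sqr_ge0 (2 * `|u| - `|u - v|).
by rewrite !expr2; move: `|u| `|u - v| => x y; lra.
Qed.

(** While the unweighted energy of the difference is at most [1], the second solution is controlled
    by the first, so all constants depend on [m] alone. The weighted bound then improves [1] to
    [eta], and continuation closes the argument. *)
Lemma gap_stable (w : Omega) (m eta lam : R) : 0 <= m -> eta < 1 ->
  solution_path j W c T u01 u1 v1 M1 a1 N1 S1 w ->
  solution_path j W c T u02 u2 v2 M2 a2 N2 S2 w ->
  \int[mu]_(r in `[0, T]) `|v1 r w| ^+ 2 <= m ->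
  (\forall r \ae mu, `[0, T]%classic r -> `|j (v1 r w)| <= m) ->
  `|u01 w - u02 w| ^+ 2 <= eta ->
  (forall t, 0 <= t <= T -> weighted_energy gap_h gap_th gap_gam t w <= lam) -> lam <= gap_factor m * eta ->
  forall t, 0 <= t <= T -> `|gap_h t w| ^+ 2 + \int[mu]_(r in `[0, t]) `|v1 r w - v2 r w| ^+ 2 <= eta.
Proof.
move=> m0 eta1 h1 h2 v1m jm x0e we lame.
have i2 := gap_v2 h1 h2; have ith := gap_th_rint h1 h2; have ig := gap_gam_rint h1 h2.
apply: continuation => //.
- have ch : {within `[0, T], continuous (gap_h ^~ w)}.
    by move=> t; apply: cvgB; [exact: (sp_cont h1)|exact: (sp_cont h2)].
  have ch2 : {within `[0, T], continuous (fun t => `|gap_h t w| ^+ 2 : R)}.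
    apply: (within_comp (F := fun x : H => `|x| ^+ 2 : R^o) ch) => x.
    have c1 : `|y| @[y --> x] --> `|x| by apply: cvg_norm; exact: cvg_id.
    exact: (cvgM c1 c1).
  have cI := parameterized_integral_continuous (ltW T0) i2.
  by move=> t; apply: cvgD; [exact: ch2|exact: cI].
- by rewrite Rintegral_itv_pt addr0 /gap_h (sp_start h1) (sp_start h2).
move=> t tT F1; have /andP[t0 tT'] := tT; have mt := measurable_segment 0 t.
have subt : `[0, t] `<=` `[0, T] by move=> r /=; rewrite !in_itv/= => /andP[-> /le_trans]; apply.
have i2t := rint_itvS i2 (lexx 0) tT'.
have hs s : 0 <= s <= t -> `|gap_h s w| <= 1.
  move=> st; rewrite -(@ler_pXn2r _ 2) ?nnegrE// expr1n; apply: le_trans (F1 s st).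
  by rewrite lerDl Rintegral_itv_ge0// => r _; exact: sqr_ge0.
have it1 : \int[mu]_(r in `[0, t]) `|v1 r w - v2 r w| ^+ 2 <= 1.
  by apply: le_trans (F1 t _); [rewrite lerDr sqr_ge0|rewrite t0 lexx].
have sz : \forall r \ae mu, `[0, t]%classic r -> size_rate (v1 r w) (v2 r w) <= 2 * m + 1.
  have ej := @filterI _ _ (ae_filter_ringOfSetsType mu) _ _ (sp_jv h1) (sp_jv h2).
  apply: (@filterS2 _ _ (ae_filter_ringOfSetsType mu) _ _ _ _ ej jm) => r [j1 j2] jr rt.
  have rT := subt _ rt; have := jr rT; rewrite /size_rate j1// j2// => h.
  have : `|gap_h r w| <= 1 by apply: hs; move: rt; rewrite /= in_itv.
  have : `|inH u2 r w| <= `|inH u1 r w| + `|gap_h r w|.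
    by rewrite -{1}(subKr (inH u1 r w) (inH u2 r w)) (le_trans (ler_normB _ _)).
  by move: h; lra.
have hG : \int[mu]_(r in `[0, t]) gap_gam r w <= gap_bound m.
  have iv1 := rint_itvS (sp_v2 h1) (lexx 0) tT'.
  have ic : rint mu `[0, t] (fun=> 1) by apply: rint_cst => //; exact: segment_finite.
  have i3 : rint mu `[0, t] (fun r => 1 + 4 * `|v1 r w| ^+ 2 + `|v1 r w - v2 r w| ^+ 2).
    exact: (rintD mt (rintD mt ic (rintZl mt 4 iv1)) i2t).
  apply: (@le_trans _ _ (\int[mu]_(r in `[0, t]) ((2 * K (2 * m + 1) * 3) *
      (1 + 4 * `|v1 r w| ^+ 2 + `|v1 r w - v2 r w| ^+ 2)))).
    apply: (ae_le_Rintegral mt (rint_itvS ig (lexx 0) tT') (rintZl mt _ i3)).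
    apply: (@filterS _ _ (ae_filter_ringOfSetsType mu) _ _ _ sz) => r hr rt.
    rewrite /gap_gam -[leRHS]mulrA; apply: ler_pM; [by rewrite mulr_ge0|exact: sqr_ge0| |exact: size2_sq_le].
    by rewrite ler_pM2l//; apply: Km; exact: hr.
  rewrite (RintegralZl _ mt i3) /gap_bound -mulrA ler_wpM2l ?mulr_ge0// ler_pM2l//.
  rewrite (RintegralD mt (rintD mt ic (rintZl mt 4 iv1)) i2t) (RintegralD mt ic (rintZl mt 4 iv1)) (RintegralZl _ mt iv1).
  have := Rintegral_itv_mono (sp_v2 h1) t0 tT' (fun r _ => sqr_ge0 _).
  rewrite (Rintegral_cst mu mt)/= lebesgue_measure_itv/= lte_fin.
  by case: ifPn => _; rewrite /= ?subr0; move: v1m it1 tT' T0; lra.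
have hk : 0 <= Num.min 1 (2 * th (2 * m + 1)) <= 1.
  by rewrite le_min ler01 ge_min lexx/= andbT mulr_ge0// ltW.
have hp : \forall r \ae mu, `[0, t]%classic r -> Num.min 1 (2 * th (2 * m + 1)) * `|v1 r w - v2 r w| ^+ 2 <= gap_th r w.
  apply: (@filterS _ _ (ae_filter_ringOfSetsType mu) _ _ _ sz) => r hr rt.
  rewrite /gap_th ler_wpM2r ?sqr_ge0// ge_min; apply/orP; right.
  by rewrite ler_pM2l//; apply: thm; exact: hr.
have := weighted_energy_lower T0 ig (fun r => gap_gam_ge0 r w) ith (fun r => gap_th_ge0 r w) i2 (sqr_ge0 `|gap_h t w|) tT hk hG hp.
rewrite -/(gap_factor m) => /le_trans/(_ (we t tT))/le_trans/(_ lame).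
by rewrite ler_pM2l// gap_factor_gt0.
Qed.

End difference_estimate.

(** * Stability in probability *)

Section outer_limits.
Context (R : realType) d (Omega : measurableType d) (P : probability Omega R).

Lemma mu_ext_ae_sub (B A : set Omega) : (\forall w \ae P, B w -> A w) ->
  (mu_ext P B <= mu_ext P A)%E.
Proof.
move=> [N [mN PN hN]].
have BAN : B `<=` A `|` N.
  by move=> w Bw; have [Aw|nAw] := pselect (A w); [left|right; apply: hN => /(_ Bw)].
apply: (le_trans (le_mu_ext P BAN)); apply: (le_trans (outer_measureU2 _ _ _)).
have N0 : mu_ext P N = 0%E by rewrite measurable_mu_extE.
by change (mu_ext P A + mu_ext P N <= mu_ext P A)%E; rewrite N0 adde0.
Qed.

Lemma ereal_cvg0 (f : nat -> \bar R) : (forall n, (0 <= f n)%E) ->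
  (forall z : R, 0 < z -> \forall n \near \oo, (f n <= z%:E)%E) -> f n @[n --> \oo] --> 0%E.
Proof.
move=> f0 h; apply/fine_cvgP; split.
  apply: filterS (h 1 ltr01) => n hn.
  by rewrite ge0_fin_numE// (le_lt_trans hn)// ltry.
apply/cvgrPdist_le => z z0; apply: filterS (h z z0) => n hn /=.
rewrite sub0r normrN ger0_norm ?fine_ge0// -lee_fin fineK//.
by rewrite ge0_fin_numE// (le_lt_trans hn)// ltry.
Qed.

Lemma cvg0_eventually (f : nat -> \bar R) (z : R) : f n @[n --> \oo] --> 0%E -> 0 < z ->
  \forall n \near \oo, (f n < z%:E)%E.
Proof. by move=> fc z0; apply: (fc [set x | (x < z%:E)%E]); apply: open_ereal_lt'; rewrite lte_fin. Qed.

End outer_limits.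

Section exhaustion.
Context (R : realType) (V H : hilbertType R) (j : bop V H) d (Omega : measurableType d).
Context (P : probability Omega R) (Fil : R -> set (set Omega)) (hF : filtration Fil) (T : R) (T0 : 0 < T).
Local Notation mu := (@lebesgue_measure R).

Lemma adapted_integral_measurable (f : R -> Omega -> R) : adapted_real Fil f -> (forall r w, 0 <= f r w) ->
  measurable_fun setT (fun w => \int[mu]_(r in `[0%R, T]) (f r w)%:E)%E.
Proof.
move=> af f0; have h := adapted_integral (ltW T0) af f0 (measurable_itv `[0, T]) (@subset_refl _ _).
move=> _ B mB; rewrite setTI; have := h measurableT B mB; rewrite setTI.
rewrite (fil_measurableE hF (ltW T0)) => h'; apply: (fil_sub hF (ltW T0) h').
Qed.

(** Almost every path satisfies both bounds for some integer, so the increasing sets [A n] exhaust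
    [Omega] up to a null set. *)
Lemma path_exhaustion (v : R -> Omega -> V) (eps : R) : adapted_strong Fil v ->
  (\forall w \ae P, rint mu `[0, T] (fun r => `|v r w| ^+ 2) /\
     exists b, \forall r \ae mu, `[0, T]%classic r -> `|j (v r w)| <= b) -> 0 < eps ->
  exists (m : R) (A : set Omega), [/\ 0 <= m, measurable A, (P (~` A) < eps%:E)%E &
    forall w, A w -> (\int[mu]_(r in `[0%R, T]) (`|v r w| ^+ 2)%:E <= m%:E)%E /\
      \forall r \ae mu, `[0, T]%classic r -> `|j (v r w)| <= m].
Proof.
move=> av hv eps0.
have mt := measurable_segment 0 T.
pose f1 w := (\int[mu]_(r in `[0%R, T]) (`|v r w| ^+ 2)%:E)%E.
(* An essential bound on [|j v|] is encoded as the vanishing of a time integral, which is measurable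
   in [w] by Tonelli. *)
pose ind (n : nat) r w : R := \1_(`]n%:R, +oo[) `|j (v r w)|.
pose f2 n w := (\int[mu]_(r in `[0%R, T]) (ind n r w)%:E)%E.
have av2 : adapted_real Fil (fun r w => `|v r w| ^+ 2).
  by apply: (adapted_real_comp (F := fun x : R => x ^+ 2)); [exact: exprn_measurable|exact: adapted_strong_norm].
have m1 : measurable_fun setT f1 by apply: adapted_integral_measurable => // r w; exact: sqr_ge0.
have aind n : adapted_real Fil (ind n).
  apply: (adapted_real_comp (F := \1_(`]n%:R, +oo[))).
    by apply: measurable_indic; exact: measurable_itv.
  by apply: adapted_strong_norm; apply: adapted_strong_comp => //; exact: bop_continuous.
have ind0 n r w : 0 <= ind n r w by rewrite /ind indicE.
have m2 n : measurable_fun setT (f2 n) by exact: adapted_integral_measurable.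
pose A n := [set w | (f1 w <= n%:R%:E)%E] `&` [set w | f2 n w = 0%E].
have mA n : measurable (A n).
  apply: measurableI.
    rewrite (_ : [set _ | _] = setT `&` f1 @^-1` `]-oo, n%:R%:E]%classic).
      by apply: m1 => //; exact: emeasurable_itv.
    by rewrite setTI; apply/seteqP; split => w /=; rewrite in_itv.
  rewrite (_ : [set _ | _] = setT `&` f2 n @^-1` [set 0%E]); first by apply: m2 => //; exact: emeasurable_set1.
  by rewrite setTI.
have pmeas w n : measurable_fun `[0, T] (ind n ^~ w) by exact: adapted_real_path.
have f2P n w : f2 n w = 0%E <-> \forall r \ae mu, `[0, T]%classic r -> `|j (v r w)| <= n%:R.
  have -> : f2 n w = (\int[mu]_(r in `[0%R, T]) `|(ind n r w)%:E|)%E.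
    by apply: eq_integral => r _; rewrite gee0_abs// lee_fin.
  have mi : measurable_fun `[0, T] (fun r => (ind n r w)%:E) by apply/measurable_EFinP; exact: pmeas.
  rewrite (ae_eq_integral_abs mu mt mi); split => h.
    apply: (@filterS _ _ (ae_filter_ringOfSetsType mu) _ _ _ h) => r hr rt; rewrite leNgt; apply/negP => lt.
    move: (hr rt) => /eqP; rewrite /ind indicE mem_set/= ?eqe ?oner_eq0//.
    by rewrite in_itv/= lt.
  apply: (@filterS _ _ (ae_filter_ringOfSetsType mu) _ _ _ h) => r hr rt; rewrite /ind indicE memNset//=.
  by rewrite in_itv/= andbT => /lt_geF; rewrite hr.
have Amono n k : (n <= k)%N -> A n `<=` A k.
  move=> nk w [h1 /f2P h2]; split; first by apply: (le_trans h1); rewrite lee_fin ler_nat.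
  apply/f2P; apply: (@filterS _ _ (ae_filter_ringOfSetsType mu) _ _ _ h2) => r hr rt.
  by rewrite (le_trans (hr rt))// ler_nat.
have c0 : P (~` A n) @[n --> \oo] --> 0%E.
  have <- : P (\bigcap_n ~` A n) = 0%E.
    have [N [mN PN hN]] := hv.
    apply/eqP; rewrite eq_le measure_ge0 andbT -PN le_measure ?inE//.
      by apply: bigcap_measurable => // k _; exact: measurableC.
    move=> w /= hw; apply: hN => -[iv [b hb]].
    have fl := rint_lty iv.
    pose n := (Num.truncn (`|fine (f1 w)| + `|b|)).+1.
    have hn : `|fine (f1 w)| + `|b| <= n%:R by rewrite ltW// truncnS_gt.
    have := hw n I; apply; split.
      have ff : f1 w \is a fin_num.
        rewrite ge0_fin_numE; last by apply: integral_ge0 => r _; rewrite lee_fin sqr_ge0.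
        by move: fl; under eq_integral do rewrite ger0_norm ?sqr_ge0//.
      rewrite /= -(fineK ff) lee_fin; apply: le_trans hn; rewrite (le_trans (ler_norm _))// lerDl//.
    apply/f2P; apply: (@filterS _ _ (ae_filter_ringOfSetsType mu) _ _ _ hb) => r hr rt.
    rewrite (le_trans (hr rt))// (le_trans (ler_norm _))//; apply: le_trans hn; rewrite lerDr//.
  apply: (@nonincreasing_cvg_mu _ _ _ P (fun n => ~` A n)).
  - by apply: (@le_lt_trans _ _ 1%E); [apply: probability_le1; exact: measurableC|exact: ltry].
  - by move=> n; exact: measurableC.
  - by apply: bigcap_measurable => // k _; exact: measurableC.
  - by move=> n k nk; apply/subsetPset; apply: subsetC; exact: Amono.
near \oo => n; exists n%:R, (A n); split => //.
  by near: n; exact: cvg0_eventually c0 eps0.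
by move=> w [h1 /f2P h2].
Unshelve. all: end_near.
Qed.

End exhaustion.

Section stability_in_probability.
Context (R : realType) (V H U : hilbertType R) (e : onb U) (j : bop V H) (jtriple : gelfand_triple j).
Context d (Omega : measurableType d) (P : probability Omega R) (Fil : R -> set (set Omega)).
Context (W : R -> U -> Omega -> R) (hF : filtration Fil) (hW : cylindrical_BM P Fil W).
Context (c : coefs V H e Omega) (hc : critical_variational j P Fil c) (T : R) (T0 : 0 < T).
Local Notation mu := (@lebesgue_measure R).

Lemma dist_le_sqrt (u01 u02 : Omega -> H) (u1 u2 : process V H Omega) v1 v2 M1 M2 a1 a2 N1 N2 S1 S2 (eta : R) w :
  0 <= eta -> adapted_strong Fil v1 -> adapted_strong Fil v2 ->
  solution_path j W c T u01 u1 v1 M1 a1 N1 S1 w ->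
  solution_path j W c T u02 u2 v2 M2 a2 N2 S2 w ->
  (forall t, 0 <= t <= T -> `|inH u1 t w - inH u2 t w| ^+ 2 <= eta) ->
  \int[mu]_(r in `[0, T]) `|v1 r w - v2 r w| ^+ 2 <= eta ->
  (dist_C T u1 u2 w <= (Num.sqrt eta)%:E)%E /\ (dist_L2 T u1 u2 w <= (Num.sqrt eta)%:E)%E.
Proof.
move=> eta0 av1 av2 h1 h2 hC hL; split.
  apply: ge_ereal_sup => _ [t tT <-]; rewrite lee_fin.
  rewrite -[leLHS](ger0_norm (normr_ge0 _)) -sqrtr_sqr ler_wsqrtr//; apply: hC.
  by move: tT; rewrite /= in_itv.
have i2 := gap_v2 T0 av1 av2 h1 h2.
have E : (\int[mu]_(t in `[0%R, T]) (`|inV u1 t w - inV u2 t w| ^+ 2)%:E)%E =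
    (\int[mu]_(r in `[0, T]) `|v1 r w - v2 r w| ^+ 2)%:E.
  rewrite (rint_EFin (measurable_segment 0 T) i2); apply: eq_integral => r _.
  by rewrite (sp_v h1) (sp_v h2).
rewrite /dist_L2 E poweR_EFin lee_fin powR12_sqrt ?ler_wsqrtr//.
by apply: Rintegral_itv_ge0 => r _; exact: sqr_ge0.
Qed.

(** Three bad events of outer probability at most [z / 3] are excluded: the path of [u] is large,
    the initial values are more than [del] apart, or the weighted energy exceeds [lam + del^2]. On
    the remaining paths [gap_stable] applies. The constant [m] belongs to [u] alone and is fixed
    before [n]. *)
Theorem stability_in_probability (u0 : Omega -> H) (u0n : nat -> Omega -> H)
    (u : process V H Omega) (un : nat -> process V H Omega) :
  strongly_mfun (Fil 0) setT u0 -> (forall n, strongly_mfun (Fil 0) setT (u0n n)) ->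
  global_solution j P Fil W c u0 u -> (forall n, global_solution j P Fil W c (u0n n) (un n)) ->
  cvg0_in_prob P (fun n w => (`|u0n n w - u0 w|)%:E) ->
  cvg0_in_prob P (fun n w => dist_C T u (un n) w + dist_L2 T u (un n) w)%E.
Proof.
move=> m0 m0n gu gun cv eps eps0; apply: ereal_cvg0 => [n|z z0]; first exact: mu_ext_ge0.
have [th [K [th0 K0 thm Km hK]]] := critical_local_monotonicity jtriple T0 hc.
have [v1 [M1 [a1 [N1 [S1 [av1 aS1 sp1]]]]]] := solution_data jtriple hF hW hc T0 gu.
have z3 : 0 < z / 3 by rewrite divr_gt0.
have [|m [A [m_ge0 mA PA hA]]] := path_exhaustion (j := j) (P := P) hF T0 (eps := z / 3) av1 _ z3.
  move: sp1; apply: filterS => w h1; split; first exact: sp_v2 h1.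
  have [b hb] := within_bounded T0 (sp_cont h1); exists b.
  apply: (@filterS _ _ (ae_filter_ringOfSetsType mu) _ _ _ (sp_jv h1)) => r hr rt.
  by rewrite hr// hb//; move: rt; rewrite /= in_itv.
(* Below [1] for the continuation, and with [sqrt eta <= eps / 2] so that the two distances add up
   to at most [eps]. *)
pose eta : R := Num.min 2^-1 ((eps / 2) ^+ 2).
have eta0 : 0 < eta by rewrite lt_min invr_gt0 ltr0n/= exprn_gt0// divr_gt0.
have eta1 : eta < 1 by rewrite gt_min invf_lt1// ltr1n.
have seta : Num.sqrt eta + Num.sqrt eta <= eps.
  have : Num.sqrt eta <= eps / 2.
    by rewrite -(@ger0_norm _ (eps / 2)) ?divr_ge0 ?(ltW eps0)// -sqrtr_sqr ler_wsqrtr// ge_min lexx orbT.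
  by lra.
pose g := gap_factor T th K m; have g0 : 0 < g by exact: gap_factor_gt0.
pose lam := g * eta / 2; have lam0 : 0 < lam by rewrite divr_gt0// mulr_gt0.
(* The three bounds give, in turn, [lam + del^2 <= g * eta], an initial difference within [eta], and
   [del^2 / lam <= z / 3] in the maximal inequality. *)
pose del2 : R := Num.min (Num.min lam eta) (lam * (z / 3)).
have del20 : 0 < del2 by rewrite lt_min (mulr_gt0 lam0 z3) andbT lt_min lam0.
have [del2l del2e] : del2 <= lam /\ del2 <= eta.
  have : del2 <= Num.min lam eta by rewrite /del2 ge_min lexx.
  by rewrite le_min => /andP.
pose del := Num.sqrt del2; have delE : del ^+ 2 = del2 by rewrite sqr_sqrtr// ltW.
have del0 : 0 < del by rewrite sqrtr_gt0.
near=> n.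
have hX : (mu_ext P [set w | (del%:E < (`|u0n n w - u0 w|)%:E)%E] <= (z / 3)%:E)%E.
  by apply: ltW; near: n; exact: cvg0_eventually (cv del del0) z3.
set X := [set w | _] in hX.
have [v2 [M2 [a2 [N2 [S2 [av2 aS2 sp2]]]]]] := solution_data jtriple hF hW hc T0 (gun n).
have est := difference_estimate jtriple hF hW T0 th0 K0 thm Km _ m0 (m0n n) av1 av2 aS1 aS2 sp1 sp2 (ltW del0) lam0.
set B := [set w | _ /\ _] in est.
have hB : (mu_ext P B <= (z / 3)%:E)%E.
  have : (lam%:E * mu_ext P B <= lam%:E * (z / 3)%:E)%E.
    apply: le_trans (est _) _; first by move: hK; apply: filterS => w hw t x y tT; have [] := hw t x y tT.
    by rewrite -EFinM lee_fin delE /del2 ge_min lexx orbT.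
  by rewrite lee_pmul2l// lte_fin.
apply: (@le_trans _ _ (mu_ext P (~` A `|` (X `|` B)))); last first.
  apply: (le_trans (outer_measureU2 _ _ _)).
  have -> : z%:E = ((z / 3)%:E + ((z / 3)%:E + (z / 3)%:E))%E by rewrite -!EFinD; congr EFin; lra.
  apply: leeD; last by apply: (le_trans (outer_measureU2 _ _ _)); exact: leeD.
  have -> : (measure_extension_mu_ext__canonical__measure_extension_OuterMeasure P (~` A) = P (~` A))%E.
    by apply: measurable_mu_extE; exact: measurableC.
  exact: ltW.
apply: mu_ext_ae_sub; move: sp1 sp2; apply: filterS2 => w h1 h2 hw.
apply: contrapT => nw; have Aw : A w by apply: contrapT => h; apply: nw; left.
have nX : `|u0 w - u0n n w| <= del.
  by rewrite leNgt; apply/negP => h; apply: nw; right; left; rewrite /X/= lte_fin distrC.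
have we : forall t, 0 <= t <= T -> weighted_energy (gap_h u (un n)) (gap_th j th v1 v2) (gap_gam j K v1 v2) t w <= lam + del ^+ 2.
  move=> t tT; rewrite leNgt; apply/negP => h; apply: nw; right; right; split => //.
  by exists t.
have [A1 A2] := hA w Aw.
have v1m : \int[mu]_(r in `[0, T]) `|v1 r w| ^+ 2 <= m.
  by rewrite -lee_fin (rint_EFin (measurable_segment 0 T) (sp_v2 h1)).
have x0e : `|u0 w - u0n n w| ^+ 2 <= eta.
  apply: (@le_trans _ _ (del ^+ 2)); first by rewrite lerXn2r ?nnegrE ?(ltW del0).
  by rewrite delE.
have lame : lam + del ^+ 2 <= g * eta.
  by move: del2l; rewrite delE /lam; lra.
have st := gap_stable T0 th0 K0 thm Km av1 av2 m_ge0 eta1 h1 h2 v1m A2 x0e we lame.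
have [|| dC dL] := dist_le_sqrt (ltW eta0) av1 av2 h1 h2 (eta := eta).
- by move=> t tT; apply: le_trans (st t tT); rewrite lerDl Rintegral_itv_ge0// => r _; exact: sqr_ge0.
- by apply: le_trans (st T _); [rewrite lerDr sqr_ge0|rewrite lexx ltW].
move: hw; rewrite /= ltNge => /negP; apply; apply: (le_trans (leeD dC dL)).
by rewrite -EFinD lee_fin.
Unshelve. all: end_near.
Qed.

End stability_in_probability.

(** * Moments *)

Fact thirds (R : realType) (z : R) : z%:E = ((z / 3)%:E + (z / 3)%:E + (z / 3)%:E)%E.
Proof. by rewrite -!EFinD; congr EFin; lra. Qed.

Section moments.
Context (R : realType) d (Omega : measurableType d) (P : probability Omega R).

Lemma integral_scaled_indic (k : R) (B : set Omega) : 0 <= k -> measurable B ->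
  (\int[P]_w (k * \1_B w)%:E = k%:E * P B)%E.
Proof.
move=> k0 mB; under eq_integral do rewrite EFinM.
rewrite ge0_integralZl//.
  by rewrite integral_indic// setIT.
by apply/measurable_EFinP; exact: measurable_indic.
Qed.

(* [B0] and [B k] are measurable hulls; [X ^ q <= (2 ^ k.+1 L) ^ q] where
   [2 ^ k L < X <= 2 ^ k.+1 L]. *)
Lemma dyadic_moment_le (X : Omega -> \bar R) (q eps L : R) (B0 : set Omega) (B : nat -> set Omega) :
  0 < q -> 0 < eps -> 0 < L -> (forall w, 0 <= X w)%E ->
  measurable B0 -> (forall k, measurable (B k)) ->
  (forall w, (eps%:E < X w)%E -> B0 w) -> (forall k w, ((2 ^+ k * L)%:E < X w)%E -> B k w) ->
  (\int[P]_w (X w `^ q) <=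
   (eps `^ q)%:E + (L `^ q)%:E * P B0 + \sum_(k <oo) ((2 ^+ k.+1 * L) `^ q)%:E * P (B k))%E.
Proof.
move=> q0 eps0 L0 X0 mB0 mB hB0 hB.
pose t k w := ((2 ^+ k.+1 * L) `^ q * \1_(B k) w)%:E.
have t0 k w : (0 <= t k w)%E by rewrite lee_fin mulr_ge0 ?powR_ge0// indicE.
have mt k : measurable_fun setT (t k).
  by apply/measurable_EFinP; apply: measurable_funM => //; exact: measurable_indic.
pose g w := ((eps `^ q)%:E + (L `^ q * \1_B0 w)%:E + \sum_(k <oo) t k w)%E.
have l0 w : (0 <= (L `^ q * \1_B0 w)%:E)%E by rewrite lee_fin mulr_ge0 ?powR_ge0// indicE.
have s0 w : (0 <= \sum_(k <oo) t k w)%E by apply: nneseries_ge0.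
have e0 : (0 <= (eps `^ q)%:E)%E by rewrite lee_fin powR_ge0.
have two k : 0 < 2 ^+ k * L by rewrite mulr_gt0// exprn_gt0.
have key w (y : R) : 0 < y -> (y%:E <= X w)%E -> ((y `^ q)%:E <= g w)%E.
  move=> y0 yX; have mono a b : 0 <= a -> a <= b -> a `^ q <= b `^ q.
    by move=> a0 ab; apply: ge0_ler_powR; rewrite ?nnegrE ?(ltW q0)// (le_trans a0).
  have [ye|ey] := leP y eps.
    apply: (@le_trans _ _ (eps `^ q)%:E); first by rewrite lee_fin mono// ltW.
    by rewrite /g -addeA; apply: leeDl; exact: adde_ge0.
  have [yL|Ly] := leP y L.
    have Bw : B0 w by apply: hB0; apply: lt_le_trans yX; rewrite lte_fin.
    apply: (@le_trans _ _ (L `^ q * \1_B0 w)%:E).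
      by rewrite indicE mem_set// mulr1 lee_fin mono// ltW.
    by rewrite /g addeAC; apply: leeDr; exact: adde_ge0.
  have ex : exists k, y <= 2 ^+ k * L.
    exists (Num.truncn (y / L)).+1; rewrite -ler_pdivrMr// ltW// (lt_le_trans (truncnS_gt _))//.
    by rewrite -natrX ler_nat ltnW// ltn_expl.
  case: (ex_minnP ex) => -[|k]; first by rewrite expr0 mul1r leNgt Ly.
  move=> yk kmin; have Bw : B k w.
    apply: hB; apply: lt_le_trans yX; rewrite lte_fin ltNge; apply/negP => /kmin.
    by rewrite ltnn.
  apply: (@le_trans _ _ (t k w)); first by rewrite /t indicE mem_set// mulr1 lee_fin mono// ltW.
  apply: (@le_trans _ _ (\sum_(i <oo) t i w)%E); last by apply: leeDr; exact: adde_ge0.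
  apply: (@le_trans _ _ (\sum_(0 <= i < k.+1) t i w)%E); last exact: nneseries_lim_ge.
  by rewrite big_nat_recr//= leeDr// sume_ge0.
have Xg w : (X w `^ q <= g w)%E.
  have := X0 w; have := key w; case: (X w) => [x| |] // kw.
    rewrite lee_fin le_eqVlt => /orP[/eqP<-|x0]; last by rewrite poweR_EFin; exact: kw.
    by rewrite poweR_EFin powR0 ?gt_eqF//; apply: adde_ge0 => //; exact: adde_ge0.
  move=> _; rewrite poweRyr ?gt_eqF// leye_eq; apply/eqP/eqyP => r r0.
  have h : 0 < r `^ q^-1 by exact: powR_gt0.
  apply: le_trans (kw _ h (leey _)).
  by rewrite lee_fin -powRrM mulVf ?gt_eqF// powRr1// ltW.
apply: (@le_trans _ _ (\int[P]_w g w)%E).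
  by apply: ge0_le_integral_sup => // w _; exact: poweR_ge0.
have mg1 : measurable_fun setT (fun w => (L `^ q * \1_B0 w)%:E).
  by apply/measurable_EFinP; apply: measurable_funM => //; exact: measurable_indic.
have mg2 : measurable_fun setT (fun w => \sum_(k <oo) t k w)%E by exact: ge0_emeasurable_sum.
rewrite /g ge0_integralD//; last 2 first.
- by move=> w _; exact: adde_ge0.
- by apply: emeasurable_funD.
rewrite ge0_integralD// (integral_cst P measurableT) [X in (_ * X)%E]probability_setT mule1 integral_scaled_indic ?powR_ge0//.
rewrite integral_nneseries//; apply: leeD => //; apply: lee_nneseries => [k _ _|k _].
  by apply: integral_ge0.
by rewrite integral_scaled_indic// powR_ge0.
Qed.

(** Values up to [eps] contribute at most [eps^q], values between [eps] and [L] are handled by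
    convergence in probability, and on the dyadic shells beyond [L] the tail bound gives a geometric
    series of ratio [2^(q - 2) < 1]. *)
Lemma moment_cvg (X : nat -> Omega -> \bar R) (C q : R) : 0 <= C -> 0 < q < 2 ->
  (forall n w, 0 <= X n w)%E -> cvg0_in_prob P X ->
  (forall n L, 0 < L -> (mu_ext P [set w | (L%:E < X n w)%E] <= (C / L ^+ 2)%:E)%E) ->
  (\int[P]_w (X n w `^ q))%E @[n --> \oo] --> 0%E.
Proof.
move=> C0 /andP[q0 q2] X0 cX tail; apply: ereal_cvg0 => [n|z z0].
  by apply: integral_ge0 => w _; exact: poweR_ge0.
have z3 : 0 < z / 3 by rewrite divr_gt0.
pose rho : R := 2 `^ (q - 2).
have rho0 : 0 < rho by exact: powR_gt0.
have rho1 : rho < 1.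
  by rewrite /rho /powR pnatr_eq0/= expR_lt1 pmulr_llt0 ?subr_lt0// ln_gt0// ltr1n.
(* [A * L^(q - 2)] is the sum of the shell contributions; as [q < 2], it equals [z / 3] for a
   suitable [L]. *)
pose A : R := (C + 1) * 2 `^ q / (1 - rho).
have A0 : 0 < A by rewrite divr_gt0 ?subr_gt0// mulr_gt0 ?powR_gt0// ltr_wpDl.
pose L := (z / 3 / A) `^ (q - 2)^-1.
have L0 : 0 < L by apply: powR_gt0; rewrite divr_gt0.
have qn : q - 2 != 0 by rewrite lt_eqF// subr_lt0.
have LE : L `^ (q - 2) = z / 3 / A by rewrite -powRrM mulVf// powRr1// divr_ge0 ?ltW.
pose eps := (z / 3) `^ q^-1.
have eps0 : 0 < eps by exact: powR_gt0.
have epsE : eps `^ q = z / 3 by rewrite -powRrM mulVf ?gt_eqF// powRr1// ltW.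
have p0 : 0 < z / 3 / L `^ q by rewrite divr_gt0// powR_gt0.
near=> n.
have hn : (mu_ext P [set w | (eps%:E < X n w)%E] < (z / 3 / L `^ q)%:E)%E.
  by near: n; exact: cvg0_eventually (cX eps eps0) p0.
have [B0 [mB0 hB0 PB0]] := mu_ext_hull hn.
have two k : 0 < 2 ^+ k * L by rewrite mulr_gt0// exprn_gt0.
(* [C + 1] instead of [C] makes the tail bound strict, as the choice of a measurable hull
   requires. *)
have /choice[B hB] : forall k, exists B, [/\ measurable B, [set w | ((2 ^+ k * L)%:E < X n w)%E] `<=` B &
    (P B < ((C + 1) / (2 ^+ k * L) ^+ 2)%:E)%E].
  move=> k; apply: mu_ext_hull; apply: (le_lt_trans (tail n _ (two k))).
  by rewrite lte_fin ltr_pM2r ?invr_gt0 ?exprn_gt0// ltrDl.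
apply: (le_trans (dyadic_moment_le q0 eps0 L0 (X0 n) mB0 (fun k => let: And3 h _ _ := hB k in h) hB0
  (fun k => let: And3 _ h _ := hB k in h))).
rewrite (thirds z).
apply: leeD; first apply: leeD.
- by rewrite epsE.
- apply: (@le_trans _ _ ((L `^ q)%:E * (z / 3 / L `^ q)%:E)%E).
    by apply: lee_wpmul2l; [rewrite lee_fin powR_ge0|exact: ltW].
  by rewrite -EFinM lee_fin mulrC divfK// gt_eqF// powR_gt0.
have term k : (2 ^+ k.+1 * L) `^ q * ((C + 1) / (2 ^+ k * L) ^+ 2) =
    ((C + 1) * 2 `^ q * L `^ (q - 2)) * rho ^+ k.
  have e1 : (2 ^+ k.+1 * L) `^ q = 2 `^ q * ((2 ^+ k * L) `^ (q - 2) * (2 ^+ k * L) ^+ 2).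
    rewrite -(powR_mulrn 2 (ltW (two k))) -powRD ?(gt_eqF (two k)) ?implybT// subrK.
    by rewrite exprS -mulrA powRM// ltW.
  have e2 : (2 ^+ k * L) `^ (q - 2) = rho ^+ k * L `^ (q - 2).
    rewrite powRM ?(ltW L0)// ?exprn_ge0//; congr (_ * _).
    by rewrite -(powR_mulrn k (_ : 0 <= 2 :> R))// powRAC powR_mulrn// ltW.
  by rewrite e1 e2; field; rewrite !gt_eqF// exprn_gt0.
apply: lime_le.
  by apply: is_cvg_nneseries => k _ _; rewrite mule_ge0 ?lee_fin ?powR_ge0.
apply: nearW => m.
apply: (@le_trans _ _ (series (geometric ((C + 1) * 2 `^ q * L `^ (q - 2)) rho) m)%:E).
  rewrite /series/= -sumEFin; apply: lee_sum => k _.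
  have [_ _ /ltW h] := hB k; rewrite /geometric/= -term EFinM.
  by apply: lee_wpmul2l => //; rewrite lee_fin powR_ge0.
rewrite lee_fin; apply: (le_trans (geometric_le_lim _ _ _ _)) => //.
- by rewrite mulr_ge0 ?powR_ge0// mulr_ge0 ?powR_ge0// addr_ge0.
- by rewrite ger0_norm// ltW.
rewrite LE (_ : _ * _ = z / 3)// /A.
by field; rewrite !gt_eqF ?subr_gt0 ?powR_gt0// ltr_wpDl.
Unshelve. all: end_near.
Qed.

End moments.

(** * Tails under coercivity *)

Section coercive_energy.
Context (R : realType) (V H U : hilbertType R) (e : onb U) (j : bop V H) (jtriple : gelfand_triple j).
Context d (Omega : measurableType d) (P : probability Omega R) (Fil : R -> set (set Omega)).
Context (W : R -> U -> Omega -> R) (hF : filtration Fil) (hW : cylindrical_BM P Fil W).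
Context (c : coefs V H e Omega) (T : R) (T0 : 0 < T).
Local Notation mu := (@lebesgue_measure R).
Local Notation itg F := (rint mu `[0, T] F).

Lemma coercive_on_weaken (eta theta M : R) : 0 <= eta ->
  coercive_on j P Fil c T (2^-1 + eta) theta M -> coercive_on j P Fil c T 2^-1 theta M.
Proof.
move=> eta0 [phi [m i h]]; exists phi; split => //; move: h; apply: filterS => w h v t tT.
apply: (le_trans (h v t tT)); rewrite mulrDl opprD addrA gerDl oppr_le0.
by rewrite mulr_ge0 ?sqr_ge0.
Qed.

Lemma borel_prog_section (phi : R -> Omega -> R^o) :
  borel_mfun (prog Fil) (fun z => phi z.1 z.2) ->
  measurable_fun (`]0, T[ `*` setT) (fun z : R * Omega => phi z.1 z.2 : R).
Proof.
move=> mphi; apply: (measurability _ (RGenOpens.measurableE R)) => _ [_ [a [b ->] <-]].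
have oO : open (`]a, b[%classic : set R^o) by exact: interval_open.
have m1 := prog_restrict_measurable hF (mphi _ oO).
have mD : measurable (`]0, T[%classic `*` setT : set (R * Omega)) by apply: measurableX => //; exact: measurable_itv.
rewrite (_ : _ `&` _ = (`]0, T[%classic `*` setT) `&` ((fun z => phi z.1 z.2) @^-1` `]a, b[%classic `&` [set z | 0 <= z.1])).
  exact: measurableI.
apply/seteqP; split => -[r w] /=; first by move=> [[rT _] h]; split => //; split => //; move: rT; rewrite in_itv/= => /andP[/ltW].
by move=> [rT [h _]].
Qed.

(** Tonelli makes the time integral of [phi^2] an integrable random variable. The passage from the
    open to the closed time interval only adds two points. *)
Lemma time_integral_data (phi : R -> Omega -> R^o) :
  borel_mfun (prog Fil) (fun z => phi z.1 z.2) ->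
  (\int[(mu \x P)%E]_(z in `]0%R, T[ `*` setT) (phi z.1 z.2 ^+ 2)%:E < +oo)%E ->
  exists Phi : Omega -> R, [/\ rint P setT Phi, forall w, 0 <= Phi w &
    \forall w \ae P, itg (fun r => phi r w ^+ 2) /\ \int[mu]_(r in `[0, T]) phi r w ^+ 2 <= Phi w].
Proof.
move=> mphi; set D := `]0, T[%classic `*` setT.
have mD : measurable (D : set (R * Omega)) by apply: measurableX => //; exact: measurable_itv.
pose F : R * Omega -> \bar R := (fun z => (phi z.1 z.2 ^+ 2)%:E) \_ D.
have mF : measurable_fun setT F.
  apply/(measurable_restrictT _ mD); apply/measurable_EFinP; apply: measurable_funX.
  exact: borel_prog_section.
have F0 z : (0 <= F z)%E by rewrite /F /patch; case: ifP => // _; rewrite lee_fin sqr_ge0.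
rewrite integral_mkcond -/F (@fubini_tonelli2 _ _ _ _ _ mu P F mF F0) => fi.
pose g w := fubini_G mu F w.
have g0 w : (0 <= g w)%E by apply: integral_ge0.
have mg : measurable_fun setT g by exact: measurable_fun_fubini_tonelli_G.
have ig : P.-integrable setT g.
  by apply/integrableP; split => //; under eq_integral do rewrite gee0_abs//.
have fg := integrable_ae measurableT ig.
exists (fine \o g); split.
- apply: rint_ge0P => //.
  + by apply: measurableT_comp; [exact: fine_measurable|exact: mg].
  + by move=> w _; exact: fine_ge0.
  + apply: le_lt_trans fi; apply: ge0_le_integral_sup => w _; first by rewrite lee_fin fine_ge0.
    by change ((fine (g w))%:E <= g w)%E; have := g0 w; case: (g w) => [x| |] //= _; exact: leey.
- by move=> w; exact: fine_ge0.
move: fg; apply: filterS => w /(_ I) fw.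
have mt := measurable_segment 0 T.
have mp : measurable_fun `[0, T] (fun r => phi r w ^+ 2).
  rewrite (_ : (fun r => phi r w ^+ 2) = (fun r => `|phi r w| ^+ 2)); last first.
    by apply: funext => r; rewrite real_normK// num_real.
  apply: measurable_funX; apply: measurable_halfline_segment.
  exact: (@borel_prog_norm_path _ _ _ _ hF _ phi w mphi).
have le : (\int[mu]_(r in `[0%R, T]) (phi r w ^+ 2)%:E <= g w)%E.
  rewrite integral_mkcond; apply: ae_le_integral_sup => //.
  - by apply/(measurable_restrictT _ mt); apply/measurable_EFinP.
  - by move=> r _; apply: erestrict_ge0 => z _; rewrite lee_fin sqr_ge0.
  exists [set 0; T]; split.
  - by apply: measurableU; exact: measurable_set1.
  - by apply: countable_lebesgue_measure0; apply: finite_set_countable; exact: finite_set2.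
  move=> r /= hr; apply: contrapT => nr; apply: hr => _; rewrite /F /patch.
  case: ifPn => [|_]; last by case: ifP => // _; rewrite lee_fin sqr_ge0.
  rewrite inE /= in_itv/= => /andP[r1 r2]; rewrite mem_set//=; split => //=.
  rewrite in_itv/= !lt_neqAle r1 r2 !andbT; apply/andP; split; apply/eqP => h; apply: nr; [left|right] => //.
split.
  apply: rint_ge0P => //; first by move=> r _; exact: sqr_ge0.
  by apply: (le_lt_trans le); rewrite -ge0_fin_numE.
rewrite /Rintegral; apply: fine_le => //.
by rewrite ge0_fin_numE; [apply: (le_lt_trans le); rewrite -ge0_fin_numE|apply: integral_ge0 => r _; rewrite lee_fin sqr_ge0].
Qed.

Context (theta Mc : R) (theta0 : 0 < theta) (Mc0 : 0 < Mc).

Section one_solution.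
Context (phi : R -> Omega -> R^o) (Phi : Omega -> R).
Hypothesis hphi : \forall w \ae P, forall (v : V) (t : R), 0 <= t <= T ->
  theta * `|v| ^+ 2 - Mc * `|j v| ^+ 2 - `|phi t w| ^+ 2 <= cA j c t w v v - 2^-1 * `|cB j c t w v| ^+ 2.
Hypotheses (iPhi : rint P setT Phi) (Phi0 : forall w, 0 <= Phi w).
Hypothesis hPhi : \forall w \ae P, itg (fun r => phi r w ^+ 2) /\ \int[mu]_(r in `[0, T]) phi r w ^+ 2 <= Phi w.

Context (u01 : Omega -> H) (u1 : process V H Omega) (v1 : R -> Omega -> V).
Context (M1 : R -> Omega -> H) (a1 : R -> Omega -> dual V) (N1 : nat -> nat).
Context (S1 : nat -> nat -> step Omega U H).
Hypotheses (m01 : strongly_mfun (Fil 0) setT u01) (av1 : adapted_strong Fil v1).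
Hypothesis aS1 : forall l i, adapted_step Fil (S1 l i).
Hypothesis sp1 : \forall w \ae P, solution_path j W c T u01 u1 v1 M1 a1 N1 S1 w.

Let mT := measurable_segment 0 T.
Let tth (r : R) (w : Omega) : R := 2 * theta * `|v1 r w| ^+ 2.
Let tgam (r : R) (w : Omega) : R := 2 * Mc.
Let tf (r : R) (w : Omega) : R := 2 * phi r w ^+ 2.

Let tail_path w : solution_path j W c T u01 u1 v1 M1 a1 N1 S1 w ->
  itg (fun r => phi r w ^+ 2) ->
  (forall (v : V) (t : R), 0 <= t <= T ->
  theta * `|v| ^+ 2 - Mc * `|j v| ^+ 2 - `|phi t w| ^+ 2 <= cA j c t w v v - 2^-1 * `|cB j c t w v| ^+ 2) ->
  energy_path j W T v1 (inH u1) M1 a1 u01 tth tgam tf (fun r w => `|cB j c r w (v1 r w)|) N1 S1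
    (fun l r w => `|cB j c r w (v1 r w) - step_op e (N1 l) (S1 l) r w|) w.
Proof.
move=> h1 if2 hc; split => //=.
- exact: sp_cont h1.
- exact: sp_start h1.
- exact: sp_jv h1.
- exact: sp_v2 h1.
- by apply: strongly_mfun_norm (sp_a h1); exact: measurable_itv.
- exact: sp_a2 h1.
- by move=> y; exact: (strongly_mfun_real (measurable_itv _) (sp_a h1) (@bop_eval_continuous _ _ _ y)).
- exact: sp_eq h1.
- exact: sp_b2 h1.
- move=> l; apply: rint_sq_norm_sub (sp_b h1) _ (sp_b2 h1) _.
    exact: strongly_mfunS (@subsetT _ _) (step_op_path e _ _ w).
  exact: step_op_rint.
- exact: sp_dl h1.
- by move=> l r _; exact: step_gram_le_sum.
- apply: filterS (sp_ML h1) => l h t tT; apply: (le_trans (h t tT)).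
  by rewrite exprS ler_piMl ?exprn_ge0// invf_le1// ler1n.
- exact: sp_M h1.
- exact: rintZl (sp_v2 h1).
- by apply: rint_cst => //; exact: segment_finite.
- exact: rintZl.
- apply: (@filterS2 _ _ (ae_filter_ringOfSetsType mu) _ _ _ _ (sp_jv h1) (sp_aA h1)) => r j1 A1 rT.
  have rT' : 0 <= r <= T by move: rT; rewrite /= in_itv.
  have := hc (v1 r w) r rT'; rewrite -A1// j1// /tth /tgam /tf real_normK ?num_real//.
  by move: (_ ^+ 2) (_ ^+ 2) (_ ^+ 2) (_ ^+ 2) (a1 _ _ _) => x y z t k; lra.
Qed.

Let tail_factor : R := expR (- (2 * Mc * T)) * Num.min 1 (2 * theta).

Let tail_factor_gt0 : 0 < tail_factor.
Proof. by rewrite mulr_gt0 ?expR_gt0// lt_min ltr01 mulr_gt0. Qed.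

Definition small_path (m : R) (w : Omega) : Prop :=
  (forall t, 0 <= t <= T -> `|inH u1 t w| ^+ 2 <= m) /\ \int[mu]_(r in `[0, T]) `|v1 r w| ^+ 2 <= m.

(** The maximal inequality for the solution itself, with constant rate [2 Mc], forcing [2 phi^2] and
    [D = |u01|^2 + 2 Phi]. Either [D] is large, which Markov's inequality bounds, or the weighted
    energy exceeds [lam + D]; both have outer probability at most [E D / lam]. *)
Lemma solution_tail (s m : R) : (\int[P]_w (`|u01 w| ^+ 2)%:E <= s%:E)%E -> 0 < m ->
  (mu_ext P [set w | ~ small_path m w] <=
   (4 * (s + 2 * \int[P]_w Phi w) / (expR (- (2 * Mc * T)) * Num.min 1 (2 * theta)) / m)%:E)%E.
Proof.
move=> hs m0; rewrite -/tail_factor.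
have mx0 : strongly_mfun (@measurable _ (subalg (Fil 0))) setT u01 by rewrite (fil_measurableE hF (lexx 0)).
have mC : Fil 0 setT by exact: filT.
have mn : measurable_fun setT (fun w => `|u01 w| ^+ 2).
  by apply: (fil_measurable_funT hF (lexx 0)); apply: measurable_funX; exact: strongly_mfun_norm.
have i0 : rint P setT (fun w => `|u01 w| ^+ 2).
  apply: rint_ge0P => //; exact: le_lt_trans hs (ltry _).
pose D w := `|u01 w| ^+ 2 + 2 * Phi w.
have iD : rint P setT D. exact: (rintD measurableT i0 (rintZl measurableT 2 iPhi)).
have D0 w : 0 <= D w by rewrite addr_ge0 ?sqr_ge0 ?mulr_ge0.
have ED : \int[P]_w D w <= s + 2 * \int[P]_w Phi w.
  rewrite (RintegralD measurableT i0 (rintZl measurableT 2 iPhi)) (RintegralZl _ measurableT iPhi) lerD2r.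
  by rewrite -lee_fin (rint_EFin measurableT i0).
(* Half of the admissible energy [tail_factor * m] is given to [lam], half to [D]. *)
pose lam := tail_factor * m / 2; have lam0 : 0 < lam by rewrite divr_gt0// mulr_gt0.
have hp : \forall w \ae P, energy_path j W T v1 (inH u1) M1 a1 u01 tth tgam tf (fun r w => `|cB j c r w (v1 r w)|) N1 S1
    (fun l r w => `|cB j c r w (v1 r w) - step_op e (N1 l) (S1 l) r w|) w.
  by move: sp1 hPhi hphi; apply: filterS3 => w h1 [h2 _] h3; exact: tail_path.
have tgam0 r w : 0 <= tgam r w by rewrite mulr_ge0// ltW.
have tth0 r w : 0 <= tth r w by rewrite !mulr_ge0 ?sqr_ge0// ltW.
have tf0 r w : 0 <= tf r w by rewrite mulr_ge0 ?sqr_ge0.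
have hD : \forall w \ae P, setT w -> `|u01 w| ^+ 2 + \int[mu]_(r in `[0, T]) tf r w <= D w.
  by move: hPhi; apply: filterS => w [h1 h2] _; rewrite lerD2l (RintegralZl _ mT h1) ler_pM2l.
have est := energy_maximal e jtriple hF hW T0 av1 mx0 (@adapted_real_cst _ _ _ Fil (2 * Mc)) tgam0 tth0 tf0 aS1 hp mC iD D0 hD lam0.
set B1 := [set w | _ /\ _] in est.
pose B2 := [set w | lam < D w].
have bound (B : set Omega) : (lam%:E * mu_ext P B <= (\int[P]_w D w)%:E)%E ->
    (mu_ext P B <= (2 * (s + 2 * \int[P]_w Phi w) / tail_factor / m)%:E)%E.
  move=> hB; have : (lam%:E * mu_ext P B <= lam%:E * (2 * (s + 2 * \int[P]_w Phi w) / tail_factor / m)%:E)%E.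
    apply: (le_trans hB); rewrite -EFinM lee_fin; apply: (le_trans ED).
    rewrite le_eqVlt; apply/orP; left; apply/eqP; rewrite /lam.
    by field; rewrite !gt_eqF.
  by rewrite lee_pmul2l// lte_fin.
have hB2 : (lam%:E * mu_ext P B2 <= (\int[P]_w D w)%:E)%E.
  rewrite (rint_EFin measurableT iD); apply: mu_ext_markov.
  - exact: ltW.
  - by apply/measurable_EFinP; exact: rint_meas iD.
  - by move=> w; rewrite lee_fin.
  - by apply: aeW => w /ltW; rewrite lee_fin.
apply: (@le_trans _ _ (mu_ext P (B1 `|` B2))); last first.
  apply: (le_trans (outer_measureU2 _ _ _)); apply: (le_trans (leeD (bound _ est) (bound _ hB2))).
  rewrite -EFinD lee_fin le_eqVlt; apply/orP; left; apply/eqP.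
  by field; rewrite !gt_eqF.
apply: mu_ext_ae_sub; move: sp1; apply: filterS => w h1 ns; apply: contrapT => nB; apply: ns.
have nD : D w <= lam by rewrite leNgt; apply/negP => h; apply: nB; right.
have we t : 0 <= t <= T -> weighted_energy (inH u1) tth tgam t w <= tail_factor * m.
  move=> tT; apply: (@le_trans _ _ (lam + D w)); last by rewrite /lam; move: nD; rewrite /lam; lra.
  by rewrite leNgt; apply/negP => h; apply: nB; left; split => //; exists t.
have ig : itg (tgam ^~ w) by apply: rint_cst => //; exact: segment_finite.
have ith : itg (tth ^~ w) by exact: rintZl (sp_v2 h1).
have hk : 0 <= Num.min 1 (2 * theta) <= 1.
  by rewrite le_min ler01 ge_min lexx/= andbT mulr_ge0// ltW.
have low t : 0 <= t <= T -> `|inH u1 t w| ^+ 2 + \int[mu]_(r in `[0, t]) `|v1 r w| ^+ 2 <= m.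
  move=> tT; have /andP[t0 tT'] := tT.
  have hG : \int[mu]_(r in `[0, t]) tgam r w <= 2 * Mc * T.
    rewrite (Rintegral_cst mu (measurable_segment 0 t))/= lebesgue_measure_itv/= lte_fin.
    rewrite ler_wpM2l ?mulr_ge0 ?(ltW Mc0)//.
    by case: ifPn => _; rewrite /= ?subr0// ltW.
  have hp' : \forall r \ae mu, `[0, t]%classic r -> Num.min 1 (2 * theta) * `|v1 r w| ^+ 2 <= tth r w.
    by apply: (@aeW _ _ _ mu) => r _; rewrite ler_wpM2r ?sqr_ge0// ge_min lexx orbT.
  have := weighted_energy_lower T0 ig (fun r => tgam0 r w) ith (fun r => tth0 r w) (sp_v2 h1) (sqr_ge0 `|inH u1 t w|) tT hk hG hp'.
  by rewrite -/tail_factor => /le_trans/(_ (we t tT)); rewrite ler_pM2l.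
split => [t tT|].
  by apply: le_trans (low t tT); rewrite lerDl Rintegral_itv_ge0// => r _; exact: sqr_ge0.
by apply: le_trans (low T _); [rewrite lerDr sqr_ge0|rewrite lexx ltW].
Qed.

End one_solution.
End coercive_energy.

(** Transfers a uniform second-moment bound to the limit. Borel-Cantelli extracts an almost surely
    convergent subsequence, along which Fatou's lemma applies. *)
Lemma fatou_in_prob (R : realType) (H : hilbertType R) d (Omega : measurableType d) (P : probability Omega R)
    (x : Omega -> H) (xn : nat -> Omega -> H) (s : R) :
  measurable_fun setT (fun w => `|x w|) -> (forall n, measurable_fun setT (fun w => `|xn n w|)) ->
  cvg0_in_prob P (fun n w => (`|xn n w - x w|)%:E) ->
  (forall n, (\int[P]_w (`|xn n w| ^+ 2)%:E <= s%:E)%E) -> (\int[P]_w (`|x w| ^+ 2)%:E <= s%:E)%E.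
Proof.
move=> mx mxn cx hs.
have h2 (l : nat) : 0 < 2^-1 ^+ l :> R by rewrite exprn_gt0.
have /choice[k hk] : forall l, exists k, (mu_ext P [set w | ((2^-1 ^+ l)%:E < (`|xn k w - x w|)%:E)%E] < (2^-1 ^+ l)%:E)%E.
  move=> l; near \oo => k; exists k; near: k.
  exact: cvg0_eventually (cx _ (h2 l)) (h2 l).
have bc := outer_borel_cantelli hk.
have [||g [mg g0 gs hg]] := @fatou_bound R _ Omega P (fun l w => (`|xn (k l) w| ^+ 2)%:E) (fun=> s) s _ _ (fun l => hs (k l)) (cvg_cst _).
- by move=> l; apply/measurable_EFinP; exact: measurable_funX.
- by move=> l w; rewrite lee_fin sqr_ge0.
apply: le_trans gs; apply: ae_le_integral_sup => //.
  by apply/measurable_EFinP; exact: measurable_funX.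
move: bc; apply: filterS => w bw _.
have c0 : (2^-1 ^+ l : R) @[l --> \oo] --> 0.
  by apply: cvg_expr; rewrite ger0_norm// invf_lt1// ltr1n.
have cw : xn (k l) w @[l --> \oo] --> x w.
  apply/cvgrPdist_le => ep ep0; near=> l; rewrite distrC.
  apply: (@le_trans _ _ (2^-1 ^+ l)).
    by rewrite leNgt; apply/negP => h; move: h; near: l; move: bw; apply: filterS => l; rewrite /= lte_fin.
  near: l; move/cvgrPdist_le : c0 => /(_ _ ep0); apply: filterS => l.
  by rewrite sub0r normrN; apply: le_trans; exact: ler_norm.
have cn : `|xn (k l) w| @[l --> \oo] --> `|x w| by exact: cvg_norm.
have c2 : `|xn (k l) w| ^+ 2 @[l --> \oo] --> `|x w| ^+ 2 by exact: (cvgM cn cn).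
have key (ep : R) : 0 < ep -> ((`|x w| ^+ 2 - ep)%:E <= g w)%E.
  move=> ep0; apply: hg; move/cvgrPdist_le : c2 => /(_ _ ep0); apply: filterS => l h.
  rewrite lee_fin; move: h; rewrite ler_norml => /andP[_]; lra.
have := g0 w; case: (g w) key => [y| |] // key _; last by rewrite leey.
rewrite lee_fin; apply/ler_addgt0Pr => ep ep0; have := key ep ep0; rewrite lee_fin; lra.
Unshelve. all: end_near.
Qed.

(** * Tails of the distance of two solutions *)

Section stability_in_mean.
Context (R : realType) (V H U : hilbertType R) (e : onb U) (j : bop V H) (jtriple : gelfand_triple j).
Context d (Omega : measurableType d) (P : probability Omega R) (Fil : R -> set (set Omega)).
Context (W : R -> U -> Omega -> R) (hF : filtration Fil) (hW : cylindrical_BM P Fil W).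
Context (c : coefs V H e Omega) (hc : critical_variational j P Fil c) (T : R) (T0 : 0 < T).

Lemma dist_C_ge0 (u1 u2 : process V H Omega) w : (0 <= dist_C T u1 u2 w)%E.
Proof.
apply: (@le_trans _ _ (`|inH u1 0 w - inH u2 0 w|)%:E); first by rewrite lee_fin.
by apply: ereal_sup_ubound; exists 0 => //=; rewrite in_itv/= lexx ltW.
Qed.

Lemma dist_L2_ge0 (u1 u2 : process V H Omega) w : (0 <= dist_L2 T u1 u2 w)%E.
Proof. exact: poweR_ge0. Qed.

(** The constant depends only on the common second-moment bound [s], so the tails are uniform over
    all approximating initial values. *)
Lemma dist_tail (theta Mc : R) : 0 < theta -> 0 < Mc -> coercive_on j P Fil c T 2^-1 theta Mc ->
  forall s : R, 0 <= s -> exists2 K : R, 0 <= K & forall u01 u02 u1 u2,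
    strongly_mfun (Fil 0) setT u01 -> strongly_mfun (Fil 0) setT u02 ->
    (\int[P]_w (`|u01 w| ^+ 2)%:E <= s%:E)%E -> (\int[P]_w (`|u02 w| ^+ 2)%:E <= s%:E)%E ->
    global_solution j P Fil W c u01 u1 -> global_solution j P Fil W c u02 u2 ->
    forall L : R, 0 < L ->
    (mu_ext P [set w | ~ (dist_C T u1 u2 w <= L%:E /\ dist_L2 T u1 u2 w <= L%:E)] <= (K / L ^+ 2)%:E)%E.
Proof.
move=> theta0 Mc0 [phi [mphi iphi hphi]] s s0.
have [Phi [iPhi Phi0 hPhi]] := time_integral_data hF mphi iphi.
pose K1 := 4 * (s + 2 * \int[P]_w Phi w) / (expR (- (2 * Mc * T)) * Num.min 1 (2 * theta)).
have K10 : 0 <= K1.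
  rewrite divr_ge0 ?mulr_ge0 ?expR_ge0//.
    by rewrite addr_ge0// mulr_ge0// Rintegral_ge0.
  by rewrite le_min ler01 mulr_ge0// ltW.
(* Each solution is kept below [m = L^2 / 4], so that [|x - y|^2 <= 4 m = L^2]; two events of
   probability [K1 / m] add up to [8 K1 / L^2]. *)
exists (8 * K1); first by rewrite mulr_ge0.
move=> u01 u02 u1 u2 m1 m2 hs1 hs2 g1 g2 L L0.
have [v1 [M1 [a1 [N1 [S1 [av1 aS1 sp1]]]]]] := solution_data jtriple hF hW hc T0 g1.
have [v2 [M2 [a2 [N2 [S2 [av2 aS2 sp2]]]]]] := solution_data jtriple hF hW hc T0 g2.
pose m := L ^+ 2 / 4; have mp : 0 < m by rewrite divr_gt0// exprn_gt0.
have t1 := solution_tail jtriple hF hW T0 theta0 Mc0 hphi iPhi Phi0 hPhi m1 av1 aS1 sp1 hs1 mp.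
have t2 := solution_tail jtriple hF hW T0 theta0 Mc0 hphi iPhi Phi0 hPhi m2 av2 aS2 sp2 hs2 mp.
rewrite -/K1 in t1 t2; set B1 := [set w | _] in t1; set B2 := [set w | _] in t2.
apply: (@le_trans _ _ (mu_ext P (B1 `|` B2))); last first.
  apply: (le_trans (outer_measureU2 _ _ _)); apply: (le_trans (leeD t1 t2)).
  rewrite -EFinD lee_fin le_eqVlt; apply/orP; left; apply/eqP; rewrite /m.
  by field; rewrite gt_eqF.
apply: mu_ext_ae_sub; move: sp1 sp2; apply: filterS2 => w h1 h2 nd; apply: contrapT => nB; apply: nd.
have [hC1 hL1] : small_path T u1 v1 m w by apply: contrapT => h; apply: nB; left.
have [hC2 hL2] : small_path T u2 v2 m w by apply: contrapT => h; apply: nB; right.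
have mE : Num.sqrt (4 * m) = L by rewrite /m mulrC divfK// sqrtr_sqr gtr0_norm.
have m4 : 0 <= 4 * m by rewrite mulr_ge0// ltW.
have := dist_le_sqrt T0 m4 av1 av2 h1 h2; rewrite mE; apply.
- move=> t tT; apply: (@le_trans _ _ ((`|inH u1 t w| + `|inH u2 t w|) ^+ 2)).
    by rewrite lerXn2r ?nnegrE ?addr_ge0// ler_normB.
  apply: (le_trans (sqrD_le_dbl _ _)); have := hC1 t tT; have := hC2 t tT.
  by move: (_ ^+ 2) (_ ^+ 2) => x y; lra.
have pv (v : R -> Omega -> V) : adapted_strong Fil v -> strongly_mfun measurable `[0, T] (v ^~ w).
  move=> av; have := strongly_mfun_section1 (av _ (ltW T0)) w; apply: strongly_mfunS => r rT.
  by split.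
apply: (le_trans (Rintegral_sq_norm_sub (pv _ av1) (pv _ av2) (sp_v2 h1) (sp_v2 h2))).
by move: hL1 hL2; move: (Rintegral _ _ _) (Rintegral _ _ _) => x y; lra.
Unshelve. all: end_near.
Qed.

End stability_in_mean.

Theorem theorem3p8 (R : realType) (V H U : hilbertType R) (e : onb U)
    (j : bop V H) (d : measure_display) (Omega : measurableType d)
    (P : probability Omega R) (Fil : R -> set (set Omega))
    (W : R -> U -> Omega -> R) (c : coefs V H e Omega)
    (u0 : Omega -> H) (u0n : nat -> Omega -> H)
    (u : process V H Omega) (un : nat -> process V H Omega) :
  gelfand_triple j ->
  (exists2 D : set U, countable D & dense D) ->
  filtration Fil ->
  cylindrical_BM P Fil W ->
  critical_variational j P Fil c ->
  (forall T : R, 0 < T -> exists eta theta M : R,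
     [/\ 0 < eta, 0 < theta, 0 < M &
         coercive_on j P Fil c T (2^-1 + eta) theta M]) \/
  (forall T : R, 0 < T -> exists theta M : R,
     [/\ 0 < theta, 0 < M & coercive_on j P Fil c T 2^-1 theta M]) ->
  strongly_mfun (Fil 0) setT u0 ->
  (forall n, strongly_mfun (Fil 0) setT (u0n n)) ->
  global_solution j P Fil W c u0 u ->
  (forall n, global_solution j P Fil W c (u0n n) (un n)) ->
  cvg0_in_prob P (fun n w => (`|u0n n w - u0 w|)%:E) ->
  forall T : R, 0 < T ->
    cvg0_in_prob P (fun n w => dist_C T u (un n) w + dist_L2 T u (un n) w)%E /\
    ((ereal_sup (range (fun n => \int[P]_w (`|u0n n w| ^+ 2)%:E)) < +oo)%E ->
     forall q : R, 0 < q < 2 ->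
       (\int[P]_w (dist_C T u (un n) w `^ q) +
        \int[P]_w (dist_L2 T u (un n) w `^ q))%E @[n --> \oo] --> 0%E).
Proof.
move=> jtriple _ hF hW hc coer m0 m0n gu gun cv T T0.
have stab := stability_in_probability jtriple hF hW hc T0 m0 m0n gu gun cv.
split => // supfin q q02.
(* The first alternative implies the second, since [eta |B|^2] only helps. *)
have [theta [Mc [theta0 Mc0 co]]] : exists theta M : R,
    [/\ 0 < theta, 0 < M & coercive_on j P Fil c T 2^-1 theta M].
  case: coer => [/(_ T T0)[eta [theta [M [eta0 ? ? h]]]]|/(_ T T0)//].
  by exists theta, M; split => //; exact: coercive_on_weaken (ltW eta0) h.
set sup := ereal_sup _ in supfin.
have le_sup n : (\int[P]_w (`|u0n n w| ^+ 2)%:E <= sup)%E by apply: ereal_sup_ubound; exists n.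
have sup0 : (0 <= sup)%E.
  by apply: le_trans (le_sup 0%N); apply: integral_ge0 => w _; rewrite lee_fin sqr_ge0.
have [s s0 supE] : exists2 s : R, 0 <= s & sup = s%:E.
  by exists (fine sup); [exact: fine_ge0|rewrite fineK// ge0_fin_numE].
have hs n : (\int[P]_w (`|u0n n w| ^+ 2)%:E <= s%:E)%E by rewrite -supE.
have mn (x : Omega -> H) : strongly_mfun (Fil 0) setT x -> measurable_fun setT (fun w => `|x w|).
  rewrite -(fil_measurableE hF (lexx 0)) => mx; apply: (fil_measurable_funT hF (lexx 0)).
  exact: strongly_mfun_norm.
(* The tail bound requires a second moment of the limit [u0] as well, which is inherited from the
   [u0n]. *)
have hs0 := fatou_in_prob (mn _ m0) (fun n => mn _ (m0n n)) cv hs.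
have [K K0 hK] := dist_tail jtriple hF hW hc T0 theta0 Mc0 co s0.
have cC : (\int[P]_w (dist_C T u (un n) w `^ q))%E @[n --> \oo] --> 0%E.
  apply: (moment_cvg K0 q02) => [n w|eps eps0|n L L0].
  - exact: dist_C_ge0.
  - apply: ereal_cvg0 => [n|z z0]; first exact: mu_ext_ge0.
    apply: filterS (cvg0_eventually (stab eps eps0) z0) => n /ltW; apply: le_trans.
    apply: le_mu_ext => w /= /lt_le_trans; apply.
    by apply: leeDl; exact: dist_L2_ge0.
  - apply: le_trans (hK _ _ _ _ m0 (m0n n) hs0 (hs n) gu (gun n) L L0).
    by apply: le_mu_ext => w /=; rewrite ltNge => /negP nl [].
have cL : (\int[P]_w (dist_L2 T u (un n) w `^ q))%E @[n --> \oo] --> 0%E.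
  apply: (moment_cvg K0 q02) => [n w|eps eps0|n L L0].
  - exact: dist_L2_ge0.
  - apply: ereal_cvg0 => [n|z z0]; first exact: mu_ext_ge0.
    apply: filterS (cvg0_eventually (stab eps eps0) z0) => n /ltW; apply: le_trans.
    apply: le_mu_ext => w /= /lt_le_trans; apply.
    by apply: leeDr; exact: dist_C_ge0.
  - apply: le_trans (hK _ _ _ _ m0 (m0n n) hs0 (hs n) gu (gun n) L L0).
    by apply: le_mu_ext => w /=; rewrite ltNge => /negP nl [].
by rewrite -[X in _ --> X]adde0; apply: cvgeD.
Qed.
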